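(* In the setting described in the context (Cartesian triangular meshes), assume $\max\{\beta^+/\beta^-,\beta^-/\beta^+\}<10.65$. Then there exist $h_1>0$ and a constant $C_s>0$, independent of the mesh size $h$ and of the interface location relative to the mesh, such that for all $h<h_1$ $$\sup_{\mathbf{v}_h\in\mathcal{ND}_{h,0}(\Omega)\setminus\{0\}}\frac{a(\mathbf{u}_h,\mathbf{v}_h)}{\|\mathbf{v}_h\|_{\mathbf{H}(\mathrm{curl};\Omega)}}\ \ge\ C_s\|\mathbf{u}_h\|_{\mathbf{H}(\mathrm{curl};\Omega)}\qquad\forall\,\mathbf{u}_h\in\mathcal{IND}_{h,0}(\Omega).$$
   Context: $\Omega\subset\mathbb{R}^2$ is a rectangular domain; $\Gamma\subset\Omega$ is a smooth simple Jordan curve not touching $\partial\Omega$ that separates $\Omega$ into subdomains $\Omega^-$ and $\Omega^+$. $\mu=\mu^\pm$, $\beta=\beta^\pm$ in $\Omega^\pm$ are positive constants. $\mathrm{curl}\,\mathbf{v}=\partial_{x_1}v_2-\partial_{x_2}v_1$. $\mathcal{T}_h$ is a Cartesian triangular mesh: $\Omega$ is partitioned into congruent squares and each square is cut into two triangles along a diagonal (same direction in all squares). The mesh is not fitted to $\Gamma$. $h$ is the mesh size; $\mathring{\mathcal{E}}_h$ is the set of interior edges. Elements cut by $\Gamma$ are interface elements (collection $\mathcal{T}_h^i$). $\Gamma$ intersects the boundary of each interface element $T$ at exactly two distinct points, on two different edges; $\Gamma_h^T$ is the segment joining them, cutting $T$ into $T_h^-$, $T_h^+$ (corresponding to $\Omega^-$,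 $\Omega^+$); $\bar{\mathbf t},\bar{\mathbf n}$ are unit tangent and normal to $\Gamma_h^T$, $X_m$ is its midpoint. $\mathcal{ND}_h(K)=\{\mathbf{a}+b[x_2,-x_1]^t:\mathbf{a}\in\mathbb{R}^2,b\in\mathbb{R}\}$; $\mathcal{ND}_{h,0}(\Omega)=\{\mathbf{v}\in\mathbf{H}(\mathrm{curl};\Omega):\mathbf{v}|_T\in\mathcal{ND}_h(T)\ \forall T,\ \mathbf{v}\cdot\mathbf{t}=0\text{ on }\partial\Omega\}$. On $T\in\mathcal{T}_h^i$, $\mathcal{C}_T:\mathcal{ND}_h(T_h^-)\to\mathcal{ND}_h(T_h^+)$ is the linear bijection determined by $\mathcal{C}_T(\mathbf{v}_h)\cdot\bar{\mathbf{t}}=\mathbf{v}_h\cdot\bar{\mathbf{t}}$, $\frac{1}{\mu^+}\mathrm{curl}\,\mathcal{C}_T(\mathbf{v}_h)=\frac{1}{\mu^-}\mathrm{curl}\,\mathbf{v}_h$, $\beta^+\mathcal{C}_T(\mathbf{v}_h)\cdot\bar{\mathbf{n}}=\beta^-\mathbf{v}_h\cdot\bar{\mathbf{n}}$ at $X_m$, and $\mathcal{IND}_h(T)$ consists of the functions equal to $\mathbf{v}_h$ on $T_h^-$ and $\mathcal{C}_T(\mathbf{v}_h)$ on $T_h^+$, $\mathbf{v}_h\in\mathcal{ND}_h(T_h^-)$. On non-interface elements $\mathcal{IND}_h(T)=\mathcal{ND}_h(T)$. $\mathcal{IND}_h(\Omega)=\{\mathbf{v}\in \mathbf{L}^2(\Omega):\mathbf{v}|_T\in\mathcal{IND}_h(T)\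 \forall T,\ \int_e[\mathbf{v}\cdot\mathbf{t}]_e\,ds=0\ \forall e\in\mathring{\mathcal{E}}_h\}$; $\mathcal{IND}_{h,0}(\Omega)$ is its subspace with zero tangential trace on $\partial\Omega$. $a(\mathbf{u},\mathbf{v})=\int_\Omega\mu^{-1}\mathrm{curl}\,\mathbf{u}\ \mathrm{curl}\,\mathbf{v}\,dX+\int_\Omega\beta\,\mathbf{u}\cdot\mathbf{v}\,dX$ and $\|\mathbf{v}\|_{\mathbf{H}(\mathrm{curl};\Omega)}^2=\|\mathbf{v}\|^2_{L^2(\Omega)}+\|\mathrm{curl}\,\mathbf{v}\|^2_{L^2(\Omega)}$, with curl taken element by element for functions in $\mathcal{IND}_h(\Omega)$. *)

(* Defs.v *)
From mathcomp Require Import all_boot all_order all_algebra.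
From mathcomp Require Import all_classical all_reals all_analysis.

Set Implicit Arguments.
Unset Strict Implicit.
Unset Printing Implicit Defensive.

Import Order.TTheory GRing.Theory Num.Theory numFieldNormedType.Exports.
Local Open Scope classical_set_scope.
Local Open Scope ring_scope.

Notation plane R := (R * R)%type.
Notation vfield R := (R * R -> R * R)%type.

Definition dot (R : realType) (x y : plane R) : R := x.1 * y.1 + x.2 * y.2.

Definition cross (R : realType) (x y : plane R) : R := x.1 * y.2 - x.2 * y.1.

(* The norm that MathComp-Analysis puts on [R * R] is the max norm. *)
Definition enorm (R : realType) (x : plane R) : R := Num.sqrt (dot x x).

Definition segment (R : realType) (P Q : plane R) : set (plane R) :=
  [set P + s *: (Q - P) | s in `[0, 1]].

Definition tangent (R : realType) (P Q : plane R) : plane R :=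
  (enorm (Q - P))^-1 *: (Q - P).

Definition normal (R : realType) (P Q : plane R) : plane R :=
  ((tangent P Q).2, - (tangent P Q).1).

Notation area R := ((@lebesgue_measure R) \x (@lebesgue_measure R))%E.

Definition line_integral (R : realType) (P Q : plane R) (f : plane R -> R) : R :=
  enorm (Q - P) *
  Rintegral (@lebesgue_measure R) `[0, 1] (fun s => f (P + s *: (Q - P))).

Definition dx1 (R : realType) (f : plane R -> R) (x : plane R) : R :=
  derive1 (fun t => f (t, x.2)) x.1.

Definition dx2 (R : realType) (f : plane R -> R) (x : plane R) : R :=
  derive1 (fun t => f (x.1, t)) x.2.

(* Pointwise classical curl.  For a piecewise smooth field it is the curl taken
   piece by piece, off the null set of the piece boundaries. *)
Definition curl (R : realType) (v : vfield R) (x : plane R) : R :=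
  dx1 (fun y => (v y).2) x - dx2 (fun y => (v y).1) x.

(* [true] stands for the partial derivative in x1, [false] for x2. *)
Definition dxs (R : realType) (s : seq bool) (f : plane R -> R) :
  plane R -> R :=
  foldr (fun b g => if b then dx1 g else dx2 g) f s.

Definition smooth2 (R : realType) (f : plane R -> R) : Prop :=
  forall s : seq bool, continuous (dxs s f) /\
    forall x : plane R,
      derivable (fun t : R => dxs s f (t, x.2)) x.1 1 /\
      derivable (fun t : R => dxs s f (x.1, t)) x.2 1.

Definition test_function (R : realType) (Om : set (plane R))
  (phi : plane R -> R) : Prop :=
  smooth2 phi /\
  exists K : set (plane R), [/\ compact K, K `<=` Om &
                              forall x, ~ K x -> phi x = 0].

Definition L2_scalar (R : realType) (Om : set (plane R)) (f : plane R -> R) :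
  Prop :=
  measurable_fun Om f /\
  (area R).-integrable Om (EFin \o (fun x => f x ^+ 2)).

Definition L2_field (R : realType) (Om : set (plane R)) (v : vfield R) : Prop :=
  L2_scalar Om (fun x => (v x).1) /\ L2_scalar Om (fun x => (v x).2).

Definition weak_curl (R : realType) (Om : set (plane R)) (v : vfield R)
  (w : plane R -> R) : Prop :=
  forall phi, test_function Om phi ->
    Rintegral (area R) Om (fun x => dot (v x) (dx2 phi x, - dx1 phi x)) =
    Rintegral (area R) Om (fun x => w x * phi x).

Definition Hcurl (R : realType) (Om : set (plane R)) (v : vfield R) : Prop :=
  L2_field Om v /\ exists2 w, L2_scalar Om w & weak_curl Om v w.

Definition L2_zero (R : realType) (Om : set (plane R)) (v : vfield R) : Prop :=
  {ae (area R), forall x, Om x -> v x = 0}.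

(* [curl v] is the piecewise curl; on a piecewise polynomial member of H(curl)
   it agrees almost everywhere with the weak curl. *)
Definition Hcurl_norm (R : realType) (Om : set (plane R)) (v : vfield R) : R :=
  Num.sqrt (Rintegral (area R) Om (fun x => dot (v x) (v x)) +
            Rintegral (area R) Om (fun x => curl v x ^+ 2)).

Variant side := minus | plus.

Record interface_data (R : realType) := InterfaceData {
  corner_lo : plane R;
  corner_hi : plane R;
  gam : R -> plane R;
  subdomain : side -> set (plane R);
  mu : side -> R;
  be : side -> R
}.

Definition Omega (R : realType) (S : interface_data R) : set (plane R) :=
  `](corner_lo S).1, (corner_hi S).1[ `*` `](corner_lo S).2, (corner_hi S).2[.

Definition Gamma (R : realType) (S : interface_data R) : set (plane R) :=
  range (gam S).

Definition smooth_jordan_curve (R : realType) (g : R -> plane R) : Prop :=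
  [/\ forall n t, derivable (derive1n n (fun s => (g s).1)) t 1 /\
                  derivable (derive1n n (fun s => (g s).2)) t 1,
      forall t, (derive1 (fun s => (g s).1) t, derive1 (fun s => (g s).2) t) != 0,
      forall t, g (t + 1) = g t &
      {in `[0, 1[ &, injective g}].

Definition separates (R : realType) (Om G : set (plane R))
  (sub : side -> set (plane R)) : Prop :=
  [/\ forall s, [/\ open (sub s), connected (sub s) & sub s !=set0],
      sub minus `&` sub plus = set0 &
      sub minus `|` sub plus = Om `\` G].

(* [Omega] is open, so [Gamma S `<=` Omega S] also keeps the curve off the
   boundary of [Omega]. *)
Definition interface_setting (R : realType) (S : interface_data R) : Prop :=
  [/\ (corner_lo S).1 < (corner_hi S).1 /\ (corner_lo S).2 < (corner_hi S).2,
      smooth_jordan_curve (gam S),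
      Gamma S `<=` Omega S,
      separates (Omega S) (Gamma S) (subdomain S) &
      forall s, 0 < mu S s /\ 0 < be S s].

(* The value given on [Gamma], a null set, is irrelevant. *)
Definition piecewise (R : realType) (S : interface_data R) (c : side -> R)
  (x : plane R) : R :=
  if x \in subdomain S minus then c minus else c plus.

(* [mesh_size] is the side of the squares.  [mesh_diag] chooses the diagonal
   cutting all squares: from lower left to upper right if [true], from upper
   left to lower right if [false]. *)
Record cartesian_mesh (R : realType) (S : interface_data R) := CartesianMesh {
  mesh_n1 : nat;
  mesh_n2 : nat;
  mesh_size : R;
  mesh_diag : bool;
  mesh_size_gt0 : 0 < mesh_size;
  mesh_width : (corner_hi S).1 - (corner_lo S).1 = mesh_n1%:R * mesh_size;
  mesh_height : (corner_hi S).2 - (corner_lo S).2 = mesh_n2%:R * mesh_size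
}.

(* ((i, j), b): one of the two triangles of the square with lower left grid
   index (i, j). *)
Definition element (R : realType) (S : interface_data R)
  (M : cartesian_mesh S) : Type :=
  ('I_(mesh_n1 M) * 'I_(mesh_n2 M) * bool)%type.

Definition grid_point (R : realType) (S : interface_data R)
  (M : cartesian_mesh S) (i j : nat) : plane R :=
  ((corner_lo S).1 + i%:R * mesh_size M, (corner_lo S).2 + j%:R * mesh_size M).

Definition vertices (R : realType) (S : interface_data R)
  (M : cartesian_mesh S) (T : element M) : 3.-tuple (plane R) :=
  let: (i, j, b) := T in
  let P00 := grid_point M i j in
  let P10 := grid_point M i.+1 j in
  let P01 := grid_point M i j.+1 in
  let P11 := grid_point M i.+1 j.+1 in
  if mesh_diag M then
    (if b then [tuple P00; P11; P01] else [tuple P00; P10; P11])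
  else
    (if b then [tuple P10; P11; P01] else [tuple P00; P10; P01]).

Section Elements.
Context (R : realType) (S : interface_data R) (M : cartesian_mesh S).
Implicit Types (T : element M) (P Q D E : plane R) (u v p q : vfield R).

Definition triangle T : set (plane R) :=
  [set x | exists l : 'I_3 -> R,
     [/\ forall k, 0 <= l k, \sum_k l k = 1 &
         x = \sum_k l k *: tnth (vertices T) k]].

Definition is_edge T P Q : Prop :=
  [/\ P \in (vertices T : seq _), Q \in (vertices T : seq _) & P != Q].

Definition triangle_boundary T : set (plane R) :=
  [set x | exists P Q, is_edge T P Q /\ segment P Q x].

Definition interior_edge T1 T2 P Q : Prop :=
  [/\ T1 <> T2, is_edge T1 P Q & is_edge T2 P Q].

Definition boundary_edge T P Q : Prop :=
  is_edge T P Q /\ segment P Q `<=` closure (Omega S) `\` Omega S.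

Definition interface_element T : Prop := Gamma S `&` interior (triangle T) !=set0.

Definition cut_points T D E : Prop :=
  [/\ D != E,
      Gamma S `&` triangle_boundary T = [set D; E] &
      exists P Q P' Q',
        [/\ is_edge T P Q, is_edge T P' Q', segment P Q <> segment P' Q',
            segment P Q D & segment P' Q' E]].

Definition unfitted_mesh : Prop :=
  forall T, interface_element T -> exists D E, cut_points T D E.

(* The part of T lying, with respect to the line DE, on the side of the vertices
   of T that belong to the subdomain s.  The closure accounts for vertices on the
   boundary of [Omega]; vertices on [Gamma] are on the line DE and select no
   side. *)
Definition subelement T D E (s : side) : set (plane R) :=
  [set x | triangle T x /\
     exists V, [/\ V \in (vertices T : seq _), closure (subdomain S s) V &
                   0 < cross (E - D) (V - D) * cross (E - D) (x - D)]].

Definition ND_field p : Prop :=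
  exists (a : plane R) (b : R), p = fun x => a + b *: (x.2, - x.1).

Definition midpoint D E : plane R := 2^-1 *: (D + E).

(* The relation C_T(p) = q. *)
Definition CT_rel D E p q : Prop :=
  [/\ forall x, segment D E x ->
        dot (q x) (tangent D E) = dot (p x) (tangent D E),
      forall x, (mu S plus)^-1 * curl q x = (mu S minus)^-1 * curl p x &
      be S plus * dot (q (midpoint D E)) (normal D E) =
      be S minus * dot (p (midpoint D E)) (normal D E)].

(* Membership in the local spaces constrains the representative only inside the
   open (sub)elements: its values on edges and on the segment DE are free, and
   traces on edges are taken as one-sided limits. *)
Definition in_ND T v : Prop :=
  exists2 p, ND_field p & forall x, interior (triangle T) x -> v x = p x.

Definition in_IND_interface T v : Prop :=
  exists D E p q,
    [/\ cut_points T D E, ND_field p, ND_field q, CT_rel D E p q &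
        (forall x, interior (triangle T) x -> subelement T D E minus x ->
           v x = p x) /\
        (forall x, interior (triangle T) x -> subelement T D E plus x ->
           v x = q x)].

Definition in_IND T v : Prop :=
  (interface_element T -> in_IND_interface T v) /\
  (~ interface_element T -> in_ND T v).

Definition trace T v (x : plane R) : plane R :=
  (lim ((v y).1 @[y --> within (interior (triangle T)) (nbhs x)]),
   lim ((v y).2 @[y --> within (interior (triangle T)) (nbhs x)])).

Definition zero_tangential_trace v : Prop :=
  forall T P Q, boundary_edge T P Q ->
    {ae (@lebesgue_measure R), forall s, s \in `[0, 1] ->
      dot (trace T v (P + s *: (Q - P))) (tangent P Q) = 0}.

Definition ND0 : set (vfield R) :=
  [set v | [/\ Hcurl (Omega S) v, forall T, in_ND T v &
               zero_tangential_trace v]].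

Definition IND : set (vfield R) :=
  [set v | [/\ L2_field (Omega S) v, forall T, in_IND T v &
     forall T1 T2 P Q, interior_edge T1 T2 P Q ->
       line_integral P Q
         (fun x => dot (trace T1 v x - trace T2 v x) (tangent P Q)) = 0]].

Definition IND0 : set (vfield R) := IND `&` [set v | zero_tangential_trace v].

End Elements.

Definition bilinear_a (R : realType) (S : interface_data R) (u v : vfield R) :
  R :=
  Rintegral (area R) (Omega S)
    (fun x => (piecewise S (mu S) x)^-1 * (curl u x * curl v x)) +
  Rintegral (area R) (Omega S)
    (fun x => piecewise S (be S) x * dot (u x) (v x)).

(* Main.v *)
(* Test [u] with a conforming field [v] that has the same mean tangential trace as [u]
   on every edge.  Both sides of the inequality then split over the elements, and it
   suffices to bound the energy of [(u, v)] below by the square of the size [m] of [u] on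
   each element, where [u] and [v] are at most of order [m].

   On an element cut by the chord [DE] into a corner piece with edge fractions [d] and
   [e] and its complement, let [P] and [Q] be the values of the two Nedelec pieces at the
   midpoint of the chord.  To leading order [v] is [Q + J g], where [J] is the jump of the
   edge moments and [g] is minus the gradient of the barycentric coordinate of the corner.
   The coupling conditions at the chord make the weighted products of [P] and [Q] with
   this vector a quadratic form in the tangential and normal components; it is definite
   as long as the ratio of the coefficients stays below 10.65, uniformly in [d] and [e].
   The curl terms have a sign, and the remainders are of relative order [h].  The curve
   itself differs from its chord only inside a strip whose relative width tends to zero,
   because a C^1 Jordan curve has nearly parallel chords at small scales.

   The glued field belongs to H(curl): on each triangle Green's formula leaves the edge
   moments of [v] times the edge means of the test function; these are equal and opposite
   for the two triangles at an interior edge. *)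

Require Import Defs.
From mathcomp Require Import all_boot all_order all_algebra.
From mathcomp Require Import all_classical all_reals all_analysis.
From mathcomp Require Import measurable_realfun ring lra.

Set Implicit Arguments.
Unset Strict Implicit.
Unset Printing Implicit Defensive.

Import Order.TTheory GRing.Theory Num.Theory numFieldNormedType.Exports.
Local Open Scope classical_set_scope.
Local Open Scope ring_scope.

(** The number 10.65 lies just below 5 + 4 sqrt 2. Write [1 + s] for the ratio of the larger
    coefficient to the smaller one. The mixed term of the quadratic form carries a factor [l] with
    [|l| <= 1/2], and for [t = s |l|] the definiteness estimate needs t^2 < 4 (1 + t), that is t < 2
    + 2 sqrt 2, which holds as long as s < 4 + 4 sqrt 2 = 9.656... Stopping at s = 9.65 leaves a
    fixed margin, and this margin pays for the strip and for the terms of order [h]. Three obstacles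
    shape the rest. A member of [IND] is arbitrary on edges and chords, and its classical curl may
    be nonmeasurable there, so every integral is handled up to null sets. A cut may pass through a
    vertex or run along an edge, and both pieces may carry the same side label; the element then
    behaves as an uncut one. Finally, when [u] has norm zero the supremum still has to be
    nonnegative, so each mesh must provide a nonzero conforming field that can be taken with either
    sign. *)

Section NullSets.
Context d (T : measurableType d) (R : realType).
Variable mu : {measure set T -> \bar R}.
Import HBNNSimple.

(** The integral of a nonnegative function is the supremum of the integrals of the simple functions
    below it. Multiplying such a simple function by the indicator of the complement of [N] brings it
    below [g] and leaves its integral unchanged. *)
Lemma ge0_integral_le_off_null (N : set T) (f g : T -> \bar R) :
  measurable N -> mu N = 0%E -> (forall x, 0 <= f x)%E -> (forall x, 0 <= g x)%E ->
  (forall x, ~ N x -> f x = g x) ->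
  (\int[mu]_x f x <= \int[mu]_x g x)%E.
Proof.
move=> mN N0 f0 g0 fg.
rewrite !ge0_integralTE//.
apply: ge_ereal_sup => _ [h /= hf <-].
have mNC : measurable (~` N) by exact: measurableC.
pose h' := mul_nnsfun h (indic_nnsfun R mNC).
have h'E x : h x * mindic R mNC x = h x * (\1_(~` N) x) by [].
have hint (k : {nnsfun T >-> R}) : sintegral mu k = (\int[mu]_x (k x)%:E)%E.
  by rewrite integral_nnsfun// patch_setT.
have h'g x : ((h' x)%:E <= g x)%E.
  rewrite [h' x]h'E indicE; have [xN|xN] := boolP (x \in ~` N).
    by rewrite mulr1 -fg ?hf//; move: xN; rewrite inE.
  by rewrite mulr0.
apply: le_trans (ereal_sup_ubound _); last by exists h'.
rewrite !hint le_eqVlt; apply/orP; left; apply/eqP.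
apply: ae_eq_integral => //; [exact/measurable_EFinP|exact/measurable_EFinP|].
exists N; split => // x /=; apply: contra_notP => xN _.
by rewrite h'E indicE mem_set// mulr1.
Qed.

(* No measurability of [f] or [g] is required: an arbitrary function can be
   changed on a measurable null set without changing its integral. *)
Lemma integral_ext_off_null (D N : set T) (f g : T -> \bar R) :
  measurable N -> mu N = 0%E ->
  (forall x, D x -> ~ N x -> f x = g x) ->
  (\int[mu]_(x in D) f x = \int[mu]_(x in D) g x)%E.
Proof.
move=> mN N0 fg.
rewrite integral_mkcond [RHS]integral_mkcond.
have {}fg x : ~ N x -> (f \_ D) x = (g \_ D) x.
  move=> xN; rewrite !patchE; case: ifPn => // xD; apply: fg => //.
  by move: xD; rewrite inE.
rewrite integralE [RHS]integralE; congr (_ - _)%E; apply/eqP; rewrite eq_le;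
  apply/andP; split; apply: (@ge0_integral_le_off_null N) => // x xN;
  by rewrite ?funeposE ?funenegE ?fg// le_max lexx orbT.
Qed.

Lemma Rintegral_ext_off_null (D N : set T) (f g : T -> R) :
  measurable N -> mu N = 0%E ->
  (forall x, D x -> ~ N x -> f x = g x) ->
  Rintegral mu D f = Rintegral mu D g.
Proof.
move=> mN N0 fg; rewrite /Rintegral; congr fine.
by apply: (integral_ext_off_null mN) => // x Dx Nx; rewrite fg.
Qed.

Lemma bounded_integrable (D : set T) (f : T -> R) (K : R) :
  measurable D -> (mu D < +oo)%E -> measurable_fun D f ->
  (forall x, D x -> `|f x| <= K) -> mu.-integrable D (EFin \o f).
Proof.
move=> mD Dfin mf fK.
apply: (@le_integrable _ _ _ mu D mD _ (cst K%:E)).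
- exact/measurable_EFinP.
- move=> x Dx /=; rewrite lee_fin (le_trans (fK _ Dx))//.
  exact: ler_norm.
- apply/integrableP; split; first exact: measurable_cst.
  rewrite integral_cst//; apply: lte_mul_pinfty => //.
Qed.

End NullSets.

(** * Measurability, Fubini and area bounds in the plane *)

Section Plane.
Context (R : realType).
Implicit Types (A : set (plane R)) (f : plane R -> R).

Lemma measurable_box (a b c d : R) : measurable (`]a, b[ `*` `]c, d[ : set (plane R)).
Proof. by apply: measurableX; exact: measurable_itv. Qed.

(** The sigma-algebra of the plane is the product one, so an open set has to be written as a
    countable union of boxes; boxes with rational corners suffice. *)
Lemma open_measurable_plane A : open A -> measurable A.
Proof.
move=> oA.
pose B (q : rat * rat * rat * rat) : set (plane R) :=
  `](ratr q.1.1.1), (ratr q.1.1.2)[ `*` `](ratr q.1.2), (ratr q.2)[.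
have -> : A = \bigcup_(q in [set q | B q `<=` A]) B q.
  apply/seteqP; split => [x Ax|x [q qA Bqx]]; last exact: qA.
  have := oA; rewrite openE => /(_ _ Ax)/nbhs_ballP[e /= e0 eA].
  have bnd (y : R) : exists q1 q2 : rat,
      [/\ y - e < ratr q1, ratr q1 < y, y < ratr q2 & ratr q2 < y + e].
    have /rat_in_itvoo[q1] : y - e < y by rewrite ltrBlDr ltrDl.
    have /rat_in_itvoo[q2] : y < y + e by rewrite ltrDl.
    rewrite !in_itv/= => /andP[? ?] /andP[? ?].
    by exists q1, q2.
  have [a [b [ha1 ha2 hb1 hb2]]] := bnd x.1.
  have [c [d [hc1 hc2 hd1 hd2]]] := bnd x.2.
  exists (a, b, c, d) => /=; last by split; rewrite /= in_itv/= ?ha2 ?hc2.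
  move=> z [/=]; rewrite !in_itv/= => /andP[z1 z2] /andP[z3 z4]; apply: eA.
  by split; rewrite /ball/= ltr_norml; lra.
rewrite bigcup_mkcond; apply: countable_bigcupT_measurable => [|q].
  exact: countableP.
by case: ifP => // _; exact: measurable_box.
Qed.

Lemma continuous_measurable_plane f (D : set (plane R)) :
  measurable D -> continuous f -> measurable_fun D f.
Proof.
move=> mD cf; apply: (measurability _ (RGenOpens.measurableE R)) => _ [_ [a [b ->] <-]].
apply: measurableI => //; apply: open_measurable_plane.
by apply: open_comp => //; exact: interval_open.
Qed.

Notation leb := (@lebesgue_measure R).

Lemma area_box_fin (a b c d : R) : (area R (`[a, b] `*` `[c, d]) < +oo)%E.
Proof.
rewrite product_measure1E//= !lebesgue_measure_itv/= !lte_fin.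
by do 2 case: ifP => _; rewrite ?mule0 ?mul0e ?ltry// -!EFinB -EFinM ltry.
Qed.

(** Cavalieri's principle, meant for thin strips: such a strip has short vertical or short
    horizontal sections, according to its direction. *)
Lemma area_le_xsection A (a b L : R) : measurable A -> a <= b -> 0 <= L ->
  (forall x, A x -> a <= x.1 <= b) ->
  (forall t, exists c, forall y, A (t, y) -> c <= y <= c + L) ->
  (area R A <= ((b - a) * L)%:E)%E.
Proof.
move=> mA ab L0 Aab AL; rewrite /product_measure1.
have h (t : R) : ((leb \o xsection A) t <= (L * \1_(`[a, b]) t)%:E)%E.
  have [/andP[at_ tb]|ntab] := boolP (a <= t <= b).
    rewrite indicE mem_set ?mulr1//=; last by rewrite in_itv/= at_ tb.
    have [c Ac] := AL t.
    apply: (@le_trans _ _ (leb `[c, c + L])).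
      apply: le_measure; rewrite ?inE//; first exact: measurable_xsection.
      by move=> y; rewrite /xsection/= inE => /Ac; rewrite in_itv.
    rewrite lebesgue_measure_itv/= lte_fin; case: ifPn => //.
    by rewrite -EFinB lee_fin => _; lra.
  rewrite /= (_ : xsection A t = set0) ?measure0 ?lee_fin ?mulr_ge0//.
  apply/seteqP; split => y //; rewrite /xsection/= inE => /Aab/=.
  by move/negP: ntab.
apply: (@le_trans _ _ (\int[leb]_t (L * \1_(`[a, b]) t)%:E)%E).
  apply: ge0_le_integral => //.
  - exact: measurable_fun_xsection.
  - by apply/measurable_EFinP; apply: measurable_funM => //; exact: measurable_indic.
under eq_integral do rewrite EFinM.
rewrite ge0_integralZl//; last by apply/measurable_EFinP; exact: measurable_indic.
have -> : (\int[leb]_t (\1_(`[a, b]) t)%:E = leb `[a, b])%E.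
  by rewrite integral_indic// setIT.
rewrite lebesgue_measure_itv/= lte_fin.
case: ifPn => _; last by rewrite mule0 lee_fin mulr_ge0// subr_ge0.
by rewrite -EFinB -EFinM mulrC.
Qed.

(** Fubini for the restriction of [f] to [A], which is integrable because it is bounded on a set
    contained in a box; the vertical section of [A] over [t] is the open interval between the two
    graphs. *)
Lemma Rintegral_normal_x (a b K : R) (lo up : R -> R) (A : set (plane R)) f :
  measurable A -> a <= b ->
  (forall x, A x <-> a < x.1 < b /\ lo x.1 < x.2 < up x.1) ->
  (exists L, forall t, a < t < b -> - L <= lo t /\ up t <= L) ->
  measurable_fun setT f -> (forall x, A x -> `|f x| <= K) ->
  Rintegral (area R) A f =
  Rintegral leb `]a, b[ (fun t => Rintegral leb `]lo t, up t[ (fun y => f (t, y))).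
Proof.
move=> mA ab AE [L hL] mf fK.
have Ain : A `<=` `[a, b] `*` `[- L, L].
  move=> x /AE[/[dup] h /andP[h1 h2] /andP[h3 h4]]; have [h5 h6] := hL _ h.
  by split; rewrite /= in_itv/=; apply/andP; split; lra.
have Afin : (area R A < +oo)%E.
  apply: (@le_lt_trans _ _ (area R (`[a, b] `*` `[- L, L]))).
    by apply: le_measure; rewrite ?inE//; apply: measurableX.
  exact: area_box_fin.
have fi : (area R).-integrable A (EFin \o f).
  apply: (@bounded_integrable _ _ _ (area R) A f K) => //.
  exact: measurable_funTS.
have gi : (area R).-integrable setT (EFin \o (f \_ A)).
  by rewrite -restrict_EFin; apply/integrable_restrict => //; rewrite setTI.
rewrite /Rintegral integral_mkcond restrict_EFin/=.
rewrite -(integral12_prod_meas1 gi) /fubini_F; congr fine.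
rewrite [RHS]integral_mkcond; apply: eq_integral => t _.
rewrite patchE; case: ifPn => [|] tab; last first.
  rewrite integral0_eq// => y _ /=; rewrite patchE memNset// => /AE[h _].
  by move/negP: tab; apply; apply/mem_set; rewrite /= in_itv.
have {}tab : a < t < b by have := set_mem tab; rewrite /= in_itv.
have lofin : (leb `]lo t, up t[ < +oo)%E.
  by rewrite lebesgue_measure_itv/= lte_fin; case: ifP => // _; rewrite -EFinB ltry.
have fti : leb.-integrable `]lo t, up t[ (EFin \o (fun y => f (t, y))).
  apply: (@bounded_integrable _ _ _ _ _ _ K) => //.
    by apply: measurable_funTS; apply: measurableT_comp.
  by move=> y; rewrite /= in_itv/= => h; apply: fK; apply/AE.
rewrite /Rintegral fineK; last exact: integrable_fin_num.
rewrite [RHS]integral_mkcond; apply: eq_integral => y _.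
rewrite /= !patchE; case: ifPn => [yA|yA].
  by rewrite mem_set//= in_itv/=; have /AE[] := set_mem yA.
rewrite memNset//= in_itv/= => h; move/negP: yA; apply; apply/mem_set.
by apply/AE.
Qed.

Lemma Rintegral_normal_y (a b K : R) (lo up : R -> R) (A : set (plane R)) f :
  measurable A -> a <= b ->
  (forall x, A x <-> a < x.2 < b /\ lo x.2 < x.1 < up x.2) ->
  (exists L, forall t, a < t < b -> - L <= lo t /\ up t <= L) ->
  measurable_fun setT f -> (forall x, A x -> `|f x| <= K) ->
  Rintegral (area R) A f =
  Rintegral leb `]a, b[ (fun t => Rintegral leb `]lo t, up t[ (fun y => f (y, t))).
Proof.
move=> mA ab AE [L hL] mf fK.
have Ain : A `<=` `[- L, L] `*` `[a, b].
  move=> x /AE[/[dup] h /andP[h1 h2] /andP[h3 h4]]; have [h5 h6] := hL _ h.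
  by split; rewrite /= in_itv/=; apply/andP; split; lra.
have Afin : (area R A < +oo)%E.
  apply: (@le_lt_trans _ _ (area R (`[- L, L] `*` `[a, b]))).
    by apply: le_measure; rewrite ?inE//; apply: measurableX.
  exact: area_box_fin.
have fi : (area R).-integrable A (EFin \o f).
  apply: (@bounded_integrable _ _ _ (area R) A f K) => //.
  exact: measurable_funTS.
have gi : (area R).-integrable setT (EFin \o (f \_ A)).
  by rewrite -restrict_EFin; apply/integrable_restrict => //; rewrite setTI.
rewrite /Rintegral integral_mkcond restrict_EFin/=.
rewrite -(integral21_prod_meas1 gi) /fubini_G; congr fine.
rewrite [RHS]integral_mkcond; apply: eq_integral => t _.
rewrite patchE; case: ifPn => [|] tab; last first.
  rewrite integral0_eq// => y _ /=; rewrite patchE memNset// => /AE[h _].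
  by move/negP: tab; apply; apply/mem_set; rewrite /= in_itv.
have {}tab : a < t < b by have := set_mem tab; rewrite /= in_itv.
have lofin : (leb `]lo t, up t[ < +oo)%E.
  by rewrite lebesgue_measure_itv/= lte_fin; case: ifP => // _; rewrite -EFinB ltry.
have fti : leb.-integrable `]lo t, up t[ (EFin \o (fun y => f (y, t))).
  apply: (@bounded_integrable _ _ _ _ _ _ K) => //.
    by apply: measurable_funTS; apply: measurableT_comp.
  by move=> y; rewrite /= in_itv/= => h; apply: fK; apply/AE.
rewrite /Rintegral fineK; last exact: integrable_fin_num.
rewrite [RHS]integral_mkcond; apply: eq_integral => y _.
rewrite /= !patchE; case: ifPn => [yA|yA].
  by rewrite mem_set//= in_itv/=; have /AE[] := set_mem yA.
rewrite memNset//= in_itv/= => h; move/negP: yA; apply; apply/mem_set.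
by apply/AE.
Qed.

Lemma area_le_ysection A (a b L : R) : measurable A -> a <= b -> 0 <= L ->
  (forall x, A x -> a <= x.2 <= b) ->
  (forall t, exists c, forall y, A (y, t) -> c <= y <= c + L) ->
  (area R A <= ((b - a) * L)%:E)%E.
Proof.
move=> mA ab L0 Aab AL.
(* [area] is built from vertical sections; uniqueness of the product measure gives the same value
   from horizontal ones. *)
have -> : area R A = (leb \x^ leb)%E A.
  apply: product_measure_unique => // B C mB mC.
  by rewrite /= product_measure2E.
rewrite /product_measure2.
have h (t : R) : ((leb \o ysection A) t <= (L * \1_(`[a, b]) t)%:E)%E.
  have [/andP[at_ tb]|ntab] := boolP (a <= t <= b).
    rewrite indicE mem_set ?mulr1//=; last by rewrite in_itv/= at_ tb.
    have [c Ac] := AL t.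
    apply: (@le_trans _ _ (leb `[c, c + L])).
      apply: le_measure; rewrite ?inE//; first exact: measurable_ysection.
      by move=> y; rewrite /ysection/= inE => /Ac; rewrite in_itv.
    rewrite lebesgue_measure_itv/= lte_fin; case: ifPn => //.
    by rewrite -EFinB lee_fin => _; lra.
  rewrite /= (_ : ysection A t = set0) ?measure0 ?lee_fin ?mulr_ge0//.
  apply/seteqP; split => y //; rewrite /ysection/= inE => /Aab/=.
  by move/negP: ntab.
apply: (@le_trans _ _ (\int[leb]_t (L * \1_(`[a, b]) t)%:E)%E).
  apply: ge0_le_integral => //.
  - exact: measurable_fun_ysection.
  - by apply/measurable_EFinP; apply: measurable_funM => //; exact: measurable_indic.
under eq_integral do rewrite EFinM.
rewrite ge0_integralZl//; last by apply/measurable_EFinP; exact: measurable_indic.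
have -> : (\int[leb]_t (\1_(`[a, b]) t)%:E = leb `[a, b])%E.
  by rewrite integral_indic// setIT.
rewrite lebesgue_measure_itv/= lte_fin.
case: ifPn => _; last by rewrite mule0 lee_fin mulr_ge0// subr_ge0.
by rewrite -EFinB -EFinM mulrC.
Qed.

End Plane.

(** * The scalar inequality behind the bound 10.65 *)

Section KeyAlgebra.
Context (R : realType).
Implicit Types (a b d e s z t k l al : R).

(* A number below 1: its distance to 1 is the margin of definiteness. *)
Definition qm : R := 2499%:R / 2500%:R.

(** The area fraction is estimated by 1, and with [t = s |l|] what remains is t^2 <= 4 qm (1 + t).
    For [qm = 1] the positive root is 2 + 2 sqrt 2 = 4.828..., while here [t <= 9.65 / 2 = 4.825].
    This covers every cut with [|l| <= k]. *)
Lemma crude_bound s k l al :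
  0 <= s <= 965%:R / 100%:R -> 0 <= al <= 1 -> `|l| <= k -> `|l| <= 2^-1 ->
  (1 + s * al) * (s ^+ 2 * l ^+ 2) <= 4 * qm * (1 + s) * (1 + s * k).
Proof.
move=> /andP[s0 s1] /andP[al0 al1] lk l2.
have -> : s ^+ 2 * l ^+ 2 = (s * `|l|) ^+ 2 by rewrite exprMn real_normK ?num_real.
have t0 : 0 <= s * `|l| by rewrite mulr_ge0.
have t1 : s * `|l| <= s * k by rewrite ler_wpM2l.
have t2 : s * `|l| <= 4825%:R / 1000%:R.
  by apply: (@le_trans _ _ (965%:R / 100%:R * 2^-1)); [rewrite ler_pM|lra].
have h1 : 1 + s * al <= 1 + s by rewrite lerD2l -[leRHS]mulr1 ler_wpM2l.
have h2 : (s * `|l|) ^+ 2 <= 4 * qm * (1 + s * k).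
  apply: (@le_trans _ _ (4 * qm * (1 + s * `|l|))); rewrite /qm; last by lra.
  by move: (s * _) t0 t2 => t t0 t2; nra.
have sl0 := sqr_ge0 (s * `|l|).
have s10 : 0 <= 1 + s by lra.
have -> : 4 * qm * (1 + s) * (1 + s * k) = (1 + s) * (4 * qm * (1 + s * k)) by ring.
apply: (@le_trans _ _ ((1 + s) * (s * `|l|) ^+ 2)); first by rewrite ler_wpM2r.
by rewrite ler_wpM2l.
Qed.

(** Equal to 10.65 - 1, the bound for the relative excess [(b - a) / a]. *)
Definition smax : R := 965%:R / 100%:R.
Notation S0 := smax.

(* The three quintic inequalities are sums of the squares and monomials listed in
   their proofs, with coefficients found by linear programming. *)
Lemma quintic1 z : 0 <= z ->
  S0 ^+ 2 * (z * (1 + S0) + 1) * z ^+ 2 <=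
  4 * qm * (1 + z) * (1 + z ^+ 2) * (1 + z ^+ 2 + S0) * (1 + S0).
Proof.
move=> z0; rewrite /qm /smax.
have h1 : 0 <= z * (z ^+ 2 - 4) ^+ 2 by rewrite mulr_ge0 ?sqr_ge0.
have h2 : 0 <= (z * (z - 182%:R / 100%:R)) ^+ 2 by rewrite sqr_ge0.
have h3 : 0 <= (z - 45%:R / 100%:R) ^+ 2 by rewrite sqr_ge0.
have h4 : 0 <= z ^+ 2 by rewrite sqr_ge0.
have h5 : 0 <= z ^+ 3 by rewrite exprn_ge0.
have h6 : 0 <= z ^+ 4 by rewrite exprn_ge0.
lra.
Qed.

Lemma quintic2 z : 0 <= z ->
  S0 ^+ 2 * (z + (1 + S0)) * z ^+ 2 <=
  4 * qm * (1 + z) * (1 + z ^+ 2) * (1 + z ^+ 2 + S0 * z ^+ 2) * (1 + S0).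
Proof.
move=> z0; rewrite /qm /smax.
have h1 : 0 <= (1 - 4 * z ^+ 2) ^+ 2 by rewrite sqr_ge0.
have h2 : 0 <= z * (1 - 182%:R / 100%:R * z) ^+ 2 by rewrite mulr_ge0 ?sqr_ge0.
have h5 : 0 <= z ^+ 3 by rewrite exprn_ge0.
have h3 : 0 <= z ^+ 3 * (z - 40%:R / 100%:R) ^+ 2 by rewrite mulr_ge0 ?sqr_ge0.
have h4 : 0 <= z ^+ 2 by rewrite sqr_ge0.
have h6 : 0 <= z ^+ 4 by rewrite exprn_ge0.
lra.
Qed.

Lemma quintic3 z : 0 <= z ->
  S0 ^+ 3 * z ^+ 2 <=
  4 * qm * (1 + z) * (1 + z ^+ 2) * (1 + z ^+ 2 + S0 / 2) * (1 + S0).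
Proof.
move=> z0; rewrite /qm /smax.
have h1 : 0 <= z * (1 - 108%:R / 100%:R * z) ^+ 2 by rewrite mulr_ge0 ?sqr_ge0.
have h2 : 0 <= (z ^+ 2 - 1) ^+ 2 by rewrite sqr_ge0.
have h3 : 0 <= z ^+ 3 by rewrite exprn_ge0.
have h4 : 0 <= z ^+ 2 by rewrite sqr_ge0.
have h6 : 0 <= z ^+ 4 by rewrite exprn_ge0.
have h7 : 0 <= z ^+ 5 by rewrite exprn_ge0.
lra.
Qed.

(* The fractions [s^2 / (w + s t)] and [s^2 / ((1 + s) (w + s t))] increase with [s]. *)
Lemma mono_s (s S w t : R) : 0 <= s <= S -> 0 <= w -> 0 <= t ->
  s ^+ 2 * (w + S * t) <= S ^+ 2 * (w + s * t) /\
  s ^+ 2 * (1 + S) * (w + S * t) <= S ^+ 2 * (1 + s) * (w + s * t).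
Proof.
move=> /andP[s0 s1] w0 t0.
have S0p : 0 <= S by rewrite (le_trans s0).
have h1 : s ^+ 2 <= S ^+ 2 by rewrite ler_pXn2r ?nnegrE.
have h2 : s ^+ 2 * S <= S ^+ 2 * s.
  have : 0 <= s * S * (S - s) by rewrite !mulr_ge0// subr_ge0.
  by lra.
have h3 : s ^+ 2 * w <= S ^+ 2 * w by rewrite ler_wpM2r.
have h4 : s ^+ 2 * S * w <= S ^+ 2 * s * w by rewrite ler_wpM2r.
have h5 : s ^+ 2 * S * t <= S ^+ 2 * s * t by rewrite ler_wpM2r.
by split; lra.
Qed.

(** This is [acute1] at [d = 1] with denominators cleared. By [mono_s] each quotient of left by
    right grows with [s], so the worst case is [s = smax], which is [quintic1]. *)
Lemma acute1_d1 s z : 0 <= s <= S0 -> 0 <= z ->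
  (1 + z + s * z) * s ^+ 2 * z ^+ 2 <=
  4 * qm * (1 + s) * (1 + z) * (1 + z ^+ 2) * (1 + z ^+ 2 + s).
Proof.
move=> hs z0.
have w0 : 0 <= 1 + z ^+ 2 by rewrite addr_ge0 ?sqr_ge0.
have [m1 m2] := mono_s hs w0 ler01.
have := quintic1 z0.
move: hs => /andP[s0 s1]; have S0p : 0 < S0 by rewrite /smax; lra.
rewrite !mulr1 in m1 m2.
set w := 1 + z ^+ 2 in w0 m1 m2 * => q1.
have ws : 0 < (w + S0) * (1 + S0) by apply: mulr_gt0; lra.
rewrite -(ler_pM2r ws).
apply: (@le_trans _ _ ((1 + s) * (w + s) * (S0 ^+ 2 * (z * (1 + S0) + 1) * z ^+ 2))); last first.
  have : (1 + s) * (w + s) * (S0 ^+ 2 * (z * (1 + S0) + 1) * z ^+ 2) <=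
    (1 + s) * (w + s) * (4 * qm * (1 + z) * w * (w + S0) * (1 + S0)).
    by rewrite ler_wpM2l// mulr_ge0// addr_ge0.
  by move=> /le_trans; apply; rewrite le_eqVlt; apply/orP; left; apply/eqP; ring.
have -> : (1 + z + s * z) * s ^+ 2 * z ^+ 2 * ((w + S0) * (1 + S0)) =
  z ^+ 2 * (z * (1 + s) * (1 + S0) * (s ^+ 2 * (w + S0)) +
            s ^+ 2 * (1 + S0) * (w + S0)) by ring.
have -> : (1 + s) * (w + s) * (S0 ^+ 2 * (z * (1 + S0) + 1) * z ^+ 2) =
  z ^+ 2 * (z * (1 + s) * (1 + S0) * (S0 ^+ 2 * (w + s)) +
            S0 ^+ 2 * (1 + s) * (w + s)) by ring.
have h1 : 0 <= 1 + s by lra.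
have h2 : 0 <= 1 + S0 by lra.
by rewrite ler_wpM2l ?sqr_ge0// lerD// ler_wpM2l// !mulr_ge0.
Qed.

(** This is [acute2] at [d = 1] with denominators cleared; [mono_s] again reduces it to [s = smax],
    now with [quintic2]. *)
Lemma acute2_d1 s z : 0 <= s <= S0 -> 0 <= z ->
  (1 + z + s) * s ^+ 2 * z ^+ 2 <=
  4 * qm * (1 + s) * (1 + z) * (1 + z ^+ 2) * (1 + z ^+ 2 + s * z ^+ 2).
Proof.
move=> hs z0.
have z20 := sqr_ge0 z.
have w0 : 0 <= 1 + z ^+ 2 by rewrite addr_ge0.
have [m1 m2] := mono_s hs w0 z20.
have := quintic2 z0.
move: hs => /andP[s0 s1]; have S0p : 0 < S0 by rewrite /smax; lra.
set w := 1 + z ^+ 2 in w0 m1 m2 * => q1.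
have wp : 0 < w by rewrite ltr_wpDr.
have ws : 0 < (w + S0 * z ^+ 2) * (1 + S0).
  by have := mulr_ge0 (ltW S0p) z20 => ?; apply: mulr_gt0; lra.
rewrite -(ler_pM2r ws).
apply: (@le_trans _ _ ((1 + s) * (w + s * z ^+ 2) * (S0 ^+ 2 * (z + (1 + S0)) * z ^+ 2))); last first.
  have : (1 + s) * (w + s * z ^+ 2) * (S0 ^+ 2 * (z + (1 + S0)) * z ^+ 2) <=
    (1 + s) * (w + s * z ^+ 2) * (4 * qm * (1 + z) * w * (w + S0 * z ^+ 2) * (1 + S0)).
    by rewrite ler_wpM2l// mulr_ge0// addr_ge0// mulr_ge0.
  by move=> /le_trans; apply; rewrite le_eqVlt; apply/orP; left; apply/eqP; ring.
have -> : (1 + z + s) * s ^+ 2 * z ^+ 2 * ((w + S0 * z ^+ 2) * (1 + S0)) =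
  z ^+ 2 * (z * (s ^+ 2 * (1 + S0) * (w + S0 * z ^+ 2)) +
            (1 + s) * (1 + S0) * (s ^+ 2 * (w + S0 * z ^+ 2))) by ring.
have -> : (1 + s) * (w + s * z ^+ 2) * (S0 ^+ 2 * (z + (1 + S0)) * z ^+ 2) =
  z ^+ 2 * (z * (S0 ^+ 2 * (1 + s) * (w + s * z ^+ 2)) +
            (1 + s) * (1 + S0) * (S0 ^+ 2 * (w + s * z ^+ 2))) by ring.
have h1 : 0 <= 1 + s by lra.
have h2 : 0 <= 1 + S0 by lra.
by rewrite ler_wpM2l// lerD// ler_wpM2l// mulr_ge0.
Qed.

(** Controls the extra term, proportional to [1 - d ^+ 2], that [acute1] gains when [d] decreases
    from 1. *)
Lemma acute1_slope s z : 0 <= s <= S0 -> 0 <= z ->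
  s ^+ 3 * z ^+ 2 <=
  4 * qm * (1 + s) * (1 + z) * (1 + z ^+ 2) * (1 + z ^+ 2 + s / 2).
Proof.
move=> hs z0.
have w0 : 0 <= 1 + z ^+ 2 by rewrite addr_ge0 ?sqr_ge0.
have h2 : (0 : R) <= 2^-1 by lra.
have [_ m2] := mono_s hs w0 h2.
have := quintic3 z0.
move: hs => /andP[s0 s1]; have S0p : 0 < S0 by rewrite /smax; lra.
set w := 1 + z ^+ 2 in w0 m2 * => q1.
have ws : 0 < (w + S0 / 2) * (1 + S0).
  by apply: mulr_gt0; lra.
rewrite -(ler_pM2r ws).
apply: (@le_trans _ _ ((1 + s) * (w + s / 2) * (S0 ^+ 3 * z ^+ 2))); last first.
  have : (1 + s) * (w + s / 2) * (S0 ^+ 3 * z ^+ 2) <=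
    (1 + s) * (w + s / 2) * (4 * qm * (1 + z) * w * (w + S0 / 2) * (1 + S0)).
    by rewrite ler_wpM2l// mulr_ge0// addr_ge0// divr_ge0.
  by move=> /le_trans; apply; rewrite le_eqVlt; apply/orP; left; apply/eqP; ring.
have -> : s ^+ 3 * z ^+ 2 * ((w + S0 / 2) * (1 + S0)) =
  z ^+ 2 * (s * (s ^+ 2 * (1 + S0) * (w + S0 / 2))) by ring.
have -> : (1 + s) * (w + s / 2) * (S0 ^+ 3 * z ^+ 2) =
  z ^+ 2 * (S0 * (S0 ^+ 2 * (1 + s) * (w + s / 2))) by ring.
rewrite ler_wpM2l ?sqr_ge0//; apply: ler_pM => //.
have h3 : 0 <= w + S0 / 2 by lra.
by rewrite !mulr_ge0 ?sqr_ge0//; lra.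
Qed.

(** For [z <= 1] the crude bound applies. For [z > 1], after clearing denominators, the left side is
    [d ^+ 2] times the left side of [acute1_d1] plus [1 - d ^+ 2] times that of [acute1_slope], so
    the two bounds can be added with these weights. *)
Lemma acute1 s d z : 0 <= s <= S0 -> 0 < d <= 1 -> d <= 1 + z -> -1 < z ->
  (1 + s * (1 - d ^+ 2 / (1 + z))) * (s ^+ 2 * (d * z / (1 + z ^+ 2)) ^+ 2) <=
  4 * qm * (1 + s) * (1 + s * (d / (1 + z ^+ 2))).
Proof.
move=> hs /andP[d0 d1] dz zm1.
have z20 := sqr_ge0 z.
have w0 : 0 < 1 + z ^+ 2 by rewrite ltr_wpDr.
have zp : 0 < 1 + z by lra.
have d20 : 0 <= d ^+ 2 by rewrite sqr_ge0.
have d21 : d ^+ 2 <= 1 by rewrite expr_le1// ltW.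
have [zle1|z1] := leP z 1.
  apply: crude_bound => //.
  - rewrite subr_ge0 ler_pdivrMr// mul1r lerBlDr lerDl divr_ge0 ?(ltW zp)// andbT.
    by rewrite expr2; apply: le_trans dz; rewrite -[leRHS]mulr1 ler_wpM2l// ltW.
  - rewrite normrM normfV (gtr0_norm w0) ler_pdivrMr// mulfVK ?gt_eqF//.
    rewrite normrM (gtr0_norm d0) -[leRHS]mulr1 ler_wpM2l ?(ltW d0)// ler_norml.
    by rewrite zle1 andbT ltW.
  - rewrite normrM normfV (gtr0_norm w0) ler_pdivrMr// normrM (gtr0_norm d0).
    apply: (@le_trans _ _ `|z|); first by rewrite -[leRHS]mul1r ler_wpM2r.
    have := sqr_ge0 (`|z| - 1); rewrite sqrrB1 real_normK ?num_real//; lra.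
have z0 : 0 <= z by lra.
have A := acute1_d1 hs z0.
have B := acute1_slope hs z0.
move: hs => /andP[s0 s1].
have q0 : 0 <= qm by rewrite /qm; lra.
have s10 : 0 <= 1 + s by lra.
set w := 1 + z ^+ 2 in w0 A B *.
(* The weighted sum of the two right sides must stay below [w + s * d]. The fraction 1/2 in
   [acute1_slope] is the largest one possible: the difference [d - d ^+ 2 * (3 - d ^+ 2) / 2] has a
   double zero at [d = 1]. *)
have h1 : d ^+ 2 * (w + s + (1 - d ^+ 2) * (w + s / 2)) <= w + s * d.
  have e1 : d ^+ 2 * (2 - d ^+ 2) <= 1 by have := sqr_ge0 (d ^+ 2 - 1); lra.
  have e2 : d ^+ 2 * (3 - d ^+ 2) / 2 <= d.
    have : 0 <= d * ((1 - d) * (1 - d) * (2 + d)).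
      by rewrite !mulr_ge0 ?subr_ge0 ?addr_ge0// ltW.
    by lra.
  have e3 : w * (d ^+ 2 * (2 - d ^+ 2)) <= w by rewrite -[leRHS]mulr1 ler_wpM2l// ltW.
  have e4 : s * (d ^+ 2 * (3 - d ^+ 2) / 2) <= s * d by rewrite ler_wpM2l.
  by lra.
have p0 : 0 < (1 + z) * w ^+ 2 by rewrite mulr_gt0// exprn_gt0.
rewrite -(ler_pM2r p0).
have -> : (1 + s * (1 - d ^+ 2 / (1 + z))) * (s ^+ 2 * (d * z / w) ^+ 2) * ((1 + z) * w ^+ 2)
  = d ^+ 2 * ((1 + z + s * z) * s ^+ 2 * z ^+ 2 + (1 - d ^+ 2) * (s ^+ 3 * z ^+ 2)).
  by field; rewrite ?gt_eqF.
have -> : 4 * qm * (1 + s) * (1 + s * (d / w)) * ((1 + z) * w ^+ 2) =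
  4 * qm * (1 + s) * (1 + z) * w * (w + s * d) by field; rewrite gt_eqF.
have k0 : 0 <= 4 * qm * (1 + s) * (1 + z) * w.
  have h4 : 0 <= 4 * qm by lra.
  by apply: mulr_ge0 (ltW w0); apply: mulr_ge0 (ltW zp); apply: mulr_ge0.
apply: le_trans (ler_wpM2l k0 h1).
rewrite [leRHS]mulrCA ler_wpM2l//.
move: k0 A B; set K := 4 * qm * _ * _ * _ => k0 A B.
rewrite [leRHS](_ : _ = K * (w + s) + (1 - d ^+ 2) * (K * (w + s / 2))); last by ring.
by apply: lerD => //; rewrite ler_wpM2l// subr_ge0.
Qed.

(** Outside [0 < z < 1] the crude bound applies. Inside, the left side increases and the right side
    decreases with [d], so [d = 1] is the worst case. *)
Lemma acute2 s d z : 0 <= s <= S0 -> 0 < d <= 1 -> d <= 1 + z -> -1 < z ->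
  (1 + s * (d ^+ 2 / (1 + z))) * (s ^+ 2 * (d * z / (1 + z ^+ 2)) ^+ 2) <=
  4 * qm * (1 + s) * (1 + s * (1 - d / (1 + z ^+ 2))).
Proof.
move=> hs /andP[d0 d1] dz zm1.
have z20 := sqr_ge0 z.
have w0 : 0 < 1 + z ^+ 2 by rewrite ltr_wpDr.
have zp : 0 < 1 + z by lra.
have d20 : 0 <= d ^+ 2 by rewrite sqr_ge0.
have d21 : d ^+ 2 <= 1 by rewrite expr_le1// ltW.
have q0 : 0 <= qm by rewrite /qm; lra.
have [|zn] := boolP ((1 <= z) || (z <= 0)).
  move=> zc; apply: crude_bound => //.
  - rewrite divr_ge0 ?(ltW zp)//= ler_pdivrMr// mul1r.
    by rewrite expr2; apply: le_trans dz; rewrite -[leRHS]mulr1 ler_wpM2l// ltW.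
  - rewrite normrM normfV (gtr0_norm w0) ler_pdivrMr// mulrBl mul1r mulfVK ?gt_eqF//.
    rewrite normrM (gtr0_norm d0).
    have [z0|z0] := leP 0 z.
      have dz1 : d * z <= z by rewrite -[leRHS]mul1r ler_wpM2r.
      case/orP: zc => zc; last first.
        have -> : z = 0 by apply/eqP; rewrite eq_le zc z0.
        rewrite normr0 mulr0; lra.
      have : 0 <= z * (z - 1) by rewrite mulr_ge0// subr_ge0.
      by rewrite ger0_norm//; lra.
    have dz1 : d * (1 - z) <= (1 + z) * (1 - z) by rewrite ler_wpM2r//; lra.
    by rewrite ltr0_norm//; lra.
  - rewrite normrM normfV (gtr0_norm w0) ler_pdivrMr// normrM (gtr0_norm d0).
    apply: (@le_trans _ _ `|z|); first by rewrite -[leRHS]mul1r ler_wpM2r.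
    have := sqr_ge0 (`|z| - 1); rewrite sqrrB1 real_normK ?num_real//; lra.
move: zn; rewrite negb_or -!ltNge => /andP[z1 z0].
have A := acute2_d1 hs (ltW z0).
move: hs => /andP[s0 s1].
have s10 : 0 <= 1 + s by lra.
apply: (@le_trans _ _ ((1 + s * (1 / (1 + z))) * (s ^+ 2 * (z / (1 + z ^+ 2)) ^+ 2))).
  apply: ler_pM.
  - by rewrite addr_ge0// mulr_ge0// divr_ge0// ltW.
  - by rewrite mulr_ge0 ?sqr_ge0.
  - by rewrite lerD2l ler_wpM2l// ler_wpM2r// invr_ge0 ltW.
  - rewrite ler_wpM2l ?sqr_ge0// ler_pXn2r ?nnegrE ?divr_ge0 ?mulr_ge0// ?(ltW w0) ?(ltW d0) ?(ltW z0)//.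
    rewrite -mulrA -[leRHS]mul1r ler_wpM2r// divr_ge0// ltW//.
apply: (@le_trans _ _ (4 * qm * (1 + s) * (1 + s * (1 - 1 / (1 + z ^+ 2))))); last first.
  have h4 : 0 <= 4 * qm * (1 + s) by apply: mulr_ge0 => //; lra.
  have w0' : 0 <= (1 + z ^+ 2)^-1 by rewrite invr_ge0 ltW.
  have h5 := ler_wpM2r w0' d1.
  have h6 := ler_wpM2l s0 h5.
  by apply: (ler_wpM2l h4); lra.
set w := 1 + z ^+ 2 in w0 A *.
have p0 : 0 < (1 + z) * w ^+ 2 by rewrite mulr_gt0// exprn_gt0.
rewrite -(ler_pM2r p0).
have -> : (1 + s * (1 / (1 + z))) * (s ^+ 2 * (z / w) ^+ 2) * ((1 + z) * w ^+ 2)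
  = (1 + z + s) * s ^+ 2 * z ^+ 2.
  by field; rewrite ?gt_eqF.
apply: (le_trans A).
rewrite le_eqVlt; apply/orP; left; apply/eqP.
have -> : z ^+ 2 = w - 1 by rewrite /w; ring.
by field; rewrite gt_eqF.
Qed.

(* In the coordinates tangential and normal to the cut, [a] and [b] are the
   coefficients on the two pieces, [al] is the area fraction of the first one. *)
Definition cut_bound a b al k l :=
  (al * a + (1 - al) * b) * (b - a) ^+ 2 * l ^+ 2 <=
  4 * qm * a * b * (a * (1 - k) + b * k).

Lemma cut_bound_swap a b al k l : cut_bound a b al k l -> cut_bound b a (1 - al) (1 - k) l.
Proof. by rewrite /cut_bound; congr (_ <= _); ring. Qed.

(** Both sides of the bound are homogeneous of degree 3 in [(a, b)]; dividing by [a ^+ 3] leaves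
    only the relative excess [s]. *)
Lemma cut_bound_scale a b al k l (s := (b - a) / a) : 0 < a -> 
  (1 + s * (1 - al)) * (s ^+ 2 * l ^+ 2) <= 4 * qm * (1 + s) * (1 + s * k) ->
  cut_bound a b al k l.
Proof.
move=> a0 h; rewrite /cut_bound -(ler_pM2r (_ : 0 < (a ^+ 3)^-1)) ?invr_gt0 ?exprn_gt0//.
move: h; rewrite /s; congr (_ <= _); field; rewrite ?gt_eqF//.
Qed.

Lemma ratio_excess a b : 0 < a -> a <= b -> b / a < 1065%:R / 100%:R ->
  0 <= (b - a) / a <= smax.
Proof.
move=> a0 ab; rewrite divr_ge0 ?subr_ge0 ?(ltW a0)//= mulrBl divff ?gt_eqF// /smax.
by lra.
Qed.

(** The corner of 45 degrees, with the leg as unit of length: [n] is the squared length of the chord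
    and [z = (d - e) / e] measures its inclination against the perpendicular of the leg. If [a > b],
    exchanging the pieces turns [al] and [k] into [1 - al] and [1 - k], which is the situation of
    [acute2]. *)
Lemma cut_bound_acute a b d e (n := e ^+ 2 + (d - e) ^+ 2) : 0 < a -> 0 < b ->
  b / a < 1065%:R / 100%:R -> a / b < 1065%:R / 100%:R ->
  0 < d <= 1 -> 0 < e <= 1 ->
  cut_bound a b (d * e) (d * e ^+ 2 / n) (d * e * (d - e) / n).
Proof.
move=> a0 b0 ba ab hd /andP[e0 e1].
have d0 : 0 < d by case/andP: hd.
pose z := (d - e) / e.
have zm1 : -1 < z by rewrite /z ltr_pdivlMr//; lra.
have z1E : 1 + z = d / e by rewrite /z; field; rewrite gt_eqF.
have dz : d <= 1 + z by rewrite z1E ler_pdivlMr// -[leRHS]mulr1 ler_wpM2l// ltW.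
have n0 : 0 < n by rewrite ltr_wpDr ?sqr_ge0// exprn_gt0.
have w0 : 0 < 1 + z ^+ 2 by rewrite ltr_wpDr// sqr_ge0.
have nE : n = e ^+ 2 * (1 + z ^+ 2) by rewrite /n /z; field; rewrite gt_eqF.
have alE : d * e = d ^+ 2 / (1 + z) by rewrite z1E; field; rewrite !gt_eqF.
have kE : d * e ^+ 2 / n = d / (1 + z ^+ 2).
  by rewrite nE; field; rewrite !gt_eqF.
have lE : d * e * (d - e) / n = d * z / (1 + z ^+ 2).
  rewrite nE; have -> : d - e = z * e by rewrite /z; field; rewrite gt_eqF.
  by field; rewrite !gt_eqF.
rewrite kE lE alE.
have [leab|ltba] := leP a b.
  by apply: cut_bound_scale => //; apply: acute1 => //; exact: ratio_excess.
rewrite -[d ^+ 2 / _](subKr 1) -[d / _](subKr 1); apply: cut_bound_swap.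
apply: cut_bound_scale => //; rewrite subKr; apply: acute2 => //.
by apply: ratio_excess => //; exact: ltW.
Qed.

(** At the right-angled corner [|l|] is bounded both by [k] and by [1 - k], so the crude bound
    serves both orderings of the coefficients. *)
Lemma cut_bound_right a b d e (n := d ^+ 2 + e ^+ 2) : 0 < a -> 0 < b ->
  b / a < 1065%:R / 100%:R -> a / b < 1065%:R / 100%:R ->
  0 < d <= 1 -> 0 < e <= 1 ->
  cut_bound a b (d * e) (d * e * (d + e) / n) (d * e * (d - e) / n).
Proof.
move=> a0 b0 ba ab /andP[d0 d1] /andP[e0 e1].
have n0 : 0 < n by rewrite addr_gt0 ?exprn_gt0.
have de0 : 0 < d * e by rewrite mulr_gt0.
have de1 : d * e <= 1.
  by rewrite -[leRHS]mulr1 ler_pM// ltW.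
have abs : `|d - e| <= d + e by rewrite ler_norml; lra.
have nn : 2 * (d * e) <= n by have := sqr_ge0 (d - e); rewrite /n; lra.
have l1 : `|d * e * (d - e) / n| <= d * e * (d + e) / n.
  rewrite normrM normfV (gtr0_norm n0) ler_pM2r ?invr_gt0//.
  by rewrite normrM (gtr0_norm de0) ler_pM2l.
have abs1 : `|d - e| <= 1 by rewrite ler_norml; lra.
have l2 : `|d * e * (d - e) / n| <= 2^-1.
  rewrite normrM normfV (gtr0_norm n0) ler_pdivrMr// normrM (gtr0_norm de0).
  by apply: (@le_trans _ _ (d * e)); [rewrite -[leRHS]mulr1 ler_pM2l|lra].
have l3 : `|d * e * (d - e) / n| <= 1 - d * e * (d + e) / n.
  rewrite normrM normfV (gtr0_norm n0) ler_pdivrMr// mulrBl mul1r mulfVK ?gt_eqF//.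
  rewrite normrM (gtr0_norm de0).
  have : d * e * `|d - e| + d * e * (d + e) <= 2 * (d * e).
    rewrite -mulrDr [leRHS]mulrC ler_pM2l//.
    have [?|?] := leP e d; [rewrite ger0_norm ?subr_ge0//|rewrite ltr0_norm ?subr_lt0//]; lra.
  by lra.
have [leab|ltba] := leP a b.
  apply: cut_bound_scale => //; apply: crude_bound => //; first exact: ratio_excess.
  by rewrite subr_ge0 de1 lerBlDr lerDl ltW.
rewrite -[X in cut_bound _ _ X](subKr 1) -[X in cut_bound _ _ _ X](subKr 1).
apply: cut_bound_swap; apply: cut_bound_scale => //; rewrite subKr.
apply: crude_bound => //; first by apply: ratio_excess => //; exact: ltW.
by rewrite de1 andbT ltW.
Qed.

(** The bound says that the mixed coefficient [B] satisfies [B ^+ 2 <= 4 * qm * A * C]. Since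
    [qm < 1], completing the square needs only part of the diagonal terms, and a fixed fraction of
    them survives. *)
Lemma cut_bound_form a b al k l (T S : R)
    (A := al * a + (1 - al) * b) (C := b^-1 + (a^-1 - b^-1) * k) : 0 < a -> 0 < b -> 0 <= al <= 1 -> 0 <= k <= 1 ->
  cut_bound a b al k l ->
  (1 / 5000%:R) * (Num.min a b * T ^+ 2 + (Num.max a b)^-1 * S ^+ 2) <=
  A * T ^+ 2 + A * (a^-1 - b^-1) * l * T * S + C * S ^+ 2.
Proof.
move=> a0 b0 /andP[al0 al1] /andP[k0 k1] cb.
have mina : Num.min a b <= a by rewrite ge_min lexx.
have minb : Num.min a b <= b by rewrite ge_min lexx orbT.
have maxa : a <= Num.max a b by rewrite le_max lexx.
have maxb : b <= Num.max a b by rewrite le_max lexx orbT.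
have min0 : 0 < Num.min a b by rewrite lt_min a0.
have max0 : 0 < Num.max a b by rewrite lt_max a0.
set mi := Num.min a b in mina minb min0 *; set ma := Num.max a b in maxa maxb max0 *.
have Ami : mi <= A.
  have h1 : al * mi <= al * a by rewrite ler_wpM2l.
  have h2 : (1 - al) * mi <= (1 - al) * b by rewrite ler_wpM2l// subr_ge0.
  by rewrite /A; lra.
have Cma : ma^-1 <= C.
  have iva : ma^-1 <= a^-1 by rewrite lef_pV2.
  have ivb : ma^-1 <= b^-1 by rewrite lef_pV2.
  have h1 : k * ma^-1 <= k * a^-1 by rewrite ler_wpM2l.
  have h2 : (1 - k) * ma^-1 <= (1 - k) * b^-1 by rewrite ler_wpM2l// subr_ge0.
  by rewrite /C; lra.
have A0 : 0 < A by rewrite (lt_le_trans min0).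
have C0 : 0 < C by rewrite (lt_le_trans _ Cma)// invr_gt0.
pose B := A * (a^-1 - b^-1) * l.
have BAC : B ^+ 2 <= 4 * qm * A * C.
  have ab2 : 0 < a ^+ 2 * b ^+ 2 by rewrite mulr_gt0 ?exprn_gt0.
  have e1 : B ^+ 2 * (a ^+ 2 * b ^+ 2) = A * (A * (b - a) ^+ 2 * l ^+ 2).
    by rewrite /B; field; rewrite !gt_eqF.
  have e2 : 4 * qm * A * C * (a ^+ 2 * b ^+ 2) = A * (4 * qm * a * b * (a * (1 - k) + b * k)).
    by rewrite /C; field; rewrite !gt_eqF.
  by rewrite -(ler_pM2r ab2) e1 e2 ler_pM2l.
have T2 := sqr_ge0 T; have S2 := sqr_ge0 S.
have h1 : mi * T ^+ 2 <= A * T ^+ 2 by rewrite ler_wpM2r.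
have h2 : ma^-1 * S ^+ 2 <= C * S ^+ 2 by rewrite ler_wpM2r.
(* [rh] is a rational upper bound for the square root of [qm]; the surviving fraction is
   [1 - rh = 1/5000]. *)
have [rh [rh0 rh1 rhq]] : exists rh : R, [/\ 0 < rh, rh <= 1 - 1 / 5000%:R & qm <= rh * rh].
  by exists (4999%:R / 5000%:R); rewrite /qm; split; clear; lra.
suff : 0 <= rh * A * T ^+ 2 + B * T * S + rh * C * S ^+ 2.
  have h3 : rh * (A * T ^+ 2) <= (1 - 1 / 5000%:R) * (A * T ^+ 2).
    by rewrite ler_wpM2r// mulr_ge0// ltW.
  have h4 : rh * (C * S ^+ 2) <= (1 - 1 / 5000%:R) * (C * S ^+ 2).
    by rewrite ler_wpM2r// mulr_ge0// ltW.
  by rewrite -/B; clear -h1 h2 h3 h4; lra.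
have rA : 0 < rh * A * 4 by apply: mulr_gt0 => //; exact: mulr_gt0.
rewrite -(pmulr_rge0 _ rA).
have -> : rh * A * 4 * (rh * A * T ^+ 2 + B * T * S + rh * C * S ^+ 2) =
  (2 * rh * A * T + B * S) ^+ 2 + (4 * (rh * rh) * A * C - B ^+ 2) * S ^+ 2 by ring.
rewrite addr_ge0 ?sqr_ge0//; apply: mulr_ge0 => //; rewrite subr_ge0 (le_trans BAC)//.
have AC0 : 0 <= A * C by rewrite mulr_ge0 ?ltW.
by have h := ler_wpM2r AC0 rhq; clear -h; lra.
Qed.

End KeyAlgebra.

(** * The quadratic form of a cut corner in vector form *)

Section Coercive.
Context (R : realType).
Implicit Types (a b d e h : R) (u v w P Q : plane R).

Definition perp v : plane R := (v.2, - v.1).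

Lemma dot_cross_split u v w : dot u u * dot v w = dot u v * dot u w + cross u v * cross u w.
Proof. by rewrite /dot /cross; ring. Qed.

(** The three kinds of corner of a right isosceles triangle with legs [h]: the right angle, then the
    two orders in which a leg and the hypotenuse can meet at 45 degrees. *)
Definition gram_case h u v :=
  [\/ [/\ dot u u = h ^+ 2, dot v v = h ^+ 2 & dot u v = 0],
      [/\ dot u u = h ^+ 2, dot v v = 2 * h ^+ 2 & dot u v = h ^+ 2] |
      [/\ dot u u = 2 * h ^+ 2, dot v v = h ^+ 2 & dot u v = h ^+ 2]].

(* The vector dual to the pair of edges: it is minus the gradient of the
   barycentric coordinate of their common vertex. *)
Definition dual_sum u v : plane R := (cross u v)^-1 *: perp (v - u).

Lemma dual_sumP u v : cross u v != 0 -> dot (dual_sum u v) u = 1 /\ dot (dual_sum u v) v = 1.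
Proof.
by rewrite /dual_sum /dot /cross /perp /= => X0; split; rewrite /GRing.scale/=; field.
Qed.

(** The parameters [k] and [l] of the form depend on the Gram matrix of the two edges only, up to
    the sign of [l]. Each kind of corner is thereby sent to one of the two scalar estimates; the
    third kind is the second with [d] and [e] exchanged. *)
Lemma cut_bound_gram a b d e h u v :
  0 < a -> 0 < b -> b / a < 1065%:R / 100%:R -> a / b < 1065%:R / 100%:R ->
  0 < d <= 1 -> 0 < e <= 1 -> h != 0 -> gram_case h u v ->
  let th := e *: v - d *: u in
  let k := d * e * dot th (v - u) / dot th th in
  let l := d * e * cross u v * (d - e) / dot th th in
  [/\ 0 < dot th th, 0 <= k <= 1 & cut_bound a b (d * e) k l].
Proof.
move=> a0 b0 ba ab hd he h0 G th k l.
have d0 : 0 < d by case/andP: hd.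
have d1 : d <= 1 by case/andP: hd.
have e0 : 0 < e by case/andP: he.
have e1 : e <= 1 by case/andP: he.
have h2 : 0 < h ^+ 2 by rewrite exprn_even_gt0.
have thE : dot th th = e ^+ 2 * dot v v - 2 * d * e * dot u v + d ^+ 2 * dot u u.
  by rewrite /th /dot /= /GRing.scale/=; ring.
have thvu : dot th (v - u) = e * dot v v - (d + e) * dot u v + d * dot u u.
  by rewrite /th /dot /= /GRing.scale/=; ring.
have X2 : cross u v ^+ 2 = dot u u * dot v v - dot u v ^+ 2.
  by rewrite /dot /cross; ring.
have dd := ltW d0; have ee := ltW e0.
have de0 : 0 <= d * e by rewrite mulr_ge0.
have ded : d * e <= d by rewrite -[leRHS]mulr1 ler_wpM2l// ltW.
have dee : d * e <= e by rewrite -[leRHS]mul1r ler_wpM2r// ltW.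
(* Only [l ^+ 2] enters the bound, and the square of [cross u v] is the Gram determinant, so
   orientation is irrelevant. *)
have cbl (l' : R) al k0 : l' ^+ 2 = l ^+ 2 -> cut_bound a b al k0 l' -> cut_bound a b al k0 l.
  by rewrite /cut_bound => ->.
case: G => -[uu vv uv]; rewrite uu vv uv in X2 thE thvu.
- have nE : dot th th = h ^+ 2 * (d ^+ 2 + e ^+ 2) by rewrite thE; ring.
  have n0 : 0 < d ^+ 2 + e ^+ 2 by rewrite addr_gt0 ?exprn_gt0.
  have kE : k = d * e * (d + e) / (d ^+ 2 + e ^+ 2).
    by rewrite /k thvu nE; field; rewrite h0 gt_eqF.
  rewrite nE; split; first by rewrite mulr_gt0.
    rewrite kE ler_pdivrMr// mul1r divr_ge0 ?(ltW n0) ?mulr_ge0 ?addr_ge0//=.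
    have := ler_wpM2r (ltW d0) dee; have := ler_wpM2r (ltW e0) ded.
    have := sqr_ge0 (d - e); lra.
  apply: (cbl (d * e * (d - e) / (d ^+ 2 + e ^+ 2))).
    rewrite /l nE !exprMn X2 [(_^-1) ^+ 2]exprVn [RHS]mulrC; field; rewrite h0 gt_eqF//.
  by rewrite kE; exact: cut_bound_right.
- pose n := e ^+ 2 + (d - e) ^+ 2.
  have nE : dot th th = h ^+ 2 * n by rewrite thE /n; ring.
  have n0 : 0 < n by rewrite ltr_wpDr ?sqr_ge0 ?exprn_gt0.
  have kE : k = d * e ^+ 2 / n.
    by rewrite /k thvu nE; field; rewrite h0 gt_eqF.
  rewrite nE; split; first by rewrite mulr_gt0.
    rewrite kE ler_pdivrMr// mul1r divr_ge0 ?(ltW n0) ?mulr_ge0 ?exprn_ge0//= /n.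
    have := ler_wpM2r (ltW e0) dee; have := sqr_ge0 (d - e); lra.
  apply: (cbl (d * e * (d - e) / n)).
    rewrite /l nE !exprMn X2 [(_^-1) ^+ 2]exprVn [RHS]mulrC; field; rewrite h0 gt_eqF//.
  by rewrite kE; exact: cut_bound_acute.
- pose n := d ^+ 2 + (e - d) ^+ 2.
  have nE : dot th th = h ^+ 2 * n by rewrite thE /n; ring.
  have n0 : 0 < n by rewrite ltr_wpDr ?sqr_ge0 ?exprn_gt0.
  have kE : k = e * d ^+ 2 / n.
    by rewrite /k thvu nE; field; rewrite h0 gt_eqF.
  rewrite nE; split; first by rewrite mulr_gt0.
    rewrite kE ler_pdivrMr// mul1r divr_ge0 ?(ltW n0) ?mulr_ge0 ?exprn_ge0//= /n.
    have := ler_wpM2r (ltW d0) ded; have := sqr_ge0 (e - d); lra.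
  apply: (cbl (e * d * (e - d) / n)).
    rewrite /l nE !exprMn X2 [(_^-1) ^+ 2]exprVn [RHS]mulrC; field; rewrite h0 gt_eqF//.
  by rewrite kE (mulrC d); exact: cut_bound_acute.
Qed.

(** The factor 1/10000 is the 1/5000 of [cut_bound_form], halved because [P] and [Q] both contribute
    to the norm. *)
Definition coercive_cst a b := Num.min a b ^+ 2 / Num.max a b / 10000%:R.

(** All vectors are resolved along and across the chord [th], which is not normalised, so everything
    is multiplied by [L = dot th th]. The coupling conditions leave two unknowns: the common
    tangential part [T] and the common flux [S]. In them the weighted sum is exactly the form of
    [cut_bound_form]. *)
Lemma cut_coercive a b d e h u v P Q (th := e *: v - d *: u)
    (W := Q + (d * dot (P - Q) u) *: dual_sum u v) :
  0 < a -> 0 < b -> b / a < 1065%:R / 100%:R -> a / b < 1065%:R / 100%:R ->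
  0 < d <= 1 -> 0 < e <= 1 -> h != 0 -> gram_case h u v -> cross u v != 0 ->
  dot P th = dot Q th -> a * cross th P = b * cross th Q ->
  coercive_cst a b * (dot P P + dot Q Q) <=
  d * e * (a * dot P W) + (1 - d * e) * (b * dot Q W).
Proof.
move=> a0 b0 ba ab hd he h0 G X0 Pth Qth.
have [L0 hk cb] := cut_bound_gram a0 b0 ba ab hd he h0 G.
move: L0 hk cb; rewrite -/th; cbv zeta; set k := d * e * dot th (v - u) / _; set l := d * e * _ * _ / _.
set L := dot th th => L0 hk cb.
pose T := dot Q th; pose S := a * cross th P.
have d0 : 0 <= d by case/andP: hd => /ltW.
have e0 : 0 <= e by case/andP: he => /ltW.
have hal : 0 <= d * e <= 1.
  rewrite mulr_ge0//=; case/andP: hd => _ d1; case/andP: he => _ e1.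
  by rewrite -[leRHS]mulr1 ler_pM.
have PE : cross th P = S / a by rewrite /S mulrC mulKf// gt_eqF.
have QE : cross th Q = S / b by rewrite /S Qth mulrC mulKf// gt_eqF.
have PT : dot P th = T by [].
have dC (x y : plane R) : dot x y = dot y x by rewrite /dot mulrC (mulrC x.2).
have := cut_bound_form T S a0 b0 hal hk cb.
set A := _ * a + _ * b; set C := b^-1 + _ => F.
have eW : L * (d * e * (a * dot P W) + (1 - d * e) * (b * dot Q W)) =
  A * T ^+ 2 + A * (a^-1 - b^-1) * l * T * S + C * S ^+ 2.
  have hPW x : L * dot x W = dot th x * dot th W + cross th x * cross th W.
    exact: dot_cross_split.
  (* [P - Q] has no component along the chord, so its moment on the edge sees only the normal jump
     [S * (a^-1 - b^-1)]. *)
  have jr : L * dot (P - Q) u = - (S * (a^-1 - b^-1)) * (e * cross u v).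
    rewrite dot_cross_split.
    have -> : dot th (P - Q) = dot P th - dot Q th by rewrite /dot /=; ring.
    have -> : cross th (P - Q) = cross th P - cross th Q by rewrite /cross /=; ring.
    have -> : cross th u = - (e * cross u v) by rewrite /cross /th /= /GRing.scale/=; ring.
    by rewrite PT PE QE /T; ring.
  have [gu gv] := dual_sumP X0.
  have thg : dot th (dual_sum u v) = e - d.
    have -> : dot th (dual_sum u v) = e * dot (dual_sum u v) v - d * dot (dual_sum u v) u.
      by rewrite /dot /th /= /GRing.scale/=; ring.
    by rewrite gu gv !mulr1.
  have txg : cross th (dual_sum u v) = - dot th (v - u) / cross u v.
    by rewrite /dual_sum /cross /dot /perp /= /GRing.scale/=; ring.
  set j := d * dot (P - Q) u in W hPW *.
  have jE : j = - (S * (a^-1 - b^-1)) * (d * e * cross u v) / L.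
    apply: (mulfI (lt0r_neq0 L0)); rewrite /j mulrCA jr; field.
    by rewrite !gt_eqF.
  have thW : dot th W = T + j * (e - d).
    by rewrite -thg /W /T /dot /= /GRing.scale/=; ring.
  have txW : cross th W = S / b + j * (- dot th (v - u) / cross u v).
    by rewrite -txg -QE /W /cross /= /GRing.scale/=; ring.
  transitivity (d * e * a * (L * dot P W) + (1 - d * e) * b * (L * dot Q W)); first by ring.
  rewrite !hPW !(dC th) PT -/T PE QE dC thW txW jE.
  rewrite /A /C /k /l -/L; field; rewrite X0 !gt_eqF//.
have LP : L * dot P P = T ^+ 2 + S ^+ 2 / a ^+ 2.
  rewrite dot_cross_split dC PT PE; field; rewrite gt_eqF//.
have LQ : L * dot Q Q = T ^+ 2 + S ^+ 2 / b ^+ 2.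
  rewrite dot_cross_split dC -/T QE; field; rewrite gt_eqF//.
rewrite -(ler_pM2l L0) eW (le_trans _ F)// mulrCA mulrDr LP LQ /coercive_cst.
have mina : Num.min a b <= a by rewrite ge_min lexx.
have minb : Num.min a b <= b by rewrite ge_min lexx orbT.
have maxb : Num.min a b <= Num.max a b by rewrite le_max mina.
have min0 : 0 < Num.min a b by rewrite lt_min a0.
have max0 : 0 < Num.max a b by rewrite lt_max a0.
set mi := Num.min a b in mina minb maxb min0 *; set ma := Num.max a b in maxb max0 *.
have T2 := sqr_ge0 T; have S2 := sqr_ge0 S.
have sq (x : R) : 0 < x -> mi <= x -> mi ^+ 2 * (S ^+ 2 / x ^+ 2) <= S ^+ 2.
  move=> x0 mx; rewrite mulrCA -[leRHS]mulr1 ler_wpM2l// ler_pdivrMr ?exprn_gt0// mul1r.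
  by rewrite ler_pXn2r ?nnegrE ?(ltW x0) ?(ltW min0).
have h1 := sq _ a0 mina; have h2 := sq _ b0 minb.
have h3 : mi ^+ 2 * T ^+ 2 <= ma * (mi * T ^+ 2).
  by rewrite expr2 -mulrA mulrCA [leRHS]mulrCA ler_wpM2l ?(ltW min0)// ler_wpM2r.
have tenk : (10000%:R : R) = 5000%:R * 2 by rewrite -natrM.
rewrite tenk -(ler_pM2l max0).
have -> : ma * (mi ^+ 2 / ma / (5000%:R * 2) * (T ^+ 2 + S ^+ 2 / a ^+ 2 + (T ^+ 2 + S ^+ 2 / b ^+ 2)))
  = 5000%:R^-1 * (mi ^+ 2 * T ^+ 2 + (mi ^+ 2 * (S ^+ 2 / a ^+ 2) + mi ^+ 2 * (S ^+ 2 / b ^+ 2)) / 2).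
  by field; rewrite !gt_eqF.
have -> : ma * (1 / 5000%:R * (mi * T ^+ 2 + ma^-1 * S ^+ 2)) =
  5000%:R^-1 * (ma * (mi * T ^+ 2) + S ^+ 2) by field; rewrite gt_eqF.
have fin (x y z t s : R) : x <= s -> y <= s -> z <= t -> z + (x + y) / 2 <= t + s.
  by clear; lra.
by apply: ler_wpM2l; [rewrite invr_ge0 ler0n|exact: fin].
Qed.

End Coercive.

(** * The curve near one of its chords *)

Section Curve.
Context (R : realType).
Implicit Types (f : R -> R) (g : R -> plane R).

Lemma mvt_unordered f (a b : R) : (forall t, derivable f t 1) ->
  exists c, [/\ Num.min a b <= c, c <= Num.max a b & f b - f a = derive1 f c * (b - a)].
Proof.
move=> df.
have H x y : x <= y -> exists c, [/\ x <= c, c <= y & f y - f x = derive1 f c * (y - x)].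
  move=> xy; have [||c] := @MVT_segment R f (derive1 f) x y xy.
  - by move=> t _; apply: DeriveDef; rewrite ?derive1E.
  - by apply: continuous_subspaceT => t; exact/differentiable_continuous/derivable1_diffP.
  by rewrite in_itv/= => /andP[? ?] ?; exists c.
have [ab|/ltW ba] := leP a b.
  by have [c [? ? ?]] := H _ _ ab; exists c.
have [c [? ? e]] := H _ _ ba; exists c; split => //.
by rewrite -opprB e; ring.
Qed.

Lemma derivable_cont f : (forall t, derivable f t 1) -> continuous f.
Proof. by move=> df t; exact/differentiable_continuous/derivable1_diffP. Qed.

Lemma bounded_on f (a b : R) : a <= b -> continuous f ->
  exists2 B, 0 <= B & forall t, a <= t <= b -> `|f t| <= B.
Proof.
move=> ab cf.
have [|c _ h] := @EVT_max R (fun t => `|f t|) a b ab.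
  apply: continuous_subspaceT => t; apply: continuous_comp; first exact: cf.
  exact: norm_continuous.
by exists `|f c| => // t tab; apply: h; rewrite in_itv.
Qed.

Lemma periodic_int g : (forall t, g (t + 1) = g t) -> forall t (z : int), g (t + z%:~R) = g t.
Proof.
move=> gp.
have gn t (n : nat) : g (t + n%:R) = g t.
  elim: n => [|n IHn]; first by rewrite addr0.
  by rewrite -natr1 addrA gp.
move=> t [n|n]; first exact: gn.
rewrite NegzE mulrNz -[in RHS](subrK (n.+1%:R) t).
by rewrite (gn (t - n.+1%:R) n.+1).
Qed.

Definition fracpart (t : R) : R := t - (Num.floor t)%:~R.

Lemma fracpart_itv t : 0 <= fracpart t < 1.
Proof.
by rewrite /fracpart subr_ge0 floor_le_tmp/= ltrBlDl; have := floorD1_gt t; rewrite intrD.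
Qed.

Lemma curve_cont g : smooth_jordan_curve g ->
  continuous (fun t => (g t).1) /\ continuous (fun t => (g t).2).
Proof.
by case=> sm _ _ _; split; apply: derivable_cont => t; [exact: (proj1 (sm 0%N t))|exact: (proj2 (sm 0%N t))].
Qed.

(** Uniform injectivity by compactness: the distance between the points of parameters [s] and
    [s + a] is positive on the compact set where [a] stays between [dl] and [1 - dl], hence has a
    positive minimum there. Points that are close in the plane therefore have close parameters
    modulo the period. *)
Lemma curve_close g (dl : R) : smooth_jordan_curve g -> 0 < dl <= 2^-1 ->
  exists2 r, 0 < r & forall s0 t0, `|g t0 - g s0| < r ->
    exists t, g t = g t0 /\ `|t - s0| < dl.
Proof.
move=> sg /andP[dl0 dl1]; have [c1 c2] := curve_cont sg.
case: (sg) => _ _ per inj.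
have gfr t : g (fracpart t) = g t.
  by rewrite -[RHS](periodic_int per _ (- Num.floor t)) mulrNz.
pose F (x : plane R) : R := `|(g (x.1 + x.2)).1 - (g x.1).1| + `|(g (x.1 + x.2)).2 - (g x.1).2|.
have cF : continuous F.
  have h f : continuous f -> continuous (fun x : plane R => `|f (x.1 + x.2) - f x.1|).
    move=> cf x; apply: cvg_norm; apply: cvgB; apply: continuous_cvg => //.
    - exact: cf.
    - by apply: cvgD; [exact: cvg_fst|exact: cvg_snd].
    - exact: cf.
    - exact: cvg_fst.
  by move=> x; exact: (cvgD (h _ c1 x) (h _ c2 x)).
pose K : set (plane R) := `[0, 1] `*` `[dl, 1 - dl].
have cK : compact K by apply: compact_setX; exact: segment_compact.
have K0 : K !=set0 by exists (0, dl); split; rewrite /= in_itv/=; lra.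
have [x xK Fx] := compact_EVT_min K0 cK (continuous_subspaceT cF).
have Fpos : 0 < F x.
  rewrite lt_neqAle addr_ge0// andbT eq_sym; apply/negP.
  rewrite paddr_eq0// !normr_eq0 !subr_eq0 => /andP[/eqP e1 /eqP e2].
  have e : g (x.1 + x.2) = g x.1 by move: e1 e2; case: (g _) (g x.1) => ? ? [? ?] /= -> ->.
  have := set_mem xK => -[/=]; rewrite !in_itv/= => /andP[x10 x11] /andP[x20 x21].
  have := inj (fracpart (x.1 + x.2)) (fracpart x.1).
  have fi t : fracpart t \in `[0, 1[ by rewrite in_itv; exact: fracpart_itv.
  rewrite !gfr => /(_ (fi _) (fi _) e); rewrite /fracpart => E.
  have : x.2 = (Num.floor (x.1 + x.2) - Num.floor x.1)%:~R by rewrite intrD mulrNz; lra.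
  move: (_ - _)%R => z xz; have z0 : (0 < z)%R by rewrite -(ltr0z R) -xz; lra.
  have z1 : (z < 1)%R by rewrite -(ltrz1 R) -xz; lra.
  by move: z0 z1; case: z {xz} => [[|n]|n].
exists (F x / 2); first by rewrite divr_gt0.
move=> s0 t0 st.
pose a := fracpart (t0 - s0).
have /andP[a0 a1] : 0 <= a < 1 by exact: fracpart_itv.
have [al|al] := ltP a dl.
  exists (s0 + a); split; last by rewrite addrC addKr ger0_norm.
  rewrite /a /fracpart -mulrNz addrA (periodic_int per); congr g; lra.
have [ar|ar] := ltP (1 - dl) a.
  exists (s0 + a - 1); split; last by rewrite ltr_norml; lra.
  rewrite -(per (_ - 1)) subrK /a /fracpart -mulrNz addrA (periodic_int per); congr g; lra.
exfalso.
have /andP[f0 f1] := fracpart_itv s0.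
have inK : (fracpart s0, a) \in K.
  by apply/mem_set; split; rewrite /= in_itv/= ?f0 ?al ?ar// ltW.
have := Fx _ inK; rewrite {2}/F /= gfr.
have -> : g (fracpart s0 + a) = g t0.
  rewrite /fracpart addrAC -mulrNz (periodic_int per) /a /fracpart -mulrNz addrA (periodic_int per).
  congr g; lra.
move: st; rewrite prod_normE /= gt_max => /andP[]; lra.
Qed.

(** Two uses of the mean value theorem: one for the increment of [f], one to compare the derivative
    found with the derivative at [s0]. *)
Lemma chord_taylor f (B : R) (s0 dl a b : R) :
  (forall n t, derivable (derive1n n f) t 1) -> 0 < dl ->
  (forall t, `|t - s0| <= dl -> `|derive1 (derive1 f) t| <= B) ->
  `|a - s0| <= dl -> `|b - s0| <= dl ->
  exists2 r, `|r| <= B * dl & f b - f a = (b - a) * (derive1 f s0 + r).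
Proof.
move=> sm dl0 hB; rewrite !ler_norml => /andP[a1 a2] /andP[b1 b2].
have [c [c1 c2 e]] := mvt_unordered a b (sm 0%N).
have {}c1 : - dl <= c - s0 by move: c1; rewrite ge_min => /orP[]; lra.
have {}c2 : c - s0 <= dl by move: c2; rewrite le_max => /orP[]; lra.
have [x [x1 x2 e2]] := mvt_unordered s0 c (sm 1%N).
have {}x1 : - dl <= x - s0 by move: x1; rewrite ge_min => /orP[]; lra.
have {}x2 : x - s0 <= dl by move: x2; rewrite le_max => /orP[]; lra.
exists (derive1 f c - derive1 f s0); last by rewrite [derive1 f s0 + _]addrC subrK mulrC; exact: e.
rewrite e2 normrM ler_pM//; last by rewrite ler_norml c1 c2.
by apply: hB; rewrite ler_norml x1 x2.
Qed.

Lemma near_parallel (m M eta eps : R) (G p q : plane R) :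
  0 <= eta -> eta <= 1 -> 0 <= M -> 0 < eps ->
  `|G.1| <= M -> `|G.2| <= M -> m <= dot G G ->
  (4 * M + 2) * eta * (1 + eps) <= eps * m ->
  `|p.1| <= eta -> `|p.2| <= eta -> `|q.1| <= eta -> `|q.2| <= eta ->
  `|cross (G + p) (G + q)| <= eps * dot (G + p) (G + q).
Proof.
move=> e0 e1 M0 eps0 G1 G2 mG hm p1 p2 q1 q2.
have pr (x y a b : R) : `|x| <= a -> `|y| <= b -> `|x * y| <= a * b.
  by move=> xa yb; rewrite normrM ler_pM.
have ee : eta * eta <= eta by rewrite -[leRHS]mulr1 ler_wpM2l.
have cr : cross (G + p) (G + q) = G.1 * q.2 - G.2 * q.1 + p.1 * G.2 - p.2 * G.1
    + p.1 * q.2 - p.2 * q.1 by rewrite /cross /=; ring.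
have dt : dot (G + p) (G + q) = dot G G + G.1 * q.1 + G.2 * q.2 + p.1 * G.1 + p.2 * G.2
    + p.1 * q.1 + p.2 * q.2 by rewrite /dot /=; ring.
have := pr _ _ _ _ G1 q2; have := pr _ _ _ _ G2 q1; have := pr _ _ _ _ p1 G2.
have := pr _ _ _ _ p2 G1; have := pr _ _ _ _ p1 q2; have := pr _ _ _ _ p2 q1.
have := pr _ _ _ _ G1 q1; have := pr _ _ _ _ G2 q2; have := pr _ _ _ _ p1 G1.
have := pr _ _ _ _ p2 G2; have := pr _ _ _ _ p1 q1; have := pr _ _ _ _ p2 q2.
rewrite !ler_norml => /andP[? ?] /andP[? ?] /andP[? ?] /andP[? ?] /andP[? ?] /andP[? ?]
  /andP[? ?] /andP[? ?] /andP[? ?] /andP[? ?] /andP[? ?] /andP[? ?].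
have h1 : `|cross (G + p) (G + q)| <= (4 * M + 2) * eta.
  by rewrite cr ler_norml; lra.
have h2 : m - (4 * M + 2) * eta <= dot (G + p) (G + q) by rewrite dt; lra.
rewrite -ler_norml; apply: (le_trans h1); apply: (@le_trans _ _ (eps * (m - (4 * M + 2) * eta))).
  by lra.
by rewrite ler_wpM2l// ltW.
Qed.

(** Points close to [A] have parameters close to that of [A], so each chord is its parameter
    increment times a vector near the nonzero derivative at [A]. The increments are common factors
    of [cross] and [dot], so the bound stays relative however short the chords are. *)
Lemma chords_parallel g (eps : R) : smooth_jordan_curve g -> 0 < eps ->
  exists2 r, 0 < r & forall A X Y Z W, range g A -> range g X -> range g Y ->
    range g Z -> range g W ->
    `|X - A| < r -> `|Y - A| < r -> `|Z - A| < r -> `|W - A| < r ->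
    `|cross (Y - X) (W - Z)| <= eps * `|dot (Y - X) (W - Z)|.
Proof.
move=> sg eps0; have [sm reg per _] := sg.
pose g1 t := (g t).1; pose g2 t := (g t).2.
have sm1 n t : derivable (derive1n n g1) t 1 := proj1 (sm n t).
have sm2 n t : derivable (derive1n n g2) t 1 := proj2 (sm n t).
have c1 n : continuous (derive1n n g1) by apply: derivable_cont => t; exact: sm1.
have c2 n : continuous (derive1n n g2) by apply: derivable_cont => t; exact: sm2.
(* The base parameter is reduced to [0, 1) and the others are within [dl <= 1/2] of it, so
   derivatives have to be bounded on [-1, 2] only. *)
have le12 : (- 1 : R) <= 2 by lra.
have [M1 M10 hM1] := bounded_on le12 (c1 1%N).
have [M2 M20 hM2] := bounded_on le12 (c2 1%N).
have [B1 B10 hB1] := bounded_on le12 (c1 2%N).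
have [B2 B20 hB2] := bounded_on le12 (c2 2%N).
pose sq t := derive1 g1 t * derive1 g1 t + derive1 g2 t * derive1 g2 t.
have csq : continuous sq.
  by move=> t; exact: (cvgD (cvgM (c1 1%N t) (c1 1%N t)) (cvgM (c2 1%N t) (c2 1%N t))).
have [t0 _ hm] := @EVT_min R sq 0 1 ler01 (continuous_subspaceT csq).
have m0 : 0 < sq t0.
  rewrite /sq -!expr2 lt_neqAle addr_ge0 ?sqr_ge0// andbT eq_sym paddr_eq0 ?sqr_ge0//.
  by have := reg t0; rewrite xpair_eqE !sqrf_eq0.
set m := sq t0 in m0 hm; pose M := M1 + M2; pose B := B1 + B2.
have M0 : 0 <= M by rewrite addr_ge0.
have B0 : 0 <= B by rewrite addr_ge0.
pose K := (4 * M + 2) * (1 + eps).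
have K0 : 0 < K by rewrite mulr_gt0; clear -M0 eps0; lra.
pose eta := Num.min 1 (eps * m / K).
have eta0 : 0 < eta by rewrite lt_min ltr01 divr_gt0// mulr_gt0.
have eta1 : eta <= 1 by rewrite ge_min lexx.
have etaK : (4 * M + 2) * eta * (1 + eps) <= eps * m.
  rewrite mulrAC -/K mulrC -ler_pdivlMr// /eta ge_min lexx orbT//.
pose dl := Num.min 2^-1 (eta / (B + 1)).
have dl0 : 0 < dl by rewrite lt_min invr_gt0 ltr0n divr_gt0//; lra.
have dl1 : dl <= 2^-1 by rewrite ge_min lexx.
have Bdl : B * dl <= eta.
  apply: (@le_trans _ _ ((B + 1) * dl)); first by rewrite ler_wpM2r ?(ltW dl0)//; lra.
  by rewrite mulrC -ler_pdivlMr; [rewrite ge_min lexx orbT|lra].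
have dlh : 0 < dl <= 2^-1 by rewrite dl0.
have [r r0 hr] := curve_close sg dlh.
exists r => // A X Y Z W [s' _ As] [x0 _ <-] [y0 _ <-] [z0 _ <-] [w0 _ <-].
have As' : g (fracpart s') = A.
  by rewrite -As /fracpart -mulrNz (periodic_int per).
have /andP[s0 s1] := fracpart_itv s'; move: (fracpart s') As' s0 s1 => s <- s0 s1.
move=> /hr[x [<- xs]] /hr[y [<- ys]] /hr[z [<- zs]] /hr[w [<- ws]].
have hb1 t : `|t - s| <= dl -> `|derive1 (derive1 g1) t| <= B1.
  by rewrite ler_norml => /andP[h h']; apply: hB1; clear -h h' s0 s1 dl1; lra.
have hb2 t : `|t - s| <= dl -> `|derive1 (derive1 g2) t| <= B2.
  by rewrite ler_norml => /andP[h h']; apply: hB2; clear -h h' s0 s1 dl1; lra.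
have chord a b : `|a - s| < dl -> `|b - s| < dl -> exists p : plane R,
    [/\ `|p.1| <= eta, `|p.2| <= eta & g b - g a = (b - a) *: ((derive1 g1 s, derive1 g2 s) + p)].
  move=> /ltW as_ /ltW bs.
  have [p1 hp1 e1] := chord_taylor sm1 dl0 hb1 as_ bs.
  have [p2 hp2 e2] := chord_taylor sm2 dl0 hb2 as_ bs.
  exists (p1, p2); split => /=.
  - by apply: (le_trans hp1); apply: le_trans Bdl; rewrite ler_wpM2r ?(ltW dl0)// /B lerDl.
  - by apply: (le_trans hp2); apply: le_trans Bdl; rewrite ler_wpM2r ?(ltW dl0)// /B lerDr.
  - by apply: injective_projections; rewrite /= /GRing.scale/=; [exact: e1|exact: e2].
have [p [p1 p2 ->]] := chord _ _ xs ys.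
have [q [q1 q2 ->]] := chord _ _ zs ws.
have np : `|cross ((derive1 g1 s, derive1 g2 s) + p) ((derive1 g1 s, derive1 g2 s) + q)| <=
  eps * dot ((derive1 g1 s, derive1 g2 s) + p) ((derive1 g1 s, derive1 g2 s) + q).
  apply: (@near_parallel m M eta) => //=; first exact: ltW.
  - by apply: (@le_trans _ _ M1); [apply: hM1; clear -s0 s1; lra|rewrite /M lerDl].
  - by apply: (@le_trans _ _ M2); [apply: hM2; clear -s0 s1; lra|rewrite /M lerDr].
  - by rewrite /dot /=; apply: hm; rewrite in_itv/= s0 ltW.
move: (_ + p) (_ + q) np => P Q np.
have -> : cross ((y - x) *: P) ((w - z) *: Q) = (y - x) * (w - z) * cross P Q.
  by rewrite /cross /= /GRing.scale/=; ring.
have -> : dot ((y - x) *: P) ((w - z) *: Q) = (y - x) * (w - z) * dot P Q.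
  by rewrite /dot /= /GRing.scale/=; ring.
rewrite !normrM mulrCA ler_wpM2l ?mulr_ge0//.
by apply: (le_trans np); rewrite ler_wpM2l ?(ltW eps0)// ler_norm.
Qed.

Lemma curve_inside (S : interface_data R) : smooth_jordan_curve (gam S) ->
  Gamma S `<=` Omega S ->
  exists2 r, 0 < r & forall X y, Gamma S X -> `|y - X| < r -> Omega S y.
Proof.
move=> sg GO; have [c1 c2] := curve_cont sg; have [_ _ per _] := sg.
have mn f : continuous f -> (forall t, 0 < f t) ->
    exists2 r, 0 < r & forall t, 0 <= t <= 1 -> r <= f t.
  move=> cf fp; have [c _ h] := @EVT_min R f 0 1 ler01 (continuous_subspaceT cf).
  by exists (f c) => // t tab; apply: h; rewrite in_itv.
have GE t : [/\ (corner_lo S).1 < (gam S t).1, (gam S t).1 < (corner_hi S).1,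
  (corner_lo S).2 < (gam S t).2 & (gam S t).2 < (corner_hi S).2].
  have : Omega S (gam S t) by apply: GO; exists t.
  by case; rewrite /= !in_itv/= => /andP[? ?] /andP[? ?].
have cB f (k : R) : continuous f -> continuous (fun t => f t - k).
  by move=> cf t; apply: cvgB; [exact: cf|exact: cvg_cst].
have cB' f (k : R) : continuous f -> continuous (fun t => k - f t).
  by move=> cf t; apply: cvgB; [exact: cvg_cst|exact: cf].
have [|r1 r10 h1] := mn _ (cB _ (corner_lo S).1 c1).
  by move=> t; rewrite subr_gt0; case: (GE t).
have [|r2 r20 h2] := mn _ (cB' _ (corner_hi S).1 c1).
  by move=> t; rewrite subr_gt0; case: (GE t).
have [|r3 r30 h3] := mn _ (cB _ (corner_lo S).2 c2).
  by move=> t; rewrite subr_gt0; case: (GE t).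
have [|r4 r40 h4] := mn _ (cB' _ (corner_hi S).2 c2).
  by move=> t; rewrite subr_gt0; case: (GE t).
exists (Num.min (Num.min r1 r2) (Num.min r3 r4)); first by rewrite !lt_min r10 r20 r30.
move=> X y [t' _ <-].
have <- : gam S (fracpart t') = gam S t'.
  by rewrite /fracpart -mulrNz (periodic_int per).
have /andP[t0 /ltW t1] := fracpart_itv t'; move: (fracpart t') t0 t1 => t t0 t1.
have t01 : 0 <= t <= 1 by rewrite t0.
rewrite !lt_min !prod_normE/= !gt_max => /andP[/andP[/andP[a1 a2] /andP[a3 a4]] /andP[/andP[b1 b2] /andP[b3 b4]]].
have := h1 _ t01; have := h2 _ t01; have := h3 _ t01; have := h4 _ t01 => ? ? ? ?.
move: a1 a3 b2 b4; rewrite !ltr_norml => ? ? ? ?.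
by split; rewrite /= in_itv/=; lra.
Qed.

Lemma affine_path_continuous (X v : plane R) : continuous (fun t : R => X + t *: v).
Proof.
by move=> t; apply: cvgD; [exact: cvg_cst|apply: cvgZl; exact: cvg_id].
Qed.

(** The segment avoids the curve, so the two subdomains cut its parameter interval into two disjoint
    relatively open sets; connectedness of [0, 1] makes one of them empty. *)
Lemma segment_same_side (S : interface_data R) s (X Y : plane R) :
  separates (Omega S) (Gamma S) (subdomain S) -> subdomain S s X ->
  (forall t, 0 <= t <= 1 -> Omega S (X + t *: (Y - X)) /\ ~ Gamma S (X + t *: (Y - X))) ->
  subdomain S s Y.
Proof.
move=> [ocn dis cov] sX free.
pose f t := X + t *: (Y - X).
have cf : continuous f by move=> t; exact: affine_path_continuous.
pose s' := if s is minus then plus else minus.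
have cov' t : 0 <= t <= 1 -> subdomain S s (f t) \/ subdomain S s' (f t).
  move=> /free[Of Gf]; have : (Omega S `\` Gamma S) (f t) by [].
  by rewrite -cov /s'; case: (s) => -[]; [left|right|right|left].
have dis' y : subdomain S s y -> subdomain S s' y -> False.
  move=> h1 h2; have : (subdomain S minus `&` subdomain S plus) y.
    by move: h1 h2; rewrite /s'; case: (s).
  by rewrite dis.
have o r : open (f @^-1` subdomain S r).
  by apply: open_comp => [t _|]; [exact: cf|case: (ocn r)].
have -> : Y = f 1 by rewrite /f scale1r addrC subrK.
have cI := @segment_connected R 0 1.
have e : `[0, 1] `&` f @^-1` subdomain S s = `[0, 1] `&` ~` (f @^-1` subdomain S s').
  apply/seteqP; split => t [tI ht]; split => //=; first by move/(dis' _ ht).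
  by move: tI; rewrite /= in_itv/= => /cov'[].
have h1 : (`[0, 1]%classic : set R) 1 by rewrite /= in_itv/= lexx ler01.
suff E : `[0, 1] `&` f @^-1` subdomain S s = `[0, 1]%classic by move: h1; rewrite -E => -[].
apply: cI.
- by exists 0; split; rewrite /= ?in_itv/= ?lexx ?ler01// /f scale0r addr0.
- by exists (f @^-1` subdomain S s).
- by exists (~` (f @^-1` subdomain S s')); [exact: open_closedC|].
Qed.

(* [a] and [b] are the tangential coordinates of a vertex seen from the two ends of the
   cut, [l] is its height and [L] the length of the cut: the last two hypotheses say that
   the vertex sees the cut under an angle between 45 and 90 degrees. *)
Lemma steep_from_an_end (eps a b l L : R) : 0 < eps -> eps <= 2^-1 -> 0 < L ->
  0 < l -> a - b = L -> 0 <= a * b + l ^+ 2 -> a * b + l ^+ 2 <= L * l ->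
  eps * `|a| < l \/ eps * `|b| < l.
Proof.
move=> e0 e1 L0 l0 ab h1 h2.
have [|ha] := ltP (eps * `|a|) l; first by left.
have [|hb] := ltP (eps * `|b|) l; first by right.
exfalso.
have l2 : l * l <= (eps * `|a|) * (eps * `|b|) by rewrite ler_pM// ltW.
have ee : eps * eps <= 4^-1 by apply: (@le_trans _ _ (2^-1 * 2^-1)); [rewrite ler_pM// ltW|lra].
have ab0 : 0 <= a * b.
  rewrite leNgt; apply/negP => abn.
  have n : `|a| * `|b| = - (a * b) by rewrite -normrM ltr0_norm.
  have l3 : l * l <= eps * eps * (- (a * b)) by rewrite -n; move: l2; congr (_ <= _); ring.
  have : eps * eps * (- (a * b)) <= 4^-1 * (- (a * b)) by rewrite ler_wpM2r//; lra.
  by move: h1; rewrite expr2; lra.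
have key (x y : R) : 0 <= x -> 0 <= y -> l <= eps * x -> L <= y -> x * y <= L * l -> False.
  move=> x0 y0 lx Ly xy.
  have : x * L <= x * y by rewrite ler_wpM2l.
  have : L * l <= L * (eps * x) by rewrite ler_wpM2l// ltW.
  have x1 : 0 < x by rewrite lt_neqAle x0 andbT; apply/eqP => x00; move: lx; rewrite -x00 mulr0; lra.
  have Lx : 0 < L * x by rewrite mulr_gt0.
  have : eps * (L * x) <= 2^-1 * (L * x) by rewrite ler_wpM2r// ltW.
  by lra.
have [b0|b0] := leP 0 b.
  have a0 : 0 <= a by lra.
  apply: (key b a) => //; first by move: hb; rewrite ger0_norm.
  - by lra.
  - by rewrite mulrC; move: h2; rewrite expr2; have := mulr_gt0 l0 l0; lra.
have a0 : a <= 0.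
  rewrite leNgt; apply/negP => a0; have : a * b < 0 by rewrite nmulr_llt0.
  by lra.
apply: (key (- a) (- b)) => //; try lra; first by move: ha; rewrite ler0_norm.
by rewrite mulrNN; move: h2; rewrite expr2; have := mulr_gt0 l0 l0; lra.
Qed.

Lemma convex_lt (a b c t : R) : 0 <= t <= 1 -> a < c -> b < c -> a + t * (b - a) < c.
Proof.
move=> /andP[t0 t1] ac bc; have [tz|tn] := eqVneq t 1.
  by rewrite tz mul1r addrC subrK.
have t1' : 0 < 1 - t by rewrite subr_gt0 lt_neqAle tn.
have h1 : (1 - t) * a < (1 - t) * c by rewrite ltr_pM2l.
have h2 : t * b <= t * c by rewrite ler_wpM2l// ltW.
by lra.
Qed.

Lemma near_segment (D x y : plane R) (r t : R) : 0 <= t <= 1 ->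
  `|x - D| < r -> `|y - D| < r -> `|x + t *: (y - x) - D| < r.
Proof.
move=> t01; rewrite !prod_normE/= !gt_max !ltr_norml.
move=> /andP[/andP[a1 a2] /andP[a3 a4]] /andP[/andP[b1 b2] /andP[b3 b4]].
rewrite /GRing.scale/=.
have h (p q c : R) : p < c -> q < c -> p + t * (q - p) < c by exact: convex_lt.
have := h _ _ _ a2 b2; have := h _ _ _ a4 b4.
have := h (- (x.1 - D.1)) (- (y.1 - D.1)) r; have := h (- (x.2 - D.2)) (- (y.2 - D.2)) r.
move=> /(_ ltac:(lra) ltac:(lra)) ? /(_ ltac:(lra) ltac:(lra)) ? ? ?.
by rewrite -!andbA; apply/and4P; split; lra.
Qed.

Lemma dot_le_norm (x y : plane R) : `|dot x y| <= 2 * `|x| * `|y|.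
Proof.
have h1 : `|x.1| <= `|x| by rewrite prod_normE le_max lexx.
have h2 : `|x.2| <= `|x| by rewrite prod_normE le_max lexx orbT.
have h3 : `|y.1| <= `|y| by rewrite prod_normE le_max lexx.
have h4 : `|y.2| <= `|y| by rewrite prod_normE le_max lexx orbT.
rewrite /dot (le_trans (ler_normD _ _))// !normrM.
have : `|x.1| * `|y.1| <= `|x| * `|y| by rewrite ler_pM.
have : `|x.2| * `|y.2| <= `|x| * `|y| by rewrite ler_pM.
by lra.
Qed.

Lemma cross_le_norm (x y : plane R) : `|cross x y| <= 2 * `|x| * `|y|.
Proof.
have -> : cross x y = dot x (y.2, - y.1) by rewrite /cross /dot /=; ring.
have <- : `|(y.2, - y.1)| = `|y| by rewrite !prod_normE /= normrN maxC.
exact: dot_le_norm.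
Qed.

Lemma dot_ge_norm (x : plane R) : `|x| ^+ 2 <= dot x x <= 2 * `|x| ^+ 2.
Proof.
have d0 : 0 <= dot x x by rewrite /dot -!expr2 addr_ge0 ?sqr_ge0.
apply/andP; split; last first.
  have := dot_le_norm x x; rewrite ger0_norm// -mulrA -expr2; exact.
rewrite prod_normE /dot -!expr2 /Num.max/=; case: ifP => _.
  by rewrite real_normK ?num_real// lerDr sqr_ge0.
by rewrite real_normK ?num_real// lerDl sqr_ge0.
Qed.

(* The chord [D E] lies close to the curve: away from a thin strip around it, the
   two sides of the line [D E] are the two sides of the curve. *)
Lemma cut_sides (S : interface_data R) (eps : R) :
  interface_setting S -> 0 < eps -> eps <= 2^-1 ->
  exists2 r, 0 < r & forall (rho : R) (O D E V W : plane R) (s s' : side),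
    0 < rho -> 16 * rho <= r -> Gamma S D -> Gamma S E -> D != E ->
    `|D - O| <= rho -> `|E - O| <= rho -> `|V - O| <= rho -> `|W - O| <= rho ->
    ~ Gamma S V -> ~ Gamma S W ->
    closure (subdomain S s) V -> closure (subdomain S s') W -> s <> s' ->
    0 <= dot (D - V) (E - V) <= `|cross (D - V) (E - V)| ->
    0 < cross (E - D) (V - D) -> cross (E - D) (W - D) < 0 ->
    forall x, `|x - O| <= rho ->
      (4 * eps * rho * `|E - D| < cross (E - D) (x - D) -> subdomain S s x) /\
      (cross (E - D) (x - D) < - (4 * eps * rho * `|E - D|) -> subdomain S s' x).
Proof.
move=> [_ sg GO sep _] eps0 eps1; case: (sep) => ocn dis cov.
have [r1 r10 hr1] := chords_parallel sg eps0.
have [r2 r20 hr2] := curve_inside sg GO.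
exists (Num.min r1 r2); first by rewrite lt_min r10.
move=> rho O D E V W s s' rho0 rhor GD GE DE DO EO VO WO GV GW sV sW ss' ang lV lW.
pose r := Num.min r1 r2.
have rr1 : r <= r1 by rewrite ge_min lexx.
have rr2 : r <= r2 by rewrite ge_min lexx orbT.
pose th := E - D; pose xi (y : plane R) := dot th (y - D); pose el (y : plane R) := cross th (y - D).
have nD y : `|y - O| <= rho -> `|y - D| <= 2 * rho.
  move=> yO; have -> : y - D = (y - O) - (D - O) by rewrite opprB addrA subrK.
  by rewrite (le_trans (ler_normB _ _))//; clear -yO DO; lra.
pose L := dot th th; pose N := `|th|.
have N0 : 0 < N by rewrite normr_gt0 subr_eq0 eq_sym.
have /andP[LN1 LN2] : N ^+ 2 <= L <= 2 * N ^+ 2 := dot_ge_norm th.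
have L0 : 0 < L by rewrite (lt_le_trans _ LN1)// exprn_gt0.
have N2 : N <= 2 * rho by rewrite /N /th nD.
have inO y : `|y - D| < r -> Omega S y by move=> yr; apply: (hr2 D) => //; exact: lt_le_trans yr rr2.
(* With [xi] and [el] as coordinates along and across the chord [D E], the curve is near [D] the
   graph of an [eps]-Lipschitz function. *)
have chord y1 y2 : Gamma S y1 -> Gamma S y2 -> `|y1 - D| < r -> `|y2 - D| < r ->
    `|el y1 - el y2| <= eps * `|xi y1 - xi y2|.
  move=> G1 G2 n1 n2.
  have := @hr1 D y2 y1 D E GD G2 G1 GD GE.
  rewrite subrr normr0 -/th -/N => /(_ (lt_le_trans n2 rr1) (lt_le_trans n1 rr1) r10).
  move=> /(_ ltac:(apply: (le_lt_trans N2); apply: lt_le_trans rr1; rewrite /r; lra)).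
  have -> : cross (y1 - y2) th = - (el y1 - el y2) by rewrite /el /cross /=; ring.
  have -> : dot (y1 - y2) th = xi y1 - xi y2 by rewrite /xi /dot /=; ring.
  by rewrite normrN.
have [elD xiD] : el D = 0 /\ xi D = 0.
  by rewrite /el /xi /cross /dot subrr /=; split; ring.
have [elE xiE] : el E = 0 /\ xi E = L by rewrite /el /xi /L /cross /dot /th /=; split; ring.
have elC y : ~ Gamma S y -> `|y - D| < r -> subdomain S minus y \/ subdomain S plus y.
  move=> Gy yr; have : (Omega S `\` Gamma S) y by split => //; exact: inO.
  by rewrite -cov.
have dis' y t t' : subdomain S t y -> subdomain S t' y -> t = t'.
  have h : (subdomain S minus `&` subdomain S plus) y -> False by rewrite dis.
  by case: t t' => -[] // h1 h2; exfalso; apply: h.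
have clo y t : closure (subdomain S t) y -> ~ Gamma S y -> `|y - D| < r -> subdomain S t y.
  move=> cy Gy yr.
  have [t' ty] : exists t', subdomain S t' y.
    by case: (elC _ Gy yr) => h; [exists minus|exists plus].
  have [op _ _] := ocn t'.
  have [z [zt zt']] := cy _ (open_nbhs_nbhs (conj op ty)).
  by rewrite (dis' _ _ _ zt zt').
have rho16 : 16 * rho <= r by [].
have nDr y : `|y - O| <= rho -> `|y - D| < r by move=> /nD h; clear -h rho16 rho0; lra.
have {}sV : subdomain S s V by apply: clo => //; exact: nDr.
have {}sW : subdomain S s' W by apply: clo => //; exact: nDr.
(* The angle condition puts [V] strictly inside the upper cone, of slope [eps], with apex at one of
   the two ends of the chord; that end becomes [G]. *)
have steep : exists G, [/\ Gamma S G, `|G - O| <= rho, el G = 0 & eps * `|xi V - xi G| < el V].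
  have LD : L * dot (D - V) (E - V) = (xi V - xi D) * (xi V - xi E) + el V ^+ 2.
    by rewrite /L /xi /el /dot /cross /th /=; ring.
  have LC : cross (D - V) (E - V) = el V by rewrite /el /cross /th /=; ring.
  have [] := @steep_from_an_end eps (xi V - xi D) (xi V - xi E) (el V) L eps0 eps1 L0 lV.
  - by rewrite xiD xiE; ring.
  - by rewrite -LD mulr_ge0 ?(ltW L0)//; case/andP: ang.
  - by rewrite -LD ler_pM2l//; case/andP: ang => _; rewrite LC gtr0_norm.
  - by exists D.
  - by exists E.
have [G [GG GO' elG VG]] := steep.
have Gr := nDr _ GO'.
have offcone y : `|y - D| < r -> eps * `|xi y - xi G| < `|el y| -> ~ Gamma S y.
  by move=> yr h Gy; have := chord _ _ Gy GG yr Gr; rewrite elG subr0 leNgt h.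
have affxi x y t : xi (x + t *: (y - x)) = xi x + t * (xi y - xi x).
  by rewrite /xi /dot /= /GRing.scale/=; ring.
have affel x y t : el (x + t *: (y - x)) = el x + t * (el y - el x).
  by rewrite /el /cross /= /GRing.scale/=; ring.
(* The Lipschitz bound keeps the curve out of the open upper and lower cones at [G]. Each cone is
   convex, so it lies locally on one side of the curve. *)
have cone (sg' : R) x y t : `|sg'| = 1 -> `|x - D| < r -> `|y - D| < r ->
    eps * `|xi x - xi G| < sg' * el x -> eps * `|xi y - xi G| < sg' * el y ->
    subdomain S t x -> subdomain S t y.
  move=> sg1 xr yr xc yc tx; apply: (segment_same_side sep tx) => a a01.
  have nr := near_segment a01 xr yr.
  split; first exact: inO.
  apply: offcone => //.
  have -> : `|el (x + a *: (y - x))| = `|sg' * el (x + a *: (y - x))| by rewrite normrM sg1 mul1r.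
  apply: lt_le_trans (ler_norm _); rewrite affxi affel.
  have -> : sg' * (el x + a * (el y - el x)) = sg' * el x + a * (sg' * el y - sg' * el x) by ring.
  have -> : xi x + a * (xi y - xi x) - xi G = (1 - a) * (xi x - xi G) + a * (xi y - xi G) by ring.
  move: a01 => /[dup] a01 /andP[a0 a1].
  have h1 : `|(1 - a) * (xi x - xi G) + a * (xi y - xi G)| <=
      (1 - a) * `|xi x - xi G| + a * `|xi y - xi G|.
    rewrite (le_trans (ler_normD _ _))// !normrM (ger0_norm a0) (ger0_norm (_ : 0 <= 1 - a))//.
    by rewrite subr_ge0.
  have h2 := ler_wpM2l (ltW eps0) h1; apply: (le_lt_trans h2).
  rewrite -subr_gt0.
  have := convex_lt a01 (_ : eps * `|xi x - xi G| - sg' * el x < 0) (_ : eps * `|xi y - xi G| - sg' * el y < 0).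
  by rewrite !subr_lt0 => /(_ xc yc) h; clear -h; lra.
have upper x : `|x - D| < r -> eps * `|xi x - xi G| < el x -> subdomain S s x.
  by move=> xr xc; apply: (@cone 1 V x) => //; rewrite ?normr1 ?mul1r// nDr.
have Wr := nDr _ WO.
(* The vertex [W] may fall outside the lower cone. The line through [W] perpendicular to the chord
   is then followed up to [T t1] in the upper cone and down to [T t2] in the lower one; the summand
   [L] in [K] makes both strictly interior. The upward segment must meet the curve, otherwise [W]
   would be on the side of [V]. By the Lipschitz bound the line meets the curve only once, so the
   downward segment is free and [T t2] is on the side of [W]. *)
have lower : exists w, [/\ `|w - D| < r, eps * `|xi w - xi G| < - el w & subdomain S s' w].
  have [Wc|Wc] := ltP (eps * `|xi W - xi G|) (- el W); first by exists W.
  pose K := eps * `|xi W - xi G| + L.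
  pose n : plane R := (- th.2, th.1).
  pose T t := W + t *: n.
  have xiT t : xi (T t) = xi W by rewrite /xi /T /n /dot /= /GRing.scale/=; ring.
  have elT t : el (T t) = el W + t * L by rewrite /el /T /n /L /cross /dot /= /GRing.scale/=; ring.
  have K0 : 0 < K by rewrite ltr_wpDl// mulr_ge0// ltW.
  pose t1 := (K - el W) / L; pose t2 := (- K - el W) / L.
  have elW0 : el W < 0 by [].
  have t10 : 0 < t1 by rewrite divr_gt0//; clear -K0 elW0; lra.
  have t20 : t2 < 0 by rewrite ltr_pdivrMr// mul0r /K; clear -Wc L0; lra.
  have nn : `|n| = N by rewrite /n /N !prod_normE /= normrN maxC.
  have WG : `|W - G| <= 2 * rho.
    have -> : W - G = (W - O) - (G - O) by rewrite opprB addrA subrK.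
    by rewrite (le_trans (ler_normB _ _))//; clear -WO GO'; lra.
  have bx : `|xi W - xi G| <= 2 * N * (2 * rho).
    have -> : xi W - xi G = dot th (W - G) by rewrite /xi /dot /=; ring.
    by rewrite (le_trans (dot_le_norm _ _))// ler_wpM2l// mulr_ge0// ltW.
  have be_ : `|el W| <= 2 * N * (2 * rho).
    by rewrite (le_trans (cross_le_norm _ _))// ler_wpM2l ?nD// mulr_ge0// ltW.
  have bL : L <= 4 * N * rho.
    by apply: (le_trans LN2); rewrite expr2; have h := ler_wpM2l (ltW N0) N2; clear -h; lra.
  have KN : K <= 6 * N * rho.
    have : eps * `|xi W - xi G| <= 2^-1 * (2 * N * (2 * rho)) by rewrite ler_pM// ltW.
    by rewrite /K => h; clear -h bL; lra.
  have tb t : `|t * L| <= K + `|el W| -> `|T t - D| < r.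
    move=> tL; have -> : T t - D = (W - D) + t *: n by rewrite /T addrAC.
    apply: (le_lt_trans (ler_normD _ _)); rewrite normrZ nn.
    have h : `|t| * N * N <= 10 * rho * N.
      rewrite normrM (gtr0_norm L0) in tL.
      have h : `|t| * N * N <= `|t| * L by rewrite -mulrA -expr2 ler_wpM2l.
      apply: (le_trans h); apply: (le_trans tL); apply: (le_trans (lerD KN be_)).
      by rewrite le_eqVlt; apply/orP; left; apply/eqP; ring.
    have {}h : `|t| * N <= 10 * rho by rewrite -(ler_pM2r N0).
    by have hw := nD _ WO; clear -hw h rho16 rho0; lra.
  have T1r : `|T t1 - D| < r.
    by apply: tb; rewrite /t1 mulfVK ?gt_eqF// (le_trans (ler_normB _ _))// (gtr0_norm K0).
  have T2r : `|T t2 - D| < r.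
    by apply: tb; rewrite /t2 mulfVK ?gt_eqF// (le_trans (ler_normB _ _))// normrN (gtr0_norm K0).
  have TE t a : W + a *: (T t - W) = T (a * t).
    by rewrite /T addrAC subrr add0r scalerA.
  have free t : `|T t - D| < r -> (forall a, 0 <= a <= 1 -> ~ Gamma S (T (a * t))) ->
      subdomain S s' (T t).
    move=> tr fr; apply: (segment_same_side sep sW) => a a01; split.
      by apply: inO; exact: near_segment.
    by rewrite TE; exact: fr.
  have T1u : subdomain S s (T t1).
    apply: upper => //; rewrite xiT elT /t1 mulfVK ?gt_eqF// [el W + _]addrC subrK /K.
    by rewrite ltrDl.
  have T2l : eps * `|xi (T t2) - xi G| < - el (T t2).
    by rewrite xiT elT /t2 mulfVK ?gt_eqF// [el W + _]addrC subrK opprK /K ltrDl.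
  have [[a [a01 Ga]]|na] := pselect (exists a, 0 <= a <= 1 /\ Gamma S (T (a * t1))); last first.
    exfalso; apply: ss'; apply: (dis' (T t1)) => //; apply: free => // a a01 Ga.
    by apply: na; exists a.
  exists (T t2); split => //; apply: free => // c c01 Gc.
  have nr1 : `|T (a * t1) - D| < r by rewrite -TE; exact: near_segment.
  have nr2 : `|T (c * t2) - D| < r by rewrite -TE; exact: near_segment.
  have := chord _ _ Ga Gc nr1 nr2; rewrite !xiT subrr normr0 mulr0 normr_le0 !elT.
  have -> : el W + a * t1 * L - (el W + c * t2 * L) = (a * t1 - c * t2) * L by ring.
  rewrite mulf_eq0 (gt_eqF L0) orbF subr_eq0 => /eqP e.
  have a1 : 0 <= a * t1 by rewrite mulr_ge0 ?(ltW t10)//; case/andP: a01.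
  have c1 : c * t2 <= 0 by rewrite mulr_ge0_le0 ?(ltW t20)//; case/andP: c01.
  have a0 : a * t1 = 0 by clear -e a1 c1; lra.
  by move: Ga; rewrite a0 /T scale0r addr0.
have [w [wr wc sw]] := lower.
move=> x xO; have xr := nDr _ xO.
have bx : eps * `|xi x - xi G| <= 4 * eps * rho * N.
  have -> : xi x - xi G = dot th (x - G) by rewrite /xi /dot /=; ring.
  have xG : `|x - G| <= 2 * rho.
    have -> : x - G = (x - O) - (G - O) by rewrite opprB addrA subrK.
    by rewrite (le_trans (ler_normB _ _))//; clear -xO GO'; lra.
  have := dot_le_norm th (x - G); rewrite -/N => h.
  have h2 : 2 * N * `|x - G| <= 2 * N * (2 * rho) by rewrite ler_wpM2l// mulr_ge0// ltW.
  by have h3 := ler_wpM2l (ltW eps0) (le_trans h h2); clear -h3; lra.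
split => hx; first by apply: upper => //; exact: le_lt_trans bx hx.
apply: (@cone (- 1) w x) => //; rewrite ?normrN1 ?mulN1r//.
by apply: (le_lt_trans bx); move: hx; rewrite -/th -/N -/(el x) => h; clear -h; lra.
Qed.

End Curve.

(** * Right isosceles triangles *)

Section RightTriangle.
Context (R : realType).
Implicit Types (c x V W A B : plane R) (s h : R).

(* A right isosceles triangle: [c] is the right-angled corner, the legs have length [h]
   and directions [s1] and [s2], which are signs. *)
Definition leg1 s1 c x := s1 * (x.1 - c.1).
Definition leg2 s2 c x := s2 * (x.2 - c.2).

Definition otri c s1 s2 h : set (plane R) :=
  [set x | [/\ 0 < leg1 s1 c x, 0 < leg2 s2 c x & leg1 s1 c x + leg2 s2 c x < h]].

Definition ctri c s1 s2 h : set (plane R) :=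
  [set x | [/\ 0 <= leg1 s1 c x, 0 <= leg2 s2 c x & leg1 s1 c x + leg2 s2 c x <= h]].

Definition tri_vertices c s1 s2 h : seq (plane R) :=
  [:: c; (c.1 + s1 * h, c.2); (c.1, c.2 + s2 * h)].

Definition arranged c s1 s2 h V W1 W2 :=
  [/\ V \in tri_vertices c s1 s2 h, W1 \in tri_vertices c s1 s2 h,
      W2 \in tri_vertices c s1 s2 h & [/\ V != W1, V != W2 & W1 != W2]].

Lemma arranged_cases c s1 s2 h V W1 W2 (A := (c.1 + s1 * h, c.2)) (B := (c.1, c.2 + s2 * h)) :
  arranged c s1 s2 h V W1 W2 ->
  [\/ V = c /\ (W1 = A /\ W2 = B \/ W1 = B /\ W2 = A),
      V = A /\ (W1 = c /\ W2 = B \/ W1 = B /\ W2 = c) |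
      V = B /\ (W1 = c /\ W2 = A \/ W1 = A /\ W2 = c)].
Proof.
case; rewrite /tri_vertices -/A -/B !inE.
move=> /or3P[]/eqP-> /or3P[]/eqP-> /or3P[]/eqP-> []; rewrite ?eqxx// => _ _ _;
  do ?[by constructor 1; split => //; [left|right]|by constructor 1; split => //; right
  |by constructor 2; split => //; left|by constructor 2; split => //; right
  |by constructor 3; split => //; left|by constructor 3; split => //; right
  |by constructor 1; split => //; left].
Qed.

Definition is_sign s := s = 1 \/ s = -1.

Lemma sign_sqr s : is_sign s -> s * s = 1.
Proof. by case=> ->; rewrite ?mulr1// mulrNN mulr1. Qed.

Lemma arranged_gram c s1 s2 h V W1 W2 : is_sign s1 -> is_sign s2 -> 0 < h ->
  arranged c s1 s2 h V W1 W2 ->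
  [/\ gram_case h (W1 - V) (W2 - V), `|cross (W1 - V) (W2 - V)| = h ^+ 2 &
      0 <= dot (W1 - V) (W2 - V) <= `|cross (W1 - V) (W2 - V)|].
Proof.
move=> hs1 hs2 h0 /arranged_cases ar.
have h2 : 0 <= h ^+ 2 by rewrite sqr_ge0.
have X : `|cross (W1 - V) (W2 - V)| = h ^+ 2.
  rewrite -[RHS]ger0_norm//; apply/eqP; rewrite eqr_norm2.
  by case: ar => -[->] [] [-> ->]; rewrite /cross /=; case: hs1 => ->; case: hs2 => ->;
    (apply/orP; (left; apply/eqP; ring) || (right; apply/eqP; ring)).
rewrite X; split => //.
  rewrite /gram_case /dot.
  case: ar => -[->] [] [-> ->] /=; case: hs1 => ->; case: hs2 => ->;
  (constructor 1; split; ring) || (constructor 2; split; ring) || (constructor 3; split; ring).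
case: ar => -[->] [] [-> ->]; rewrite /dot /=; case: hs1 => ->; case: hs2 => ->; apply/andP; split; clear -h2; lra.
Qed.

(** Barycentric coordinates at an arbitrary vertex [V]. They allow the corner cut off by the
    interface to be treated alike, whether it is the right angle or an acute one. *)
Lemma arranged_bary c s1 s2 h V W1 W2 x : is_sign s1 -> is_sign s2 -> 0 < h ->
  arranged c s1 s2 h V W1 W2 ->
  exists a b, [/\ x = V + a *: (W1 - V) + b *: (W2 - V),
    otri c s1 s2 h x <-> [/\ 0 < a, 0 < b & a + b < 1] &
    ctri c s1 s2 h x <-> [/\ 0 <= a, 0 <= b & a + b <= 1]].
Proof.
move=> hs1 hs2 h0 /arranged_cases ar.
have e1 := sign_sqr hs1; have e2 := sign_sqr hs2.
pose p := leg1 s1 c x / h; pose q := leg2 s2 c x / h.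
have pE : leg1 s1 c x = h * p by rewrite /p mulrC mulfVK ?gt_eqF.
have qE : leg2 s2 c x = h * q by rewrite /q mulrC mulfVK ?gt_eqF.
have x1 : x.1 = c.1 + s1 * h * p.
  by rewrite -mulrA -pE /leg1 mulrA e1 mul1r addrC subrK.
have x2 : x.2 = c.2 + s2 * h * q.
  by rewrite -mulrA -qE /leg2 mulrA e2 mul1r addrC subrK.
have o : otri c s1 s2 h x <-> [/\ 0 < p, 0 < q & p + q < 1].
  have hh y : (h * y < h) = (y < 1) by rewrite -[ltRHS]mulr1 ltr_pM2l.
  have pq : leg1 s1 c x + leg2 s2 c x = h * (p + q) by rewrite pE qE mulrDr.
  by rewrite /otri/= pq hh pE qE (pmulr_rgt0 p h0) (pmulr_rgt0 q h0); split.
have cl : ctri c s1 s2 h x <-> [/\ 0 <= p, 0 <= q & p + q <= 1].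
  have hh y : (h * y <= h) = (y <= 1) by rewrite -[leRHS]mulr1 ler_pM2l.
  have pq : leg1 s1 c x + leg2 s2 c x = h * (p + q) by rewrite pE qE mulrDr.
  by rewrite /ctri/= pq hh pE qE (pmulr_rge0 p h0) (pmulr_rge0 q h0); split.
have G a b : (s1 * h * p, s2 * h * q) = V - c + a *: (W1 - V) + b *: (W2 - V) ->
  x = V + a *: (W1 - V) + b *: (W2 - V).
  move=> e; have -> : x = c + (s1 * h * p, s2 * h * q).
    by apply: injective_projections; rewrite /= ?x1 ?x2.
  by rewrite e; apply: injective_projections; rewrite /= /GRing.scale/=; ring.
case: ar => -[vE] [] [w1 w2]; [exists p, q|exists q, p|exists (1 - p - q), q|
  exists q, (1 - p - q)|exists (1 - p - q), p|exists p, (1 - p - q)]; split;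
  try (apply: G; rewrite vE w1 w2; apply: injective_projections; rewrite /= /GRing.scale/=; ring);
  rewrite ?o ?cl; clear; split=> -[? ? ?]; split; lra.
Qed.

Lemma ctri_dist c s1 s2 h x y : is_sign s1 -> is_sign s2 ->
  ctri c s1 s2 h x -> ctri c s1 s2 h y -> `|x - y| <= h.
Proof.
move=> hs1 hs2 [a1 a2 a3] [b1 b2 b3]; rewrite prod_normE /= ge_max !ler_norml.
move: a1 a2 a3 b1 b2 b3; rewrite /leg1 /leg2.
by case: hs1 => ->; case: hs2 => -> *; apply/andP; split; apply/andP; split; lra.
Qed.

Lemma otri_ctri c s1 s2 h : otri c s1 s2 h `<=` ctri c s1 s2 h.
Proof. by move=> x [a b d]; split; apply: ltW. Qed.

Lemma leg1_cont s c : continuous (leg1 s c).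
Proof.
move=> x; apply: cvgM; first exact: cvg_cst.
by apply: cvgB; [exact: cvg_fst|exact: cvg_cst].
Qed.

Lemma leg2_cont s c : continuous (leg2 s c).
Proof.
move=> x; apply: cvgM; first exact: cvg_cst.
by apply: cvgB; [exact: cvg_snd|exact: cvg_cst].
Qed.

Lemma otri_open c s1 s2 h : open (otri c s1 s2 h).
Proof.
have -> : otri c s1 s2 h = leg1 s1 c @^-1` [set t | 0 < t] `&` leg2 s2 c @^-1` [set t | 0 < t]
    `&` (fun x => leg1 s1 c x + leg2 s2 c x) @^-1` [set t | t < h].
  by apply/seteqP; split => x /= => [[]|[[]]].
apply: openI; [apply: openI|]; apply: open_comp; do ?[exact: open_gt|exact: open_lt].
- by move=> x _; exact: leg1_cont.
- by move=> x _; exact: leg2_cont.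
- by move=> x _; apply: cvgD; [exact: leg1_cont|exact: leg2_cont].
Qed.

Lemma otri_measurable c s1 s2 h : measurable (otri c s1 s2 h).
Proof. apply: open_measurable_plane; exact: otri_open. Qed.

Lemma interior_ctri c s1 s2 h : is_sign s1 -> is_sign s2 ->
  interior (ctri c s1 s2 h) = otri c s1 s2 h.
Proof.
move=> hs1 hs2; apply/seteqP; split => [x|]; last first.
  rewrite -open_subsetE; [exact: otri_ctri|exact: otri_open].
rewrite /interior/= => /nbhs_ballP[e /= e0 xe].
have e2 : 0 < e / 2 by rewrite divr_gt0.
have B (p q : R) : `|p| <= 1 -> `|q| <= 1 ->
    ctri c s1 s2 h (x.1 + e / 2 * p, x.2 + e / 2 * q).
  move=> p1 q1; apply: xe; split; rewrite /ball/= opprD addNKr normrN normrM (gtr0_norm e2).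
    apply: (@le_lt_trans _ _ (e / 2)); last by lra.
    by rewrite -[leRHS]mulr1; apply: ler_wpM2l => //; exact: ltW.
  apply: (@le_lt_trans _ _ (e / 2)); last by lra.
  by rewrite -[leRHS]mulr1; apply: ler_wpM2l => //; exact: ltW.
have s11 : `|s1| <= 1 by case: hs1 => ->; rewrite ?normrN1 ?normr1.
have s21 : `|s2| <= 1 by case: hs2 => ->; rewrite ?normrN1 ?normr1.
have q1 := sign_sqr hs1; have q2 := sign_sqr hs2.
have E1 (p q : R) : leg1 s1 c (x.1 + e / 2 * (s1 * p), q) = leg1 s1 c x + e / 2 * p.
  have -> : leg1 s1 c (x.1 + e / 2 * (s1 * p), q) = s1 * (x.1 - c.1) + e / 2 * (s1 * s1) * p.
    by rewrite /leg1 /=; ring.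
  by rewrite q1 mulr1.
have E2 (p q : R) : leg2 s2 c (q, x.2 + e / 2 * (s2 * p)) = leg2 s2 c x + e / 2 * p.
  have -> : leg2 s2 c (q, x.2 + e / 2 * (s2 * p)) = s2 * (x.2 - c.2) + e / 2 * (s2 * s2) * p.
    by rewrite /leg2 /=; ring.
  by rewrite q2 mulr1.
have b1 : `|s1 * -1| <= 1 by rewrite mulrN1 normrN.
have b2 : `|s2 * -1| <= 1 by rewrite mulrN1 normrN.
have b3 : `|s1 * 1| <= 1 by rewrite mulr1.
have b4 : `|s2 * 0| <= 1 by rewrite mulr0 normr0.
have [h1 _ _] := B _ _ b1 b2.
have [_ h2 _] := B _ _ b1 b2.
have [_ _ h3] := B _ _ b3 b4.
by move: h1 h2 h3; rewrite !E1 !E2 => h1 h2 h3; split; lra.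
Qed.

(** A point of the closed triangle is moved slightly towards the barycentre [m]. This is what gives
    the one-sided traces on the edges a meaning. *)
Lemma otri_dense c s1 s2 h x (U : set (plane R)) : is_sign s1 -> is_sign s2 -> 0 < h ->
  ctri c s1 s2 h x -> nbhs x U -> exists2 y, U y & otri c s1 s2 h y.
Proof.
move=> hs1 hs2 h0 [a1 a2 a3] /nbhs_ballP[e /= e0 xe].
pose m : plane R := (c.1 + s1 * (h / 3), c.2 + s2 * (h / 3)).
have q1 := sign_sqr hs1; have q2 := sign_sqr hs2.
have m1 : leg1 s1 c m = h / 3.
  by rewrite /leg1 /m /= addrC addKr mulrA q1 mul1r.
have m2 : leg2 s2 c m = h / 3.
  by rewrite /leg2 /m /= addrC addKr mulrA q2 mul1r.
have mx : `|m - x| <= h.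
  by apply: (@ctri_dist c s1 s2 h) => //; split; rewrite ?m1 ?m2; lra.
pose t := Num.min 1 (e / (2 * h)).
have h20 : 0 < 2 * h by rewrite mulr_gt0.
have t0 : 0 < t by rewrite lt_min ltr01 divr_gt0.
have t1 : t <= 1 by rewrite ge_min lexx.
have th : t * h <= e / 2.
  apply: (@le_trans _ _ (e / (2 * h) * h)).
    by rewrite ler_wpM2r ?(ltW h0)// ge_min lexx orbT.
  by rewrite le_eqVlt; apply/orP; left; apply/eqP; field; rewrite gt_eqF.
pose y : plane R := x + t *: (m - x).
exists y.
  apply: xe; rewrite -ball_normE /ball_/= opprD addNKr normrN normrZ (gtr0_norm t0).
  apply: (@le_lt_trans _ _ (t * h)); first by rewrite ler_wpM2l// ltW.
  by apply: (le_lt_trans th); lra.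
have E1 : leg1 s1 c y = (1 - t) * leg1 s1 c x + t * leg1 s1 c m.
  by rewrite /y /leg1 /= /GRing.scale/=; ring.
have E2 : leg2 s2 c y = (1 - t) * leg2 s2 c x + t * leg2 s2 c m.
  by rewrite /y /leg2 /= /GRing.scale/=; ring.
have th0 : 0 < t * (h / 3) by rewrite !mulr_gt0.
have u1 : 0 <= (1 - t) * leg1 s1 c x by rewrite mulr_ge0 ?subr_ge0.
have u2 : 0 <= (1 - t) * leg2 s2 c x by rewrite mulr_ge0 ?subr_ge0.
have u3 : (1 - t) * (leg1 s1 c x + leg2 s2 c x) <= (1 - t) * h by rewrite ler_wpM2l ?subr_ge0.
by split; rewrite ?E1 ?E2 ?m1 ?m2; lra.
Qed.

Definition open_corner V (u v : plane R) : set (plane R) :=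
  [set x | exists a b, [/\ 0 < a, 0 < b, a + b < 1 & x = V + a *: u + b *: v]].

Lemma open_corner_swap V u v : open_corner V u v = open_corner V v u.
Proof.
by apply/seteqP; split => x [a [b [a0 b0 ab ->]]]; exists b, a;
  split => //; [by rewrite addrC|exact: addrAC|by rewrite addrC|exact: addrAC].
Qed.

Lemma Rintegral_affine_interval (p r V2 : R) : r != 0 ->
  Rintegral (@lebesgue_measure R) `](Num.min V2 (V2 + r)), (Num.max V2 (V2 + r))[
    (fun t => p * (1 - (t - V2) / r)) = p * `|r| / 2.
Proof.
move=> r0; set a := Num.min _ _; set b := Num.max _ _.
have ab : a < b.
  rewrite /a /b; have [rp|rn] := ltP 0 r.
    by rewrite min_l ?max_r ?ltrDl// lerDl ltW.
  rewrite min_r ?max_l ?gerDl//; rewrite -subr_gt0 opprD addNKr oppr_gt0 lt_neqAle r0//.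
pose F (t : R) := - (p * r / 2) * (1 - (t - V2) / r) ^+ 2.
pose f (t : R) := p * (1 - (t - V2) / r).
have dF (t : R) : is_derive t (1 : R) F (f t).
  apply: is_derive_eq; rewrite /f /= !(scaler0, subr0, add0r, sub0r, oppr0, mulr1, addr0, scale0r).
  by rewrite /GRing.scale/=; field.
have cf : continuous f.
  move=> t; apply: cvgM; first exact: cvg_cst.
  apply: cvgB; first exact: cvg_cst.
  by apply: cvgM; [apply: cvgB; [exact: cvg_id|exact: cvg_cst]|exact: cvg_cst].
have cF : continuous F.
  by move=> t; apply/differentiable_continuous/derivable1_diffP; case: (dF t).
have int : (\int[lebesgue_measure]_(t in `[a, b]) (f t)%:E = (F b)%:E - (F a)%:E)%E.
  apply: continuous_FTC2 => //.
  - exact: continuous_subspaceT.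
  - split.
    + by move=> t _; case: (dF t).
    + by apply: cvg_at_right_filter; exact: cF.
    + by apply: cvg_at_left_filter; exact: cF.
  - by move=> t _; rewrite derive1E; case: (dF t).
rewrite /Rintegral.
have -> : (\int[lebesgue_measure]_(t in `]a, b[) (p * (1 - (t - V2) / r))%:E =
  \int[lebesgue_measure]_(t in `[a, b]) (f t)%:E)%E.
  rewrite [LHS]integral_itv_bndoo//; first by rewrite [RHS]integral_itv_bndoo//;
    apply/measurable_EFinP; apply: measurable_funTS; exact: continuous_measurable_fun.
  by apply/measurable_EFinP; apply: measurable_funTS; exact: continuous_measurable_fun.
rewrite int -EFinB /= /F /a /b; have [rp|rn] := ltP 0 r.
  rewrite (gtr0_norm rp) min_l ?max_r ?lerDl ?(ltW rp)//.
  by field.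
rewrite (ler0_norm rn) min_r ?max_l ?gerDl//.
by field.
Qed.

Lemma area_fin_box (A : set (plane R)) (a b c d : R) : measurable A ->
  (forall x, A x -> a <= x.1 <= b /\ c <= x.2 <= d) -> (area R A < +oo)%E.
Proof.
move=> mA Ab; apply: (@le_lt_trans _ _ (area R (`[a, b] `*` `[c, d]))); last exact: area_box_fin.
by apply: le_measure; rewrite ?inE//=; exact: measurableX.
Qed.

Lemma leb_itv_oo (a b : R) : a <= b -> fine (@lebesgue_measure R `]a, b[) = b - a.
Proof.
move=> ab; rewrite lebesgue_measure_itv/= lte_fin; case: ltP => //= ba.
by apply/esym/eqP; rewrite subr_eq0 eq_le ab ba.
Qed.

Lemma measure_one (A : set (plane R)) : measurable A ->
  fine (area R A) = Rintegral (area R) A (fun=> 1).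
Proof. by move=> mA; rewrite Rintegral_cst// mul1r. Qed.

Local Notation leb := (@lebesgue_measure R).

(** Cut into slices parallel to the horizontal edge [u], the triangle has at the fraction [t] of its
    height a slice of length [|u.1| * (1 - t)]. Every corner of a mesh triangle has a horizontal or
    a vertical edge. *)
Lemma area_open_corner_x V (u v : plane R) : u.2 = 0 -> u.1 != 0 -> v.2 != 0 ->
  measurable (open_corner V u v) ->
  fine (area R (open_corner V u v)) = `|cross u v| / 2.
Proof.
move=> u2 u1 v2 mA; rewrite measure_one//.
pose r := v.2; pose q := v.1; pose p := u.1.
pose lo (t : R) := V.1 + (t - V.2) / r * q + Num.min 0 ((1 - (t - V.2) / r) * p).
pose up (t : R) := V.1 + (t - V.2) / r * q + Num.max 0 ((1 - (t - V.2) / r) * p).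
have tb (t : R) : (Num.min V.2 (V.2 + r) < t < Num.max V.2 (V.2 + r)) =
    (0 < (t - V.2) / r < 1).
  have [rp|rn] := ltP 0 r.
    rewrite min_l ?max_r ?lerDl ?(ltW rp)// ltr_pdivlMr// ltr_pdivrMr// mul0r mul1r.
    by rewrite subr_gt0 ltrBlDl.
  have {}rn : r < 0 by rewrite lt_neqAle v2.
  rewrite min_r ?max_l ?gerDl ?(ltW rn)// ltr_ndivlMr// ltr_ndivrMr// mul0r mul1r.
  by rewrite subr_lt0 ltrBrDl andbC.
have wid t : up t - lo t = `|(1 - (t - V.2) / r) * p|.
  rewrite /up /lo; set y := _ * p; have [y0|y0] := leP 0 y.
    by rewrite ger0_norm//; ring.
  by rewrite ltr0_norm//; ring.
rewrite (@Rintegral_normal_y _ (Num.min V.2 (V.2 + r)) (Num.max V.2 (V.2 + r)) 1 lo up)//.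
- transitivity (Rintegral leb `](Num.min V.2 (V.2 + r)), (Num.max V.2 (V.2 + r))[
    (fun t => `|p| * (1 - (t - V.2) / r))).
    apply: eq_Rintegral => t; rewrite inE /= in_itv/= tb => /andP[t0 t1].
    have w0 : 0 <= 1 - (t - V.2) / r by rewrite subr_ge0 ltW.
    rewrite Rintegral_cst// mul1r leb_itv_oo.
      by rewrite wid normrM mulrC (ger0_norm w0).
    by rewrite -subr_ge0 wid.
  rewrite Rintegral_affine_interval// /cross u2 mul0r subr0 normrM//.
- by rewrite ge_min le_max lexx.
- move=> x; rewrite tb; split.
    move=> [a [b [a0 b0 ab ->]]].
    have bE : (V.2 + a * u.2 + b * v.2 - V.2) / r = b.
      by rewrite u2 mulr0 addr0 addrC addKr mulfK.
    rewrite /= /GRing.scale/= /lo /up bE; split; first by rewrite b0; lra.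
    have b1 : 0 < 1 - b by lra.
    rewrite /p /q; have [up0|un] := ltP 0 u.1.
      have y0 : 0 < (1 - b) * u.1 by rewrite mulr_gt0.
      have := ltr_pM2r up0 a (1 - b); have := mulr_gt0 a0 up0.
      rewrite (min_l (ltW y0)) (max_r (ltW y0)) => h1 h2.
      have h3 : a * u.1 < (1 - b) * u.1 by rewrite h2; lra.
      by apply/andP; split; lra.
    have {}un : u.1 < 0 by rewrite lt_neqAle u1.
    have y0 : (1 - b) * u.1 < 0 by rewrite pmulr_rlt0.
    have h2 : a * u.1 < 0 by rewrite pmulr_rlt0.
    have h3 : (1 - b) * u.1 < a * u.1 by rewrite ltr_nM2r//; lra.
    by rewrite (min_r (ltW y0)) (max_l (ltW y0)); apply/andP; split; lra.
  move=> [/andP[b0 b1]]; rewrite /lo /up; set b := (x.2 - V.2) / r in b0 b1 *.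
  rewrite -/p -/q => /andP[l1 l2].
  exists ((x.1 - V.1 - b * q) / p), b.
  have b2 : 0 < 1 - b by lra.
  have aE : (x.1 - V.1 - b * q) / p * p = x.1 - V.1 - b * q by rewrite mulfVK.
  have bE : b * r = x.2 - V.2 by rewrite /b mulfVK.
  set a := _ / p in aE *.
  have [a0 a1] : 0 < a /\ a < 1 - b.
    have [pp|pn] := ltP 0 p.
      have y0 : 0 <= (1 - b) * p by rewrite mulr_ge0 ?ltW.
      move: l1 l2; rewrite min_l// max_r// => l1 l2.
      by split; rewrite -(ltr_pM2r pp) ?mul0r aE; lra.
    have {}pn : p < 0 by rewrite lt_neqAle u1.
    have y0 : (1 - b) * p <= 0 by rewrite mulr_ge0_le0 ?ltW.
    move: l1 l2; rewrite min_r// max_l// => l1 l2.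
    by split; rewrite -(ltr_nM2r pn) ?mul0r aE; lra.
  split => //; first by lra.
  apply: injective_projections; rewrite /= /GRing.scale/= ?u2 -/p -/q -/r ?aE ?bE; ring.
- exists (`|V.1| + `|q| + `|p|) => t; rewrite tb => /andP[t0 t1]; rewrite /lo /up.
  set b := _ / r in t0 t1 *.
  have y : `|(1 - b) * p| <= `|p|.
    by rewrite normrM ger0_norm ?subr_ge0 ?(ltW t1)// -[leRHS]mul1r ler_wpM2r//; lra.
  have bq : `|b * q| <= `|q|.
    by rewrite normrM ger0_norm ?(ltW t0)// -[leRHS]mul1r ler_wpM2r// ltW.
  have v1 := ler_norm V.1; have v2' := ler_norm (- V.1); rewrite normrN in v2'.
  move: y bq; rewrite !ler_norml => /andP[y1 y2] /andP[q1 q2].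
  have p0 := normr_ge0 p; have q0 := normr_ge0 q; have v0 := normr_ge0 V.1.
  split.
    by rewrite -lerBlDl le_min; apply/andP; split; lra.
  by rewrite -lerBrDl ge_max; apply/andP; split; lra.
- by move=> x _; rewrite normr1.
Qed.

Lemma area_open_corner_y V (u v : plane R) : u.1 = 0 -> u.2 != 0 -> v.1 != 0 ->
  measurable (open_corner V u v) ->
  fine (area R (open_corner V u v)) = `|cross u v| / 2.
Proof.
move=> u2 u1 v2 mA; rewrite measure_one//.
pose r := v.1; pose q := v.2; pose p := u.2.
pose lo (t : R) := V.2 + (t - V.1) / r * q + Num.min 0 ((1 - (t - V.1) / r) * p).
pose up (t : R) := V.2 + (t - V.1) / r * q + Num.max 0 ((1 - (t - V.1) / r) * p).
have tb (t : R) : (Num.min V.1 (V.1 + r) < t < Num.max V.1 (V.1 + r)) =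
    (0 < (t - V.1) / r < 1).
  have [rp|rn] := ltP 0 r.
    rewrite min_l ?max_r ?lerDl ?(ltW rp)// ltr_pdivlMr// ltr_pdivrMr// mul0r mul1r.
    by rewrite subr_gt0 ltrBlDl.
  have {}rn : r < 0 by rewrite lt_neqAle v2.
  rewrite min_r ?max_l ?gerDl ?(ltW rn)// ltr_ndivlMr// ltr_ndivrMr// mul0r mul1r.
  by rewrite subr_lt0 ltrBrDl andbC.
have wid t : up t - lo t = `|(1 - (t - V.1) / r) * p|.
  rewrite /up /lo; set y := _ * p; have [y0|y0] := leP 0 y.
    by rewrite ger0_norm//; ring.
  by rewrite ltr0_norm//; ring.
rewrite (@Rintegral_normal_x _ (Num.min V.1 (V.1 + r)) (Num.max V.1 (V.1 + r)) 1 lo up)//.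
- transitivity (Rintegral leb `](Num.min V.1 (V.1 + r)), (Num.max V.1 (V.1 + r))[
    (fun t => `|p| * (1 - (t - V.1) / r))).
    apply: eq_Rintegral => t; rewrite inE /= in_itv/= tb => /andP[t0 t1].
    have w0 : 0 <= 1 - (t - V.1) / r by rewrite subr_ge0 ltW.
    rewrite Rintegral_cst// mul1r leb_itv_oo.
      by rewrite wid normrM mulrC (ger0_norm w0).
    by rewrite -subr_ge0 wid.
  rewrite Rintegral_affine_interval// /cross u2 mul0r sub0r normrN normrM//.
- by rewrite ge_min le_max lexx.
- move=> x; rewrite tb; split.
    move=> [a [b [a0 b0 ab ->]]].
    have bE : (V.1 + a * u.1 + b * v.1 - V.1) / r = b.
      by rewrite u2 mulr0 addr0 addrC addKr mulfK.
    rewrite /= /GRing.scale/= /lo /up bE; split; first by rewrite b0; lra.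
    have b1 : 0 < 1 - b by lra.
    rewrite /p /q; have [up0|un] := ltP 0 u.2.
      have y0 : 0 < (1 - b) * u.2 by rewrite mulr_gt0.
      have := ltr_pM2r up0 a (1 - b); have := mulr_gt0 a0 up0.
      rewrite (min_l (ltW y0)) (max_r (ltW y0)) => h1 h2.
      have h3 : a * u.2 < (1 - b) * u.2 by rewrite h2; lra.
      by apply/andP; split; lra.
    have {}un : u.2 < 0 by rewrite lt_neqAle u1.
    have y0 : (1 - b) * u.2 < 0 by rewrite pmulr_rlt0.
    have h2 : a * u.2 < 0 by rewrite pmulr_rlt0.
    have h3 : (1 - b) * u.2 < a * u.2 by rewrite ltr_nM2r//; lra.
    by rewrite (min_r (ltW y0)) (max_l (ltW y0)); apply/andP; split; lra.
  move=> [/andP[b0 b1]]; rewrite /lo /up; set b := (x.1 - V.1) / r in b0 b1 *.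
  rewrite -/p -/q => /andP[l1 l2].
  exists ((x.2 - V.2 - b * q) / p), b.
  have b2 : 0 < 1 - b by lra.
  have aE : (x.2 - V.2 - b * q) / p * p = x.2 - V.2 - b * q by rewrite mulfVK.
  have bE : b * r = x.1 - V.1 by rewrite /b mulfVK.
  set a := _ / p in aE *.
  have [a0 a1] : 0 < a /\ a < 1 - b.
    have [pp|pn] := ltP 0 p.
      have y0 : 0 <= (1 - b) * p by rewrite mulr_ge0 ?ltW.
      move: l1 l2; rewrite min_l// max_r// => l1 l2.
      by split; rewrite -(ltr_pM2r pp) ?mul0r aE; lra.
    have {}pn : p < 0 by rewrite lt_neqAle u1.
    have y0 : (1 - b) * p <= 0 by rewrite mulr_ge0_le0 ?ltW.
    move: l1 l2; rewrite min_r// max_l// => l1 l2.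
    by split; rewrite -(ltr_nM2r pn) ?mul0r aE; lra.
  split => //; first by lra.
  apply: injective_projections; rewrite /= /GRing.scale/= ?u2 -/p -/q -/r ?aE ?bE; ring.
- exists (`|V.2| + `|q| + `|p|) => t; rewrite tb => /andP[t0 t1]; rewrite /lo /up.
  set b := _ / r in t0 t1 *.
  have y : `|(1 - b) * p| <= `|p|.
    by rewrite normrM ger0_norm ?subr_ge0 ?(ltW t1)// -[leRHS]mul1r ler_wpM2r//; lra.
  have bq : `|b * q| <= `|q|.
    by rewrite normrM ger0_norm ?(ltW t0)// -[leRHS]mul1r ler_wpM2r// ltW.
  have v1 := ler_norm V.2; have v2' := ler_norm (- V.2); rewrite normrN in v2'.
  move: y bq; rewrite !ler_norml => /andP[y1 y2] /andP[q1 q2].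
  have p0 := normr_ge0 p; have q0 := normr_ge0 q; have v0 := normr_ge0 V.2.
  split.
    by rewrite -lerBlDl le_min; apply/andP; split; lra.
  by rewrite -lerBrDl ge_max; apply/andP; split; lra.
- by move=> x _; rewrite normr1.
Qed.

Lemma cross_cont (u D : plane R) : continuous (fun x => cross u (x - D)).
Proof.
move=> x; apply: cvgB; (apply: cvgM; first exact: cvg_cst).
  by apply: cvgB; [exact: cvg_snd|exact: cvg_cst].
by apply: cvgB; [exact: cvg_fst|exact: cvg_cst].
Qed.

Lemma open_cornerP V (u v x : plane R) : cross u v != 0 ->
  open_corner V u v x <->
  [/\ 0 < cross v (x - V) / - cross u v, 0 < cross u (x - V) / cross u v &
      cross v (x - V) / - cross u v + cross u (x - V) / cross u v < 1].
Proof.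
move=> X0; split.
  move=> [a [b [a0 b0 ab ->]]].
  have -> : cross v (V + a *: u + b *: v - V) / - cross u v = a.
    have -> : cross v (V + a *: u + b *: v - V) = a * - cross u v.
      by rewrite /cross /= /GRing.scale/=; ring.
    by rewrite mulfK// oppr_eq0.
  have -> : cross u (V + a *: u + b *: v - V) / cross u v = b.
    have -> : cross u (V + a *: u + b *: v - V) = b * cross u v.
      by rewrite /cross /= /GRing.scale/=; ring.
    by rewrite mulfK.
  by [].
move=> [a0 b0 ab]; eexists; eexists; split; [exact: a0|exact: b0|exact: ab|].
move: X0 {a0 b0 ab}; rewrite /cross => X0.
by apply: injective_projections; rewrite /= /GRing.scale/=; field.
Qed.

Lemma open_corner_measurable V (u v : plane R) : cross u v != 0 ->
  measurable (open_corner V u v).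
Proof.
move=> X0; apply: open_measurable_plane.
have cc (w : plane R) (k : R) : continuous (fun x : plane R => cross w (x - V) / k).
  by move=> x; apply: cvgM; [exact: cross_cont|exact: cvg_cst].
have -> : open_corner V u v =
  (fun x => cross v (x - V) / - cross u v) @^-1` [set t | 0 < t] `&`
  (fun x => cross u (x - V) / cross u v) @^-1` [set t | 0 < t] `&`
  (fun x => cross v (x - V) / - cross u v + cross u (x - V) / cross u v) @^-1` [set t | t < 1].
  by apply/seteqP; split => x; [move/(open_cornerP _ _ X0) => []|move=> [[? ?] ?]; apply/open_cornerP].
apply: openI; [apply: openI|]; apply: open_comp; do ?[exact: open_gt|exact: open_lt].
- by move=> x _; exact: cc.
- by move=> x _; exact: cc.
- by move=> x _; apply: cvgD; exact: cc.
Qed.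

Lemma area_corner_arranged c s1 s2 h V W1 W2 (d e : R) : is_sign s1 -> is_sign s2 -> 0 < h ->
  arranged c s1 s2 h V W1 W2 -> 0 < d -> 0 < e ->
  fine (area R (open_corner V (d *: (W1 - V)) (e *: (W2 - V)))) = d * e * h ^+ 2 / 2.
Proof.
move=> hs1 hs2 h0 ar d0 e0.
have [_ X _] := arranged_gram hs1 hs2 h0 ar.
have X' : `|cross (d *: (W1 - V)) (e *: (W2 - V))| = d * e * h ^+ 2.
  have -> : cross (d *: (W1 - V)) (e *: (W2 - V)) = d * e * cross (W1 - V) (W2 - V).
    by rewrite /cross /= /GRing.scale/=; ring.
  by rewrite normrM X ger0_norm// mulr_ge0 ?ltW.
have h20 : 0 < h ^+ 2 by rewrite exprn_gt0.
have X0 : cross (d *: (W1 - V)) (e *: (W2 - V)) != 0.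
  by rewrite -normr_eq0 X' gt_eqF// !mulr_gt0.
have mA := open_corner_measurable V X0.
have Xs : cross (e *: (W2 - V)) (d *: (W1 - V)) = - cross (d *: (W1 - V)) (e *: (W2 - V)).
  by rewrite /cross; ring.
have X0s : cross (e *: (W2 - V)) (d *: (W1 - V)) != 0 by rewrite Xs oppr_eq0.
have mAs := open_corner_measurable V X0s.
have s10 : s1 != 0 by case: hs1 => ->; rewrite ?oppr_eq0 oner_eq0.
have s20 : s2 != 0 by case: hs2 => ->; rewrite ?oppr_eq0 oner_eq0.
have hn := lt0r_neq0 h0; have dn := lt0r_neq0 d0; have en := lt0r_neq0 e0.
have nz (k s q : R) : k != 0 -> s != 0 -> k * (q + s * h - q) != 0.
  by move=> k0 s0; rewrite addrC addKr !mulf_neq0.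
have nz' (k s q : R) : k != 0 -> s != 0 -> k * (q - (q + s * h)) != 0.
  by move=> k0 s0; rewrite opprD addNKr mulrN oppr_eq0 !mulf_neq0.
rewrite -X'; case/arranged_cases: ar mA mAs X0 X0s Xs => -[->] [] [-> ->] mA mAs X0 X0s Xs.
- by rewrite area_open_corner_x//= /GRing.scale/= ?subrr ?mulr0//; apply: nz.
- by rewrite area_open_corner_y//= /GRing.scale/= ?subrr ?mulr0//; apply: nz.
- by rewrite area_open_corner_x//= /GRing.scale/= ?subrr ?mulr0//; (apply: nz || apply: nz').
- rewrite open_corner_swap area_open_corner_x ?Xs ?normrN//= /GRing.scale/= ?subrr ?mulr0//;
  by (apply: nz || apply: nz').
- by rewrite area_open_corner_y//= /GRing.scale/= ?subrr ?mulr0//; (apply: nz || apply: nz').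
- rewrite open_corner_swap area_open_corner_y ?Xs ?normrN//= /GRing.scale/= ?subrr ?mulr0//;
  by (apply: nz || apply: nz').
Qed.

Lemma strip_measurable (u D : plane R) (k : R) :
  measurable [set x : plane R | `|cross u (x - D)| <= k].
Proof.
have mf : measurable_fun setT (fun x : plane R => cross u (x - D)).
  by apply: continuous_measurable_plane => //; exact: cross_cont.
have -> : [set x : plane R | `|cross u (x - D)| <= k] =
    setT `&` (fun x : plane R => cross u (x - D)) @^-1` `[- k, k]%classic.
  by apply/seteqP; split => x /=; rewrite in_itv/= ler_norml// => -[].
by apply: mf.
Qed.

(** The sections are taken across the larger coordinate of [u], the one equal to its max norm, so
    that the width [k * |u|] in terms of [cross] becomes a section of length [2 * k]. *)
Lemma strip_area (A : set (plane R)) (u D : plane R) (k L a b : R) :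
  measurable A -> u != 0 -> 0 <= k -> 0 <= L ->
  (forall x, A x -> [/\ a <= x.1 <= a + L, b <= x.2 <= b + L & `|cross u (x - D)| <= k * `|u|]) ->
  (area R A <= (2 * k * L)%:E)%E.
Proof.
move=> mA u0 k0 L0 hA.
have N0 : 0 < `|u| by rewrite normr_gt0.
have aL : a <= a + L by rewrite lerDl.
have bL : b <= b + L by rewrite lerDl.
have k20 : 0 <= 2 * k by rewrite mulr_ge0.
have [uE|uE] : `|u| = `|u.1| \/ `|u| = `|u.2|.
  by rewrite prod_normE /Num.max/=; case: ifP; [right|left].
- have u1 : u.1 != 0 by rewrite -normr_eq0 -uE gt_eqF.
  have := @area_le_xsection _ A a (a + L) (2 * k) mA aL k20.
  have -> : (a + L - a) * (2 * k) = 2 * k * L by ring.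
  apply; first by move=> x /hA[].
  move=> t; exists (D.2 + u.2 * (t - D.1) / u.1 - k) => y /hA[_ _].
  rewrite uE /cross /= => h.
  have : `|y - (D.2 + u.2 * (t - D.1) / u.1)| <= k.
    have e : u.1 * (y - D.2) - u.2 * (t - D.1) = u.1 * (y - (D.2 + u.2 * (t - D.1) / u.1)).
      by field.
    by move: h; rewrite e normrM mulrC ler_pM2r// normr_gt0.
  by rewrite ler_norml => /andP[? ?]; apply/andP; split; lra.
have u2 : u.2 != 0 by rewrite -normr_eq0 -uE gt_eqF.
have := @area_le_ysection _ A b (b + L) (2 * k) mA bL k20.
have -> : (b + L - b) * (2 * k) = 2 * k * L by ring.
apply; first by move=> x /hA[].
move=> t; exists (D.1 + u.1 * (t - D.2) / u.2 - k) => y /hA[_ _].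
rewrite uE /cross /= => h.
have : `|y - (D.1 + u.1 * (t - D.2) / u.2)| <= k.
  have e : u.1 * (t - D.2) - u.2 * (y - D.1) = - u.2 * (y - (D.1 + u.1 * (t - D.2) / u.2)).
    by field.
  by move: h; rewrite e normrM normrN mulrC ler_pM2r// normr_gt0.
by rewrite ler_norml => /andP[? ?]; apply/andP; split; lra.
Qed.

(** Density of [O] at [x] makes the filter of neighbourhoods within [O] proper, so that [lim] is a
    true limit and not a default value. *)
Lemma trace_value (O : set (plane R)) (u p : vfield R) (x : plane R) (U : set (plane R)) :
  (forall W : set (plane R), nbhs x W -> exists2 y, W y & O y) -> nbhs x U ->
  (forall y, U y -> O y -> u y = p y) -> {for x, continuous p} ->
  (lim ((u y).1 @[y --> within O (nbhs x)]), lim ((u y).2 @[y --> within O (nbhs x)])) = p x.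
Proof.
move=> dense Ux up cp.
have PF : ProperFilter (within O (nbhs x)).
  apply: Build_ProperFilter_ex => P; rewrite /within/= => /dense[y Py Oy].
  by exists y; exact: Py.
have key (f : plane R -> R) : {for x, continuous (f \o p)} ->
    lim (f (u y) @[y --> within O (nbhs x)]) = f (p x).
  move=> cf; apply/cvg_lim; first exact: Rhausdorff.
  apply: (@cvg_trans _ (f (p y) @[y --> within O (nbhs x)])).
    apply: near_eq_cvg; rewrite /prop_near1 /within/=.
    by apply: filterS Ux => y Uy Oy; rewrite up.
  apply: cvg_within_filter; exact: cf.
rewrite [RHS]surjective_pairing; congr pair; apply: key.
  by apply: continuous_comp; [exact: cp|exact: cvg_fst].
by apply: continuous_comp; [exact: cp|exact: cvg_snd].
Qed.

Lemma bary_unique V (u v : plane R) (a b a' b' : R) : cross u v != 0 ->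
  V + a *: u + b *: v = V + a' *: u + b' *: v -> a = a' /\ b = b'.
Proof.
move=> X0 e.
have e1 : cross (V + a *: u + b *: v - V) v = cross (V + a' *: u + b' *: v - V) v by rewrite e.
have e2 : cross u (V + a *: u + b *: v - V) = cross u (V + a' *: u + b' *: v - V) by rewrite e.
have f1 (p q : R) : cross (V + p *: u + q *: v - V) v = p * cross u v.
  by rewrite /cross /= /GRing.scale/=; ring.
have f2 (p q : R) : cross u (V + p *: u + q *: v - V) = q * cross u v.
  by rewrite /cross /= /GRing.scale/=; ring.
by move: e1 e2; rewrite !f1 !f2 => /(mulIf X0) -> /(mulIf X0) ->.
Qed.

Lemma tri_vertex_ctri c s1 s2 h X : is_sign s1 -> is_sign s2 -> 0 < h ->
  X \in tri_vertices c s1 s2 h -> ctri c s1 s2 h X.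
Proof.
move=> hs1 hs2 h0.
have q1 := sign_sqr hs1; have q2 := sign_sqr hs2.
have a1 : s1 * (c.1 + s1 * h - c.1) = h by rewrite addrC addKr mulrA q1 mul1r.
have a2 : s2 * (c.2 + s2 * h - c.2) = h by rewrite addrC addKr mulrA q2 mul1r.
have h0' := ltW h0.
by rewrite !inE => /or3P[] /eqP ->; split; rewrite /leg1 /leg2 /= ?subrr ?mulr0 ?a1 ?a2 ?addr0 ?add0r.
Qed.

Lemma ctri_convex c s1 s2 h X Y t : ctri c s1 s2 h X -> ctri c s1 s2 h Y -> 0 <= t <= 1 ->
  ctri c s1 s2 h (X + t *: (Y - X)).
Proof.
move=> [a1 a2 a3] [g1 g2 g3] /andP[t0 t1].
have E1 : leg1 s1 c (X + t *: (Y - X)) = (1 - t) * leg1 s1 c X + t * leg1 s1 c Y.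
  by rewrite /leg1 /= /GRing.scale/=; ring.
have E2 : leg2 s2 c (X + t *: (Y - X)) = (1 - t) * leg2 s2 c X + t * leg2 s2 c Y.
  by rewrite /leg2 /= /GRing.scale/=; ring.
have t1' : 0 <= 1 - t by lra.
have := ler_wpM2l t1' a3; have := ler_wpM2l t0 g3.
by split; rewrite ?E1 ?E2; [apply: addr_ge0; exact: mulr_ge0|apply: addr_ge0; exact: mulr_ge0|lra].
Qed.

Lemma midpoint_seg (X Y : plane R) : midpoint X Y = X + 2^-1 *: (Y - X).
Proof.
by apply: injective_projections; rewrite /midpoint /= /GRing.scale/=; field.
Qed.

Lemma tri_vertices_uniq c s1 s2 h : is_sign s1 -> is_sign s2 -> 0 < h -> uniq (tri_vertices c s1 s2 h).
Proof.
move=> hs1 hs2 h0.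
have sn s : is_sign s -> s * h != 0.
  by move=> hs; rewrite mulf_neq0 ?(lt0r_neq0 h0)//; case: hs => ->; rewrite ?oppr_eq0 oner_eq0.
have n1 := sn _ hs1; have n2 := sn _ hs2.
have ne (k q : R) : q != 0 -> (k == k + q) = false.
  by move=> q0; rewrite eq_sym -subr_eq0 addrC addKr; apply/negbTE.
case: c => c1 c2; rewrite /tri_vertices /= !inE !negb_or !xpair_eqE /= ?andbT.
by rewrite !ne// !andbF.
Qed.

End RightTriangle.

(** * Functions bounded off a null set *)

Section EssBounded.
Context (R : realType).
Implicit Types (O N : set (plane R)) (f g : plane R -> R).

(* Almost everywhere on [O] equal to a bounded measurable function.  The function
   itself may fail to be measurable, as happens to a classical curl. *)
Definition ess_bounded O f := exists g N K,
  [/\ measurable N, area R N = 0%E, measurable_fun setT g, forall x, `|g x| <= K &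
      forall x, O x -> ~ N x -> f x = g x].

Lemma ess_bounded_ext O N f g : measurable N -> area R N = 0%E ->
  (forall x, O x -> ~ N x -> f x = g x) -> ess_bounded O g -> ess_bounded O f.
Proof.
move=> mN N0 fg [k [N' [K [mN' N'0 mk kK gk]]]].
exists k, (N `|` N'), K; split => //.
- exact: measurableU.
- by rewrite measureU0.
- by move=> x Ox /not_orP[n1 n2]; rewrite fg ?gk.
Qed.

Lemma ess_bounded_cst O (k : R) : ess_bounded O (fun=> k).
Proof. by exists (fun=> k), set0, `|k|; split => //; exact: measure0. Qed.

Lemma ess_boundedM O f g : ess_bounded O f -> ess_bounded O g ->
  ess_bounded O (fun x => f x * g x).
Proof.
move=> [f' [N [K [mN N0 mf fK ff]]]] [g' [N' [K' [mN' N'0 mg gK gg]]]].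
exists (fun x => f' x * g' x), (N `|` N'), (K * K'); split => //.
- exact: measurableU.
- by rewrite measureU0.
- exact: measurable_funM.
- by move=> x; rewrite normrM ler_pM.
- by move=> x Ox /not_orP[n1 n2]; rewrite ff ?gg.
Qed.

Lemma ess_boundedD O f g : ess_bounded O f -> ess_bounded O g ->
  ess_bounded O (fun x => f x + g x).
Proof.
move=> [f' [N [K [mN N0 mf fK ff]]]] [g' [N' [K' [mN' N'0 mg gK gg]]]].
exists (fun x => f' x + g' x), (N `|` N'), (K + K'); split => //.
- exact: measurableU.
- by rewrite measureU0.
- exact: measurable_funD.
- by move=> x; rewrite (le_trans (ler_normD _ _))// lerD.
- by move=> x Ox /not_orP[n1 n2]; rewrite ff ?gg.
Qed.

Lemma ess_bounded_indic O A : measurable A -> ess_bounded O (\1_A : plane R -> R).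
Proof.
move=> mA; exists (\1_A : plane R -> R), set0, 1; split => //.
by move=> x; rewrite indicE; case: (_ \in _); rewrite ?normr1 ?normr0.
Qed.

Lemma ess_bounded_continuous O f (K : R) : measurable O -> continuous f ->
  (forall x, O x -> `|f x| <= K) -> ess_bounded O f.
Proof.
move=> mO cf fK; exists (f \_ O), set0, (Num.max 0 K); split => //.
- rewrite (_ : f \_ O = fun x => f x * \1_O x).
    by apply: measurable_funM; [exact: continuous_measurable_plane|exact: measurable_indic].
  by apply/funext => x; rewrite patchE indicE; case: (_ \in _); rewrite ?mulr1 ?mulr0.
- move=> x; rewrite patchE; case: ifPn => [/set_mem Ox|_].
    by rewrite (le_trans (fK _ Ox))// le_max lexx orbT.
  by rewrite normr0 le_max lexx.
- by move=> x Ox _; rewrite patchE mem_set.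
Qed.

Definition fin_area O := measurable O /\ (area R O < +oo)%E.

Lemma ess_bounded_rep O f : fin_area O -> ess_bounded O f -> exists g N,
  [/\ measurable N, area R N = 0%E, (area R).-integrable O (EFin \o g),
      Rintegral (area R) O f = Rintegral (area R) O g &
      forall x, O x -> ~ N x -> f x = g x].
Proof.
move=> [mO Of] [g [N [K [mN N0 mg gK fg]]]]; exists g, N; split => //.
  apply: (@bounded_integrable _ _ _ (area R) O g K) => //; exact: measurable_funTS.
exact: (@Rintegral_ext_off_null _ _ _ (area R) O N).
Qed.

Lemma ess_Rintegral_le O N f g : fin_area O -> ess_bounded O f -> ess_bounded O g ->
  measurable N -> area R N = 0%E ->
  (forall x, O x -> ~ N x -> f x <= g x) ->
  Rintegral (area R) O f <= Rintegral (area R) O g.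
Proof.
move=> fO bf bg mN N0 fg.
have [f' [Nf [mNf Nf0 if' -> ff]]] := ess_bounded_rep fO bf.
have [g' [Ng [mNg Ng0 ig' -> gg]]] := ess_bounded_rep fO bg.
case: fO => mO Of.
pose M := N `|` (Nf `|` Ng).
have mM : measurable M by apply: measurableU => //; exact: measurableU.
have M0 : area R M = 0%E by rewrite measureU0 ?measureU0//; exact: measurableU.
rewrite -subr_ge0 -RintegralB//.
(* The measurable representatives are ordered only off a null set; there the difference equals its
   absolute value, which is nonnegative everywhere. *)
have -> : Rintegral (area R) O (fun x => g' x - f' x) =
    Rintegral (area R) O (fun x => `|g' x - f' x|).
  apply: (@Rintegral_ext_off_null _ _ _ (area R) O M) => // x Ox /not_orP[n /not_orP[nf ng]].
  by rewrite ger0_norm// subr_ge0 -ff// -gg// fg.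
exact: Rintegral_ge0.
Qed.

Lemma ess_RintegralD O f g : fin_area O -> ess_bounded O f -> ess_bounded O g ->
  Rintegral (area R) O (fun x => f x + g x) =
  Rintegral (area R) O f + Rintegral (area R) O g.
Proof.
move=> fO bf bg.
have [f' [Nf [mNf Nf0 if' -> ff]]] := ess_bounded_rep fO bf.
have [g' [Ng [mNg Ng0 ig' -> gg]]] := ess_bounded_rep fO bg.
case: fO => mO Of; rewrite -RintegralD//.
apply: (@Rintegral_ext_off_null _ _ _ (area R) O (Nf `|` Ng)).
- exact: measurableU.
- by rewrite measureU0.
- by move=> x Ox /not_orP[? ?]; rewrite ff ?gg.
Qed.

Lemma ess_RintegralZ O f (k : R) : fin_area O -> ess_bounded O f ->
  Rintegral (area R) O (fun x => k * f x) = k * Rintegral (area R) O f.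
Proof.
move=> fO bf.
have [f' [Nf [mNf Nf0 if' -> ff]]] := ess_bounded_rep fO bf.
case: fO => mO Of; rewrite -RintegralZl//.
by apply: (@Rintegral_ext_off_null _ _ _ (area R) O Nf) => // x Ox Nx; rewrite ff.
Qed.

Lemma Rintegral_indic O A : fin_area O -> measurable A -> A `<=` O ->
  Rintegral (area R) O (\1_A : plane R -> R) = fine (area R A).
Proof.
move=> [mO Of] mA AO; rewrite /Rintegral integral_indic//; congr (fine (_ _)).
exact/setIidl.
Qed.

Definition total_area O := fine (area R O).

Lemma Rintegral_const O (k : R) : fin_area O -> Rintegral (area R) O (fun=> k) = k * total_area O.
Proof. by move=> [mO _]; rewrite Rintegral_cst. Qed.

Lemma ess_boundedZ O f (k : R) : ess_bounded O f -> ess_bounded O (fun x => k * f x).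
Proof. by move=> bf; apply: ess_boundedM => //; exact: ess_bounded_cst. Qed.

(** The integrand is compared with a step function: one value on each piece of the cut triangle, a
    loss [kz] on the strip [Z] where the coefficient may be the wrong one, and a uniform loss [kr]
    from freezing the fields. *)
Lemma Rintegral_two_pieces_ge O N A B Z f (ka kb kz kr : R) :
  fin_area O -> ess_bounded O f -> measurable N -> area R N = 0%E ->
  measurable A -> measurable B -> measurable Z -> A `<=` O -> B `<=` O -> Z `<=` O ->
  (forall x, O x -> ~ N x -> A x \/ B x) -> (forall x, A x -> B x -> False) -> 0 <= kz ->
  (forall x, A x -> ka - kz * \1_Z x - kr <= f x) ->
  (forall x, B x -> kb - kz * \1_Z x - kr <= f x) ->
  ka * total_area A + kb * total_area B - kz * total_area Z - kr * total_area O <=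
  Rintegral (area R) O f.
Proof.
move=> fO bf mN N0 mA mB mZ AO BO ZO AB dis kz0 fA fB.
have bA := ess_boundedZ ka (ess_bounded_indic O mA).
have bB := ess_boundedZ kb (ess_bounded_indic O mB).
have bZ := ess_boundedZ (- kz) (ess_bounded_indic O mZ).
have bR := ess_bounded_cst O (- kr).
have bAB := ess_boundedD bA bB.
have bABZ := ess_boundedD bAB bZ.
have ball_ := ess_boundedD bABZ bR.
have -> : ka * total_area A + kb * total_area B - kz * total_area Z - kr * total_area O =
    Rintegral (area R) O (fun x => ka * \1_A x + kb * \1_B x + - kz * \1_Z x + - kr).
  rewrite (ess_RintegralD fO bABZ bR) (ess_RintegralD fO bAB bZ) (ess_RintegralD fO bA bB).
  rewrite !ess_RintegralZ//; do ?exact: ess_bounded_indic.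
  by rewrite !Rintegral_indic// Rintegral_const// !mulNr.
apply: (ess_Rintegral_le fO ball_ bf mN N0) => x Ox Nx.
rewrite !mulNr; case: (AB _ Ox Nx) => [Ax|Bx].
  have -> : (\1_A x : R) = 1 by rewrite indicE mem_set.
  have -> : (\1_B x : R) = 0 by rewrite indicE memNset// => /(dis _ Ax).
  by rewrite mulr1 mulr0 addr0; exact: fA.
have -> : (\1_B x : R) = 1 by rewrite indicE mem_set.
have -> : (\1_A x : R) = 0 by rewrite indicE memNset// => /dis/(_ Bx).
by rewrite mulr1 mulr0 add0r; exact: fB.
Qed.

Lemma ess_Rintegral_le_cst O N f (k : R) : fin_area O -> ess_bounded O f ->
  measurable N -> area R N = 0%E ->
  (forall x, O x -> ~ N x -> f x <= k) ->
  Rintegral (area R) O f <= k * total_area O.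
Proof.
move=> fO bf mN N0 fk; rewrite -Rintegral_const//.
by apply: (ess_Rintegral_le fO bf _ mN N0) => //; exact: ess_bounded_cst.
Qed.

Lemma ess_Rintegral_ge_cst O N f (k : R) : fin_area O -> ess_bounded O f ->
  measurable N -> area R N = 0%E ->
  (forall x, O x -> ~ N x -> k <= f x) ->
  k * total_area O <= Rintegral (area R) O f.
Proof.
move=> fO bf mN N0 fk; rewrite -Rintegral_const//.
by apply: (ess_Rintegral_le fO _ bf mN N0) => //; exact: ess_bounded_cst.
Qed.

Definition ndf (a : plane R) (b : R) : vfield R := fun x => a + b *: (x.2, - x.1).

Lemma ndf_center a b X : ndf a b = fun x => ndf a b X + b *: perp (x - X).
Proof.
apply/funext => x; apply: injective_projections; rewrite /ndf /perp /= /GRing.scale/=; ring.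
Qed.

Lemma ndf_cont a b : continuous (ndf a b).
Proof.
have c1 : continuous (fun x : plane R => (ndf a b x).1).
  move=> x; apply: cvgD; first exact: cvg_cst.
  by apply: cvgM; [exact: cvg_cst|exact: cvg_snd].
have c2 : continuous (fun x : plane R => (ndf a b x).2).
  move=> x; apply: cvgD; first exact: cvg_cst.
  by apply: cvgM; [exact: cvg_cst|apply: cvgN; exact: cvg_fst].
by move=> x; exact: (cvg_pair (c1 x) (c2 x)).
Qed.

Lemma derive1_affine (k l t : R) : derive1 (fun s => k + l * s) t = l.
Proof.
rewrite derive1E; apply: derive_val; apply: is_derive_eq.
by rewrite /GRing.scale/=; ring.
Qed.

Lemma curl_ndf a b x : curl (ndf a b) x = - 2 * b.
Proof.
rewrite /curl /dx1 /dx2 /ndf /= /GRing.scale/=.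
have -> : (fun t => a.2 + b * - t) = (fun t => a.2 + - b * t).
  by apply/funext => t; rewrite mulrN mulNr.
by rewrite !derive1_affine; ring.
Qed.

(** The classical curl depends only on the germ of the field, so it can be computed inside each open
    piece whatever the values on the piece boundaries. *)
Lemma curl_near (u v : vfield R) (x : plane R) :
  nbhs x [set y | u y = v y] -> curl u x = curl v x.
Proof.
move=> h; rewrite /curl /dx1 /dx2.
have p1 : (t, x.2) @[t --> x.1] --> ((x.1, x.2) : plane R).
  exact: (cvg_pair (@cvg_id _ (nbhs x.1)) (@cvg_cst _ x.2 _ (nbhs x.1) _)).
have p2 : (x.1, t) @[t --> x.2] --> ((x.1, x.2) : plane R).
  exact: (cvg_pair (@cvg_cst _ x.1 _ (nbhs x.2) _) (@cvg_id _ (nbhs x.2))).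
move: h; rewrite {1}(surjective_pairing x) => h.
have h1 : nbhs x.1 [set t | u (t, x.2) = v (t, x.2)] by exact: (p1 _ h).
have h2 : nbhs x.2 [set t | u (x.1, t) = v (x.1, t)] by exact: (p2 _ h).
rewrite !derive1E; congr (_ - _).
  apply: near_eq_derive.
  by apply: filterS h1 => t /= ->.
apply: near_eq_derive.
by apply: filterS h2 => t /= ->.
Qed.

Lemma ndf_bounded O a b (K : R) : measurable O -> (forall x, O x -> `|x| <= K) ->
  ess_bounded O (fun x => (ndf a b x).1) /\ ess_bounded O (fun x => (ndf a b x).2).
Proof.
move=> mO OK; split.
  apply: (@ess_bounded_continuous _ _ (`|a.1| + `|b| * K)) => //.
    by move=> x; apply: cvg_comp; [exact: ndf_cont|exact: cvg_fst].
  move=> x /OK; rewrite prod_normE ge_max => /andP[_ x2].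
  by rewrite /ndf /= /GRing.scale/= (le_trans (ler_normD _ _))// lerD2l normrM ler_wpM2l.
apply: (@ess_bounded_continuous _ _ (`|a.2| + `|b| * K)) => //.
  by move=> x; apply: cvg_comp; [exact: ndf_cont|exact: cvg_snd].
move=> x /OK; rewrite prod_normE ge_max => /andP[x1 _].
by rewrite /ndf /= /GRing.scale/= (le_trans (ler_normD _ _))// lerD2l normrM normrN ler_wpM2l.
Qed.

Lemma two_pieces_bounded O A B N (f g k : plane R -> R) : measurable A -> measurable N ->
  area R N = 0%E -> (forall x, O x -> ~ N x -> A x \/ B x) ->
  (forall x, A x -> f x = g x) -> (forall x, B x -> f x = k x) ->
  ess_bounded O g -> ess_bounded O k -> ess_bounded O f.
Proof.
move=> mA mN N0 AB fA fB bg bk.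
have bi := ess_bounded_indic O mA.
have bc := ess_bounded_cst O (1 : R).
have := ess_boundedD (ess_boundedM bi bg) (ess_boundedM (ess_boundedD bc (ess_boundedZ (- 1) bi)) bk).
apply: (ess_bounded_ext mN N0) => x Ox Nx; rewrite indicE.
have [/set_mem Ax|Ax] := boolP (x \in A).
  by rewrite fA//= mul1r mulr1 subrr mul0r addr0.
case: (AB _ Ox Nx) => [h|Bx]; first by move/negP: Ax; case; exact: mem_set.
by rewrite fB//= mul0r mulr0 addr0 mul1r add0r.
Qed.

Definition field_bounded O (u : vfield R) :=
  [/\ ess_bounded O (fun x => (u x).1), ess_bounded O (fun x => (u x).2) & ess_bounded O (curl u)].

Lemma two_pieces_field O A B N (u : vfield R) ap bp aq bq (K : R) :
  measurable O -> (forall x, O x -> `|x| <= K) -> open A -> open B -> measurable N ->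
  area R N = 0%E -> (forall x, O x -> ~ N x -> A x \/ B x) ->
  (forall x, A x -> u x = ndf ap bp x) -> (forall x, B x -> u x = ndf aq bq x) ->
  [/\ field_bounded O u, forall x, A x -> curl u x = - 2 * bp &
      forall x, B x -> curl u x = - 2 * bq].
Proof.
move=> mO OK oA oB mN N0 AB uA uB.
have mA := open_measurable_plane oA.
have cA x : A x -> curl u x = - 2 * bp.
  move=> Ax; rewrite -(curl_ndf ap bp x); apply: curl_near.
  by apply: filterS (open_nbhs_nbhs (conj oA Ax)).
have cB x : B x -> curl u x = - 2 * bq.
  move=> Bx; rewrite -(curl_ndf aq bq x); apply: curl_near.
  by apply: filterS (open_nbhs_nbhs (conj oB Bx)).
have [p1 p2] := ndf_bounded ap bp mO OK; have [q1 q2] := ndf_bounded aq bq mO OK.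
split => //; split.
- by apply: (two_pieces_bounded mA mN N0 AB _ _ p1 q1) => x => [/uA|/uB] ->.
- by apply: (two_pieces_bounded mA mN N0 AB _ _ p2 q2) => x => [/uA|/uB] ->.
- by apply: (two_pieces_bounded mA mN N0 AB cA cB); exact: ess_bounded_cst.
Qed.

Lemma ess_bounded_dot O (u v : vfield R) : field_bounded O u -> field_bounded O v ->
  ess_bounded O (fun x => dot (u x) (v x)).
Proof. by move=> [u1 u2 _] [v1 v2 _]; apply: ess_boundedD; apply: ess_boundedM. Qed.

Lemma piecewise_bounded (S : interface_data R) (c : side -> R) O :
  open (subdomain S minus) -> ess_bounded O (piecewise S c).
Proof.
move=> o; have mS := open_measurable_plane o.
apply: (@two_pieces_bounded O (subdomain S minus) (~` subdomain S minus) set0 _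
  (fun=> c minus) (fun=> c plus)) => //.
- by move=> x _ _; have [?|?] := pselect (subdomain S minus x); [left|right].
- by move=> x h; rewrite /piecewise mem_set.
- by move=> x h; rewrite /piecewise memNset.
- exact: ess_bounded_cst.
- exact: ess_bounded_cst.
Qed.

Lemma piecewise_on (S : interface_data R) (c : side -> R) s x :
  separates (Omega S) (Gamma S) (subdomain S) -> subdomain S s x -> piecewise S c x = c s.
Proof.
move=> [_ dis _]; rewrite /piecewise; case: s => sx; first by rewrite mem_set.
rewrite memNset// => h; have : (subdomain S minus `&` subdomain S plus) x by [].
by rewrite dis.
Qed.

Lemma piecewise_range (S : interface_data R) (c : side -> R) x :
  Num.min (c minus) (c plus) <= piecewise S c x <= Num.max (c minus) (c plus).
Proof.
rewrite /piecewise ge_min le_max; case: ifP => _; rewrite lexx ?orbT//=.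
Qed.

End EssBounded.

(** * Stability on one element *)

Section Local.
Context (R : realType) (S : interface_data R).
Hypothesis hS : interface_setting S.
Implicit Types (c V W D E : plane R).

Definition bmin := Num.min (be S minus) (be S plus).
Definition bmax := Num.max (be S minus) (be S plus).
Definition mmin := Num.min (mu S minus) (mu S plus).
Definition mmax := Num.max (mu S minus) (mu S plus).

Definition energy (O : set (plane R)) (u v : vfield R) :=
  Rintegral (area R) O (fun x => (piecewise S (mu S) x)^-1 * (curl u x * curl v x)) +
  Rintegral (area R) O (fun x => piecewise S (be S) x * dot (u x) (v x)).

Definition norm2 (O : set (plane R)) (u : vfield R) :=
  Rintegral (area R) O (fun x => dot (u x) (u x)) +
  Rintegral (area R) O (fun x => curl u x ^+ 2).

(* [m] measures the size of [u]; [w] is the local test function. *)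
Definition local_stable (O : set (plane R)) (h : R) (u w : vfield R) (c0 : R) :=
  field_bounded O u /\ field_bounded O w /\
  exists m, [/\ 0 <= m, c0 * m * h ^+ 2 <= energy O u w,
    norm2 O u <= 100%:R * m * h ^+ 2 & norm2 O w <= 100%:R * m * h ^+ 2].

Let sep : separates (Omega S) (Gamma S) (subdomain S).
Proof. by case: hS. Qed.

Let opm : open (subdomain S minus).
Proof. by case: sep => /(_ minus) []. Qed.

Let b0 s : 0 < be S s. Proof. by case: hS => _ _ _ _ /(_ s) []. Qed.
Let m0 s : 0 < mu S s. Proof. by case: hS => _ _ _ _ /(_ s) []. Qed.

Lemma bmin0 : 0 < bmin. Proof. by rewrite lt_min !b0. Qed.
Lemma bmax0 : 0 < bmax. Proof. by rewrite lt_max !b0. Qed.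
Lemma mmin0 : 0 < mmin. Proof. by rewrite lt_min !m0. Qed.
Lemma mmax0 : 0 < mmax. Proof. by rewrite lt_max !m0. Qed.
Lemma be_range s : bmin <= be S s <= bmax.
Proof. by rewrite /bmin /bmax ge_min le_max; case: s; rewrite lexx ?orbT. Qed.
Lemma mu_range s : mmin <= mu S s <= mmax.
Proof. by rewrite /mmin /mmax ge_min le_max; case: s; rewrite lexx ?orbT. Qed.

Lemma inv_mu_bounded O : ess_bounded O (fun x => (piecewise S (mu S) x)^-1).
Proof.
have -> : (fun x => (piecewise S (mu S) x)^-1) = piecewise S (fun s => (mu S s)^-1).
  by apply/funext => x; rewrite /piecewise; case: ifP.
exact: piecewise_bounded.
Qed.

Lemma energy_terms O u w : field_bounded O u -> field_bounded O w ->
  ess_bounded O (fun x => (piecewise S (mu S) x)^-1 * (curl u x * curl w x)) /\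
  ess_bounded O (fun x => piecewise S (be S) x * dot (u x) (w x)).
Proof.
move=> bu bw; split; apply: ess_boundedM.
- exact: inv_mu_bounded.
- by case: bu bw => _ _ ? [_ _ ?]; apply: ess_boundedM.
- exact: piecewise_bounded.
- exact: ess_bounded_dot.
Qed.

Lemma norm2_le O N u (k : R) : fin_area O -> field_bounded O u ->
  measurable N -> area R N = 0%E ->
  (forall x, O x -> ~ N x -> dot (u x) (u x) + curl u x ^+ 2 <= k) ->
  norm2 O u <= k * total_area O.
Proof.
move=> fO bu mN N0 hk; rewrite /norm2.
have b1 := ess_bounded_dot bu bu.
have b2 : ess_bounded O (fun x => curl u x ^+ 2) by case: bu => _ _ ?; apply: ess_boundedM.
by rewrite -ess_RintegralD//; apply: (ess_Rintegral_le_cst fO (ess_boundedD b1 b2) mN N0).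
Qed.

Lemma perp_norm (x : plane R) : `|perp x| = `|x|.
Proof. by rewrite !prod_normE /= normrN maxC. Qed.

Lemma otri_area c s1 s2 h : is_sign s1 -> is_sign s2 -> 0 < h ->
  fin_area (otri c s1 s2 h) /\ total_area (otri c s1 s2 h) = h ^+ 2 / 2.
Proof.
move=> hs1 hs2 h0; split.
  split; first exact: otri_measurable.
  apply: (@area_fin_box _ _ (c.1 - h) (c.1 + h) (c.2 - h) (c.2 + h)).
    exact: otri_measurable.
  move=> x [a b d]; move: a b d; rewrite /leg1 /leg2.
  by case: hs1 => ->; case: hs2 => -> *; split; apply/andP; split; lra.
pose A : plane R := (c.1 + s1 * h, c.2); pose B : plane R := (c.1, c.2 + s2 * h).
have ar : arranged c s1 s2 h c A B.
  have := tri_vertices_uniq c hs1 hs2 h0; rewrite /= !inE negb_or => /andP[/andP[? ?] /andP[? _]].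
  by split; rewrite ?inE ?eqxx ?orbT.
have := area_corner_arranged hs1 hs2 h0 ar ltr01 ltr01.
rewrite !mul1r !scale1r => <-; congr (fine (area R _)).
have [_ X _] := arranged_gram hs1 hs2 h0 ar.
have X0 : cross (A - c) (B - c) != 0 by rewrite -normr_eq0 X gt_eqF// exprn_gt0.
apply/seteqP; split => x.
  have [a [b [xE o _]]] := arranged_bary x hs1 hs2 h0 ar.
  by move=> /o[? ? ?]; exists a, b.
move=> [a [b [a0 b0' ab xE]]].
have [a' [b' [xE' o _]]] := arranged_bary x hs1 hs2 h0 ar.
have [ea eb] := bary_unique X0 (etrans (esym xE') xE).
by apply/o; rewrite ea eb.
Qed.

Lemma otri_norm c s1 s2 h x : is_sign s1 -> is_sign s2 -> otri c s1 s2 h x -> `|x| <= `|c| + h.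
Proof.
move=> hs1 hs2 Ox.
have cc : ctri c s1 s2 h c.
  by case: Ox => a b d; split; rewrite /leg1 /leg2 !subrr !mulr0 ?addr0//; lra.
have -> : x = c + (x - c) by rewrite addrC subrK.
rewrite (le_trans (ler_normD _ _))// lerD2l.
exact: (ctri_dist hs1 hs2 (otri_ctri Ox) cc).
Qed.

Definition c_single := Num.min (bmin / 2) (2 / mmax) / 4.

(** The test field is the Nedelec field that represents [u], so the energy is a sum of squares. The
    mass term controls the value [P] at the corner up to an error [2 * bmin * h ^+ 2 * b ^+ 2], and
    the condition on [h] lets half of the curl term absorb it. *)
Lemma local_single c s1 s2 h u (G N : set (plane R)) a b :
  is_sign s1 -> is_sign s2 -> 0 < h -> h <= 1 -> bmin * h ^+ 2 <= 1 / mmax ->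
  open G -> measurable N -> area R N = 0%E ->
  (forall x, otri c s1 s2 h x -> ~ N x -> G x) ->
  (forall x, G x -> u x = ndf a b x) ->
  local_stable (otri c s1 s2 h) h u (ndf a b) c_single.
Proof.
move=> hs1 hs2 h0 h1 hh oG mN N0 OG uG.
set O := otri c s1 s2 h.
have [fO aO] := otri_area c hs1 hs2 h0.
have mO : measurable O by case: fO.
have OK x : O x -> `|x| <= `|c| + h by exact: otri_norm.
have OG' x : O x -> ~ N x -> G x \/ G x by move=> Ox Nx; left; exact: OG.
have [bu cu _] := two_pieces_field mO OK oG oG mN N0 OG' uG uG.
have oT : open (setT : set (plane R)) := openT.
have [bw cw _] := @two_pieces_field _ O setT setT N (ndf a b) a b a b _ mO OK oT oT mN N0
  (fun x _ _ => or_introl I) (fun x _ => erefl) (fun x _ => erefl).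
split => //; split => //.
pose P := ndf a b c; pose n := `|P| + `|b|.
exists (n ^+ 2).
have n0 : 0 <= n by rewrite addr_ge0.
have PE x : ndf a b x = P + b *: perp (x - c) by rewrite (ndf_center a b c).
have xc x : O x -> `|perp (x - c)| <= h.
  move=> Ox; rewrite perp_norm; apply: (ctri_dist hs1 hs2 (otri_ctri Ox)).
  by split; rewrite /leg1 /leg2 !subrr !mulr0 ?addr0// ltW.
have up x : O x -> dot (ndf a b x) (ndf a b x) + curl (ndf a b) x ^+ 2 <= 6 * n ^+ 2.
  move=> Ox; rewrite curl_ndf.
  have h2 : `|ndf a b x| <= n.
    rewrite PE (le_trans (ler_normD _ _))// lerD2l normrZ -[leRHS]mulr1 ler_wpM2l//.
    exact: le_trans (xc _ Ox) h1.
  have /andP[_ d1] := dot_ge_norm (ndf a b x).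
  have d2 : `|ndf a b x| ^+ 2 <= n ^+ 2 by rewrite ler_pXn2r ?nnegrE.
  have d3 : b ^+ 2 <= n ^+ 2 by rewrite -real_normK ?num_real// ler_pXn2r ?nnegrE// lerDr.
  by rewrite exprMn; lra.
have h20 : 0 < h ^+ 2 by rewrite exprn_gt0.
have nh : 0 <= n ^+ 2 * h ^+ 2 by rewrite mulr_ge0// ?sqr_ge0 ?ltW.
split; first exact: sqr_ge0.
- rewrite /energy; have [t1 t2] := energy_terms bu bw.
  rewrite -ess_RintegralD//.
  have := ess_Rintegral_ge_cst (k := Num.min (bmin / 2) (2 / mmax) * (n ^+ 2 / 2)) fO (ess_boundedD t1 t2) mN N0.
  move=> H; apply: le_trans (H _) => {H}.
    by rewrite aO /c_single le_eqVlt; apply/orP; left; apply/eqP; field.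
  move=> x Ox Nx; have Gx := OG _ Ox Nx.
  rewrite (cu _ Gx) (cw x I) (uG _ Gx).
  have /andP[B1 _] := piecewise_range S (be S) x.
  have /andP[M1 M2] := piecewise_range S (mu S) x.
  rewrite -/bmin in B1; rewrite -/mmin in M1; rewrite -/mmax in M2.
  have mp : 0 < piecewise S (mu S) x by rewrite (lt_le_trans mmin0).
  have iM : mmax^-1 <= (piecewise S (mu S) x)^-1 by rewrite lef_pV2 ?posrE ?mmax0.
  set mn := Num.min _ _.
  have mn1 : mn <= bmin / 2 by rewrite /mn ge_min lexx.
  have mn2 : mn <= 2 / mmax by rewrite /mn ge_min lexx orbT.
  have mn0 : 0 <= mn by rewrite /mn le_min !divr_ge0// ltW// ?bmin0 ?mmax0.
  have b2 := sqr_ge0 b.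
  have e1 : 4 * b ^+ 2 / mmax <= (piecewise S (mu S) x)^-1 * (-2 * b * (-2 * b)).
    have -> : -2 * b * (-2 * b) = 4 * b ^+ 2 by ring.
    by rewrite mulrC ler_wpM2r// mulr_ge0.
  (* Half of the square of [P] survives the perturbation [b *: y]; the identity below completes the
     square with [P + 2 * b *: y]. *)
  have dp : `|P| ^+ 2 / 2 - 2 * h ^+ 2 * b ^+ 2 <= dot (ndf a b x) (ndf a b x).
    rewrite PE; set y := perp _.
    have /andP[q1 _] := dot_ge_norm P.
    have /andP[_ q2] := dot_ge_norm y.
    have q3 : `|y| ^+ 2 <= h ^+ 2 by rewrite ler_pXn2r ?nnegrE ?xc// ltW.
    have -> : dot (P + b *: y) (P + b *: y) =
      dot P P / 2 - b ^+ 2 * dot y y + dot (P + 2 * b *: y) (P + 2 * b *: y) / 2.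
      by rewrite /dot /= /GRing.scale/=; field.
    have q4 : 0 <= dot (P + 2 * b *: y) (P + 2 * b *: y).
      have /andP[+ _] := dot_ge_norm (P + 2 * b *: y); apply: le_trans.
      exact: sqr_ge0.
    have q5 : b ^+ 2 * dot y y <= b ^+ 2 * (2 * h ^+ 2) by rewrite ler_wpM2l//; lra.
    by lra.
  have dpp : 0 <= dot (ndf a b x) (ndf a b x).
    have /andP[+ _] := dot_ge_norm (ndf a b x); apply: le_trans; exact: sqr_ge0.
  have e2 : bmin * (`|P| ^+ 2 / 2 - 2 * h ^+ 2 * b ^+ 2) <= piecewise S (be S) x * dot (ndf a b x) (ndf a b x).
    apply: (@le_trans _ _ (bmin * dot (ndf a b x) (ndf a b x))).
      by rewrite ler_wpM2l// ltW// bmin0.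
    by rewrite ler_wpM2r.
  apply: le_trans (lerD e1 e2).
  have e3 : bmin * h ^+ 2 * b ^+ 2 <= 1 / mmax * b ^+ 2 by rewrite ler_wpM2r.
  have P2 := sqr_ge0 `|P|.
  have e4 : mn * `|P| ^+ 2 <= bmin / 2 * `|P| ^+ 2 by rewrite ler_wpM2r.
  have e5 : mn * b ^+ 2 <= 2 / mmax * b ^+ 2 by rewrite ler_wpM2r.
  have e6 : n ^+ 2 / 2 <= `|P| ^+ 2 + b ^+ 2.
    by rewrite /n -(real_normK (num_real b)); have := sqr_ge0 (`|P| - `|b|); lra.
  have e7 := ler_wpM2l mn0 e6.
  by lra.
- apply: (le_trans (norm2_le (k := 6 * n ^+ 2) fO bu mN N0 _)).
    by move=> x Ox Nx; have Gx := OG _ Ox Nx; rewrite uG// cu// -(curl_ndf a b x); exact: up.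
  by rewrite aO; lra.
- apply: (le_trans (norm2_le (k := 6 * n ^+ 2) fO bw mN N0 _)).
    by move=> x Ox _; exact: up.
  by rewrite aO; lra.
Qed.

End Local.

(** * Stability on an element crossed by the interface *)

Section CutElement.
Context (R : realType) (S : interface_data R).
Hypothesis hS : interface_setting S.
Implicit Types (c V W D E : plane R).

Let b0 s : 0 < be S s. Proof. by case: hS => _ _ _ _ /(_ s) []. Qed.
Let m0 s : 0 < mu S s. Proof. by case: hS => _ _ _ _ /(_ s) []. Qed.

Definition c_mu := 2 * mmin S ^+ 2 / mmax S ^+ 3.

Lemma c_mu_gt0 : 0 < c_mu.
Proof. by rewrite divr_gt0 ?mulr_gt0 ?exprn_gt0 ?(mmin0 hS) ?(mmax0 hS). Qed.

(* The common value of [b / mu] on the two sides makes the curl term positive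
   whatever coefficient is met. *)
Lemma curl_term_ge (sA sB : side) (bp bq t m : R) : bp / mu S sA = bq / mu S sB ->
  0 <= t <= 1 -> mmin S <= m <= mmax S ->
  c_mu * (bp ^+ 2 + bq ^+ 2) <= m^-1 * ((- 2 * bp) * (- 2 * (t * bp + (1 - t) * bq))).
Proof.
set g := bp / _ => gE /andP[t0 t1] /andP[ml mu'].
have eA : bp = mu S sA * g by rewrite /g; field; rewrite gt_eqF.
have eB : bq = mu S sB * g by rewrite gE; field; rewrite gt_eqF.
have /andP[A1 A2] := mu_range S sA; have /andP[B1 B2] := mu_range S sB.
have n0 := mmin0 hS; have x0 := mmax0 hS.
clearbody g; set n := mmin S in ml A1 B1 n0 *; set x := mmax S in mu' A2 B2 x0 *.
have mp : 0 < m by apply: lt_le_trans ml.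
have g2 := sqr_ge0 g.
have s1 : mu S sA ^+ 2 <= x ^+ 2 by rewrite ler_pXn2r ?nnegrE// ltW.
have s2 : mu S sB ^+ 2 <= x ^+ 2 by rewrite ler_pXn2r ?nnegrE// ltW.
have -> : (- 2 * bp) * (- 2 * (t * bp + (1 - t) * bq)) =
  4 * g ^+ 2 * (mu S sA * (t * mu S sA + (1 - t) * mu S sB)) by rewrite eA eB; ring.
have i1 : n <= t * mu S sA + (1 - t) * mu S sB.
  have := ler_wpM2l t0 A1; have : (1 - t) * n <= (1 - t) * mu S sB by rewrite ler_wpM2l// subr_ge0.
  by lra.
have i2 : n ^+ 2 <= mu S sA * (t * mu S sA + (1 - t) * mu S sB).
  by rewrite expr2; apply: ler_pM => //; exact: ltW.
apply: (@le_trans _ _ (x^-1 * (4 * g ^+ 2 * n ^+ 2))); last first.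
  apply: ler_pM.
  - by rewrite invr_ge0 ltW.
  - by apply: mulr_ge0; [apply: mulr_ge0|exact: sqr_ge0].
  - by rewrite lef_pV2 ?posrE.
  - by rewrite ler_wpM2l// mulr_ge0.
have -> : x^-1 * (4 * g ^+ 2 * n ^+ 2) = c_mu * (2 * x ^+ 2 * g ^+ 2).
  by rewrite /c_mu -/n -/x; field; rewrite gt_eqF.
rewrite ler_wpM2l ?(ltW c_mu_gt0)// eA eB !exprMn.
have := ler_wpM2r g2 s1; have := ler_wpM2r g2 s2; lra.
Qed.

(** Replaces both fields by their values at the midpoint of the chord; 14 collects the three cross
    terms 4, 6 and 4. *)
Lemma dot_perturb (P W y z : plane R) (n h : R) : 0 <= n -> 0 <= h <= 1 -> `|P| <= n -> `|W| <= 3 * n ->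
  `|y| <= n * h -> `|z| <= 2 * n * h ->
  dot P W - 14 * n ^+ 2 * h <= dot (P + y) (W + z).
Proof.
move=> n0 /andP[h0 h1] Pn Wn yn zn.
have -> : dot (P + y) (W + z) = dot P W + (dot P z + dot y W + dot y z) by rewrite /dot /=; ring.
have nh0 : 0 <= n * h by rewrite mulr_ge0.
have b1 : `|dot P z| <= 4 * n ^+ 2 * h.
  apply: le_trans (dot_le_norm _ _) _.
  have : `|P| * `|z| <= n * (2 * n * h) by apply: ler_pM.
  lra.
have b2 : `|dot y W| <= 6 * n ^+ 2 * h.
  apply: le_trans (dot_le_norm _ _) _.
  have : `|y| * `|W| <= (n * h) * (3 * n) by apply: ler_pM.
  lra.
have b3 : `|dot y z| <= 4 * n ^+ 2 * h.
  apply: le_trans (dot_le_norm _ _) _.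
  have : `|y| * `|z| <= (n * h) * (2 * n * h) by apply: ler_pM.
  have : n ^+ 2 * h * h <= n ^+ 2 * h * 1 by rewrite ler_wpM2l// mulr_ge0 ?sqr_ge0.
  lra.
move: b1 b2 b3; rewrite !ler_norml => /andP[? _] /andP[? _] /andP[? _]; lra.
Qed.

(* [zz] is [0] where the coefficient is the one of the side, [1] elsewhere. *)
Lemma mass_term_ge (s : side) (b zz n k h q : R) (P W : plane R) : 0 <= n -> 0 <= h ->
  bmin S <= b <= bmax S -> zz = 1 \/ zz = 0 /\ b = be S s -> `|P| <= n -> `|W| <= 3 * n ->
  dot P W - k <= q -> 0 <= k ->
  be S s * dot P W - 6 * bmax S * n ^+ 2 * zz - bmax S * k <= b * q.
Proof.
move=> n0 h0 /andP[b1 b2] hz Pn Wn hq k0.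
have bp : 0 < b by apply: lt_le_trans b1; exact: bmin0.
have bM := bmax0 hS.
have e1 : b * (dot P W - k) <= b * q by rewrite ler_wpM2l// ltW.
have e2 : b * k <= bmax S * k by rewrite ler_wpM2r.
have /andP[s1 s2] := be_range S s; have s0 := b0 s.
have e3 : `|dot P W| <= 6 * n ^+ 2.
  apply: le_trans (dot_le_norm _ _) _.
  have : `|P| * `|W| <= n * (3 * n) by apply: ler_pM.
  by lra.
case: hz => [->|[-> eb]]; last by rewrite -eb; lra.
suff : (be S s - b) * dot P W <= 6 * bmax S * n ^+ 2 by lra.
apply: le_trans (ler_norm _) _; rewrite normrM.
have : `|be S s - b| * `|dot P W| <= bmax S * (6 * n ^+ 2).
  apply: ler_pM => //; rewrite ler_norml; apply/andP; split; lra.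
by lra.
Qed.

(** The Nedelec field with the edge moments of the two-piece field. The [dual_sum] term adds the
    same moment on the two edges at [V] and none on [W1 W2]. The rotation about the midpoint of
    [W1 W2] has no moment on that edge either; it supplies what the two pieces differ by away from
    the midpoint of the chord. The resulting rotation coefficient is the mean of [bp] and [bq]
    weighted by area. *)
Definition cut_test (V W1 W2 : plane R) (d e : R) ap bp aq bq : vfield R :=
  let Xm := midpoint (V + d *: (W1 - V)) (V + e *: (W2 - V)) in
  fun x => ndf aq bq x + (d * dot (ndf ap bp Xm - ndf aq bq Xm) (W1 - V)) *: dual_sum (W1 - V) (W2 - V)
    + (d * e * (bp - bq)) *: perp (x - midpoint W1 W2).

Lemma cut_test_ndf V W1 W2 (d e : R) ap bp aq bq :
  exists a, cut_test V W1 W2 d e ap bp aq bq = ndf a (d * e * bp + (1 - d * e) * bq).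
Proof.
rewrite /cut_test /=; set J := _ * dot _ _; set g := dual_sum _ _; set M := midpoint W1 W2.
exists (aq + J *: g - (d * e * (bp - bq)) *: perp M); apply/funext => x.
by apply: injective_projections; rewrite /ndf /perp /= /GRing.scale/=; ring.
Qed.

Lemma cut_test_center V W1 W2 (d e : R) ap bp aq bq x
  (Xm := midpoint (V + d *: (W1 - V)) (V + e *: (W2 - V)))
  (P := ndf ap bp Xm) (Q := ndf aq bq Xm) :
  cut_test V W1 W2 d e ap bp aq bq x =
  (Q + (d * dot (P - Q) (W1 - V)) *: dual_sum (W1 - V) (W2 - V)) +
  (bq *: perp (x - Xm) + (d * e * (bp - bq)) *: perp (x - midpoint W1 W2)).
Proof.
rewrite /cut_test -/Xm -/P -/Q; rewrite {1}(ndf_center aq bq Xm) -/Q.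
by rewrite [RHS]addrA; congr (_ + _); rewrite addrAC.
Qed.

Section Bounds.
Variables (c V W1 W2 : plane R) (s1 s2 h d e : R) (ap aq : plane R) (bp bq : R).
Hypotheses (hs1 : is_sign s1) (hs2 : is_sign s2) (h0 : 0 < h)
  (ar : arranged c s1 s2 h V W1 W2)
  (d0 : 0 < d) (d1 : d <= 1) (e0 : 0 < e) (e1 : e <= 1).
Let D := V + d *: (W1 - V).
Let E := V + e *: (W2 - V).
Let Xm := midpoint D E.
Let P := ndf ap bp Xm.
Let Q := ndf aq bq Xm.
Let n := `|P| + `|Q| + `|bp| + `|bq|.
Let W0 := Q + (d * dot (P - Q) (W1 - V)) *: dual_sum (W1 - V) (W2 - V).

Lemma cut_points_ctri : [/\ ctri c s1 s2 h D, ctri c s1 s2 h E, ctri c s1 s2 h Xm &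
  ctri c s1 s2 h (midpoint W1 W2)].
Proof.
have [V0 W10 W20 _] := ar.
have hd : 0 <= d <= 1 by rewrite (ltW d0).
have he : 0 <= e <= 1 by rewrite (ltW e0).
have h2 : 0 <= (2^-1 : R) <= 1 by apply/andP; split; lra.
have cD : ctri c s1 s2 h D by apply: ctri_convex => //; exact: tri_vertex_ctri.
have cE : ctri c s1 s2 h E by apply: ctri_convex => //; exact: tri_vertex_ctri.
split => //; rewrite ?/Xm midpoint_seg; apply: ctri_convex => //; exact: tri_vertex_ctri.
Qed.

Lemma n_ge : [/\ `|P| <= n, `|Q| <= n, `|bp| + `|bq| <= n & `|P| + `|Q| <= n].
Proof.
have := normr_ge0 P; have := normr_ge0 Q; have := normr_ge0 bp; have := normr_ge0 bq.
by rewrite /n; split; lra.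
Qed.

Lemma W0_le : `|W0| <= 3 * n.
Proof.
have [V0 W10 W20 _] := ar.
have [_ Xh _] := arranged_gram hs1 hs2 h0 ar.
have cd X Y : X \in tri_vertices c s1 s2 h -> Y \in tri_vertices c s1 s2 h -> `|X - Y| <= h.
  by move=> hX hY; exact: (ctri_dist hs1 hs2 (tri_vertex_ctri hs1 hs2 h0 hX) (tri_vertex_ctri hs1 hs2 h0 hY)).
have g1 : `|dual_sum (W1 - V) (W2 - V)| <= h^-1.
  rewrite /dual_sum normrZ normfV Xh perp_norm opprB addrA subrK.
  have := cd _ _ W20 W10 => k1.
  apply: (@le_trans _ _ ((h ^+ 2)^-1 * h)); first by rewrite ler_wpM2l// invr_ge0 sqr_ge0.
  by rewrite le_eqVlt; apply/orP; left; apply/eqP; field; rewrite gt_eqF.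
have j1 : `|d * dot (P - Q) (W1 - V)| <= 2 * (`|P| + `|Q|) * h.
  rewrite normrM gtr0_norm//.
  have k2 : `|dot (P - Q) (W1 - V)| <= 2 * (`|P| + `|Q|) * h.
    apply: le_trans (dot_le_norm _ _) _; apply: ler_pM; rewrite ?mulr_ge0//.
      by rewrite ler_pM2l//; exact: ler_normB.
    exact: cd.
  by apply: le_trans k2; rewrite ler_piMl.
have [_ _ _ k3] := n_ge; have k4 := normr_ge0 P; have k5 := normr_ge0 Q.
apply: le_trans (ler_normD _ _) _; rewrite normrZ.
have : `|d * dot (P - Q) (W1 - V)| * `|dual_sum (W1 - V) (W2 - V)| <= 2 * (`|P| + `|Q|) * h * h^-1.
  exact: ler_pM.
by rewrite mulfK ?gt_eqF// => ?; lra.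
Qed.

Lemma cut_pieces_le x : ctri c s1 s2 h x ->
  [/\ `|bp *: perp (x - Xm)| <= n * h, `|bq *: perp (x - Xm)| <= n * h &
   `|bq *: perp (x - Xm) + (d * e * (bp - bq)) *: perp (x - midpoint W1 W2)| <= 2 * n * h].
Proof.
move=> cx; have [_ _ cm cM] := cut_points_ctri.
have k1 : `|perp (x - Xm)| <= h by rewrite perp_norm; exact: (ctri_dist hs1 hs2 cx cm).
have k2 : `|perp (x - midpoint W1 W2)| <= h by rewrite perp_norm; exact: (ctri_dist hs1 hs2 cx cM).
have [_ _ k3 _] := n_ge; have k4 := normr_ge0 bp; have k5 := normr_ge0 bq.
have A1 : `|bp *: perp (x - Xm)| <= n * h by rewrite normrZ; apply: ler_pM => //; lra.
have A2 : `|bq *: perp (x - Xm)| <= n * h by rewrite normrZ; apply: ler_pM => //; lra.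
split => //; apply: le_trans (ler_normD _ _) _.
have de1 : `|d * e * (bp - bq)| <= n.
  rewrite normrM gtr0_norm ?mulr_gt0//.
  apply: (@le_trans _ _ (`|bp| + `|bq|)) => //.
  apply: le_trans (ler_normB _ _); rewrite ler_piMl// mulr_ile1// ltW//.
have A3 : `|(d * e * (bp - bq)) *: perp (x - midpoint W1 W2)| <= n * h.
  by rewrite normrZ; apply: ler_pM.
by lra.
Qed.

End Bounds.

Definition c_cut := Num.min (coercive_cst (be S minus) (be S plus)) c_mu.

Lemma otri_box c s1 s2 h : is_sign s1 -> is_sign s2 -> exists a b, forall x,
  otri c s1 s2 h x -> a <= x.1 <= a + h /\ b <= x.2 <= b + h.
Proof.
move=> [->|->] [->|->].
- by exists c.1, c.2 => x [] a1 a2 a3; move: a1 a2 a3; rewrite /leg1 /leg2 => ? ? ?; split; apply/andP; split; lra.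
- by exists c.1, (c.2 - h) => x [] a1 a2 a3; move: a1 a2 a3; rewrite /leg1 /leg2 => ? ? ?; split; apply/andP; split; lra.
- by exists (c.1 - h), c.2 => x [] a1 a2 a3; move: a1 a2 a3; rewrite /leg1 /leg2 => ? ? ?; split; apply/andP; split; lra.
- by exists (c.1 - h), (c.2 - h) => x [] a1 a2 a3; move: a1 a2 a3; rewrite /leg1 /leg2 => ? ? ?; split; apply/andP; split; lra.
Qed.

Lemma otri_strip c s1 s2 h (D th : plane R) (k : R) (Z := otri c s1 s2 h `&` [set x | `|cross th (x - D)| <= k * `|th| ]) :
  is_sign s1 -> is_sign s2 -> 0 < h -> th != 0 -> 0 <= k ->
  measurable Z /\ (area R Z <= (2 * k * h)%:E)%E.
Proof.
move=> hs1 hs2 h0 th0 k0.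
have mZ : measurable Z by apply: measurableI; [exact: otri_measurable|exact: strip_measurable].
have [a [b hab]] := otri_box c h hs1 hs2.
split => //; apply: (@strip_area _ Z th D k h a b) => //; first exact: ltW.
by move=> x [Ox Zx]; have [? ?] := hab _ Ox; split.
Qed.

Lemma otri_line c s1 s2 h (D th : plane R) (N := otri c s1 s2 h `&` [set x | cross th (x - D) = 0]) :
  is_sign s1 -> is_sign s2 -> 0 < h -> th != 0 -> measurable N /\ area R N = 0%E.
Proof.
move=> hs1 hs2 h0 th0; have [mZ Z0] := otri_strip c D hs1 hs2 h0 th0 (lexx 0).
have -> : N = otri c s1 s2 h `&` [set x | `|cross th (x - D)| <= 0 * `|th| ].
  by rewrite /N; congr (_ `&` _); apply/seteqP; split => x /=; rewrite mul0r normr_le0 => /eqP.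
split => //; apply/eqP; rewrite eq_le measure_ge0 andbT.
by apply: le_trans Z0 _; rewrite mulr0 mul0r.
Qed.

(** The cut-off corner as a half of the triangle. The factor [X], the signed double area, makes [V]
    lie on the positive side for both orientations of the vertices. *)
Lemma corner_otri c s1 s2 h V W1 W2 (d e : R) (u := W1 - V) (v := W2 - V) (X := cross u v)
    (D := V + d *: u) (th := V + e *: v - D) :
  is_sign s1 -> is_sign s2 -> 0 < h -> arranged c s1 s2 h V W1 W2 -> 0 < d <= 1 -> 0 < e <= 1 ->
  open_corner V (d *: u) (e *: v) = otri c s1 s2 h `&` [set x | 0 < X * cross th (x - D)].
Proof.
move=> hs1 hs2 h0 ar /andP[d0 d1] /andP[e0 e1].
have [_ Xh _] := arranged_gram hs1 hs2 h0 ar.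
have X0 : X != 0 by rewrite -normr_eq0 Xh gt_eqF// exprn_gt0.
have X2 : 0 < X ^+ 2 by rewrite lt_neqAle sqr_ge0 andbT eq_sym sqrf_eq0.
have lE (a b : R) : X * cross th (V + a *: u + b *: v - D) = X ^+ 2 * (d * e - a * e - b * d).
  by rewrite /X /th /D /cross /= /GRing.scale/=; ring.
apply/seteqP; split => x.
  move=> [a [b [a0 b0' ab ->]]]; rewrite !scalerA /=.
  have [a' [b' [xE o _]]] := arranged_bary (V + (a * d) *: u + (b * e) *: v) hs1 hs2 h0 ar.
  have [ea eb] := bary_unique X0 xE.
  rewrite lE; split.
    apply/o; rewrite -ea -eb; split; rewrite ?mulr_gt0//.
    have : a * d <= a * 1 by rewrite ler_pM2l.
    have : b * e <= b * 1 by rewrite ler_pM2l.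
    by lra.
  apply: mulr_gt0 => //; have -> : d * e - a * d * e - b * e * d = d * e * (1 - (a + b)) by ring.
  by rewrite !mulr_gt0// subr_gt0.
move=> [Ox]; have [a [b [xE o _]]] := arranged_bary x hs1 hs2 h0 ar.
have [a0 b0' ab] := o.1 Ox.
rewrite /= xE lE pmulr_rgt0// => h1; exists (a / d), (b / e); split.
- exact: divr_gt0.
- exact: divr_gt0.
- have -> : a / d + b / e = (a * e + b * d) / (d * e) by field; rewrite !gt_eqF.
  by rewrite ltr_pdivrMr ?mulr_gt0// mul1r; lra.
- by rewrite !scalerA !divfK ?gt_eqF.
Qed.

Lemma pieces_area c s1 s2 h (D th : plane R) (X : R) (O := otri c s1 s2 h)
  (A := O `&` [set x | 0 < X * cross th (x - D)]) (B := O `&` [set x | X * cross th (x - D) < 0]) :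
  is_sign s1 -> is_sign s2 -> 0 < h -> th != 0 -> X != 0 ->
  [/\ open A, open B & total_area B = total_area O - total_area A].
Proof.
move=> hs1 hs2 h0 th0 X0.
have cl : continuous (fun x : plane R => X * cross th (x - D)).
  by move=> x; apply: cvgM; [exact: cvg_cst|exact: cross_cont].
have oA : open A.
  apply: openI; first exact: otri_open.
  by apply: (@open_comp _ _ (fun x : plane R => X * cross th (x - D)) [set t | 0 < t]) => //; exact: open_gt.
have oB : open B.
  apply: openI; first exact: otri_open.
  by apply: (@open_comp _ _ (fun x : plane R => X * cross th (x - D)) [set t | t < 0]) => //; exact: open_lt.
have [fO _] := otri_area c hs1 hs2 h0.
have mA := open_measurable_plane oA; have mB := open_measurable_plane oB.
have [mN N0] := otri_line c D hs1 hs2 h0 th0.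
split => //.
have fin (C : set (plane R)) : measurable C -> C `<=` O -> area R C \is a fin_num.
  move=> mC CO; rewrite ge0_fin_numE ?measure_ge0//.
  by apply: le_lt_trans fO.2; apply: le_measure; rewrite ?inE//; case: fO.
have OE : O = (A `|` B) `|` (O `&` [set x | cross th (x - D) = 0]).
  apply/seteqP; split => [x Ox|x [[[]|[]]|[]]//].
  case: (ltrgtP (X * cross th (x - D)) 0) => hx.
  - by left; right.
  - by left; left.
  - by right; split => //=; move/eqP: hx; rewrite mulf_eq0 (negbTE X0) => /eqP.
suff -> : total_area O = total_area A + total_area B by rewrite addrC addKr.
have mAB : measurable (A `|` B) by exact: measurableU.
have dis : A `&` B = set0 by apply/seteqP; split => // x [[_ /= p] [_ /= q]]; lra.
have e1 : area R O = area R (A `|` B) by rewrite {1}OE measureU0.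
have e2 : area R (A `|` B) = (area R A + area R B)%E by rewrite measureU.
rewrite /total_area e1 e2 fineD//; apply: fin => //.
- by move=> x [].
- by move=> x [].
Qed.

Lemma c_cut_gt0 : 0 < c_cut.
Proof.
rewrite lt_min c_mu_gt0 andbT /coercive_cst !divr_gt0// ?exprn_gt0// ?lt_min ?lt_max ?b0//.
Qed.

Lemma sqr_sum4 (a b k l : R) : (a + b + k + l) ^+ 2 <= 4 * (a ^+ 2 + b ^+ 2 + (k ^+ 2 + l ^+ 2)).
Proof.
have := sqr_ge0 (a - b); have := sqr_ge0 (a - k); have := sqr_ge0 (a - l).
have := sqr_ge0 (b - k); have := sqr_ge0 (b - l); have := sqr_ge0 (k - l); lra.
Qed.

Lemma local_cut c s1 s2 h V W1 W2 (d e : R) (f : vfield R) ap bp aq bq (sA sB : side) (eps : R)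
    (O := otri c s1 s2 h) (u := W1 - V) (v := W2 - V) (X := cross u v)
    (D := V + d *: u) (E := V + e *: v) (th := E - D) (Xm := midpoint D E)
    (P := ndf ap bp Xm) (Q := ndf aq bq Xm) (w := cut_test V W1 W2 d e ap bp aq bq) :
  is_sign s1 -> is_sign s2 -> 0 < h -> h <= 1 -> arranged c s1 s2 h V W1 W2 ->
  0 < d <= 1 -> 0 < e <= 1 -> 0 <= eps -> sA <> sB ->
  be S plus / be S minus < 1065%:R / 100%:R -> be S minus / be S plus < 1065%:R / 100%:R ->
  dot P th = dot Q th -> be S sA * cross th P = be S sB * cross th Q ->
  bp / mu S sA = bq / mu S sB ->
  (forall x, O x -> 0 < X * cross th (x - D) -> f x = ndf ap bp x) ->
  (forall x, O x -> X * cross th (x - D) < 0 -> f x = ndf aq bq x) ->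
  (forall x, O x -> 4 * eps * h * `|th| * h ^+ 2 < X * cross th (x - D) -> subdomain S sA x) ->
  (forall x, O x -> X * cross th (x - D) < - (4 * eps * h * `|th| * h ^+ 2) -> subdomain S sB x) ->
  48%:R * bmax S * eps + 7 * bmax S * h <= c_cut / 16 ->
  local_stable S O h f w (c_cut / 16).
Proof.
move=> hs1 hs2 h0 h1 ar hd he eps0 sAB r1 r2 tg nm cu fA fB sideA sideB small.
have [gram Xh _] := arranged_gram hs1 hs2 h0 ar; rewrite -/u -/v -/X in gram Xh.
have /andP[d0 d1] := hd; have /andP[e0 e1] := he.
have h20 : 0 < h ^+ 2 by rewrite exprn_gt0.
have X0 : X != 0 by rewrite -normr_eq0 Xh gt_eqF.
have thE : th = e *: v - d *: u.
  by rewrite /th /E /D opprD addrACA subrr add0r.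
have th0 : th != 0.
  apply/negP => /eqP t0; have : cross u th = e * X by rewrite thE /X /cross /= /GRing.scale/=; ring.
  rewrite t0 /cross /= !mulr0 subrr => /esym/eqP; rewrite mulf_eq0 (negbTE X0) orbF => /eqP; lra.
have [fO aO] := otri_area c hs1 hs2 h0.
have mO : measurable O by case: fO.
have [mN N0] := otri_line c D hs1 hs2 h0 th0.
have [oA oB aB] := pieces_area c D hs1 hs2 h0 th0 X0.
have aA := area_corner_arranged hs1 hs2 h0 ar d0 e0.
rewrite -/u -/v (corner_otri hs1 hs2 h0 ar hd he) -/u -/v -/X -/D -/E -/th in aA.
set A := otri c s1 s2 h `&` [set x | 0 < X * cross th (x - D)] in oA aB aA.
set B := otri c s1 s2 h `&` [set x | X * cross th (x - D) < 0] in oB aB.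
set N := otri c s1 s2 h `&` [set x | cross th (x - D) = 0] in mN N0.
have OAB x : O x -> ~ N x -> A x \/ B x.
  move=> Ox Nx; case: (ltrgtP (X * cross th (x - D)) 0) => hx; [by right|by left|].
  by case: Nx; split => //=; move/eqP: hx; rewrite mulf_eq0 (negbTE X0) => /eqP.
have fA' x : A x -> f x = ndf ap bp x by case=> ? ?; exact: fA.
have fB' x : B x -> f x = ndf aq bq x by case=> ? ?; exact: fB.
have OK x : O x -> `|x| <= `|c| + h by exact: otri_norm.
have [bf cA cB] := two_pieces_field mO OK oA oB mN N0 OAB fA' fB'.
have [aw wE] := cut_test_ndf V W1 W2 d e ap bp aq bq; rewrite -/w in wE.
set bw := _ + _ in wE.
have oT : open (setT : set (plane R)) := openT.
have [bfw cw _] := @two_pieces_field _ O setT setT N w aw bw aw bw _ mO OK oT oT mN N0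
  (fun x _ _ => or_introl I) (fun x _ => f_equal (fun g => g x) wE) (fun x _ => f_equal (fun g => g x) wE).
split => //; split => //.
pose n := `|P| + `|Q| + `|bp| + `|bq|.
have n0 : 0 <= n by rewrite !addr_ge0.
exists (n ^+ 2).
have [Pn Qn bpqn PQn] := n_ge V W1 W2 d e ap aq bp bq.
rewrite -/u -/v -/D -/E -/Xm -/P -/Q -/n in Pn Qn bpqn PQn.
pose W0 := Q + (d * dot (P - Q) u) *: dual_sum u v.
have W0n : `|W0| <= 3 * n := W0_le e ap aq bp bq hs1 hs2 h0 ar d0 d1.
pose y1 x := bp *: perp (x - Xm); pose y2 x := bq *: perp (x - Xm).
pose z x := y2 x + (d * e * (bp - bq)) *: perp (x - midpoint W1 W2).
have wz x : w x = W0 + z x by exact: cut_test_center.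
have pz x : O x -> [/\ `|y1 x| <= n * h, `|y2 x| <= n * h & `|z x| <= 2 * n * h].
  by move=> /otri_ctri; exact: (cut_pieces_le ap aq bp bq hs1 hs2 h0 ar d0 d1 e0 e1).
have pE x : ndf ap bp x = P + y1 x by rewrite (ndf_center ap bp Xm).
have qE x : ndf aq bq x = Q + y2 x by rewrite (ndf_center aq bq Xm).
have h01 : 0 <= h <= 1 by rewrite h1 ltW.
have hp := ltW h0.
have nh : 0 <= n * h by exact: mulr_ge0.
have nh1 : n * h <= n by rewrite ler_piMr.
have n20 := sqr_ge0 n.
have hbp : `|bp| <= n by apply: le_trans bpqn; rewrite lerDl.
have hbq : `|bq| <= n by apply: le_trans bpqn; rewrite lerDr.
have de0 : 0 < d * e by rewrite mulr_gt0.
have de1 : d * e <= 1 by apply: mulr_ile1 => //; exact: ltW.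
have sqn (t k : R) : `|t| <= k -> t ^+ 2 <= k ^+ 2.
  by move=> tk; rewrite -real_normK ?num_real// ler_pXn2r ?nnegrE// (le_trans _ tk).
have sqv (t : plane R) k : `|t| <= k -> dot t t <= 2 * k ^+ 2.
  move=> tk; have /andP[_ +] := dot_ge_norm t; move/le_trans; apply.
  by rewrite ler_pM2l// ler_pXn2r ?nnegrE// (le_trans _ tk).
have bwn : `|bw| <= n.
  apply: le_trans bpqn; rewrite /bw; apply: le_trans (ler_normD _ _) _.
  apply: lerD; rewrite normrM ler_piMl// ger0_norm ?subr_ge0 ?gerBl ?(ltW de0)//.
have nn h' (k : R) (g : vfield R) : 0 <= h' -> field_bounded O g -> k <= 200%:R * h' ->
    (forall x, O x -> ~ N x -> dot (g x) (g x) + curl g x ^+ 2 <= k) ->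
    norm2 O g <= 100%:R * h' * h ^+ 2.
  move=> h'0 bg kh gk; apply: le_trans (norm2_le fO bg mN N0 gk) _.
  have : k * h ^+ 2 <= 200%:R * h' * h ^+ 2 by rewrite ler_wpM2r// ltW.
  by rewrite aO; clear; lra.
split; first exact: sqr_ge0.
- rewrite /energy; have [t1 t2] := energy_terms hS bf bfw.
  rewrite -ess_RintegralD//.
  (* Outside the strip [Z] of half-width [k0] around the chord the two sides of the chord are the
     two sides of the curve, so the coefficient is the expected one. The area of [Z] is at most
     [8 * eps * h ^+ 2]. *)
  pose k0 := 4 * eps * h; have k00 : 0 <= k0 by rewrite !mulr_ge0// ltW.
  have [mZ aZ] := otri_strip c D hs1 hs2 h0 th0 k00.
  set Z := otri c s1 s2 h `&` _ in mZ aZ.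
  pose cc := c_mu * (bp ^+ 2 + bq ^+ 2); pose kz := 6 * bmax S * n ^+ 2.
  pose kr := bmax S * (14 * n ^+ 2 * h).
  have bM := bmax0 hS.
  have kz0 : 0 <= kz by rewrite !mulr_ge0// ltW.
  have r140 : 0 <= 14 * n ^+ 2 * h by rewrite !mulr_ge0// ltW.
  have Zcase x (s : side) : O x -> (~ Z x -> subdomain S s x) ->
      (\1_Z x : R) = 1 \/ (\1_Z x : R) = 0 /\ piecewise S (be S) x = be S s.
    move=> Ox hx; rewrite indicE; have [/set_mem Zx|Zx] := boolP (x \in Z); first by left.
    right; split => //; apply: piecewise_on; first by case: hS.
    by apply: hx => Zx'; move/negP: Zx; apply; exact: mem_set.
  have nZ x : O x -> ~ Z x -> k0 * `|th| * h ^+ 2 < `|X * cross th (x - D)|.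
    move=> Ox Zx; rewrite normrM Xh mulrC ltr_pM2l// ltNge; apply/negP => hx; exact: Zx.
  have ptA x : A x -> be S sA * dot P W0 + cc - kz * \1_Z x - kr <=
    (piecewise S (mu S) x)^-1 * (curl f x * curl w x) + piecewise S (be S) x * dot (f x) (w x).
    move=> Ax; have [Ox lx] := Ax; rewrite /= in lx.
    have [Y1 Y2 Z1] := pz _ Ox.
    have sx : ~ Z x -> subdomain S sA x.
      by move=> Zx; apply: sideA => //; have := nZ _ Ox Zx; rewrite gtr0_norm.
    have := mass_term_ge n0 (ltW h0) (piecewise_range S (be S) x) (Zcase _ _ Ox sx) Pn W0n
      (dot_perturb n0 h01 Pn W0n Y1 Z1) r140.
    have := curl_term_ge (t := d * e) cu _ (piecewise_range S (mu S) x).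
    rewrite (ltW de0) de1 => /(_ isT) k1 k2.
    rewrite fA' // cA // cw // pE wz.
    by apply: le_trans (lerD k1 k2); rewrite /kz /kr /cc; clear; lra.
  have ptB x : B x -> be S sB * dot Q W0 + cc - kz * \1_Z x - kr <=
    (piecewise S (mu S) x)^-1 * (curl f x * curl w x) + piecewise S (be S) x * dot (f x) (w x).
    move=> Bx; have [Ox lx] := Bx; rewrite /= in lx.
    have [Y1 Y2 Z1] := pz _ Ox.
    have sx : ~ Z x -> subdomain S sB x.
      by move=> Zx; apply: sideB => //; have := nZ _ Ox Zx; rewrite ltr0_norm// /k0; clear; lra.
    have := mass_term_ge n0 (ltW h0) (piecewise_range S (be S) x) (Zcase _ _ Ox sx) Qn W0n
      (dot_perturb n0 h01 Qn W0n Y2 Z1) r140.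
    have := curl_term_ge (t := 1 - d * e) (esym cu) _ (piecewise_range S (mu S) x).
    rewrite subr_ge0 de1 gerBl (ltW de0) => /(_ isT) k1 k2.
    rewrite fB' // cB // cw // qE wz.
    have e3 : (1 - d * e) * bq + (1 - (1 - d * e)) * bp = bw by rewrite /bw; ring.
    rewrite e3 in k1.
    by apply: le_trans (lerD k1 k2); rewrite /kz /kr /cc; clear; lra.
  have mA := open_measurable_plane oA; have mB := open_measurable_plane oB.
  have AO : A `<=` O by move=> ? [].
  have BO : B `<=` O by move=> ? [].
  have ZO : Z `<=` O by move=> ? [].
  have dis x : A x -> B x -> False by move=> [_ /= la] [_ /= lb]; clear -la lb; lra.
  have := Rintegral_two_pieces_ge fO (ess_boundedD t1 t2) mN N0 mA mB mZ AO BO ZO OAB dis kz0 ptA ptB.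
  apply: le_trans.
  rewrite aB -/O aO {1 2}/total_area aA.
  have tZ : total_area Z <= 8 * eps * h ^+ 2.
    rewrite /total_area; apply: (@le_trans _ _ (fine (2 * k0 * h)%:E)); last by rewrite /= /k0 le_eqVlt; apply/orP; left; apply/eqP; ring.
    apply: fine_le => //; rewrite ge0_fin_numE ?measure_ge0//.
    by apply: le_lt_trans aZ _; rewrite ltry.
  have tZ' : kz * total_area Z <= kz * (8 * eps * h ^+ 2) by rewrite ler_wpM2l.
  have cmain : coercive_cst (be S minus) (be S plus) * (dot P P + dot Q Q) <=
      d * e * (be S sA * dot P W0) + (1 - d * e) * (be S sB * dot Q W0).
    have csym : coercive_cst (be S minus) (be S plus) = coercive_cst (be S sA) (be S sB).
      by clear -sAB; case: sA sB sAB => -[]// _; rewrite /coercive_cst minC maxC.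
    rewrite csym /W0; apply: (@cut_coercive _ _ _ _ _ h) => //.
    - by clear -sAB r1 r2; case: sA sB sAB => -[]// _.
    - by clear -sAB r1 r2; case: sA sB sAB => -[]// _.
    - by rewrite gt_eqF.
    - by rewrite -thE.
    - by rewrite -thE.
  have /andP[p1 _] := dot_ge_norm P; have /andP[q1 _] := dot_ge_norm Q.
  have c3a : c_cut <= coercive_cst (be S minus) (be S plus) by rewrite /c_cut ge_min lexx.
  have c3b : c_cut <= c_mu by rewrite /c_cut ge_min lexx orbT.
  have c30 := ltW c_cut_gt0.
  have n2 : n ^+ 2 <= 4 * (`|P| ^+ 2 + `|Q| ^+ 2 + (bp ^+ 2 + bq ^+ 2)).
    rewrite /n -(real_normK (num_real bp)) -(real_normK (num_real bq)).
    exact: sqr_sum4.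
  have PQ0 : 0 <= dot P P + dot Q Q.
    by apply: addr_ge0; [apply: le_trans p1|apply: le_trans q1]; exact: sqr_ge0.
  have bb0 : 0 <= bp ^+ 2 + bq ^+ 2 by rewrite addr_ge0 ?sqr_ge0.
  have L1 := ler_wpM2r PQ0 c3a; have L2 := ler_wpM2r bb0 c3b.
  have L3 : c_cut * n ^+ 2 <= c_cut * (4 * (dot P P + dot Q Q + (bp ^+ 2 + bq ^+ 2))).
    by rewrite ler_wpM2l//; clear -n2 p1 q1; lra.
  have L4 : (48%:R * bmax S * eps + 7 * bmax S * h) * n ^+ 2 <= c_cut / 16 * n ^+ 2.
    by rewrite ler_wpM2r.
  (* [n] is a sum of four terms, so the main part is at least [c_cut / 4 * n ^+ 2] before the area
     factor 1/2, hence [c_cut / 8] after it. Half of this is spent on the errors: 48 is the loss 6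
     on the strip times its area factor 8, and 7 is half of 14. *)
  have core : c_cut / 16 * n ^+ 2 <=
      (d * e * (be S sA * dot P W0) + (1 - d * e) * (be S sB * dot Q W0) + cc) / 2
      - 8 * eps * kz - kr / 2.
    rewrite /kz /kr /cc; clear -L1 L2 L3 L4 cmain; lra.
  have := ler_wpM2r (ltW h20) core.
  clear -tZ'; lra.
- apply: (nn (n ^+ 2) (12 * n ^+ 2)) => //; first (clear -n20; lra).
  move=> x Ox Nx; have [Y1 Y2 Z1] := pz _ Ox.
  case: (OAB _ Ox Nx) => hx.
    rewrite fA' // cA // pE exprMn.
    have := sqn _ _ hbp; have : `|P + y1 x| <= 2 * n by apply: le_trans (ler_normD _ _) _; clear -Pn Y1 nh1; lra.
    by move/sqv; rewrite exprMn; clear -n20; lra.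
  rewrite fB' // cB // qE exprMn.
  have := sqn _ _ hbq; have : `|Q + y2 x| <= 2 * n by apply: le_trans (ler_normD _ _) _; clear -Qn Y2 nh1; lra.
  by move/sqv; rewrite exprMn; clear -n20; lra.
- apply: (nn (n ^+ 2) (54 * n ^+ 2)) => //; first (clear -n20; lra).
  move=> x Ox Nx; have [Y1 Y2 Z1] := pz _ Ox.
  rewrite cw // exprMn wz.
  have := sqn _ _ bwn; have : `|W0 + z x| <= 5 * n by apply: le_trans (ler_normD _ _) _; clear -W0n Z1 nh1; lra.
  by move/sqv; rewrite exprMn; clear -n20; lra.
Qed.

End CutElement.

(** * Edge moments *)

Section EdgeDof.
Context (R : realType).
Implicit Types (c V W D E P Q : plane R) (O : set (plane R)) (u w : vfield R).

Definition trace_on O u (x : plane R) : plane R :=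
  (lim ((u y).1 @[y --> within O (nbhs x)]), lim ((u y).2 @[y --> within O (nbhs x)])).

(* The tangential trace of [u] along [PQ] takes two values, the first one on the
   proportion [d] of the edge; [k] is its mean. *)
Definition edge_dof O u P Q (k : R) := exists d k1 k2 : R,
  [/\ 0 <= d <= 1, k = d * k1 + (1 - d) * k2 &
   forall s, 0 < s < 1 ->
     (s < d -> dot (trace_on O u (P + s *: (Q - P))) (Q - P) = k1) /\
     (d < s -> dot (trace_on O u (P + s *: (Q - P))) (Q - P) = k2)].

Lemma edge_dof_sym O u P Q k : edge_dof O u P Q k -> edge_dof O u Q P (- k).
Proof.
move=> [d [k1 [k2 [d01 -> hk]]]]; exists (1 - d), (- k2), (- k1).
have dn x : dot x (P - Q) = - dot x (Q - P) by rewrite /dot /=; ring.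
split; [lra|ring|] => s hs.
have -> : Q + s *: (P - Q) = P + (1 - s) *: (Q - P).
  by apply: injective_projections; rewrite /= /GRing.scale/=; ring.
have hs' : 0 < 1 - s < 1 by lra.
have [h1 h2] := hk _ hs'.
by split => sd; rewrite dn; [rewrite h2//; lra|rewrite h1//; lra].
Qed.

Lemma ndf_edge a b P Q (s : R) : dot (ndf a b (P + s *: (Q - P))) (Q - P) = dot (ndf a b P) (Q - P).
Proof. by rewrite /ndf /dot /= /GRing.scale/=; ring. Qed.

Lemma ndf_dofC a b P Q : dot (ndf a b Q) (P - Q) = - dot (ndf a b P) (Q - P).
Proof. by rewrite /ndf /dot /= /GRing.scale/=; ring. Qed.

Lemma tri_segment c s1 s2 h P Q (s : R) : is_sign s1 -> is_sign s2 -> 0 < h ->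
  P \in tri_vertices c s1 s2 h -> Q \in tri_vertices c s1 s2 h -> 0 <= s <= 1 ->
  ctri c s1 s2 h (P + s *: (Q - P)).
Proof. by move=> hs1 hs2 h0 hP hQ hs; apply: ctri_convex => //; exact: tri_vertex_ctri. Qed.

Lemma trace_piece c s1 s2 h u a b x (U : set (plane R)) :
  is_sign s1 -> is_sign s2 -> 0 < h -> ctri c s1 s2 h x -> open U -> U x ->
  (forall y, otri c s1 s2 h y -> U y -> u y = ndf a b y) ->
  trace_on (otri c s1 s2 h) u x = ndf a b x.
Proof.
move=> hs1 hs2 h0 cx oU Ux hU; apply: (@trace_value _ _ u (ndf a b) x U).
- by move=> W nW; exact: otri_dense nW.
- exact: open_nbhs_nbhs.
- by move=> y Uy Oy; exact: hU.
- exact: ndf_cont.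
Qed.

Lemma arranged_third c s1 s2 h P Q : P \in tri_vertices c s1 s2 h -> Q \in tri_vertices c s1 s2 h ->
  P != Q -> is_sign s1 -> is_sign s2 -> 0 < h -> exists W, arranged c s1 s2 h P Q W.
Proof.
move=> hP hQ PQ hs1 hs2 h0.
pose A : plane R := (c.1 + s1 * h, c.2); pose B : plane R := (c.1, c.2 + s2 * h).
have := tri_vertices_uniq c hs1 hs2 h0; rewrite /= !inE negb_or -/A -/B => /andP[/andP[cA cB] /andP[AB _]].
have iA : A \in tri_vertices c s1 s2 h by rewrite !inE eqxx orbT.
have iB : B \in tri_vertices c s1 s2 h by rewrite !inE eqxx !orbT.
have ic : c \in tri_vertices c s1 s2 h by rewrite !inE eqxx.
have AC : A != c by rewrite eq_sym.
have BC : B != c by rewrite eq_sym.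
have BA : B != A by rewrite eq_sym.
move: (hP) (hQ) PQ; rewrite !inE => /or3P[] /eqP -> /or3P[] /eqP ->; rewrite ?eqxx // => _;
  by [exists c|exists A|exists B].
Qed.

Lemma line_open (D th : plane R) : open [set x | cross th (x - D) != 0].
Proof.
have -> : [set x | cross th (x - D) != 0] = (fun x => cross th (x - D)) @^-1` [set t | t != 0] by [].
by apply: open_comp; [move=> x _; exact: cross_cont|exact: open_neq].
Qed.

(** The field is known only off a line. If the line is transversal to the edge it affects at most
    one edge point, where the step may be put; if it is parallel and disjoint it affects none; if it
    contains the edge it misses the open triangle, and one-sided limits see only that. *)
Lemma edge_dof_single c s1 s2 h u a b (D th : plane R) P Q :
  is_sign s1 -> is_sign s2 -> 0 < h -> th != 0 ->
  (forall x, otri c s1 s2 h x -> cross th (x - D) != 0 -> u x = ndf a b x) ->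
  P \in tri_vertices c s1 s2 h -> Q \in tri_vertices c s1 s2 h -> P != Q ->
  edge_dof (otri c s1 s2 h) u P Q (dot (ndf a b P) (Q - P)).
Proof.
move=> hs1 hs2 h0 th0 hu hP hQ PQ.
set k := dot _ _.
have fE (s : R) : cross th (P + s *: (Q - P) - D) = cross th (P - D) + s * cross th (Q - P).
  by rewrite /cross /= /GRing.scale/=; ring.
have off (s : R) : 0 < s < 1 -> cross th (P + s *: (Q - P) - D) != 0 ->
    dot (trace_on (otri c s1 s2 h) u (P + s *: (Q - P))) (Q - P) = k.
  move=> hs fs; rewrite (@trace_piece _ _ _ _ _ a b _ [set x | cross th (x - D) != 0])//.
  - exact: ndf_edge.
  - by apply: tri_segment => //; lra.
  - exact: line_open.
have kk (d : R) : k = d * k + (1 - d) * k by ring.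
have [be0|be0] := eqVneq (cross th (Q - P)) 0; last first.
  pose d0 := - cross th (P - D) / cross th (Q - P).
  have root s : s != d0 -> cross th (P + s *: (Q - P) - D) != 0.
    rewrite fE; apply: contraNneq => e; rewrite /d0; apply/eqP; apply: (mulIf be0).
    by rewrite divfK//; lra.
  exists (Num.max 0 (Num.min 1 d0)), k, k; split => //.
    by rewrite le_max lexx ge_max ler01 ge_min lexx.
  move=> s hs; split => sd; apply: off => //; apply: root; apply/negP => /eqP E; move: sd hs; rewrite E;
    rewrite /Num.max /Num.min/=; do ?case: ifP; lra.
have [al0|al0] := eqVneq (cross th (P - D)) 0; last first.
  exists 0, k, k; split => //; first by rewrite lexx ler01.
  by move=> s hs; split => _; apply: off => //; rewrite fE be0 mulr0 addr0.
have [W ar] := arranged_third hP hQ PQ hs1 hs2 h0.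
have [_ Xh _] := arranged_gram hs1 hs2 h0 ar.
have X0 : cross (Q - P) (W - P) != 0 by rewrite -normr_eq0 Xh gt_eqF// exprn_gt0.
have W0 : cross th (W - P) != 0.
  apply: contra_neq th0 => e.
  have e1 : cross (Q - P) (W - P) * th.1 = (Q - P).1 * cross th (W - P) - (W - P).1 * cross th (Q - P).
    by rewrite /cross; ring.
  have e2 : cross (Q - P) (W - P) * th.2 = (Q - P).2 * cross th (W - P) - (W - P).2 * cross th (Q - P).
    by rewrite /cross; ring.
  move: e1 e2; rewrite e be0 !mulr0 subrr => /eqP; rewrite mulf_eq0 (negbTE X0) /= => /eqP e1 /eqP.
  rewrite mulf_eq0 (negbTE X0) /= => /eqP e2.
  exact: injective_projections.
exists 0, k, k; split => //; first by rewrite lexx ler01.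
move=> s hs.
suff -> : trace_on (otri c s1 s2 h) u (P + s *: (Q - P)) = ndf a b (P + s *: (Q - P)).
  by rewrite ndf_edge.
apply: (@trace_piece _ _ _ _ _ a b _ setT) => //.
- by apply: tri_segment => //; lra.
- exact: openT.
- move=> y Oy _; apply: hu => //.
  have [a' [b' [yE o _]]] := arranged_bary y hs1 hs2 h0 ar.
  have [_ b'0 _] := o.1 Oy.
  have -> : cross th (y - D) = cross th (P - D) + a' * cross th (Q - P) + b' * cross th (W - P).
    by rewrite yE /cross /= /GRing.scale/=; ring.
  by rewrite al0 be0 mulr0 !add0r mulf_neq0// gt_eqF.
Qed.

Lemma arranged_mem c s1 s2 h V W1 W2 P : arranged c s1 s2 h V W1 W2 -> P \in tri_vertices c s1 s2 h ->
  [\/ P = V, P = W1 | P = W2].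
Proof.
rewrite !inE => /arranged_cases[] [-> []] [-> ->] /or3P[] /eqP ->;
  by [constructor 1|constructor 2|constructor 3].
Qed.

Lemma edge_dof_arranged c s1 s2 h u w a b V W1 W2 : w = ndf a b -> arranged c s1 s2 h V W1 W2 ->
  edge_dof (otri c s1 s2 h) u V W1 (dot (w V) (W1 - V)) ->
  edge_dof (otri c s1 s2 h) u V W2 (dot (w V) (W2 - V)) ->
  edge_dof (otri c s1 s2 h) u W1 W2 (dot (w W1) (W2 - W1)) ->
  forall P Q, P \in tri_vertices c s1 s2 h -> Q \in tri_vertices c s1 s2 h -> P != Q ->
  edge_dof (otri c s1 s2 h) u P Q (dot (w P) (Q - P)).
Proof.
move=> -> ar d1 d2 d3 P Q hP hQ PQ.
have sy X Y : edge_dof (otri c s1 s2 h) u X Y (dot (ndf a b X) (Y - X)) ->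
    edge_dof (otri c s1 s2 h) u Y X (dot (ndf a b Y) (X - Y)).
  by move=> d; rewrite ndf_dofC; exact: edge_dof_sym.
have d1' := sy _ _ d1; have d2' := sy _ _ d2; have d3' := sy _ _ d3.
case: (arranged_mem ar hP) (arranged_mem ar hQ) PQ => -> [] ->; rewrite ?eqxx // => _; assumption.
Qed.

(** On each edge at [V] the trace is a step at the end of the chord, and its mean is computed from
    the values of both pieces at the midpoint of the chord. The hypothesis [d < 1 \/ e < 1] keeps
    the open edge [W1 W2] off the chord, so that only the far piece is seen there. *)
Lemma edge_dof_cut c s1 s2 h u ap bp aq bq V W1 W2 (d e : R) (X := cross (W1 - V) (W2 - V))
    (D := V + d *: (W1 - V)) (E := V + e *: (W2 - V)) (th := E - D) (Xm := midpoint D E)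
    (w := cut_test V W1 W2 d e ap bp aq bq) :
  is_sign s1 -> is_sign s2 -> 0 < h -> arranged c s1 s2 h V W1 W2 -> 0 < d <= 1 -> 0 < e <= 1 ->
  d < 1 \/ e < 1 ->
  dot (ndf ap bp Xm) th = dot (ndf aq bq Xm) th ->
  (forall x, otri c s1 s2 h x -> 0 < X * cross th (x - D) -> u x = ndf ap bp x) ->
  (forall x, otri c s1 s2 h x -> X * cross th (x - D) < 0 -> u x = ndf aq bq x) ->
  forall P Q, P \in tri_vertices c s1 s2 h -> Q \in tri_vertices c s1 s2 h -> P != Q ->
  edge_dof (otri c s1 s2 h) u P Q (dot (w P) (Q - P)).
Proof.
move=> hs1 hs2 h0 ar /andP[d0 d1] /andP[e0 e1] de tg uA uB.
have [V0 W10 W20 _] := ar.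
have [_ Xh _] := arranged_gram hs1 hs2 h0 ar; rewrite -/X in Xh.
have X0 : X != 0 by rewrite -normr_eq0 Xh gt_eqF// exprn_gt0.
have X2 : 0 < X ^+ 2 by rewrite lt_neqAle sqr_ge0 andbT eq_sym sqrf_eq0.
have [q1 q2] := dual_sumP X0.
have cl : continuous (fun x : plane R => X * cross th (x - D)).
  by move=> x; apply: cvgM; [exact: cvg_cst|exact: cross_cont].
have oA : open [set x | 0 < X * cross th (x - D)].
  by apply: (@open_comp _ _ (fun x : plane R => X * cross th (x - D)) [set t | 0 < t]) => //; exact: open_gt.
have oB : open [set x | X * cross th (x - D) < 0].
  by apply: (@open_comp _ _ (fun x : plane R => X * cross th (x - D)) [set t | t < 0]) => //; exact: open_lt.
have trA x : ctri c s1 s2 h x -> 0 < X * cross th (x - D) -> trace_on (otri c s1 s2 h) u x = ndf ap bp x.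
  by move=> cx lx; apply: (trace_piece hs1 hs2 h0 cx oA lx) => y Oy; exact: uA.
have trB x : ctri c s1 s2 h x -> X * cross th (x - D) < 0 -> trace_on (otri c s1 s2 h) u x = ndf aq bq x.
  by move=> cx lx; apply: (trace_piece hs1 hs2 h0 cx oB lx) => y Oy; exact: uB.
have [aw wE] := cut_test_ndf V W1 W2 d e ap bp aq bq; rewrite -/w in wE.
have cs P Q s : P \in tri_vertices c s1 s2 h -> Q \in tri_vertices c s1 s2 h -> 0 < s < 1 ->
    ctri c s1 s2 h (P + s *: (Q - P)).
  by move=> hP hQ hs; apply: tri_segment => //; lra.
have lV1 s : X * cross th (V + s *: (W1 - V) - D) = X ^+ 2 * (e * (d - s)).
  by rewrite /X /th /E /D /cross /= /GRing.scale/=; ring.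
have lV2 s : X * cross th (V + s *: (W2 - V) - D) = X ^+ 2 * (d * (e - s)).
  by rewrite /X /th /E /D /cross /= /GRing.scale/=; ring.
have lW s : X * cross th (W1 + s *: (W2 - W1) - D) = X ^+ 2 * - ((1 - s) * e * (1 - d) + s * d * (1 - e)).
  by rewrite /X /th /E /D /cross /= /GRing.scale/=; ring.
apply: (edge_dof_arranged wE ar).
- exists d, (dot (ndf ap bp V) (W1 - V)), (dot (ndf aq bq V) (W1 - V)); split.
  + by rewrite (ltW d0).
  + rewrite /w /cut_test -/D -/E -/Xm.
    set J := d * dot _ _; set g := dual_sum _ _ in q1 q2 *.
    have -> : dot (ndf aq bq V + J *: g + (d * e * (bp - bq)) *: perp (V - midpoint W1 W2)) (W1 - V) =
      dot (ndf aq bq V) (W1 - V) + J * dot g (W1 - V) +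
      d * e * (bp - bq) * dot (perp (V - midpoint W1 W2)) (W1 - V).
      by rewrite /dot /= /GRing.scale/=; ring.
    by rewrite q1 /J /dot /ndf /perp /Xm /D /E /midpoint /= /GRing.scale/=; field.
  + move=> s hs; split => sd; [rewrite trA|rewrite trB]; rewrite ?ndf_edge//;
      do ?exact: cs; rewrite lV1.
    * by apply: mulr_gt0 => //; apply: mulr_gt0 => //; rewrite subr_gt0.
    * by rewrite pmulr_rlt0// pmulr_rlt0// subr_lt0.
- exists e, (dot (ndf ap bp V) (W2 - V)), (dot (ndf aq bq V) (W2 - V)); split.
  + by rewrite (ltW e0).
  + have Je : d * dot (ndf ap bp Xm - ndf aq bq Xm) (W1 - V) = e * dot (ndf ap bp Xm - ndf aq bq Xm) (W2 - V).
      have : dot (ndf ap bp Xm - ndf aq bq Xm) th = 0.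
        have -> : dot (ndf ap bp Xm - ndf aq bq Xm) th = dot (ndf ap bp Xm) th - dot (ndf aq bq Xm) th.
          by rewrite /dot /=; ring.
        by rewrite tg subrr.
      have -> : dot (ndf ap bp Xm - ndf aq bq Xm) th = e * dot (ndf ap bp Xm - ndf aq bq Xm) (W2 - V) -
         d * dot (ndf ap bp Xm - ndf aq bq Xm) (W1 - V).
        by rewrite /th /E /D /dot /= /GRing.scale/=; ring.
      by move/eqP; rewrite subr_eq0 => /eqP.
    rewrite /w /cut_test -/D -/E -/Xm Je.
    set J := e * dot _ _; set g := dual_sum _ _ in q1 q2 *.
    have -> : dot (ndf aq bq V + J *: g + (d * e * (bp - bq)) *: perp (V - midpoint W1 W2)) (W2 - V) =
      dot (ndf aq bq V) (W2 - V) + J * dot g (W2 - V) +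
      d * e * (bp - bq) * dot (perp (V - midpoint W1 W2)) (W2 - V).
      by rewrite /dot /= /GRing.scale/=; ring.
    by rewrite q2 /J /dot /ndf /perp /Xm /D /E /midpoint /= /GRing.scale/=; field.
  + move=> s hs; split => sd; [rewrite trA|rewrite trB]; rewrite ?ndf_edge//;
      do ?exact: cs; rewrite lV2.
    * by apply: mulr_gt0 => //; apply: mulr_gt0 => //; rewrite subr_gt0.
    * by rewrite pmulr_rlt0// pmulr_rlt0// subr_lt0.
(* The step is placed at 0: the whole edge belongs to the far piece and the first value is a
   dummy. *)
- exists 0, 0, (dot (ndf aq bq W1) (W2 - W1)); split.
  + by rewrite lexx ler01.
  + rewrite mul0r add0r subr0 mul1r /w /cut_test -/D -/E -/Xm.
    set J := d * dot _ _; set g := dual_sum _ _ in q1 q2 *.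
    have -> : dot (ndf aq bq W1 + J *: g + (d * e * (bp - bq)) *: perp (W1 - midpoint W1 W2)) (W2 - W1) =
      dot (ndf aq bq W1) (W2 - W1) + J * (dot g (W2 - V) - dot g (W1 - V)) +
      d * e * (bp - bq) * dot (perp (W1 - midpoint W1 W2)) (W2 - W1).
      by rewrite /dot /= /GRing.scale/=; ring.
    by rewrite q1 q2 /dot /ndf /perp /midpoint /= /GRing.scale/=; field.
  + move=> s hs; split => sd; first by move: hs; rewrite ltNge (ltW sd).
    rewrite trB ?ndf_edge//; first exact: cs.
    rewrite lW pmulr_rlt0// oppr_lt0.
    have /andP[s0 s1'] := hs.
    have p1 : 0 <= (1 - s) * e * (1 - d) by rewrite !mulr_ge0// ?subr_ge0// ltW.
    have p2 : 0 <= s * d * (1 - e) by rewrite !mulr_ge0// ?subr_ge0// ltW.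
    case: de => hde.
      by apply: ltr_pwDl => //; apply: mulr_gt0; rewrite ?subr_gt0//; apply: mulr_gt0; rewrite ?subr_gt0.
    by apply: ltr_pwDr => //; apply: mulr_gt0; rewrite ?subr_gt0//; apply: mulr_gt0.
Qed.

End EdgeDof.

(** * A test field on every kind of element *)

Section LocalGood.
Context (R : realType) (S : interface_data R).
Hypothesis hS : interface_setting S.
Implicit Types (c V W D E P Q : plane R) (u w : vfield R).

Definition c_local := Num.min (c_single S) (c_cut S / 16).

Lemma c_local_gt0 : 0 < c_local.
Proof.
rewrite lt_min !divr_gt0 ?c_cut_gt0// lt_min !divr_gt0 ?(bmin0 hS) ?(mmax0 hS)//.
Qed.

Definition local_good c (s1 s2 h : R) u w :=
  [/\ local_stable S (otri c s1 s2 h) h u w c_local,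
    exists a b, w = ndf a b &
    forall P Q, P \in tri_vertices c s1 s2 h -> Q \in tri_vertices c s1 s2 h -> P != Q ->
      edge_dof (otri c s1 s2 h) u P Q (dot (w P) (Q - P))].

Lemma local_stable_le O (h : R) u w (c0 c1 : R) : c1 <= c0 -> local_stable S O h u w c0 ->
  local_stable S O h u w c1.
Proof.
move=> cc [bu [bw [m [m00 e1 e2 e3]]]]; split => //; split => //; exists m; split => //.
by apply: le_trans e1; rewrite ler_wpM2r ?sqr_ge0// ler_wpM2r.
Qed.

Definition small_h (h : R) := [/\ 0 < h, h <= 1 & bmin S * h ^+ 2 <= 1 / mmax S].

Lemma good_off_line c s1 s2 h u a b (D th : plane R) : is_sign s1 -> is_sign s2 -> small_h h ->
  th != 0 ->
  (forall x, otri c s1 s2 h x -> cross th (x - D) != 0 -> u x = ndf a b x) ->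
  local_good c s1 s2 h u (ndf a b).
Proof.
move=> hs1 hs2 [h0 h1 h2] th0 hu; split; first last.
- by move=> P Q; exact: (edge_dof_single hs1 hs2 h0 th0 hu).
- by exists a, b.
have [mN N0] := otri_line c D hs1 hs2 h0 th0.
apply: (@local_stable_le _ _ _ _ (c_single S)); first by rewrite /c_local ge_min lexx.
apply: (@local_single _ _ hS _ _ _ _ _ (otri c s1 s2 h `&` [set x | cross th (x - D) != 0]) _ _ _ hs1 hs2 h0 h1 h2 _ mN N0).
- by apply: openI; [exact: otri_open|exact: line_open].
- by move=> x Ox Nx; split => //=; apply/eqP => e; exact: Nx.
- by move=> x [Ox lx]; exact: hu.
Qed.

Lemma good_plain c s1 s2 h u a b : is_sign s1 -> is_sign s2 -> small_h h ->
  (forall x, otri c s1 s2 h x -> u x = ndf a b x) -> local_good c s1 s2 h u (ndf a b).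
Proof.
move=> hs1 hs2 sh hu; apply: (@good_off_line _ _ _ _ _ _ _ 0 (1, 0)) => //.
  by rewrite xpair_eqE oner_eq0.
by move=> x Ox _; exact: hu.
Qed.

Definition side_part c (s1 s2 h : R) D E (s : side) : set (plane R) :=
  [set x | ctri c s1 s2 h x /\
     exists V, [/\ V \in tri_vertices c s1 s2 h, closure (subdomain S s) V &
                   0 < cross (E - D) (V - D) * cross (E - D) (x - D)]].

Lemma curve_closed : closed (Gamma S).
Proof.
have [_ sg _ _ _] := hS; have [c1 c2] := curve_cont sg.
have cg : continuous (gam S).
  move=> t; have := cvg_pair (c1 t) (c2 t).
  have -> : gam S = fun s => ((gam S s).1, (gam S s).2) by apply/funext => s; exact: surjective_pairing.
  exact.
have -> : Gamma S = gam S @` `[0, 1]%classic.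
  apply/seteqP; split => x [t _ <-]; last by exists t.
  have [_ _ per _] := sg; exists (t - (Num.floor t)%:~R).
    have /andP[f0 f1] := fracpart_itv t; rewrite /= in_itv/=; exact/andP/(conj f0)/ltW.
  by rewrite -(periodic_int per _ (Num.floor t)) subrK.
apply: compact_closed; first exact: norm_hausdorff.
apply: continuous_compact; last exact: segment_compact.
exact: continuous_subspaceT.
Qed.

(** The curve is closed, so the closure of [Omega] consists of the curve and the closures of the two
    subdomains. This labels every mesh vertex off the curve, also on the boundary of the domain. *)
Lemma closure_sides x : closure (Omega S) x -> ~ Gamma S x -> exists s, closure (subdomain S s) x.
Proof.
have [_ _ GO [_ _ cov] _] := hS.
have -> : Omega S = subdomain S minus `|` subdomain S plus `|` Gamma S.
  rewrite cov; apply/seteqP; split => y; last by move=> [[]|/GO].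
  by move=> Oy; have [?|?] := pselect (Gamma S y); [right|left].
rewrite !closureU => -[[]|]; [by exists minus|by exists plus|].
by rewrite -((closure_id _).1 curve_closed).
Qed.

Lemma segment_sym P Q : segment P Q = segment Q P.
Proof.
have h A B : segment A B `<=` segment B A.
  move=> x [s]; rewrite /= in_itv/= => /andP[a b] <-; exists (1 - s).
    by rewrite /= in_itv/=; lra.
  by apply: injective_projections; rewrite /= /GRing.scale/=; ring.
by apply/seteqP; split; exact: h.
Qed.

(** Two different edges of a triangle share a vertex, which becomes the corner [V] cut off by the
    chord. *)
Lemma two_edges c (s1 s2 h : R) P Q P' Q' D E : is_sign s1 -> is_sign s2 -> 0 < h ->
  P \in tri_vertices c s1 s2 h -> Q \in tri_vertices c s1 s2 h -> P != Q ->
  P' \in tri_vertices c s1 s2 h -> Q' \in tri_vertices c s1 s2 h -> P' != Q' ->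
  segment P Q <> segment P' Q' -> segment P Q D -> segment P' Q' E ->
  exists V W1 W2 (d e : R), [/\ arranged c s1 s2 h V W1 W2, 0 <= d <= 1, 0 <= e <= 1,
    D = V + d *: (W1 - V) & E = V + e *: (W2 - V)].
Proof.
move=> hs1 hs2 h0 hP hQ PQ hP' hQ' PQ' sd sD sE.
have fin V W1 W2 : arranged c s1 s2 h V W1 W2 -> segment V W1 D -> segment V W2 E ->
    exists V W1 W2 (d e : R), [/\ arranged c s1 s2 h V W1 W2, 0 <= d <= 1, 0 <= e <= 1,
    D = V + d *: (W1 - V) & E = V + e *: (W2 - V)].
  move=> ar [d]; rewrite /= in_itv/= => hd <- [e]; rewrite /= in_itv/= => he <-.
  by exists V, W1, W2, d, e.
have [W ar] := arranged_third hP hQ PQ hs1 hs2 h0.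
have ar' : arranged c s1 s2 h Q P W.
  by case: ar => a1 a2 a3 [b1 b2 b3]; split => //; split => //; rewrite eq_sym.
have sD' : segment Q P D by rewrite segment_sym.
have sE' : segment Q' P' E by rewrite segment_sym.
case: (arranged_mem ar hP') => eP; case: (arranged_mem ar hQ') => eQ; rewrite eP eQ in sd sE sE' PQ';
  first [by move: PQ'; rewrite eqxx | by case: sd | by case: sd; exact: segment_sym
    | exact: fin ar sD sE | exact: fin ar' sD' sE | exact: fin ar sD sE' | exact: fin ar' sD' sE'].
Qed.

Lemma enorm_neq0 P Q : P != Q -> enorm (Q - P) != 0.
Proof.
move=> PQ; rewrite /enorm sqrtr_eq0 -ltNge; have /andP[+ _] := dot_ge_norm (Q - P); apply: lt_le_trans.
by rewrite exprn_gt0// normr_gt0 subr_eq0 eq_sym.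
Qed.

Lemma dot_tangent P Q x : dot x (tangent P Q) = (enorm (Q - P))^-1 * dot x (Q - P).
Proof. by rewrite /tangent /dot /= /GRing.scale/=; ring. Qed.

Lemma CT_facts D E ap bp aq bq (Xm := midpoint D E) : D != E -> CT_rel S D E (ndf ap bp) (ndf aq bq) ->
  [/\ dot (ndf ap bp Xm) (E - D) = dot (ndf aq bq Xm) (E - D),
    be S minus * cross (E - D) (ndf ap bp Xm) = be S plus * cross (E - D) (ndf aq bq Xm) &
    bp / mu S minus = bq / mu S plus].
Proof.
move=> DE [tg cu nm].
have n0 := enorm_neq0 DE.
have i0 : (enorm (E - D))^-1 != 0 by rewrite invr_eq0.
split.
- have sX : segment D E Xm.
    by exists 2^-1; [rewrite /= in_itv/=; apply/andP; split; lra|rewrite /Xm midpoint_seg].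
  apply: (mulfI i0).
  by rewrite -!dot_tangent tg.
- apply: (mulfI i0).
  have nE x : dot x (normal D E) = - ((enorm (E - D))^-1 * cross (E - D) x).
    by rewrite /normal /tangent /dot /cross /= /GRing.scale/=; ring.
  move: nm; rewrite !nE !mulrN => /oppr_inj nm.
  by rewrite mulrCA -nm mulrCA.
- have := cu 0; rewrite !curl_ndf => h.
  have t0 : (-2 : R) != 0 by rewrite oppr_eq0 pnatr_eq0.
  by apply: (mulfI t0); rewrite !mulrA [LHS]mulrC -h mulrC.
Qed.

(** Only a chord that leaves both sides of its line inside the triangle, with different labels,
    needs [local_cut]. In all other configurations [u] agrees off the chord line with one Nedelec
    field and [good_off_line] applies. *)
Lemma good_interface :
  be S plus / be S minus < 1065%:R / 100%:R -> be S minus / be S plus < 1065%:R / 100%:R ->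
  exists2 r, 0 < r & forall c s1 s2 h u D E ap bp aq bq, is_sign s1 -> is_sign s2 -> small_h h -> h <= r ->
    D != E -> Gamma S D -> Gamma S E ->
    (forall V, V \in tri_vertices c s1 s2 h -> Gamma S V -> V = D \/ V = E) ->
    (forall V, V \in tri_vertices c s1 s2 h -> closure (Omega S) V) ->
    (exists V W1 W2 (d e : R), [/\ arranged c s1 s2 h V W1 W2, 0 <= d <= 1, 0 <= e <= 1,
      D = V + d *: (W1 - V) & E = V + e *: (W2 - V)]) ->
    CT_rel S D E (ndf ap bp) (ndf aq bq) ->
    (forall x, otri c s1 s2 h x -> side_part c s1 s2 h D E minus x -> u x = ndf ap bp x) ->
    (forall x, otri c s1 s2 h x -> side_part c s1 s2 h D E plus x -> u x = ndf aq bq x) ->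
    exists w, local_good c s1 s2 h u w.
Proof.
move=> r1 r2.
have bM := bmax0 hS; have cc := c_cut_gt0 hS.
(* The margin [c_cut / 16] of [local_cut] is shared equally between the strip, through [eps], and
   the mesh size. *)
pose eps := Num.min 2^-1 (c_cut S / 32 / (48%:R * bmax S)).
have eps0 : 0 < eps by rewrite lt_min invr_gt0 ltr0n/= !divr_gt0// mulr_gt0.
have eps1 : eps <= 2^-1 by rewrite ge_min lexx.
have eps2 : 48%:R * bmax S * eps <= c_cut S / 32.
  by rewrite mulrC -ler_pdivlMr ?mulr_gt0// ge_min lexx orbT.
have [r r0 hr] := cut_sides hS eps0 eps1.
exists (Num.min (r / 16) (c_cut S / 32 / (7 * bmax S))).
  by rewrite lt_min !divr_gt0// mulr_gt0.
move=> c s1 s2 h u D E ap bp aq bq hs1 hs2 sh hle DE GD GE GV OV [V [W1 [W2 [d [e [ar hd he DE1 EE1]]]]]] CT up uq.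
have [h0 h1 _] := sh.
have hr16 : 16 * h <= r.
  have : h <= r / 16 by apply: le_trans hle _; rewrite ge_min lexx.
  by rewrite ler_pdivlMr// mulrC.
have h7 : 7 * bmax S * h <= c_cut S / 32.
  rewrite mulrC -ler_pdivlMr ?mulr_gt0//; apply: le_trans hle _; rewrite ge_min lexx orbT//.
pose u1 := W1 - V; pose u2 := W2 - V; pose X := cross u1 u2; pose th := E - D.
have [gram Xh ang] := arranged_gram hs1 hs2 h0 ar; rewrite -/u1 -/u2 -/X in gram Xh ang.
have h20 : 0 < h ^+ 2 by rewrite exprn_gt0.
have X0 : X != 0 by rewrite -normr_eq0 Xh gt_eqF.
have X2 : 0 < X ^+ 2 by rewrite lt_neqAle sqr_ge0 andbT eq_sym sqrf_eq0.
have th0 : th != 0 by rewrite subr_eq0 eq_sym.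
have [V0 W10 W20 _] := ar.
have /andP[d0 d1] := hd; have /andP[e0 e1] := he.
pose l x := cross th (x - D).
have lE a b : X * l (V + a *: u1 + b *: u2) = X ^+ 2 * (d * e - a * e - b * d).
  by rewrite /l /th DE1 EE1 /X /u1 /u2 /cross /= /GRing.scale/=; ring.
have lV : X * l V = X ^+ 2 * (d * e).
  have {1}-> : V = V + 0 *: u1 + 0 *: u2 by rewrite !scale0r !addr0.
  by rewrite lE; congr (_ * _); ring.
have lW1 : X * l W1 = X ^+ 2 * - (e * (1 - d)).
  have -> : W1 = V + 1 *: u1 + 0 *: u2 by rewrite scale1r scale0r addr0 /u1 addrC subrK.
  by rewrite lE; congr (_ * _); ring.
have lW2 : X * l W2 = X ^+ 2 * - (d * (1 - e)).
  have -> : W2 = V + 0 *: u1 + 1 *: u2 by rewrite scale1r scale0r addr0 /u2 addrC subrK.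
  by rewrite lE; congr (_ * _); ring.
have lD : l D = 0 by rewrite /l subrr /cross /= !mulr0 subrr.
have lEE : l E = 0 by rewrite /l /th /cross /=; ring.
have label Y : Y \in tri_vertices c s1 s2 h -> X * l Y != 0 -> exists s, closure (subdomain S s) Y.
  move=> hY lY; apply: closure_sides; first exact: OV.
  by move=> /(GV _ hY)[] E'; move: lY; rewrite E' ?lD ?lEE mulr0 eqxx.
pose aF s := if s is minus then ap else aq; pose bF s := if s is minus then bp else bq.
have uF s x Y : otri c s1 s2 h x -> Y \in tri_vertices c s1 s2 h -> closure (subdomain S s) Y ->
    0 < (X * l Y) * (X * l x) -> u x = ndf (aF s) (bF s) x.
  move=> Ox hY cY; rewrite mulrACA -expr2 pmulr_rgt0// => ly.
  have : side_part c s1 s2 h D E s x by split; [exact: otri_ctri|exists Y].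
  by case: s cY => _; [exact: up|exact: uq].
have single s : (forall x, otri c s1 s2 h x -> l x != 0 ->
      exists Y, [/\ Y \in tri_vertices c s1 s2 h, closure (subdomain S s) Y & 0 < (X * l Y) * (X * l x)]) ->
    exists w, local_good c s1 s2 h u w.
  move=> hs; exists (ndf (aF s) (bF s)); apply: (good_off_line hs1 hs2 sh th0) => x Ox lx.
  by have [Y [hY cY ly]] := hs _ Ox lx; exact: uF Ox hY cY ly.
(* The chord starts at [V] and lies in the edge [V W2], so the open triangle is entirely on the side
   of [W1]; the case [e = 0] is symmetric. *)
have [ed0|dn0] := eqVneq d 0.
  have e0' : 0 < e.
    rewrite lt_neqAle e0 andbT; apply: contra DE => /eqP e00.
    by rewrite DE1 EE1 ed0 -e00 !scale0r.
  have l1 : X * l W1 < 0 by rewrite lW1 ed0 subr0 mulr1 pmulr_rlt0// oppr_lt0.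
  have [s cs] := label _ W10 (ltr0_neq0 l1).
  apply: (single s) => x Ox _; exists W1; split => //.
  have [a [b [xE o _]]] := arranged_bary x hs1 hs2 h0 ar; have [a0 b0' _] := o.1 Ox.
  rewrite xE lE ed0 nmulr_rgt0// pmulr_rlt0// mul0r mulr0 subr0 sub0r oppr_lt0; exact: mulr_gt0.
have [ee0|en0] := eqVneq e 0.
  have d0' : 0 < d by rewrite lt_neqAle d0 andbT eq_sym.
  have l1 : X * l W2 < 0 by rewrite lW2 ee0 subr0 mulr1 pmulr_rlt0// oppr_lt0.
  have [s cs] := label _ W20 (ltr0_neq0 l1).
  apply: (single s) => x Ox _; exists W2; split => //.
  have [a [b [xE o _]]] := arranged_bary x hs1 hs2 h0 ar; have [a0 b0' _] := o.1 Ox.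
  rewrite xE lE ee0 nmulr_rgt0// pmulr_rlt0// !mulr0 subr0 sub0r oppr_lt0; exact: mulr_gt0.
have d0' : 0 < d by rewrite lt_neqAle d0 andbT eq_sym.
have e0' : 0 < e by rewrite lt_neqAle e0 andbT eq_sym.
have lVp : 0 < X * l V by rewrite lV; apply: mulr_gt0 => //; exact: mulr_gt0.
have [sA cA] := label _ V0 (lt0r_neq0 lVp).
(* The chord is the whole edge [W1 W2], and the open triangle is on the side of [V]. *)
have [de1|de1] := boolP ((d == 1) && (e == 1)).
  move/andP: de1 => [/eqP ed1 /eqP ee1].
  apply: (single sA) => x Ox _; exists V; split => //.
  have [a [b [xE o _]]] := arranged_bary x hs1 hs2 h0 ar; have [a0 b0' ab] := o.1 Ox.
  by rewrite xE lE ed1 ee1 pmulr_rgt0// pmulr_rgt0//; clear -ab; lra.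
have de : d < 1 \/ e < 1.
  by move: de1; rewrite negb_and => /orP[] ?; [left|right]; rewrite lt_neqAle; apply/andP.
have [W [hW lW]] : exists W, W \in tri_vertices c s1 s2 h /\ X * l W < 0.
  case: de => hh; [exists W1|exists W2]; split => //.
    by rewrite lW1 pmulr_rlt0// oppr_lt0 mulr_gt0// subr_gt0.
  by rewrite lW2 pmulr_rlt0// oppr_lt0 mulr_gt0// subr_gt0.
have [sB cB] := label _ hW (ltr0_neq0 lW).
have sgn x : l x != 0 -> 0 < (X * l V) * (X * l x) \/ 0 < (X * l W) * (X * l x).
  move=> lx; have nz : X * l x != 0 by rewrite mulf_neq0.
  case: (ltrgtP (X * l x) 0) => lx0.
  - by right; rewrite nmulr_rgt0.
  - by left; rewrite pmulr_rgt0.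
  - by rewrite lx0 eqxx in nz.
(* With equal labels on both sides of the chord, the part of the triangle assigned to that label is
   everything off the chord line. *)
have [sAB|sAB] := pselect (sA = sB).
  subst sB; apply: (single sA) => x Ox lx.
  by case: (sgn _ lx) => ?; [exists V|exists W].
have [ct1 ct2 ct3] := CT_facts DE CT.
have ctF : [/\ dot (ndf (aF sA) (bF sA) (midpoint D E)) (E - D) = dot (ndf (aF sB) (bF sB) (midpoint D E)) (E - D),
    be S sA * cross (E - D) (ndf (aF sA) (bF sA) (midpoint D E)) =
    be S sB * cross (E - D) (ndf (aF sB) (bF sB) (midpoint D E)) &
    bF sA / mu S sA = bF sB / mu S sB].
  by clear -ct1 ct2 ct3 sAB; case: sA sB sAB => -[].
have [f1 f2 f3] := ctF.
have hd' : 0 < d <= 1 by rewrite d0'.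
have he' : 0 < e <= 1 by rewrite e0'.
have uA x : otri c s1 s2 h x -> 0 < X * l x -> u x = ndf (aF sA) (bF sA) x.
  by move=> Ox lx; apply: (uF _ _ V) => //; exact: mulr_gt0.
have uB x : otri c s1 s2 h x -> X * l x < 0 -> u x = ndf (aF sB) (bF sB) x.
  by move=> Ox lx; apply: (uF _ _ W) => //; rewrite nmulr_rgt0.
have cD : ctri c s1 s2 h D by rewrite DE1; apply: tri_segment.
have cE : ctri c s1 s2 h E by rewrite EE1; apply: tri_segment.
have cd Y : ctri c s1 s2 h Y -> `|Y - D| <= h by move=> cY; exact: (ctri_dist hs1 hs2 cY cD).
have cVD := cd _ (tri_vertex_ctri hs1 hs2 h0 V0).
have cWD := cd _ (tri_vertex_ctri hs1 hs2 h0 hW).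
have DD : `|D - D| <= h by rewrite subrr normr0 ltW.
have nG Y : X * l Y != 0 -> Y \in tri_vertices c s1 s2 h -> ~ Gamma S Y.
  by move=> lY hY /(GV _ hY)[] E'; move: lY; rewrite E' ?lD ?lEE mulr0 eqxx.
have GVn := nG _ (lt0r_neq0 lVp) V0; have GWn := nG _ (ltr0_neq0 lW) hW.
have angle : 0 <= dot (D - V) (E - V) <= `|cross (D - V) (E - V)|.
  have -> : dot (D - V) (E - V) = d * e * dot u1 u2.
    by rewrite DE1 EE1 /u1 /u2 /dot /= /GRing.scale/=; ring.
  have -> : cross (D - V) (E - V) = d * e * X.
    by rewrite DE1 EE1 /X /u1 /u2 /cross /= /GRing.scale/=; ring.
  have /andP[g1 g2] := ang; have de0 : 0 <= d * e by rewrite mulr_ge0.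
  by rewrite normrM (ger0_norm de0) mulr_ge0//= ler_wpM2l.
have sides x : otri c s1 s2 h x ->
    (4 * eps * h * `|th| * h ^+ 2 < X * l x -> subdomain S sA x) /\
    (X * l x < - (4 * eps * h * `|th| * h ^+ 2) -> subdomain S sB x).
  move=> Ox; have xD := cd _ (otri_ctri Ox).
  (* [cut_sides] requires [V] on the positive side of the oriented chord; for a negatively oriented
     corner it is applied to the reversed chord. *)
  case: (ltrP 0 X) => Xs.
    have XE : X = h ^+ 2 by rewrite -Xh gtr0_norm.
    have pV : 0 < l V by rewrite -(pmulr_rgt0 _ Xs).
    have pW : l W < 0 by rewrite -(pmulr_rlt0 _ Xs).
    have [g1 g2] := hr h D D E V W sA sB h0 hr16 GD GE DE DD (cd _ cE) cVD cWD GVn GWn cA cB sAB angle pV pW x xD.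
    by rewrite XE [h ^+ 2 * _]mulrC -mulNr !ltr_pM2r.
  have Xs' : X < 0 by rewrite lt_neqAle X0.
  have XE : X = - h ^+ 2 by rewrite -Xh ltr0_norm// opprK.
  have lN Y : cross (D - E) (Y - E) = - l Y by rewrite /l /th /cross /=; ring.
  have pV : 0 < cross (D - E) (V - E) by rewrite lN oppr_gt0 -(nmulr_rgt0 _ Xs').
  have pW : cross (D - E) (W - E) < 0 by rewrite lN oppr_lt0 -(nmulr_rlt0 _ Xs').
  have ED : E != D by rewrite eq_sym.
  have angle' : 0 <= dot (E - V) (D - V) <= `|cross (E - V) (D - V)|.
    have -> : dot (E - V) (D - V) = dot (D - V) (E - V) by rewrite /dot; ring.
    have -> : cross (E - V) (D - V) = - cross (D - V) (E - V) by rewrite /cross; ring.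
    by rewrite normrN.
  have [g1 g2] := hr h D E D V W sA sB h0 hr16 GE GD ED (cd _ cE) DD cVD cWD GVn GWn cA cB sAB angle' pV pW x xD.
  move: g1 g2; rewrite lN distrC -/th => g1 g2.
  by rewrite XE mulNr -mulrN [h ^+ 2 * _]mulrC -mulNr !ltr_pM2r.
have small : 48%:R * bmax S * eps + 7 * bmax S * h <= c_cut S / 16.
  by clear -eps2 h7; lra.
rewrite /l /th in uA uB sides.
subst D E.
exists (cut_test V W1 W2 d e (aF sA) (bF sA) (aF sB) (bF sB)); split.
- apply: (@local_stable_le _ _ _ _ (c_cut S / 16)); first by rewrite /c_local ge_min lexx orbT.
  apply: (local_cut hS hs1 hs2 h0 h1 ar hd' he' (ltW eps0) sAB r1 r2 f1 f2 f3 uA uB _ _ small).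
  + by move=> x Ox; case: (sides _ Ox).
  + by move=> x Ox; case: (sides _ Ox).
- have [a ea] := cut_test_ndf V W1 W2 d e (aF sA) (bF sA) (aF sB) (bF sB).
  by eexists; eexists; exact: ea.
- exact: (edge_dof_cut hs1 hs2 h0 ar hd' he' de f1 uA uB).
Qed.

End LocalGood.

(** * The mesh *)

Section Splitting.
Context (R : realType).
Implicit Types (O A : set (plane R)) (f : plane R -> R).

Lemma ess_Rintegral_sum (I : Type) (r : seq I) O (g : I -> plane R -> R) : fin_area O ->
  (forall i, ess_bounded O (g i)) ->
  ess_bounded O (fun x => \sum_(i <- r) g i x) /\
  Rintegral (area R) O (fun x => \sum_(i <- r) g i x) = \sum_(i <- r) Rintegral (area R) O (g i).
Proof.
move=> fO bg; elim: r => [|i r [IH1 IH2]].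
  have -> : (fun x : plane R => \sum_(i <- [::]) g i x) = fun=> 0 by apply/funext => x; rewrite big_nil.
  by rewrite big_nil Rintegral_const// mul0r; split => //; exact: ess_bounded_cst.
have -> : (fun x : plane R => \sum_(j <- i :: r) g j x) = fun x => g i x + \sum_(j <- r) g j x.
  by apply/funext => x; rewrite big_cons.
by rewrite big_cons ess_RintegralD// IH2; split => //; exact: ess_boundedD.
Qed.

Lemma Rintegral_indicM O A f : A `<=` O ->
  Rintegral (area R) O (fun x => \1_A x * f x) = Rintegral (area R) A f.
Proof.
move=> AO; rewrite -{2}(setIidr AO) Rintegral_mkcondr; congr Rintegral.
by apply/funext => x; rewrite patchE indicE; case: (_ \in _); rewrite ?mul1r ?mul0r.
Qed.

Section Pieces.
Variables (I : finType) (O : set (plane R)) (A : I -> set (plane R)).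
Hypotheses (fO : fin_area O) (mA : forall i, measurable (A i)) (AO : forall i, A i `<=` O)
  (dA : forall i j x, A i x -> A j x -> i = j)
  (tA : total_area O = \sum_i total_area (A i)).

Definition rest : set (plane R) := O `\` \bigcup_(i in [set: I]) A i.

Lemma rest_measurable : measurable rest.
Proof.
case: fO => mO _; apply: measurableD => //.
by apply: fin_bigcup_measurable => //; exact: finite_finset.
Qed.

Lemma sum_indic x (f : plane R -> R) : O x -> ~ rest x ->
  f x = \sum_i \1_(A i) x * f x.
Proof.
move=> Ox nr; have [i Ai] : exists i, A i x.
  apply: contrapT => h; apply: nr; split => // -[i _ Ai]; apply: h; by exists i.
rewrite (bigD1 i)//= big1; first by rewrite indicE mem_set// mul1r addr0.
move=> j ji; rewrite indicE memNset ?mul0r// => Aj.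
by move/eqP: ji; apply; exact: dA Aj Ai.
Qed.

(** The areas of the pieces already add up to that of [O], so additivity leaves area zero for the
    rest; the geometry of the edges is not examined. *)
Lemma rest_null : area R rest = 0%E.
Proof.
have mr := rest_measurable; have rO : rest `<=` O by move=> x [].
have b1 i : ess_bounded O (fun x => \1_(A i) x * (1 : R)).
  by apply: ess_boundedM; [exact: ess_bounded_indic|exact: ess_bounded_cst].
have [bs es] := ess_Rintegral_sum (index_enum I) fO b1.
have : total_area O = \sum_i total_area (A i) + total_area rest.
  rewrite -[LHS]mul1r -Rintegral_const//.
  have -> : (fun=> 1) = fun x => (if x \in O then \sum_i \1_(A i) x * (1 : R) + \1_rest x else 1).
    apply/funext => x; case: ifPn => // /set_mem Ox.
    rewrite indicE; have [/set_mem rx|/negP rx] := boolP (x \in rest).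
      rewrite big1 ?add0r// => i _; rewrite indicE memNset ?mul0r// => Ai.
      by case: rx => _; apply; exists i.
    by rewrite addr0 -(@sum_indic x (fun=> 1))// => rx'; apply: rx; exact: mem_set.
  have m0 : measurable (set0 : set (plane R)) by [].
  have z0 : area R set0 = 0%E by rewrite measure0.
  rewrite (@Rintegral_ext_off_null _ _ _ (area R) O set0 _ (fun x => \sum_i \1_(A i) x * (1 : R) + \1_rest x))//.
    rewrite ess_RintegralD//; last exact: ess_bounded_indic.
    rewrite es Rintegral_indic//; congr (_ + _); apply: eq_bigr => i _.
    by rewrite Rintegral_indicM// Rintegral_cst ?mul1r//; exact: mA.
  by move=> x Ox _; rewrite mem_set.
rewrite tA -[LHS]addr0 => /addrI/esym.
rewrite /total_area => h; apply/eqP; rewrite -(@fineK _ (area R rest)) ?h//.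
rewrite ge0_fin_numE ?measure_ge0//; case: fO => mO; apply: le_lt_trans.
by apply: le_measure; rewrite ?inE.
Qed.

Lemma Rintegral_pieces f : ess_bounded O f ->
  Rintegral (area R) O f = \sum_i Rintegral (area R) (A i) f.
Proof.
move=> bf.
have b1 i : ess_bounded O (fun x => \1_(A i) x * f x).
  by apply: ess_boundedM => //; exact: ess_bounded_indic.
have [_ es] := ess_Rintegral_sum (index_enum I) fO b1.
under [RHS]eq_bigr => i _ do rewrite -(Rintegral_indicM _ (@AO i)).
rewrite -es; apply: (@Rintegral_ext_off_null _ _ _ (area R) O rest).
- exact: rest_measurable.
- exact: rest_null.
- by move=> x Ox nx; exact: sum_indic.
Qed.

Lemma ess_bounded_pieces f : (forall i, ess_bounded (A i) f) -> ess_bounded O f.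
Proof.
move=> bf.
have b1 i : ess_bounded O (fun x => \1_(A i) x * f x).
  have [g [N [K [mN N0 mg gK fg]]]] := bf i.
  apply: (@ess_bounded_ext _ _ N _ (fun x => \1_(A i) x * g x)) => //.
    move=> x _ Nx; rewrite indicE; have [/set_mem Ai|] := boolP (x \in A i); last by rewrite !mul0r.
    by rewrite fg.
  apply: ess_boundedM; first exact: ess_bounded_indic.
  by exists g, set0, K; split => //.
have [bs _] := ess_Rintegral_sum (index_enum I) fO b1.
apply: ess_bounded_ext bs; [exact: rest_measurable|exact: rest_null|].
by move=> x Ox nx; exact: sum_indic.
Qed.

End Pieces.
End Splitting.

Local Notation elt M := ('I_(mesh_n1 M) * 'I_(mesh_n2 M) * bool)%type.

Section Mesh.
Context (R : realType) (S : interface_data R) (M : cartesian_mesh S).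
Local Notation h := (mesh_size M).
Local Notation diag := (mesh_diag M).
Implicit Types (T : elt M).

(** Each mesh triangle in normal form: [(ci, cj)] is the grid index of its right-angled corner, and
    [sg1], [sg2] are the directions of its legs. The flag [T.2] tells the upper triangle from the
    lower one, and its comparison with the diagonal tells on which vertical side of the square the
    corner lies. *)
Definition sg1 T : R := if diag == T.2 then 1 else -1.
Definition sg2 T : R := if T.2 then -1 else 1.
Definition ci T : nat := T.1.1 + (diag != T.2).
Definition cj T : nat := T.1.2 + T.2.
Definition corner T := grid_point M (ci T) (cj T).
Definition tri T := otri (corner T) (sg1 T) (sg2 T) h.
Definition ctri_of T := ctri (corner T) (sg1 T) (sg2 T) h.
Definition tri_verts T := tri_vertices (corner T) (sg1 T) (sg2 T) h.

Lemma sg1P T : is_sign (sg1 T).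
Proof. by rewrite /sg1; case: ifP => _; [left|right]. Qed.
Lemma sg2P T : is_sign (sg2 T).
Proof. by rewrite /sg2; case: ifP => _; [right|left]. Qed.
Lemma h_gt0 : 0 < h. Proof. exact: mesh_size_gt0. Qed.

Lemma mem_vertices T : (vertices T : seq _) =i tri_verts T.
Proof.
case: T => -[i j] b x; rewrite /tri_verts /tri_vertices /corner /ci /cj /sg1 /sg2 /vertices /=.
pose p : R := (corner_lo S).1 + i%:R * h; pose q : R := (corner_lo S).2 + j%:R * h.
have a1 : (corner_lo S).1 + i.+1%:R * h = p + h by rewrite -natr1 /p; ring.
have b1 : (corner_lo S).2 + j.+1%:R * h = q + h by rewrite -natr1 /q; ring.
have k1 (t : R) : t + h + -1 * h = t by ring.
case: diag; case: b; rewrite /grid_point /= ?addn0 ?addn1 ?a1 ?b1 -/p -/q !inE ?k1 ?mul1r;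
  do 3 case: (x == _) => //=.
Qed.

Lemma tri_verts_uniq T : uniq (tri_verts T).
Proof. exact: (tri_vertices_uniq _ (sg1P T) (sg2P T) h_gt0). Qed.

Lemma triangleE T : triangle T = ctri_of T.
Proof.
have V k : tnth (vertices T) k \in tri_verts T by rewrite -mem_vertices mem_tnth.
have uv : uniq (vertices T : seq _).
  apply: (leq_size_uniq (tri_verts_uniq T)); last by rewrite size_tuple.
  by move=> x; rewrite mem_vertices.
have nd (k l : 'I_3) : k != l -> tnth (vertices T) k != tnth (vertices T) l.
  by apply: contraNneq => /eqP; rewrite !(tnth_nth 0) nth_uniq ?size_tuple.
pose k0 : 'I_3 := inord 0; pose k1 : 'I_3 := inord 1; pose k2 : 'I_3 := inord 2.
have ar : arranged (corner T) (sg1 T) (sg2 T) h (tnth (vertices T) k0) (tnth (vertices T) k1) (tnth (vertices T) k2).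
  by split => //; split; apply: nd; rewrite -val_eqE /= !inordK.
have bs (F : 'I_3 -> plane R) : \sum_k F k = F k0 + F k1 + F k2.
  rewrite !big_ord_recl big_ord0 addr0 addrA; congr (_ + _ + _); congr F; apply: val_inj; rewrite /= !inordK //.
have bs' (F : 'I_3 -> R) : \sum_k F k = F k0 + F k1 + F k2.
  rewrite !big_ord_recl big_ord0 addr0 addrA; congr (_ + _ + _); congr F; apply: val_inj; rewrite /= !inordK //.
apply/seteqP; split => x.
  move=> [l [l0 l1 xE]].
  have [a [b [xE' _ o]]] := arranged_bary x (sg1P T) (sg2P T) h_gt0 ar.
  have [_ Xh _] := arranged_gram (sg1P T) (sg2P T) h_gt0 ar.
  have X0 : cross (tnth (vertices T) k1 - tnth (vertices T) k0) (tnth (vertices T) k2 - tnth (vertices T) k0) != 0.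
    by rewrite -normr_eq0 Xh gt_eqF// exprn_gt0// h_gt0.
  rewrite bs' in l1; rewrite bs in xE.
  have [ea eb] : a = l k1 /\ b = l k2.
    apply: (bary_unique (V := tnth (vertices T) k0) X0); rewrite -xE' xE.
    have -> : l k0 = 1 - l k1 - l k2 by rewrite -l1; ring.
    by apply: injective_projections; rewrite /= /GRing.scale/=; ring.
  have p0 := l0 k0; have p1 := l0 k1; have p2 := l0 k2.
  apply/o; rewrite ea eb; split => //; lra.
move=> cx; have [a [b [xE _ o]]] := arranged_bary x (sg1P T) (sg2P T) h_gt0 ar.
have [a0 b0 ab] := o.1 cx.
exists (fun k => if k == k0 then 1 - a - b else if k == k1 then a else b).
have k10 : (k1 == k0) = false by apply/negbTE; rewrite -val_eqE /= !inordK.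
have k20 : (k2 == k0) = false by apply/negbTE; rewrite -val_eqE /= !inordK.
have k21 : (k2 == k1) = false by apply/negbTE; rewrite -val_eqE /= !inordK.
split.
- by move=> k; case: ifP => _; [lra|case: ifP].
- by rewrite bs' eqxx k10 k20 k21 eqxx; ring.
- rewrite bs eqxx k10 k20 k21 eqxx xE.
  by apply: injective_projections; rewrite /= /GRing.scale/=; ring.
Qed.

Lemma interior_triangle T : interior (triangle T) = tri T.
Proof. by rewrite triangleE interior_ctri//; [exact: sg1P|exact: sg2P]. Qed.

Lemma tri_cell T x (a := x.1 - (corner_lo S).1 - T.1.1%:R * h)
    (b := x.2 - (corner_lo S).2 - T.1.2%:R * h) : tri T x ->
  [/\ 0 < a < h, 0 < b < h &
   if diag then (if T.2 then a < b else b < a) else (if T.2 then h < a + b else a + b < h)].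
Proof.
move: @a @b; case: T => -[i j] t /=.
rewrite /tri /otri /leg1 /leg2 /corner /ci /cj /sg1 /sg2 /grid_point /= => -[].
have hp := h_gt0.
by case: diag; case: t; rewrite /= ?addn0 ?natrD /= => *; split; try (apply/andP; split); lra.
Qed.

Lemma tri_sub T : tri T `<=` Omega S.
Proof.
move=> x /tri_cell[/andP[a0 a1] /andP[b0 b1] _].
have w := mesh_width M; have g := mesh_height M; have hp := h_gt0.
have li : (T.1.1.+1)%:R * h <= (mesh_n1 M)%:R * h by rewrite ler_pM2r// ler_nat.
have lj : (T.1.2.+1)%:R * h <= (mesh_n2 M)%:R * h by rewrite ler_pM2r// ler_nat.
have i0 : 0 <= (T.1.1)%:R * h by rewrite mulr_ge0// ltW.
have j0 : 0 <= (T.1.2)%:R * h by rewrite mulr_ge0// ltW.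
rewrite -natr1 in li; rewrite -natr1 in lj.
by split; rewrite /= in_itv/=; apply/andP; split; lra.
Qed.

Lemma tri_disjoint T T' x : tri T x -> tri T' x -> T = T'.
Proof.
move=> /tri_cell[/andP[a0 a1] /andP[b0 b1] t] /tri_cell[/andP[a0' a1'] /andP[b0' b1'] t'].
have hp := h_gt0.
have le (i i' : nat) (y : R) : 0 < y - i%:R * h -> y - i'%:R * h < h -> (i <= i')%N.
  move=> y1 y2; rewrite -ltnS -(@ltr_nat R) -(ltr_pM2r hp) -natr1; lra.
have ei : T.1.1 = T'.1.1 by apply/val_inj/anti_leq/andP; split; apply: le; eassumption.
have ej : T.1.2 = T'.1.2 by apply/val_inj/anti_leq/andP; split; apply: le; eassumption.
have eb : T.2 = T'.2.
  by move: t t'; rewrite ei ej; case: diag; case: (T.2); case: (T'.2) => // *; exfalso; lra.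
by move: ei ej eb; case: T t a0 a1 b0 b1 => -[i j] t; case: T' t' a0' a1' b0' b1' => -[i' j'] t' /= * ; congr (_, _, _).
Qed.

Lemma tri_area T : fin_area (tri T) /\ total_area (tri T) = h ^+ 2 / 2.
Proof. by apply: otri_area; [exact: sg1P|exact: sg2P|exact: h_gt0]. Qed.

Lemma Omega_area : fin_area (Omega S) /\ total_area (Omega S) = \sum_(T : elt M) total_area (tri T).
Proof.
have w := mesh_width M; have g := mesh_height M; have hp := h_gt0.
have le1 : (corner_lo S).1 <= (corner_hi S).1 by rewrite -subr_ge0 w mulr_ge0// ltW.
have le2 : (corner_lo S).2 <= (corner_hi S).2 by rewrite -subr_ge0 g mulr_ge0// ltW.
have mO : measurable (Omega S) by apply: measurableX.
have fO : fin_area (Omega S).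
  split => //; apply: (@area_fin_box _ _ (corner_lo S).1 (corner_hi S).1 (corner_lo S).2 (corner_hi S).2) => //.
  move=> x []; rewrite /= !in_itv/= => /andP[? ?] /andP[? ?]; split; apply/andP; split; exact: ltW.
split => //.
under eq_bigr => T _ do rewrite (tri_area T).2.
rewrite sumr_const card_prod card_prod !card_ord card_bool.
have -> : total_area (Omega S) = ((corner_hi S).1 - (corner_lo S).1) * ((corner_hi S).2 - (corner_lo S).2).
  rewrite /total_area /Omega product_measure1E//= fineM; first by rewrite !leb_itv_oo.
  - by rewrite lebesgue_measure_itv/=; case: ifP.
  - by rewrite lebesgue_measure_itv/=; case: ifP.
by rewrite w g -[RHS]mulr_natr !natrM; field.
Qed.

Lemma mesh_pieces (f : plane R -> R) :
  ((forall T, ess_bounded (tri T) f) -> ess_bounded (Omega S) f) /\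
  (ess_bounded (Omega S) f ->
    Rintegral (area R) (Omega S) f = \sum_(T : elt M) Rintegral (area R) (tri T) f).
Proof.
have [fO tO] := Omega_area.
have m T : measurable (tri T) by exact: otri_measurable.
split.
  exact: (ess_bounded_pieces fO m (@tri_sub) (@tri_disjoint) tO).
exact: (Rintegral_pieces fO m (@tri_sub) (@tri_disjoint) tO).
Qed.

End Mesh.

(** * Mean tangential traces and conformity of the local test fields *)

Section Steps.
Context (R : realType).
Local Notation leb := (@lebesgue_measure R).

Lemma null_points (p q r : R) : measurable [set x | [\/ x = p, x = q | x = r]] /\
  leb [set x | [\/ x = p, x = q | x = r]] = 0%E.
Proof.
have -> : [set x | [\/ x = p, x = q | x = r]] = [set p] `|` [set q] `|` [set r].
  apply/seteqP; split => x /=; first by case; [left; left|left; right|right].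
  by move=> [[]|]; [constructor 1|constructor 2|constructor 3].
have m (t : R) : measurable [set t] by exact: measurable_set1.
split; first by apply: measurableU => //; exact: measurableU.
rewrite measureU0//; [|exact: measurableU|exact: lebesgue_measure_set1].
by rewrite measureU0//; exact: lebesgue_measure_set1.
Qed.

Definition step_fun (d k1 k2 s : R) : R := if s <= d then k1 else k2.

Lemma step_integral (d k1 k2 : R) : 0 <= d <= 1 ->
  leb.-integrable `[0, 1] (EFin \o step_fun d k1 k2) /\
  Rintegral leb `[0, 1] (step_fun d k1 k2) = d * k1 + (1 - d) * k2.
Proof.
move=> /andP[d0 d1].
have E : step_fun d k1 k2 = fun s => k2 + (k1 - k2) * \1_(`]-oo, d]%classic) s.
  apply/funext => s; rewrite /step_fun indicE mem_setE in_itv/=.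
  by case: ifP => _ /=; ring.
have mf : measurable_fun setT (step_fun d k1 k2).
  rewrite E; apply: measurable_funD; first exact: measurable_cst.
  by apply: measurable_funM; [exact: measurable_cst|exact: measurable_indic].
have l01 : leb `[0, 1]%classic = 1%:E by rewrite lebesgue_measure_itv/= lte_fin ltr01 -EFinB subr0.
have fl : (leb `[0%R, 1%R]%classic < +oo)%E by rewrite l01 ltry.
have ld : fine (leb `[0, d]%classic) = d.
  rewrite lebesgue_measure_itv/= lte_fin; case: ltP => /=; first by rewrite subr0.
  by move=> d0'; apply/eqP; rewrite eq_le d0 d0'.
have bi (f : R -> R) K : measurable_fun setT f -> (forall x, `|f x| <= K) ->
    leb.-integrable `[0, 1] (EFin \o f).
  move=> mf' fK; apply: (@bounded_integrable _ _ _ leb `[0, 1]%classic f K) => //.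
  exact: measurable_funTS.
have i1 : leb.-integrable `[0, 1] (EFin \o fun=> k2).
  by apply: (bi _ `|k2|); [exact: measurable_cst|].
have m2 : measurable_fun setT (\1_(`]-oo, d]%classic) : R -> R) by exact: measurable_indic.
have i2 : leb.-integrable `[0, 1] (EFin \o (\1_(`]-oo, d]%classic) : R -> R)).
  by apply: (bi _ 1) => // x; rewrite indicE; case: (_ \in _); rewrite ?normr1 ?normr0.
split.
  apply: (bi _ (Num.max `|k1| `|k2|)) => // x; rewrite /step_fun le_max; case: ifP => _; rewrite lexx ?orbT//.
rewrite E.
have i3 : leb.-integrable `[0, 1] (EFin \o fun s => (k1 - k2) * \1_(`]-oo, d]%classic) s).
  apply: (bi _ `|k1 - k2|); first by apply: measurable_funM; [exact: measurable_cst|].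
  by move=> x; rewrite indicE normrM; case: (_ \in _); rewrite ?normr1 ?normr0 ?mulr1 ?mulr0.
have c1 : Rintegral leb `[0, 1] (fun=> k2) = k2 by rewrite Rintegral_cst// [X in fine X]l01 mulr1.
rewrite RintegralD// c1 RintegralZl//.
have -> : Rintegral leb `[0, 1] (\1_(`]-oo, d]%classic) : R -> R) = d.
  rewrite /Rintegral integral_indic//.
  have -> : `]-oo, d]%classic `&` `[0, 1]%classic = `[0, d]%classic :> set R.
    by apply/seteqP; split => x /=; rewrite !in_itv/=; [move=> [? /andP[? ?]]; exact/andP|
      move=> /andP[? xd]; split => //; apply/andP; split => //; exact: le_trans xd d1].
  exact: ld.
by ring.
Qed.

Lemma ae_step (f : R -> R) (d k1 k2 : R) :
  (forall s, 0 < s < 1 -> (s < d -> f s = k1) /\ (d < s -> f s = k2)) ->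
  forall s, `[0, 1]%classic s -> ~ [\/ s = 0, s = 1 | s = d] -> f s = step_fun d k1 k2 s.
Proof.
move=> h s; rewrite /= in_itv/= => /andP[s0 s1] n.
have n0 : s != 0 by apply/eqP => e; apply: n; constructor 1.
have n1 : s != 1 by apply/eqP => e; apply: n; constructor 2.
have nd : s != d by apply/eqP => e; apply: n; constructor 3.
have s01 : 0 < s < 1 by rewrite (lt_neqAle 0) (eq_sym 0) n0 s0 lt_neqAle n1.
have [h1 h2] := h s s01.
rewrite /step_fun; case: (ltrgtP s d) => e; [exact: h1|exact: h2|by rewrite e eqxx in nd].
Qed.

End Steps.

Section Conforming.
Context (R : realType) (S : interface_data R) (M : cartesian_mesh S).
Local Notation h := (mesh_size M).
Implicit Types (T : elt M) (P Q : plane R) (u : vfield R).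
Local Notation leb := (@lebesgue_measure R).

Lemma trace_tri T u x : trace T u x = trace_on (tri T) u x.
Proof. by rewrite /trace interior_triangle. Qed.

(** Off finitely many points both traces are step functions whose integrals over [0, 1] are the two
    moments; the jump condition on the edge says that these integrals agree. *)
Lemma edge_dof_eq T1 T2 u P Q k1 k2 : P != Q ->
  edge_dof (tri T1) u P Q k1 -> edge_dof (tri T2) u P Q k2 ->
  line_integral P Q (fun x => dot (trace T1 u x - trace T2 u x) (tangent P Q)) = 0 -> k1 = k2.
Proof.
move=> PQ [d [p1 [p2 [hd -> hp]]]] [e [q1 [q2 [he -> hq]]]] L.
have e0 := enorm_neq0 PQ.
have [i1 E1] := step_integral p1 p2 hd; have [i2 E2] := step_integral q1 q2 he.
have [mN1 N1] := null_points 0 1 d; have [mN2 N2] := null_points 0 1 e.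
apply/eqP; rewrite -subr_eq0 -E1 -E2 -RintegralB//.
have F : Rintegral leb `[0, 1] (fun s => dot (trace T1 u (P + s *: (Q - P)) - trace T2 u (P + s *: (Q - P))) (tangent P Q)) = 0.
  by move/eqP: L; rewrite /line_integral mulf_eq0 (negbTE e0) => /eqP.
suff -> : Rintegral leb `[0, 1] (fun s => step_fun d p1 p2 s - step_fun e q1 q2 s) =
   enorm (Q - P) * Rintegral leb `[0, 1] (fun s => dot (trace T1 u (P + s *: (Q - P)) - trace T2 u (P + s *: (Q - P))) (tangent P Q)).
  by rewrite F mulr0.
have -> : Rintegral leb `[0, 1] (fun s => dot (trace T1 u (P + s *: (Q - P)) - trace T2 u (P + s *: (Q - P))) (tangent P Q)) =
   Rintegral leb `[0, 1] (fun s => (enorm (Q - P))^-1 * (step_fun d p1 p2 s - step_fun e q1 q2 s)).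
  apply: (@Rintegral_ext_off_null _ _ _ leb `[0, 1]%classic _ _ _ (measurableU _ _ mN1 mN2)); first by rewrite measureU0.
  move=> s s01 /not_orP[n1 n2].
  rewrite dot_tangent -(ae_step hp s01 n1) -(ae_step hq s01 n2) !trace_tri.
  by rewrite /dot /=; ring.
rewrite RintegralZl//; first by rewrite mulrA mulfV// mul1r.
have ib : leb.-integrable `[0, 1] ((EFin \o step_fun d p1 p2) \- (EFin \o step_fun e q1 q2))%E.
  by apply: integrableB.
by apply: eq_integrable ib.
Qed.

Lemma edge_dof_zero T u P Q k : P != Q -> edge_dof (tri T) u P Q k ->
  {ae leb, forall s, s \in `[0, 1] -> dot (trace T u (P + s *: (Q - P))) (tangent P Q) = 0} -> k = 0.
Proof.
move=> PQ [d [p1 [p2 [hd -> hp]]]] [N [mN N0 aeN]].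
have [_ <-] := step_integral p1 p2 hd.
have e0 := enorm_neq0 PQ.
have [mN1 N1] := null_points 0 1 d.
transitivity (Rintegral leb `[0, 1] (fun=> 0 : R)); last by rewrite Rintegral_cst// mul0r.
apply: (@Rintegral_ext_off_null _ _ _ leb `[0, 1]%classic _ _ _ (measurableU _ _ mN1 mN)); first by rewrite measureU0.
move=> s s01 /not_orP[n1 n2].
rewrite -(ae_step hp s01 n1).
have : dot (trace T u (P + s *: (Q - P))) (tangent P Q) = 0.
  by apply: contrapT => hn; apply: n2; apply: aeN => /= hs; apply: hn; exact: hs.
rewrite dot_tangent trace_tri => /eqP; rewrite mulf_eq0 invr_eq0 (negbTE e0) => /eqP //.
Qed.

End Conforming.

Section ElementTest.
Context (R : realType) (S : interface_data R).
Hypothesis hS : interface_setting S.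

Lemma tri_closure (M : cartesian_mesh S) (T : elt M) V : V \in tri_verts T -> closure (Omega S) V.
Proof.
move=> hV B nB.
have cV : ctri (corner T) (sg1 T) (sg2 T) (mesh_size M) V.
  by apply: tri_vertex_ctri hV; [exact: sg1P|exact: sg2P|exact: h_gt0].
have [y By Oy] := otri_dense (sg1P T) (sg2P T) (@h_gt0 _ _ M) cV nB.
by exists y; split => //; exact: tri_sub Oy.
Qed.

Lemma is_edgeP (M : cartesian_mesh S) (T : elt M) P Q : is_edge T P Q <->
  [/\ P \in tri_verts T, Q \in tri_verts T & P != Q].
Proof. by split => -[p q pq]; split => //; [rewrite -mem_vertices|rewrite -mem_vertices|rewrite mem_vertices|rewrite mem_vertices]. Qed.

Lemma element_test :
  be S plus / be S minus < 1065%:R / 100%:R -> be S minus / be S plus < 1065%:R / 100%:R ->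
  exists2 h1, 0 < h1 & forall M : cartesian_mesh S, mesh_size M < h1 -> unfitted_mesh M ->
    forall u, (forall T : element M, in_IND T u) ->
    exists W : elt M -> vfield R, forall T,
      local_good S (corner T) (sg1 T) (sg2 T) (mesh_size M) u (W T).
Proof.
move=> r1 r2; have [r r0 hr] := good_interface hS r1 r2.
have b0 := bmin0 hS; have m0 := mmax0 hS.
pose t := 1 / (bmin S * mmax S).
have t0 : 0 < t by rewrite divr_gt0// mulr_gt0.
exists (Num.min r (Num.min 1 t)); first by rewrite !lt_min r0 ltr01 t0.
move=> M; rewrite !lt_min => /andP[hr' /andP[h1 ht]] uf u uI.
have h0 := h_gt0 M.
have sh : small_h S (mesh_size M).
  split => //; first exact: ltW.
  have : mesh_size M ^+ 2 <= t.
    rewrite expr2; apply: le_trans (ltW ht); rewrite ler_piMr// ltW//.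
  move/(ler_wpM2l (ltW b0))/le_trans; apply.
  by rewrite /t le_eqVlt; apply/orP; left; apply/eqP; field; rewrite !gt_eqF.
suff : forall T : elt M, exists w, local_good S (corner T) (sg1 T) (sg2 T) (mesh_size M) u w.
  by move=> h; have [W hW] := boolp.choice h; exists W.
move=> T; have [iI iN] := uI T.
have [ie|ni] := pselect (interface_element T); last first.
  have [p [a [b pE]] up] := iN ni.
  exists (ndf a b); apply: (good_plain hS (sg1P T) (sg2P T) sh) => x Ox.
  by rewrite up ?interior_triangle// pE.
have [D [E [p [q [cut [ap [bp pE]] [aq [bq qE]] CT [up uq]]]]]] := iI ie.
have [DE GB [P [Q [P' [Q' [e1 e2 sne sD sE]]]]]] := cut.
have [GD GE] : Gamma S D /\ Gamma S E.
  have dD : [set D; E] D by left.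
  have dE : [set D; E] E by right.
  by rewrite -GB in dD dE; case: dD; case: dE.
move/is_edgeP: e1 => [hP hQ PQ]; move/is_edgeP: e2 => [hP' hQ' PQ'].
apply: (hr (corner T) (sg1 T) (sg2 T) (mesh_size M) u D E ap bp aq bq (sg1P T) (sg2P T) sh (ltW hr') DE GD GE).
- move=> V hV GV.
  suff : [set D; E] V by [].
  rewrite -GB; split => //.
  have [X hX VX] : exists2 X, X \in tri_verts T & V != X.
    have [e|ne] := eqVneq V P; last by exists P.
    by exists Q => //; rewrite e.
  exists V, X; split; first exact/is_edgeP.
  by exists 0; [rewrite /= in_itv/= lexx ler01|rewrite scale0r addr0].
- by move=> V; exact: tri_closure.
- exact: (two_edges (sg1P T) (sg2P T) h0 hP hQ PQ hP' hQ' PQ' sne sD sE).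
- by move: CT; rewrite pE qE; apply.
- move=> x Ox [cx [V [hV cV lV]]]; rewrite -[ndf ap bp]/(fun y => _) -pE; apply: up.
    by rewrite interior_triangle.
  by split; [rewrite triangleE|exists V; rewrite mem_vertices].
- move=> x Ox [cx [V [hV cV lV]]]; rewrite -[ndf aq bq]/(fun y => _) -qE; apply: uq.
    by rewrite interior_triangle.
  by split; [rewrite triangleE|exists V; rewrite mem_vertices].
Qed.

(* Local test functions match along interior edges and vanish tangentially on the
   boundary because their edge moments are those of [u]. *)
Lemma element_test_conforming (M : cartesian_mesh S) u (W : elt M -> vfield R) : IND0 M u ->
  (forall T, local_good S (corner T) (sg1 T) (sg2 T) (mesh_size M) u (W T)) ->
  (forall T1 T2 P Q, interior_edge T1 T2 P Q -> dot (W T1 P) (Q - P) = dot (W T2 P) (Q - P)) /\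
  (forall T P Q, boundary_edge T P Q -> dot (W T P) (Q - P) = 0).
Proof.
move=> [[_ _ jump] ztr] good.
have dof T P Q : is_edge T P Q -> edge_dof (tri T) u P Q (dot (W T P) (Q - P)).
  by move=> /is_edgeP[hP hQ PQ]; have [_ _] := good T; apply.
split.
  move=> T1 T2 P Q ie; have [_ e1 e2] := ie; have [_ _ PQ] := e1.
  exact: (edge_dof_eq PQ (dof _ _ _ e1) (dof _ _ _ e2) (jump _ _ _ _ ie)).
move=> T P Q be; have [e _] := be; have [_ _ PQ] := e.
exact: (edge_dof_zero PQ (dof _ _ _ e) (ztr _ _ _ be)).
Qed.

End ElementTest.

(** * Green's formula on the mesh *)

Section OneDim.
Context (R : realType).
Local Notation leb := (@lebesgue_measure R).
Implicit Types (f g F : R -> R).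

Lemma Rintegral_oo_cc (a b : R) f : continuous f ->
  Rintegral leb `]a, b[ f = Rintegral leb `[a, b] f.
Proof.
move=> cf; have mf : measurable_fun setT f by exact: continuous_measurable_fun.
rewrite /Rintegral; congr fine.
rewrite [LHS]integral_itv_bndoo//; first by rewrite [RHS]integral_itv_bndoo//;
  apply/measurable_EFinP; apply: measurable_funTS.
by apply/measurable_EFinP; apply: measurable_funTS.
Qed.

Lemma FTC_oo (a b : R) f F : a < b -> continuous f -> (forall t, is_derive t (1 : R) F (f t)) ->
  Rintegral leb `]a, b[ f = F b - F a.
Proof.
move=> ab cf dF; rewrite Rintegral_oo_cc//.
have cF : continuous F.
  by move=> t; apply/differentiable_continuous/derivable1_diffP; case: (dF t).
rewrite /Rintegral (@continuous_FTC2 _ f F)//.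
- exact: continuous_subspaceT.
- split.
  + by move=> t _; case: (dF t).
  + by apply: cvg_at_right_filter; exact: cF.
  + by apply: cvg_at_left_filter; exact: cF.
- by move=> t _; rewrite derive1E; case: (dF t).
Qed.

Definition itv_from (p r : R) : set R := `](Num.min p (p + r)), (Num.max p (p + r))[%classic.

Lemma FTC_signed (s L q : R) f F : is_sign s -> 0 < L -> continuous f ->
  (forall t, is_derive t (1 : R) F (f t)) ->
  Rintegral leb (itv_from q (s * L)) f = s * (F (q + s * L) - F q).
Proof.
move=> hs L0 cf dF; rewrite /itv_from.
case: hs => ->.
  by rewrite !mul1r min_l ?max_r ?lerDl ?(ltW L0)// (FTC_oo _ cf dF)// ltrDl.
rewrite !mulN1r min_r ?max_l ?gerDl ?oppr_le0 ?(ltW L0)//.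
by rewrite (FTC_oo _ cf dF) ?opprB// gtrDl oppr_lt0.
Qed.

Lemma affine_is_derive (p r t : R) : is_derive t (1 : R) (fun x => p + x * r) r.
Proof. by apply: is_derive_eq; rewrite /GRing.scale/=; ring. Qed.

(** Affine substitution for either sign of [r]: a leg of a mesh triangle may point in the positive
    or the negative direction of its axis. *)
Lemma Rintegral_subst (p r : R) g : r != 0 -> continuous g ->
  Rintegral leb (itv_from p r) g = `|r| * Rintegral leb `[0, 1] (fun t => g (p + t * r)).
Proof.
move=> r0 cg; rewrite /itv_from Rintegral_oo_cc//.
have cF : continuous (fun t : R => p + t * r).
  move=> t; apply: cvgD; first exact: cvg_cst.
  by apply: cvgM; [exact: cvg_id|exact: cvg_cst].
have dE : derive1 (fun x => p + x * r) = fun=> r.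
  by apply/funext => t; rewrite derive1E; have [_ ->] := affine_is_derive p r t.
have cgF : continuous (fun t : R => g (p + t * r)).
  by move=> t; apply: cvg_comp (cF t) _; exact: cg.
have F0 : p + 0 * r = p by rewrite mul0r addr0.
have F1 : p + 1 * r = p + r by rewrite mul1r.
have ci (f : R -> R) : continuous f -> leb.-integrable `[0, 1] (EFin \o f).
  by move=> cf; apply: continuous_compact_integrable; [exact: segment_compact|exact: continuous_subspaceT].
rewrite -RintegralZl//; last exact: ci.
have LR : derivable_oo_LRcontinuous (fun x => p + x * r) 0 1.
  split.
  - by move=> t _; case: (affine_is_derive p r t).
  - by apply: cvg_at_right_filter; exact: cF.
  - by apply: cvg_at_left_filter; exact: cF.
have [rp|rn] := ltP 0 r.
  rewrite min_l ?max_r ?lerDl ?(ltW rp)// /Rintegral -{1}F0 -F1.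
  rewrite (@integration_by_substitution_increasing _ (fun x => p + x * r))//.
  - by congr fine; apply: eq_integral => t _; rewrite dE /= gtr0_norm// mulrC.
  - by move=> x y _ _ xy; rewrite ltrD2l ltr_pM2r.
  - by rewrite dE => x _; exact: cvg_cst.
  - by rewrite dE; apply: is_cvg_cst.
  - by rewrite dE; apply: is_cvg_cst.
  - exact: continuous_subspaceT.
have rn' : r < 0 by rewrite lt_neqAle r0.
rewrite min_r ?max_l ?gerDl// /Rintegral -{2}F0 -F1.
rewrite (@integration_by_substitution_decreasing _ (fun x => p + x * r))//.
- by congr fine; apply: eq_integral => t _; rewrite dE /= ltr0_norm// mulrC.
- by move=> x y _ _ xy; rewrite ltrD2l ltr_nM2r.
- by rewrite dE => x _; exact: cvg_cst.
- by rewrite dE; apply: is_cvg_cst.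
- by rewrite dE; apply: is_cvg_cst.
- exact: continuous_subspaceT.
Qed.

End OneDim.

Section EdgeIntegral.
Context (R : realType).
Local Notation leb := (@lebesgue_measure R).
Implicit Types (P Q : plane R) (g : plane R -> R).

Definition edge_mean g P Q := Rintegral leb `[0, 1] (fun t => g (P + t *: (Q - P))).

Lemma edge_cont g P Q : continuous g -> continuous (fun t : R => g (P + t *: (Q - P))).
Proof. by move=> cg t; apply: cvg_comp; [exact: affine_path_continuous|exact: cg]. Qed.

Lemma edge_integrable g P Q : continuous g ->
  leb.-integrable `[0, 1] (EFin \o fun t : R => g (P + t *: (Q - P))).
Proof.
move=> cg; apply: continuous_compact_integrable; first exact: segment_compact.
by apply: continuous_subspaceT; exact: edge_cont.
Qed.

Lemma edge_mean_sym g P Q : continuous g -> edge_mean g P Q = edge_mean g Q P.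
Proof.
move=> cg; rewrite /edge_mean (@Rintegration_by_substitution_onem _ _ 1); last 2 first.
- by rewrite ler01 lexx.
- by apply: continuous_subspaceT; exact: edge_cont.
rewrite /unstable.onem subrr; apply: eq_Rintegral => t _; congr g.
by apply: injective_projections; rewrite /= /GRing.scale/=; ring.
Qed.

Lemma edge_mean_lin g1 g2 (k1 k2 : R) P Q : continuous g1 -> continuous g2 ->
  k1 * edge_mean g1 P Q + k2 * edge_mean g2 P Q = edge_mean (fun x => k1 * g1 x + k2 * g2 x) P Q.
Proof.
move=> c1 c2; have i1 := edge_integrable P Q c1; have i2 := edge_integrable P Q c2.
have cZ (k : R) g : continuous g -> continuous (fun x => k * g x).
  by move=> cg x; apply: cvgM; [exact: cvg_cst|exact: cg].
have j1 := edge_integrable P Q (cZ k1 _ c1); have j2 := edge_integrable P Q (cZ k2 _ c2).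
by rewrite /edge_mean RintegralD// !RintegralZl.
Qed.

End EdgeIntegral.

Section GreenTriangle.
Context (R : realType).
Local Notation leb := (@lebesgue_measure R).
Implicit Types (P Q c : plane R) (g : plane R -> R).

Lemma itv_leg (s q k y : R) : is_sign s -> 0 < k ->
  Num.min q (q + s * k) < y < Num.max q (q + s * k) <-> 0 < s * (y - q) < k.
Proof.
move=> hs k0; case: hs => ->.
  by rewrite !mul1r min_l ?max_r ?lerDl ?(ltW k0)//; split => /andP[? ?]; apply/andP; split; lra.
by rewrite !mulN1r min_r ?max_l ?gerDl ?oppr_le0 ?(ltW k0)//; split => /andP[? ?]; apply/andP; split; lra.
Qed.

Lemma bounded_on_otri c (s1 s2 h : R) g : is_sign s1 -> is_sign s2 -> continuous g ->
  exists K, forall x, otri c s1 s2 h x -> `|g x| <= K.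
Proof.
move=> hs1 hs2 cg; pose r := `|c| + `|h|.
pose B := (`[- r, r] `*` `[- r, r])%classic : set (plane R).
have cB : compact B by apply: compact_setX; exact: segment_compact.
have r0 : 0 <= r by rewrite addr_ge0.
have B0 : B !=set0.
  by exists (0, 0); split; rewrite /= in_itv/= oppr_le0 r0.
have cn : continuous (fun x => `|g x|).
  by move=> x; apply: (continuous_comp (cg x)); exact: norm_continuous.
have [x _ hx] := compact_EVT_max B0 cB (continuous_subspaceT cn).
exists `|g x| => y Oy; apply: hx; apply/mem_set.
have : `|y| <= r by apply: le_trans (otri_norm hs1 hs2 Oy) _; rewrite lerD2l ler_norm.
by rewrite prod_normE ge_max !ler_norml => /andP[? ?]; split; rewrite /= in_itv.
Qed.

(** Fubini with vertical slices and the fundamental theorem on each slice, which runs from the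
    horizontal leg to the hypotenuse. Both edges are parametrised by the same first coordinate,
    hence the common factor [h]. *)
Lemma otri_normal_x c (s1 s2 h : R) (f F : plane R -> R) : is_sign s1 -> is_sign s2 -> 0 < h ->
  continuous f -> continuous F ->
  (forall x y : R, is_derive y (1 : R) (fun y => F (x, y)) (f (x, y))) ->
  Rintegral (area R) (otri c s1 s2 h) f =
  s2 * h * (edge_mean F (c.1, c.2 + s2 * h) (c.1 + s1 * h, c.2) -
            edge_mean F c (c.1 + s1 * h, c.2)).
Proof.
move=> hs1 hs2 h0 cf cF dF.
have [K hK] := bounded_on_otri c h hs1 hs2 cf.
have q1 := sign_sqr hs1.
have n1 : `|s1 * h| = h by rewrite normrM (gtr0_norm h0); case: hs1 => ->; rewrite ?normrN normr1 mul1r.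
have s1h : s1 * h != 0 by rewrite -normr_eq0 n1 gt_eqF.
pose k (t : R) := h - s1 * (t - c.1).
rewrite (@Rintegral_normal_x R (Num.min c.1 (c.1 + s1 * h)) (Num.max c.1 (c.1 + s1 * h)) K
  (fun t => Num.min c.2 (c.2 + s2 * k t)) (fun t => Num.max c.2 (c.2 + s2 * k t)))//; last first.
- exact: continuous_measurable_plane.
- exists (`|c.2| + h) => t /(itv_leg _ _ hs1 h0) /andP[a1 a2].
  have := ler_norm c.2; have := ler_norm (- c.2); rewrite normrN => e1 e2.
  have k1 : 0 < k t by rewrite /k; lra.
  have k2 : k t < h by rewrite /k; lra.
  by rewrite le_min ge_max; case: hs2 => ->; split; apply/andP; split; lra.
- move=> x; split.
    move=> [a1 a2 a3]; have k0 : 0 < k x.1 by rewrite /k; move: a3 a2; rewrite /leg1; lra.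
    split; first by apply/itv_leg => //; apply/andP; split => //; move: a3 a2; rewrite /leg1 /leg2; lra.
    by apply/itv_leg => //; apply/andP; split => //; move: a3; rewrite /leg1 /leg2 /k; lra.
  move=> [/(itv_leg _ _ hs1 h0)/andP[a1 a2]].
  have k0 : 0 < k x.1 by rewrite /k; lra.
  move=> /(itv_leg _ _ hs2 k0)/andP[b1 b2].
  by split; rewrite /leg1 /leg2 //; move: b2; rewrite /k; lra.
- by rewrite le_max ge_min lexx.
- exact: otri_measurable.
pose G (t : R) := s2 * (F (t, c.2 + s2 * k t) - F (t, c.2)).
have cp (y : R -> R) : continuous y -> continuous (fun t : R => F (t, y t)).
  by move=> cy t; apply: cvg_comp; [exact: (cvg_pair cvg_id (cy t))|exact: cF].
have cG : continuous G.
  move=> t; apply: cvgM; first exact: cvg_cst.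
  apply: cvgB; apply: cp => u; last exact: cvg_cst.
  apply: cvgD; first exact: cvg_cst.
  apply: cvgM; first exact: cvg_cst.
  apply: cvgB; first exact: cvg_cst.
  apply: cvgM; first exact: cvg_cst.
  by apply: cvgB; [exact: cvg_id|exact: cvg_cst].
transitivity (Rintegral leb (itv_from c.1 (s1 * h)) G).
  apply: eq_Rintegral => t; rewrite inE /itv_from /= in_itv/= => /(itv_leg _ _ hs1 h0)/andP[a1 a2].
  have k0 : 0 < k t by rewrite /k; lra.
  rewrite -[RHS](FTC_signed c.2 hs2 k0 _ (dF t))//.
  by move=> y; apply: cvg_comp; [exact: (cvg_pair (@cvg_cst _ t _ (nbhs y) _) cvg_id)|exact: cf].
rewrite (Rintegral_subst _ s1h cG) n1 -[RHS]mulrA [RHS]mulrCA; congr (_ * _).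
pose A : plane R := (c.1 + s1 * h, c.2); pose B : plane R := (c.1, c.2 + s2 * h).
have i1 := edge_integrable B A cF; have i2 := edge_integrable c A cF.
rewrite /edge_mean -/A -/B -RintegralB// -RintegralZl//; last first.
  apply: continuous_compact_integrable; first exact: segment_compact.
  by apply: continuous_subspaceT => t; apply: cvgB; exact: edge_cont.
apply: eq_Rintegral => t _; rewrite /G; congr (_ * (F _ - F _)).
  apply: injective_projections; rewrite /A /B /k /= /GRing.scale/=; first ring.
  have -> : s1 * (c.1 + t * (s1 * h) - c.1) = s1 * s1 * (t * h) by ring.
  by rewrite q1; ring.
by apply: injective_projections; rewrite /A /= /GRing.scale/=; ring.
Qed.

Lemma otri_normal_y c (s1 s2 h : R) (f F : plane R -> R) : is_sign s1 -> is_sign s2 -> 0 < h ->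
  continuous f -> continuous F ->
  (forall x y : R, is_derive x (1 : R) (fun x => F (x, y)) (f (x, y))) ->
  Rintegral (area R) (otri c s1 s2 h) f =
  s1 * h * (edge_mean F (c.1 + s1 * h, c.2) (c.1, c.2 + s2 * h) -
            edge_mean F c (c.1, c.2 + s2 * h)).
Proof.
move=> hs1 hs2 h0 cf cF dF.
have [K hK] := bounded_on_otri c h hs1 hs2 cf.
have q2 := sign_sqr hs2.
have n2 : `|s2 * h| = h by rewrite normrM (gtr0_norm h0); case: hs2 => ->; rewrite ?normrN normr1 mul1r.
have s2h : s2 * h != 0 by rewrite -normr_eq0 n2 gt_eqF.
pose k (t : R) := h - s2 * (t - c.2).
rewrite (@Rintegral_normal_y R (Num.min c.2 (c.2 + s2 * h)) (Num.max c.2 (c.2 + s2 * h)) K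
  (fun t => Num.min c.1 (c.1 + s1 * k t)) (fun t => Num.max c.1 (c.1 + s1 * k t)))//; last first.
- exact: continuous_measurable_plane.
- exists (`|c.1| + h) => t /(itv_leg _ _ hs2 h0) /andP[a1 a2].
  have := ler_norm c.1; have := ler_norm (- c.1); rewrite normrN => e1 e2.
  have k1 : 0 < k t by rewrite /k; lra.
  have k2 : k t < h by rewrite /k; lra.
  by rewrite le_min ge_max; case: hs1 => ->; split; apply/andP; split; lra.
- move=> x; split.
    move=> [a1 a2 a3]; have k0 : 0 < k x.2 by rewrite /k; move: a3 a2; rewrite /leg2; lra.
    split; first by apply/itv_leg => //; apply/andP; split => //; move: a3 a1; rewrite /leg1 /leg2; lra.
    by apply/itv_leg => //; apply/andP; split => //; move: a3; rewrite /leg1 /leg2 /k; lra.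
  move=> [/(itv_leg _ _ hs2 h0)/andP[a1 a2]].
  have k0 : 0 < k x.2 by rewrite /k; lra.
  move=> /(itv_leg _ _ hs1 k0)/andP[b1 b2].
  by split; rewrite /leg1 /leg2 //; move: b2; rewrite /k; lra.
- by rewrite le_max ge_min lexx.
- exact: otri_measurable.
pose G (t : R) := s1 * (F (c.1 + s1 * k t, t) - F (c.1, t)).
have cp (y : R -> R) : continuous y -> continuous (fun t : R => F (y t, t)).
  by move=> cy t; apply: cvg_comp; [exact: (cvg_pair (cy t) cvg_id)|exact: cF].
have cG : continuous G.
  move=> t; apply: cvgM; first exact: cvg_cst.
  apply: cvgB; last exact: (cp (fun=> c.1) (fun u => cvg_cst _)).
  apply: (cp (fun t => c.1 + s1 * k t)) => u.
  apply: cvgD; first exact: cvg_cst.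
  apply: cvgM; first exact: cvg_cst.
  apply: cvgB; first exact: cvg_cst.
  apply: cvgM; first exact: cvg_cst.
  by apply: cvgB; [exact: cvg_id|exact: cvg_cst].
transitivity (Rintegral leb (itv_from c.2 (s2 * h)) G).
  apply: eq_Rintegral => t; rewrite inE /itv_from /= in_itv/= => /(itv_leg _ _ hs2 h0)/andP[a1 a2].
  have k0 : 0 < k t by rewrite /k; lra.
  rewrite -[RHS](FTC_signed c.1 hs1 k0 _ (fun x => dF x t))//.
  by move=> y; apply: cvg_comp; [exact: (cvg_pair cvg_id (@cvg_cst _ t _ (nbhs y) _))|exact: cf].
rewrite (Rintegral_subst _ s2h cG) n2 -[RHS]mulrA [RHS]mulrCA; congr (_ * _).
pose A : plane R := (c.1 + s1 * h, c.2); pose B : plane R := (c.1, c.2 + s2 * h).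
have i1 := edge_integrable A B cF; have i2 := edge_integrable c B cF.
rewrite /edge_mean -/A -/B -RintegralB// -RintegralZl//; last first.
  apply: continuous_compact_integrable; first exact: segment_compact.
  by apply: continuous_subspaceT => t; apply: cvgB; exact: edge_cont.
apply: eq_Rintegral => t _; rewrite /G; congr (_ * (F _ - F _)).
  apply: injective_projections; rewrite /A /B /k /= /GRing.scale/=; last ring.
  have -> : s2 * (c.2 + t * (s2 * h) - c.2) = s2 * s2 * (t * h) by ring.
  by rewrite q2; ring.
by apply: injective_projections; rewrite /B /= /GRing.scale/=; ring.
Qed.

(** The tangential component of a Nedelec field is constant along a straight edge, so it leaves the
    integral. *)
Lemma ndf_edge_mean a b (phi : plane R -> R) P Q : continuous phi ->
  (Q - P).1 * edge_mean (fun x => (ndf a b x).1 * phi x) P Q +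
  (Q - P).2 * edge_mean (fun x => (ndf a b x).2 * phi x) P Q =
  dot (ndf a b P) (Q - P) * edge_mean phi P Q.
Proof.
move=> cphi.
have c1 : continuous (fun x => (ndf a b x).1 * phi x).
  by move=> x; apply: cvgM; [apply: cvg_comp; [exact: ndf_cont|exact: cvg_fst]|exact: cphi].
have c2 : continuous (fun x => (ndf a b x).2 * phi x).
  by move=> x; apply: cvgM; [apply: cvg_comp; [exact: ndf_cont|exact: cvg_snd]|exact: cphi].
rewrite edge_mean_lin// /edge_mean -RintegralZl//; last exact: edge_integrable.
apply: eq_Rintegral => t _; rewrite -(ndf_edge a b P Q t) /dot; ring.
Qed.

(* The boundary is traversed through [c], [A], [B], and [s1 * s2] is the orientation. *)
Lemma green_otri c (s1 s2 h : R) a b (phi : plane R -> R)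
    (A := (c.1 + s1 * h, c.2)) (B := (c.1, c.2 + s2 * h))
    (k := fun P Q => dot (ndf a b P) (Q - P) * edge_mean phi P Q) :
  is_sign s1 -> is_sign s2 -> 0 < h -> smooth2 phi ->
  Rintegral (area R) (otri c s1 s2 h) (fun x => dot (ndf a b x) (dx2 phi x, - dx1 phi x)) -
  Rintegral (area R) (otri c s1 s2 h) (fun x => - 2 * b * phi x) =
  - (s1 * s2) * (k c A + k A B - k c B).
Proof.
move=> hs1 hs2 h0 sm.
have [c0 d0] := sm [::]; have [cx _] := sm [:: true]; have [cy _] := sm [:: false].
rewrite /= in c0 d0 cx cy.
have cn1 : continuous (fun x => (ndf a b x).1).
  by move=> x; apply: cvg_comp; [exact: ndf_cont|exact: cvg_fst].
have cn2 : continuous (fun x => (ndf a b x).2).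
  by move=> x; apply: cvg_comp; [exact: ndf_cont|exact: cvg_snd].
have cM (f g : plane R -> R) : continuous f -> continuous g -> continuous (fun x => f x * g x).
  by move=> cf cg x; apply: cvgM; [exact: cf|exact: cg].
have cD (f g : plane R -> R) : continuous f -> continuous g -> continuous (fun x => f x + g x).
  by move=> cf cg x; apply: cvgD; [exact: cf|exact: cg].
have cK (r : R) : continuous ((fun=> r) : plane R -> R) by move=> x; exact: cvg_cst.
(* [gy] and [gx] are the derivatives of the first component times [phi] in the second variable and
   of the second component times [phi] in the first one. Their difference is the first integrand
   minus the second. *)
pose gy x := b * phi x + (ndf a b x).1 * dx2 phi x.
pose gx x := - b * phi x + (ndf a b x).2 * dx1 phi x.
have cgy : continuous gy.
  by apply: cD; [apply: cM; [exact: cK|exact: c0]|apply: cM; [exact: cn1|exact: cy]].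
have cgx : continuous gx.
  by apply: cD; [apply: cM; [exact: cK|exact: c0]|apply: cM; [exact: cn2|exact: cx]].
have dy (x y : R) : is_derive y (1 : R) (fun y => (ndf a b (x, y)).1 * phi (x, y)) (gy (x, y)).
  have d1 : is_derive y (1 : R) (fun y => a.1 + b * y) b.
    by apply: is_derive_eq; rewrite /GRing.scale/=; ring.
  have d2 : is_derive y (1 : R) (fun y => phi (x, y)) (dx2 phi (x, y)).
    by split; [exact: (d0 (x, y)).2|rewrite /dx2 derive1E].
  apply: (is_derive_eq (is_deriveM d1 d2)).
  by rewrite /gy /ndf /= /GRing.scale/=; ring.
have dx (x y : R) : is_derive x (1 : R) (fun x => (ndf a b (x, y)).2 * phi (x, y)) (gx (x, y)).
  have d1 : is_derive x (1 : R) (fun x => a.2 + b * - x) (- b).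
    by apply: is_derive_eq; rewrite /GRing.scale/=; ring.
  have d2 : is_derive x (1 : R) (fun x => phi (x, y)) (dx1 phi (x, y)).
    by split; [exact: (d0 (x, y)).1|rewrite /dx1 derive1E].
  apply: (is_derive_eq (is_deriveM d1 d2)).
  by rewrite /gx /ndf /= /GRing.scale/=; ring.
have [fO _] := otri_area c hs1 hs2 h0.
have ebc (f : plane R -> R) : continuous f -> ess_bounded (otri c s1 s2 h) f.
  move=> cf; have [K hK] := bounded_on_otri c h hs1 hs2 cf.
  by apply: (ess_bounded_continuous _ cf hK); exact: otri_measurable.
have E : Rintegral (area R) (otri c s1 s2 h) (fun x => dot (ndf a b x) (dx2 phi x, - dx1 phi x)) -
  Rintegral (area R) (otri c s1 s2 h) (fun x => - 2 * b * phi x) =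
  Rintegral (area R) (otri c s1 s2 h) gy - Rintegral (area R) (otri c s1 s2 h) gx.
  have cgx' : continuous (fun x => - 1 * gx x) by apply: cM.
  have cp : continuous (fun x => - 1 * (- 2 * b * phi x)) by apply: (cM) => //; apply: (cM).
  have cp' : continuous (fun x => - 2 * b * phi x) by apply: cM.
  have cd : continuous (fun x => dot (ndf a b x) (dx2 phi x, - dx1 phi x)).
    apply: cD; apply: cM => //= x; exact: cvgN (cx x).
  have z (f : plane R -> R) : continuous f -> - Rintegral (area R) (otri c s1 s2 h) f =
      Rintegral (area R) (otri c s1 s2 h) (fun x => - 1 * f x).
    by move=> cf; rewrite ess_RintegralZ ?mulN1r//; exact: ebc.
  rewrite (z _ cp') (z _ cgx) -(ess_RintegralD fO (ebc _ cd) (ebc _ cp)) -(ess_RintegralD fO (ebc _ cgy) (ebc _ cgx')).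
  by apply: eq_Rintegral => x _; rewrite /gx /gy /dot /=; ring.
have cF1 : continuous (fun x => (ndf a b x).1 * phi x) by exact: (cM).
have cF2 : continuous (fun x => (ndf a b x).2 * phi x) by exact: (cM).
rewrite E (@otri_normal_x c s1 s2 h gy (fun x => (ndf a b x).1 * phi x) hs1 hs2 h0 cgy cF1 dy).
rewrite (@otri_normal_y c s1 s2 h gx (fun x => (ndf a b x).2 * phi x) hs1 hs2 h0 cgx cF2 dx).
rewrite -/A -/B /k -!ndf_edge_mean//.
rewrite (edge_mean_sym B A cF1).
have q1 := sign_sqr hs1; have q2 := sign_sqr hs2.
set m1 := edge_mean _ A B; set m2 := edge_mean _ c A; set m3 := edge_mean _ A B; set m4 := edge_mean _ c B.
set m5 := edge_mean _ c A; set m6 := edge_mean _ c B.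
have -> : (A - c).1 = s1 * h by rewrite /A /=; ring.
have -> : (A - c).2 = 0 by rewrite /A /=; ring.
have -> : (B - A).1 = - (s1 * h) by rewrite /A /B /=; ring.
have -> : (B - A).2 = s2 * h by rewrite /A /B /=; ring.
have -> : (B - c).1 = 0 by rewrite /B /=; ring.
have -> : (B - c).2 = s2 * h by rewrite /B /=; ring.
have e1 : - (s1 * s2) * (s1 * h) = - s2 * h by rewrite -[s1 * s2]mulrC; transitivity (- (s1 * s1) * s2 * h); [ring|rewrite q1; ring].
have e2 : - (s1 * s2) * (s2 * h) = - s1 * h by transitivity (- (s2 * s2) * s1 * h); [ring|rewrite q2; ring].
transitivity ((- (s1 * s2) * (s1 * h)) * (m2 - m1) + (- (s1 * s2) * (s2 * h)) * (m3 - m4)).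
  by rewrite e1 e2; ring.
by ring.
Qed.

End GreenTriangle.

Lemma telescope_ord (R : realType) (n : nat) (t b : 'I_n -> R) :
  (forall i j : 'I_n, j = i.+1 :> nat -> t i = b j) ->
  (forall i : 'I_n, i.+1 = n -> t i = 0) -> (forall i : 'I_n, i = 0%N :> nat -> b i = 0) ->
  \sum_i (t i - b i) = 0.
Proof.
case: n t b => [|n] t b tb tn b0; first by rewrite big_ord0.
rewrite big_split/= sumrN big_ord_recr big_ord_recl /= tn// b0// addr0 add0r -sumrB big1// => i _.
by rewrite (tb _ (lift ord0 i)) ?subrr.
Qed.

(** * Gluing the local fields: cancellation of the edge fluxes *)

Section Gluing.
Context (R : realType) (S : interface_data R) (M : cartesian_mesh S).
Local Notation h := (mesh_size M).
Local Notation diag := (mesh_diag M).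
Implicit Types (T : elt M) (P Q : plane R).

(** A sum with indicators rather than a choice of triangle: it is measurable at once, and its value
    0 on the edges is harmless because membership in the local spaces is tested in the open
    triangles only. *)
Definition glue (g : elt M -> plane R -> R) : plane R -> R :=
  fun x => \sum_(T : elt M) \1_(tri T) x * g T x.

Lemma glueE g T x : tri T x -> glue g x = g T x.
Proof.
move=> Tx; rewrite /glue (bigD1 T)//= big1; first by rewrite indicE mem_set// mul1r addr0.
move=> T' ne; rewrite indicE memNset ?mul0r// => Tx'.
by move/eqP: ne; apply; exact: tri_disjoint Tx' Tx.
Qed.

Lemma glue_L2 g : (forall T, continuous (g T)) -> L2_scalar (Omega S) (glue g).
Proof.
move=> cg.
have mg : measurable_fun setT (glue g).
  apply: measurable_sum => T; apply: measurable_funM; last exact: continuous_measurable_plane.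
  by apply: measurable_indic; exact: otri_measurable.
have [K hK] : exists K : elt M -> R, forall T x, tri T x -> `|g T x| <= K T.
  have h1 : forall T : elt M, exists K, forall x, tri T x -> `|g T x| <= K.
    by move=> T; exact: (bounded_on_otri _ _ (sg1P T) (sg2P T) (cg T)).
  by have [K hK] := boolp.choice h1; exists K.
have bd x : `|glue g x| <= \sum_(T : elt M) `|K T|.
  apply: le_trans (ler_norm_sum _ _ _) _; apply: ler_sum => T _; rewrite normrM indicE.
  have [/set_mem Tx|_] := boolP (x \in tri T); last by rewrite normr0 mul0r.
  by rewrite normr1 mul1r; apply: le_trans (hK _ _ Tx) _; exact: ler_norm.
have [[mO fO] _] := @Omega_area _ _ M.
split; first exact: measurable_funTS.
apply: (@bounded_integrable _ _ _ (area R) _ (fun x => glue g x ^+ 2) ((\sum_(T : elt M) `|K T|) ^+ 2)) => //.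
  by apply: measurable_funTS; apply: measurable_funX.
by move=> x; rewrite normrX ler_pXn2r ?nnegrE ?sumr_ge0.
Qed.

Lemma corner_cases T (p := (corner_lo S).1 + T.1.1%:R * h) (q := (corner_lo S).2 + T.1.2%:R * h)
    (c := corner T) (A := (c.1 + sg1 T * h, c.2)) (B := (c.1, c.2 + sg2 T * h)) :
  [/\ c = (if diag == T.2 then p else p + h, if T.2 then q + h else q),
    A = (if diag == T.2 then p + h else p, if T.2 then q + h else q) &
    B = (if diag == T.2 then p else p + h, if T.2 then q else q + h)].
Proof.
move: @p @q @c @A @B; case: T => -[i j] b /=.
rewrite /corner /ci /cj /sg1 /sg2 /grid_point /=.
have a1 : (corner_lo S).1 + i.+1%:R * h = (corner_lo S).1 + i%:R * h + h by rewrite -natr1; ring.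
have b1 : (corner_lo S).2 + j.+1%:R * h = (corner_lo S).2 + j%:R * h + h by rewrite -natr1; ring.
have k1 (t : R) : t + h + -1 * h = t by ring.
by case: diag; case: b; rewrite /= ?addn0 ?addn1 ?a1 ?b1 ?k1 ?mul1r.
Qed.

(** The horizontal and the vertical edge of a triangle, always traversed upwards in the coordinate.
    With this convention the signs of the fluxes depend on the position in the square only, and
    neighbouring triangles name a shared edge identically. *)
Definition row_left T : plane R := grid_point M T.1.1 (T.1.2 + T.2).
Definition row_right T : plane R := grid_point M T.1.1.+1 (T.1.2 + T.2).
Definition col_bot T : plane R := grid_point M (T.1.1 + (diag != T.2)) T.1.2.
Definition col_top T : plane R := grid_point M (T.1.1 + (diag != T.2)) T.1.2.+1.

Lemma row_col_edges T : is_edge T (row_left T) (row_right T) /\ is_edge T (col_bot T) (col_top T).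
Proof.
have hp := h_gt0 M.
have ne (t : R) (k : nat) : (t + k%:R * h == t + k.+1%:R * h) = false.
  apply/negbTE; rewrite -subr_eq0; have -> : t + k%:R * h - (t + k.+1%:R * h) = - h by rewrite -natr1; ring.
  by rewrite oppr_eq0 gt_eqF.
case: T => -[i j] b; rewrite /is_edge /row_left /row_right /col_bot /col_top /vertices /=.
split; split; try by rewrite /grid_point xpair_eqE ne ?andbF.
all: by case: diag; case: b; rewrite /= ?addn0 ?addn1 !inE eqxx ?orbT.
Qed.

Variables (W : elt M -> vfield R).
Hypothesis ndW : forall T, exists a b, W T = ndf a b.
Hypothesis conf : forall T1 T2 P Q, interior_edge T1 T2 P Q -> dot (W T1 P) (Q - P) = dot (W T2 P) (Q - P).
Variables (phi : plane R -> R).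
Hypothesis cphi : continuous phi.
Hypothesis phi0 : forall x, ~ Omega S x -> phi x = 0.

Definition edge_flux T P Q := dot (W T P) (Q - P) * edge_mean phi P Q.

Lemma edge_fluxC T P Q : edge_flux T Q P = - edge_flux T P Q.
Proof.
rewrite /edge_flux; have [a [b ->]] := ndW T.
by rewrite (edge_mean_sym _ _ cphi) -mulNr -ndf_dofC.
Qed.

Lemma edge_flux_conf T1 T2 P Q : T1 <> T2 -> is_edge T1 P Q -> is_edge T2 P Q ->
  edge_flux T1 P Q = edge_flux T2 P Q.
Proof. by move=> ne e1 e2; rewrite /edge_flux (@conf T1 T2 P Q). Qed.

Lemma edge_mean_out P Q : (forall t, 0 <= t <= 1 -> ~ Omega S (P + t *: (Q - P))) -> edge_mean phi P Q = 0.
Proof.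
move=> out; rewrite /edge_mean.
transitivity (Rintegral (@lebesgue_measure R) `[0, 1] (fun=> 0 : R)); last by rewrite Rintegral_cst// mul0r.
by apply: eq_Rintegral => t; rewrite inE /= in_itv/= => /out/phi0.
Qed.

Definition boundary_flux T :=
  let c := corner T in let A := (c.1 + sg1 T * h, c.2) in let B := (c.1, c.2 + sg2 T * h) in
  - (sg1 T * sg2 T) * (edge_flux T c A + edge_flux T A B - edge_flux T c B).

Lemma boundary_flux_split T (c := corner T) (A := (c.1 + sg1 T * h, c.2)) (B := (c.1, c.2 + sg2 T * h)) :
  boundary_flux T = - sg2 T * edge_flux T (row_left T) (row_right T)
    + sg1 T * edge_flux T (col_bot T) (col_top T) - sg1 T * sg2 T * edge_flux T A B.
Proof.
have [ec eA eB] := corner_cases T; rewrite -/c -/A -/B in ec eA eB.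
have q1 := sign_sqr (sg1P T); have q2 := sign_sqr (sg2P T).
have a1 : (corner_lo S).1 + T.1.1.+1%:R * h = (corner_lo S).1 + T.1.1%:R * h + h by rewrite -natr1; ring.
have b1 : (corner_lo S).2 + T.1.2.+1%:R * h = (corner_lo S).2 + T.1.2%:R * h + h by rewrite -natr1; ring.
have e1 : edge_flux T c A = sg1 T * edge_flux T (row_left T) (row_right T).
  rewrite /row_left /row_right /grid_point ec eA /sg1; case: (diag == T.2); case: (T.2);
    rewrite /= ?addn0 ?addn1 ?a1 ?b1 ?mul1r ?mulN1r -?edge_fluxC //.
have e2 : edge_flux T c B = sg2 T * edge_flux T (col_bot T) (col_top T).
  rewrite /col_bot /col_top /grid_point ec eB /sg2; case: (diag == T.2); case: (T.2);
    rewrite /= ?addn0 ?addn1 ?a1 ?b1 ?mul1r ?mulN1r -?edge_fluxC //.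
rewrite /boundary_flux -/c -/A -/B e1 e2.
transitivity (- (sg1 T * sg1 T) * sg2 T * edge_flux T (row_left T) (row_right T)
  + (sg2 T * sg2 T) * sg1 T * edge_flux T (col_bot T) (col_top T) - sg1 T * sg2 T * edge_flux T A B).
  by ring.
by rewrite q1 q2; ring.
Qed.

(** The two triangles of a square have the same orientation sign and traverse the diagonal in
    opposite directions. *)
Lemma diag_cancel i j (T := ((i, j), true) : elt M) (T' := ((i, j), false) : elt M) :
  sg1 T * sg2 T * edge_flux T ((corner T).1 + sg1 T * h, (corner T).2) ((corner T).1, (corner T).2 + sg2 T * h) +
  sg1 T' * sg2 T' * edge_flux T' ((corner T').1 + sg1 T' * h, (corner T').2) ((corner T').1, (corner T').2 + sg2 T' * h) = 0.
Proof.
have [_ eA eB] := corner_cases T; have [_ eA' eB'] := corner_cases T'.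
set A := (_, _) in eA *; set B := (_, _) in eB *; set A' := (_, _) in eA' *; set B' := (_, _) in eB' *.
have AB' : A' = B by rewrite eA' eB /=; case: diag.
have BA' : B' = A by rewrite eA eB' /=; case: diag.
have ss : sg1 T * sg2 T = sg1 T' * sg2 T'.
  by rewrite /sg1 /sg2 /=; case: diag => /=; ring.
have eT : is_edge T A B.
  apply/is_edgeP; split; rewrite ?inE ?eqxx ?orbT//.
  have := tri_verts_uniq T; rewrite /tri_verts /tri_vertices /= !inE => /andP[_ /andP[+ _]] //.
have eT' : is_edge T' A B.
  have : is_edge T' A' B'.
    apply/is_edgeP; split; rewrite ?inE ?eqxx ?orbT//.
    have := tri_verts_uniq T'; rewrite /tri_verts /tri_vertices /= !inE => /andP[_ /andP[+ _]] //.
  by rewrite AB' BA' => -[? ? ?]; split => //; rewrite eq_sym.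
have ne : T <> T' by [].
by rewrite AB' BA' (edge_fluxC T') -(edge_flux_conf ne eT eT') ss; ring.
Qed.

(** Along a column of squares the top edge of one is the bottom edge of the next, so the fluxes
    telescope. The first and the last edge lie outside the open domain, where [phi] vanishes. *)
Lemma row_sum i : \sum_(j < mesh_n2 M) (edge_flux ((i, j), true) (row_left ((i, j), true)) (row_right ((i, j), true)) -
   edge_flux ((i, j), false) (row_left ((i, j), false)) (row_right ((i, j), false))) = 0.
Proof.
apply: telescope_ord.
- move=> j j' jj.
  have e1 : row_left ((i, j), true) = row_left ((i, j'), false) by rewrite /row_left /= jj addn0 addn1.
  have e2 : row_right ((i, j), true) = row_right ((i, j'), false) by rewrite /row_right /= jj addn0 addn1.
  rewrite -e1 -e2; apply: edge_flux_conf => //; first by case: (row_col_edges ((i, j), true)).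
  by rewrite e1 e2; case: (row_col_edges ((i, j'), false)).
- move=> j jn; rewrite /edge_flux edge_mean_out ?mulr0// => t _ [_ /=].
  rewrite /row_left /row_right /grid_point /= addn1 jn in_itv/= subrr /GRing.scale/= mulr0 addr0 -(mesh_height M).
  by rewrite addrC subrK ltxx andbF.
- move=> j j0; rewrite /edge_flux edge_mean_out ?mulr0// => t _ [_ /=].
  by rewrite /row_left /row_right /grid_point /= addn0 j0 in_itv/= subrr /GRing.scale/= mulr0 mul0r !addr0 ltxx.
Qed.

Lemma col_sum j : \sum_(i < mesh_n1 M) (edge_flux ((i, j), ~~ diag) (col_bot ((i, j), ~~ diag)) (col_top ((i, j), ~~ diag)) -
   edge_flux ((i, j), diag) (col_bot ((i, j), diag)) (col_top ((i, j), diag))) = 0.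
Proof.
have d1 : (diag != ~~ diag) = true by case: diag.
have d2 : (diag != diag) = false by case: diag.
apply: telescope_ord.
- move=> i i' ii.
  have e1 : col_bot ((i, j), ~~ diag) = col_bot ((i', j), diag) by rewrite /col_bot /= ii d1 d2 addn0 addn1.
  have e2 : col_top ((i, j), ~~ diag) = col_top ((i', j), diag) by rewrite /col_top /= ii d1 d2 addn0 addn1.
  rewrite -e1 -e2; apply: edge_flux_conf; last 2 first.
  + by case: (row_col_edges ((i, j), ~~ diag)).
  + by rewrite e1 e2; case: (row_col_edges ((i', j), diag)).
  by move=> [_ e]; move: d1; rewrite -{1}e eqxx.
- move=> i ip; rewrite /edge_flux edge_mean_out ?mulr0// => t _ [/=].
  rewrite /col_bot /col_top /grid_point /= d1 addn1 ip in_itv/= subrr /GRing.scale/= mulr0 addr0 -(mesh_width M).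
  by rewrite addrC subrK ltxx andbF.
- move=> i i0; rewrite /edge_flux edge_mean_out ?mulr0// => t _ [/=].
  by rewrite /col_bot /col_top /grid_point /= d2 addn0 i0 in_itv/= subrr /GRing.scale/= mulr0 mul0r !addr0 ltxx.
Qed.

(** Instead of enumerating edges, the sum is split by direction: horizontal edges telescope in [j],
    vertical edges telescope in [i], and the diagonals cancel inside each square. *)
Lemma boundary_flux_sum : \sum_(T : elt M) boundary_flux T = 0.
Proof.
pose H (i : 'I_(mesh_n1 M)) (j : 'I_(mesh_n2 M)) b := edge_flux ((i, j), b) (row_left ((i, j), b)) (row_right ((i, j), b)).
pose V (i : 'I_(mesh_n1 M)) (j : 'I_(mesh_n2 M)) b := edge_flux ((i, j), b) (col_bot ((i, j), b)) (col_top ((i, j), b)).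
rewrite (eq_bigr (fun p : elt M => (fun q b => boundary_flux (q, b)) p.1 p.2)); last by case.
rewrite -(pair_bigA _ (fun q b => boundary_flux (q, b)))/=.
rewrite (eq_bigr (fun p => (fun i j => (H i j true - H i j false) - (V i j (~~ diag) - V i j diag)) p.1 p.2)).
  rewrite -(pair_bigA _ (fun i j => (H i j true - H i j false) - (V i j (~~ diag) - V i j diag)))/=.
  under eq_bigr do rewrite sumrB.
  rewrite sumrB [X in _ - X]exchange_big/=.
  rewrite big1; last by move=> i _; exact: row_sum.
  by rewrite big1 ?subr0// => j _; exact: col_sum.
move=> [i j] _; rewrite big_bool /= !boundary_flux_split.
have dc := diag_cancel i j; rewrite /= in dc.
pose F b := sg1 ((i, j), b) * V i j b.
have sw (G : bool -> R) d : G true + G false = G (~~ d) + G d by case: d; rewrite // addrC.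
have FT := sw F diag.
have F1 : F (~~ diag) = - V i j (~~ diag).
  by rewrite /F /sg1 /=; case: (diag) => /=; rewrite mulN1r.
have F2 : F diag = V i j diag by rewrite /F /sg1 /= eqxx mul1r.
have s1 : sg2 ((i, j), true) = -1 by [].
have s0 : sg2 ((i, j), false) = 1 by [].
rewrite -/(H i j true) -/(H i j false) -/(V i j true) -/(V i j false) -/(F true) -/(F false).
rewrite {1}s1 {1}s0.
move: dc; set D1 := _ * _ * edge_flux _ _ _; set D2 := _ * _ * edge_flux _ _ _ => dc.
transitivity (H i j true - H i j false + (F true + F false) - (D1 + D2)); first by ring.
by rewrite FT dc F1 F2; ring.
Qed.

End Gluing.

Section GluedField.
Context (R : realType) (S : interface_data R) (M : cartesian_mesh S).
Local Notation h := (mesh_size M).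
Implicit Types (T : elt M) (P Q : plane R).
Variables (W : elt M -> vfield R).
Hypothesis ndW : forall T, exists a b, W T = ndf a b.

Definition glued : vfield R :=
  fun x => (glue (fun T y => (W T y).1) x, glue (fun T y => (W T y).2) x).

Lemma gluedE T x : tri T x -> glued x = W T x.
Proof. by move=> Tx; rewrite /glued !(glueE _ Tx) -surjective_pairing. Qed.

Lemma curl_glued T x : tri T x -> curl glued x = curl (W T) x.
Proof.
move=> Tx; apply: curl_near.
have oT : open (tri T) by exact: otri_open.
by apply: filterS (open_nbhs_nbhs (conj oT Tx)) => y; exact: gluedE.
Qed.

Hypothesis conf : forall T1 T2 P Q, interior_edge T1 T2 P Q -> dot (W T1 P) (Q - P) = dot (W T2 P) (Q - P).
Hypothesis bdry : forall T P Q, boundary_edge T P Q -> dot (W T P) (Q - P) = 0.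

Lemma glued_weak_curl : weak_curl (Omega S) glued (glue (fun T _ => curl (W T) 0)).
Proof.
move=> phi [sm [K [_ KO phiK]]].
have phi0 x : ~ Omega S x -> phi x = 0 by move=> nO; apply: phiK => /KO.
have [c0 _] := sm [::]; have [cx _] := sm [:: true]; have [cy _] := sm [:: false].
rewrite /= in c0 cx cy.
have eb T (f : plane R -> R) : continuous f -> ess_bounded (tri T) f.
  move=> cf; have [k hk] := bounded_on_otri (corner T) h (sg1P T) (sg2P T) cf.
  by apply: (ess_bounded_continuous _ cf hk); exact: otri_measurable.
have cM (f g : plane R -> R) : continuous f -> continuous g -> continuous (fun x => f x * g x).
  by move=> cf cg x; apply: cvgM; [exact: cf|exact: cg].
have ext T (f g : plane R -> R) : continuous g -> (forall x, tri T x -> f x = g x) -> ess_bounded (tri T) f.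
  move=> cg fg; apply: (@ess_bounded_ext _ _ set0 _ g) => //; first by move=> x Tx _; exact: fg.
  exact: eb.
have cD T : continuous (fun x => dot (W T x) (dx2 phi x, - dx1 phi x)).
  have [a [b ->]] := ndW T.
  move=> x; apply: cvgD; apply: cvgM.
  - by apply: cvg_comp; [exact: ndf_cont|exact: cvg_fst].
  - exact: cy.
  - by apply: cvg_comp; [exact: ndf_cont|exact: cvg_snd].
  - by apply: cvgN; exact: cx.
have cC T : continuous (fun x => curl (W T) 0 * phi x).
  by apply: cM => // x; exact: cvg_cst.
have fD T x : tri T x -> dot (glued x) (dx2 phi x, - dx1 phi x) = dot (W T x) (dx2 phi x, - dx1 phi x).
  by move=> /gluedE ->.
have fC T x : tri T x -> glue (fun T _ => curl (W T) 0) x * phi x = curl (W T) 0 * phi x.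
  by move=> Tx; rewrite (glueE _ Tx).
have [b1 i1] := mesh_pieces M (fun x => dot (glued x) (dx2 phi x, - dx1 phi x)).
have [b2 i2] := mesh_pieces M (fun x => glue (fun T _ => curl (W T) 0) x * phi x).
rewrite i1; last by apply: b1 => T; exact: ext (cD T) (fD T).
rewrite i2; last by apply: b2 => T; exact: ext (cC T) (fC T).
apply/eqP; rewrite -subr_eq0 -sumrB; apply/eqP.
rewrite -[RHS](boundary_flux_sum ndW conf c0 phi0); apply: eq_bigr => T _.
transitivity (Rintegral (area R) (tri T) (fun x => dot (W T x) (dx2 phi x, - dx1 phi x)) -
  Rintegral (area R) (tri T) (fun x => curl (W T) 0 * phi x)).
  by congr (_ - _); apply: eq_Rintegral => x /set_mem Tx; [exact: fD|exact: fC].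
rewrite /boundary_flux /edge_flux; have [a [b ->]] := ndW T.
rewrite curl_ndf; apply: green_otri => //; [exact: sg1P|exact: sg2P|exact: h_gt0].
Qed.

Lemma glued_ND0 : ND0 M glued.
Proof.
have cW T : continuous (fun x => (W T x).1) /\ continuous (fun x => (W T x).2).
  have [a [b ->]] := ndW T; split => x; apply: cvg_comp; do ?[exact: ndf_cont|exact: cvg_fst|exact: cvg_snd].
split.
- split; first by split; apply: glue_L2 => T; case: (cW T).
  exists (glue (fun T _ => curl (W T) 0)); last exact: glued_weak_curl.
  by apply: glue_L2 => T x; exact: cvg_cst.
- move=> T; exists (W T); first by have [a [b ->]] := ndW T; exists a, b.
  by move=> x; rewrite interior_triangle => /gluedE.
- move=> T P Q be; apply: aeW => s.
  have [/is_edgeP[hP hQ PQ] _] := be.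
  rewrite in_itv/= => s01.
  have [a [b wE]] := ndW T.
  rewrite trace_tri (@trace_piece _ (corner T) (sg1 T) (sg2 T) h _ a b _ setT)//.
  + by rewrite dot_tangent ndf_edge -wE (bdry be) mulr0.
  + exact: sg1P.
  + exact: sg2P.
  + exact: h_gt0.
  + by apply: tri_segment => //; [exact: sg1P|exact: sg2P|exact: h_gt0].
  + exact: openT.
  + by move=> y Oy _; rewrite (gluedE Oy) wE.
Qed.

End GluedField.

(** * Global stability *)

Section GlobalSums.
Context (R : realType) (S : interface_data R) (M : cartesian_mesh S).
Hypothesis hS : interface_setting S.
Local Notation h := (mesh_size M).
Implicit Types (T : elt M) (P Q : plane R) (u : vfield R).

Lemma tri_ndf_bounded T a b : field_bounded (tri T) (ndf a b).
Proof.
have m : measurable (tri T) by exact: otri_measurable.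
have [b1 b2] := ndf_bounded a b m (fun x => @otri_norm _ _ _ _ _ x (sg1P T) (sg2P T)).
split => //; apply: (@ess_bounded_ext _ _ set0 _ (fun=> - 2 * b)) => //; last exact: ess_bounded_cst.
by move=> x _ _; exact: curl_ndf.
Qed.

Lemma field_bounded_ext O u v : (forall x, O x -> u x = v x) -> (forall x, O x -> curl u x = curl v x) ->
  field_bounded O v -> field_bounded O u.
Proof.
move=> uv cuv [v1 v2 v3].
split; [apply: (@ess_bounded_ext _ _ set0 _ _ _ _ _ v1)|apply: (@ess_bounded_ext _ _ set0 _ _ _ _ _ v2)
  |apply: (@ess_bounded_ext _ _ set0 _ _ _ _ _ v3)] => // x Ox _; rewrite ?uv ?cuv//.
Qed.

Section Glued.
Variable (W : elt M -> vfield R).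
Hypothesis ndW : forall T, exists a b, W T = ndf a b.

Lemma ndW_bounded T : field_bounded (tri T) (W T).
Proof. by have [a [b ->]] := ndW T; exact: tri_ndf_bounded. Qed.

Lemma glued_bounded T : field_bounded (tri T) (glued W).
Proof.
apply: field_bounded_ext (ndW_bounded T); [exact: gluedE|exact: curl_glued].
Qed.

Lemma bilinear_pieces u : (forall T, field_bounded (tri T) u) ->
  bilinear_a S u (glued W) = \sum_(T : elt M) energy S (tri T) u (W T).
Proof.
move=> bu; rewrite /bilinear_a.
have [b1 i1] := mesh_pieces M (fun x => (piecewise S (mu S) x)^-1 * (curl u x * curl (glued W) x)).
have [b2 i2] := mesh_pieces M (fun x => piecewise S (be S) x * dot (u x) (glued W x)).
rewrite i1; last by apply: b1 => T; case: (energy_terms hS (bu T) (glued_bounded T)).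
rewrite i2; last by apply: b2 => T; case: (energy_terms hS (bu T) (glued_bounded T)).
rewrite -big_split/=; apply: eq_bigr => T _; rewrite /energy.
apply: f_equal2; apply: eq_Rintegral => x /set_mem Tx.
  by rewrite (curl_glued W Tx).
by rewrite (gluedE W Tx).
Qed.

End Glued.

Lemma norm_pieces u : (forall T, field_bounded (tri T) u) ->
  Rintegral (area R) (Omega S) (fun x => dot (u x) (u x)) +
  Rintegral (area R) (Omega S) (fun x => curl u x ^+ 2) = \sum_(T : elt M) norm2 (tri T) u.
Proof.
move=> bu.
have [b1 i1] := mesh_pieces M (fun x => dot (u x) (u x)).
have [b2 i2] := mesh_pieces M (fun x => curl u x ^+ 2).
rewrite i1; last by apply: b1 => T; apply: ess_bounded_dot.
rewrite i2; last by apply: b2 => T; case: (bu T) => _ _ ?; apply: ess_boundedM.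
by rewrite -big_split.
Qed.

Lemma norm_pieces_glued W : (forall T, exists a b, W T = ndf a b) ->
  Rintegral (area R) (Omega S) (fun x => dot (glued W x) (glued W x)) +
  Rintegral (area R) (Omega S) (fun x => curl (glued W) x ^+ 2) = \sum_(T : elt M) norm2 (tri T) (W T).
Proof.
move=> ndW; rewrite norm_pieces; last by move=> T; exact: glued_bounded.
apply: eq_bigr => T _; rewrite /norm2.
apply: f_equal2; apply: eq_Rintegral => x /set_mem Tx.
  by rewrite (gluedE W Tx).
by rewrite (curl_glued W Tx).
Qed.

Lemma norm2_ge0 O u : 0 <= norm2 O u.
Proof.
apply: addr_ge0; apply: Rintegral_ge0 => x _; last exact: sqr_ge0.
by have /andP[+ _] := dot_ge_norm (u x); apply: le_trans; exact: sqr_ge0.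
Qed.

Lemma norm2_ndf_gt0 T a b : ndf a b <> ndf 0 0 -> 0 < norm2 (tri T) (ndf a b).
Proof.
move=> ne; have [fT aT] := tri_area T.
have hp := h_gt0 M.
have t0 : 0 < total_area (tri T) by rewrite aT divr_gt0 ?exprn_gt0.
have dd (x : plane R) : 0 <= dot x x.
  by have /andP[+ _] := dot_ge_norm x; apply: le_trans; exact: sqr_ge0.
have c2 : Rintegral (area R) (tri T) (fun x => curl (ndf a b) x ^+ 2) = 4 * b ^+ 2 * total_area (tri T).
  rewrite -Rintegral_const//; apply: eq_Rintegral => x _; rewrite curl_ndf; ring.
rewrite /norm2 c2; have [b0|b0] := eqVneq b 0; last first.
  apply: ltr_wpDl; first by apply: Rintegral_ge0 => x _.
  have b2 : 0 < b ^+ 2 by rewrite lt_neqAle sqr_ge0 andbT eq_sym sqrf_eq0.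
  by apply: mulr_gt0 => //; apply: mulr_gt0.
have a0 : a <> 0 by move=> a0; apply: ne; rewrite a0 b0.
have -> : Rintegral (area R) (tri T) (fun x => dot (ndf a b x) (ndf a b x)) = dot a a * total_area (tri T).
  rewrite -Rintegral_const//; apply: eq_Rintegral => x _; rewrite b0 /ndf scale0r addr0 //.
rewrite b0 expr0n mulr0 mul0r addr0 mulr_gt0//.
have /andP[+ _] := dot_ge_norm a; apply: lt_le_trans.
by rewrite exprn_gt0// normr_gt0; apply/eqP.
Qed.

(* A nonzero Nedelec field vanishes in at most one point. *)
Lemma ndf_not_ae0 T a b : ndf a b <> ndf 0 0 ->
  ~ (exists N, [/\ measurable N, area R N = 0%E & forall x, tri T x -> ~ N x -> ndf a b x = 0]).
Proof.
move=> ne [N [mN N0 z]]; have [[mT fT] aT] := tri_area T.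
have hp := h_gt0 M.
have [x0 hx0] : exists x0 : plane R, forall x, ndf a b x = 0 -> x.2 = x0.2.
  have [b0|b0] := eqVneq b 0.
    exists 0 => x; rewrite b0 /ndf scale0r addr0 => a0; exfalso; apply: ne; by rewrite a0 b0.
  exists (0, - a.1 / b) => x /(congr1 fst); rewrite /ndf /= /GRing.scale/= => e.
  have <- : b * x.2 = - a.1 by lra.
  by rewrite mulrC mulKf.
have th0 : (1, 0) != 0 :> plane R by rewrite xpair_eqE oner_eq0.
have [mL L0] := otri_line (corner T) x0 (sg1P T) (sg2P T) hp th0.
set L := _ `&` _ in mL L0.
have sub : tri T `<=` N `|` L.
  move=> x Tx; have [Nx|Nx] := pselect (N x); first by left.
  right; split => //; rewrite /= /cross /= (hx0 _ (z _ Tx Nx)); ring.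
have : (area R (tri T) <= 0)%E.
  rewrite -[X in (_ <= X)%E]N0 -(measureU0 mN mL L0); apply: le_measure; rewrite ?inE//.
  exact: measurableU.
rewrite -(@fineK _ (area R (tri T))); last by rewrite ge0_fin_numE ?measure_ge0.
rewrite [fine _]aT lee_fin leNgt divr_gt0 ?exprn_gt0//.
Qed.

(** Allows a test field to be replaced by its opposite. Applied to the zero field it shows that the
    energy against it is zero. *)
Lemma energyN O u a b : fin_area O -> field_bounded O u -> field_bounded O (ndf a b) ->
  energy S O u (ndf (- a) (- b)) = - energy S O u (ndf a b).
Proof.
move=> fO bu bw; have [t1 t2] := energy_terms hS bu bw.
rewrite /energy -[RHS]mulN1r mulrDr -!ess_RintegralZ//.
apply: f_equal2; apply: eq_Rintegral => x _; rewrite ?curl_ndf; first ring.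
rewrite /dot /ndf /= /GRing.scale/=; ring.
Qed.

End GlobalSums.

(** * A nonzero conforming field on every mesh *)

Section Witness.
Context (R : realType) (S : interface_data R) (M : cartesian_mesh S).
Local Notation h := (mesh_size M).
Implicit Types (T : elt M) (P Q : plane R).
Variables (i0 : 'I_(mesh_n1 M)) (j0 : 'I_(mesh_n2 M)).

(* The Nedelec basis function of the diagonal of one square. *)
Definition diag_basis (k : R) T : vfield R :=
  let e := if T.1 == (i0, j0) then (if T.2 then k else - k) else 0 in
  ndf (e *: (- (corner T).2, (corner T).1)) e.

Lemma diag_basis_dof k T P Q : dot (diag_basis k T P) (Q - P) =
  - (if T.1 == (i0, j0) then (if T.2 then k else - k) else 0) * cross (P - corner T) (Q - corner T).
Proof.
by rewrite /diag_basis; set e := if _ then _ else _; rewrite /ndf /dot /cross /= /GRing.scale/=; ring.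
Qed.

(** The edge opposite the right-angled corner is the diagonal, and its midpoint is the centre of the
    square. Hence it is interior to the domain, and any triangle having this edge belongs to the
    same square. *)
Lemma cell_center T T' P Q : P \in tri_verts T -> Q \in tri_verts T -> P != Q ->
  P != corner T -> Q != corner T ->
  [/\ P + Q = ((corner_lo S).1 + (corner_lo S).1 + T.1.1%:R * h + T.1.1%:R * h + h,
      (corner_lo S).2 + (corner_lo S).2 + T.1.2%:R * h + T.1.2%:R * h + h),
    Omega S (2^-1 *: (P + Q)) &
    P \in tri_verts T' -> Q \in tri_verts T' -> T'.1 = T.1].
Proof.
have hp := h_gt0 M.
move=> hP hQ PQ Pc Qc.
have [ec eA eB] := corner_cases T.
set A := (_, _) in eA; set B := (_, _) in eB.
have sum : P + Q = A + B.
  move: hP hQ; rewrite /tri_verts /tri_vertices !inE (negbTE Pc) (negbTE Qc) /= -/A -/B.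
  move=> /orP[] /eqP eP /orP[] /eqP eQ; move: PQ; rewrite eP eQ ?eqxx // => _.
  by rewrite addrC.
have c : P + Q = ((corner_lo S).1 + (corner_lo S).1 + T.1.1%:R * h + T.1.1%:R * h + h,
      (corner_lo S).2 + (corner_lo S).2 + T.1.2%:R * h + T.1.2%:R * h + h).
  rewrite sum eA eB.
  by apply: injective_projections => /=; do ?case: ifP => _; ring.
have w := mesh_width M; have g := mesh_height M.
have li : (T.1.1.+1)%:R * h <= (mesh_n1 M)%:R * h by rewrite ler_pM2r// ler_nat.
have lj : (T.1.2.+1)%:R * h <= (mesh_n2 M)%:R * h by rewrite ler_pM2r// ler_nat.
have n1 : 0 <= (T.1.1)%:R * h by rewrite mulr_ge0// ltW.
have n2 : 0 <= (T.1.2)%:R * h by rewrite mulr_ge0// ltW.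
rewrite -natr1 in li; rewrite -natr1 in lj.
split => //.
  rewrite c; split; rewrite /= in_itv/= /GRing.scale/=; apply/andP; split; lra.
move=> hP' hQ'.
have cm : ctri (corner T') (sg1 T') (sg2 T') h (2^-1 *: (P + Q)).
  rewrite -/(midpoint P Q) midpoint_seg; apply: ctri_convex; last by lra.
  - by apply: tri_vertex_ctri hP'; [exact: sg1P|exact: sg2P|exact: h_gt0].
  - by apply: tri_vertex_ctri hQ'; [exact: sg1P|exact: sg2P|exact: h_gt0].
have [ec' _ _] := corner_cases T'.
move: cm; rewrite /ctri c ec' /leg1 /leg2 /= /GRing.scale/= /sg1 /sg2 => -[k1 k2 k3].
have le (i i' : nat) : i%:R * h < i'%:R * h + h -> (i <= i')%N.
  by move=> l1; rewrite -ltnS -(@ltr_nat R) -(ltr_pM2r hp) -natr1; lra.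
have eqn (i i' : nat) : i%:R * h <= i'%:R * h + h / 2 -> i'%:R * h + h / 2 <= i%:R * h + h -> i = i'.
  by move=> l1 l2; apply/anti_leq/andP; split; apply: le; clear -l1 l2 hp; lra.
have e1 : T'.1.1 = T.1.1.
  by apply/val_inj/eqn; move: k1 k2 k3; clear -hp; case: (_ == _); case: (T'.2) => /= *; lra.
have e2 : T'.1.2 = T.1.2.
  by apply/val_inj/eqn; move: k1 k2 k3; clear -hp; case: (_ == _); case: (T'.2) => /= *; lra.
by rewrite [LHS]surjective_pairing [RHS]surjective_pairing e1 e2.
Qed.

(** In each triangle the field is a rotation about the right-angled corner, so its moments on the
    legs vanish. On the diagonal the two corners are reflections of each other in the centre, which
    reverses the sign of the moment; the opposite coefficients [k] and [- k] restore it. *)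
Lemma diag_basis_conf k T1 T2 P Q : interior_edge T1 T2 P Q ->
  dot (diag_basis k T1 P) (Q - P) = dot (diag_basis k T2 P) (Q - P).
Proof.
move=> [ne /is_edgeP[P1 Q1 PQ] /is_edgeP[P2 Q2 _]].
have main U V : U <> V -> P \in tri_verts U -> Q \in tri_verts U -> P \in tri_verts V -> Q \in tri_verts V ->
    P != corner U -> Q != corner U ->
    dot (diag_basis k U P) (Q - P) = dot (diag_basis k V P) (Q - P).
  move=> UV PU QU PV QV Pc Qc.
  have [cE _ same] := @cell_center U V P Q PU QU PQ Pc Qc.
  have e := same PV QV.
  have nb : V.2 = ~~ U.2.
    move: UV e; case: (U) => u []; case: (V) => v [] //= UV e; exfalso; apply: UV; by rewrite e.
  rewrite !diag_basis_dof e nb; case: ifP => _; last by rewrite !oppr0 !mul0r.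
  have [ec _ _] := corner_cases U; have [ec' _ _] := corner_cases V.
  have -> : corner V = P + Q - corner U.
    rewrite cE ec' ec e nb; apply: injective_projections => /=.
      by case: (mesh_diag M); case: (U.2) => /=; ring.
    by case: (U.2) => /=; ring.
  by case: (U.2) => /=; rewrite /cross /=; ring.
have zero T : P = corner T \/ Q = corner T -> dot (diag_basis k T P) (Q - P) = 0.
  by move=> [e|e]; rewrite diag_basis_dof -e /cross /=; ring.
have [c1|/not_orP[n1 n2]] := pselect (P = corner T1 \/ Q = corner T1).
  have [c2|/not_orP[n1 n2]] := pselect (P = corner T2 \/ Q = corner T2).
    by rewrite !zero.
  by apply/esym; apply: main => //; [exact/nesym|exact/eqP|exact/eqP].
by apply: main => //; exact/eqP.
Qed.

Lemma diag_basis_bdry k T P Q : boundary_edge T P Q -> dot (diag_basis k T P) (Q - P) = 0.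
Proof.
move=> [/is_edgeP[hP hQ PQ] out].
have [c|/not_orP[/eqP n1 /eqP n2]] := pselect (P = corner T \/ Q = corner T).
  by case: c => e; rewrite diag_basis_dof -e /cross /=; ring.
have [_ mO _] := @cell_center T T P Q hP hQ PQ n1 n2.
case: (out (2^-1 *: (P + Q))) => //.
exists 2^-1; first by rewrite /= in_itv/=; apply/andP; split; lra.
by rewrite -midpoint_seg.
Qed.

Lemma diag_basis_neq0 k : k != 0 -> diag_basis k ((i0, j0), true) <> ndf 0 0.
Proof.
move=> k0 /(congr1 (fun f => f (0, -1) - f (0, 0))) /(congr1 fst).
rewrite /diag_basis eqxx /ndf /= /GRing.scale/= => e; move/eqP: k0; apply.
lra.
Qed.

Lemma diag_basisN k T : exists a b, diag_basis k T = ndf a b /\ diag_basis (- k) T = ndf (- a) (- b).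
Proof.
rewrite /diag_basis; eexists; eexists; split; first reflexivity.
have -> : (if T.1 == (i0, j0) then if T.2 then - k else - - k else 0) =
  - (if T.1 == (i0, j0) then if T.2 then k else - k else 0).
  by case: ifP => _; [case: (T.2)|rewrite oppr0].
by rewrite scaleNr.
Qed.

End Witness.

Section Stability.
Context (R : realType) (S : interface_data R).
Hypothesis hS : interface_setting S.

(** Summation over the elements gives energy at least [c_local * s], while both norms are at most
    [10 * Num.sqrt s]; the product of the two 10 is the 100 in the constant. *)
Lemma inf_sup (M : cartesian_mesh S) (u : vfield R) (W : elt M -> vfield R) : IND0 M u ->
  (forall T, local_good S (corner T) (sg1 T) (sg2 T) (mesh_size M) u (W T)) ->
  (((c_local S / 100%:R) * Hcurl_norm (Omega S) u)%:E <=
     ereal_sup [set (bilinear_a S u v / Hcurl_norm (Omega S) v)%:E |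
                v in ND0 M `\` [set v | L2_zero (Omega S) v]])%E.
Proof.
move=> uI good.
have hp := h_gt0 M; have c0 := c_local_gt0 hS.
have [conf bdry] := element_test_conforming uI good.
have ndW T : exists a b, W T = ndf a b by have [_ ? _] := good T.
have bu (T : elt M) : field_bounded (tri T) u by have [[? _] _ _] := good T.
have bW (T : elt M) : field_bounded (tri T) (W T) by have [[_ [? _]] _ _] := good T.
have hm : forall T : elt M, exists m, [/\ 0 <= m, c_local S * m * mesh_size M ^+ 2 <= energy S (tri T) u (W T),
    norm2 (tri T) u <= 100%:R * m * mesh_size M ^+ 2 & norm2 (tri T) (W T) <= 100%:R * m * mesh_size M ^+ 2].
  by move=> T; have [[_ [_ ?]] _ _] := good T.
have [m mP] := boolp.choice hm.
pose s := (\sum_(T : elt M) m T) * mesh_size M ^+ 2.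
have h20 : 0 < mesh_size M ^+ 2 by rewrite exprn_gt0.
have s0 : 0 <= s.
  by apply: mulr_ge0; [apply: sumr_ge0 => T _; case: (mP T)|exact: ltW].
have nu : Rintegral (area R) (Omega S) (fun x => dot (u x) (u x)) +
    Rintegral (area R) (Omega S) (fun x => curl u x ^+ 2) <= 100%:R * s.
  rewrite (norm_pieces bu) /s mulrA mulr_sumr mulr_suml; apply: ler_sum => T _.
  have [_ _ e _] := mP T.
  exact: e.
have fin x v : ND0 M v -> ~ L2_zero (Omega S) v -> x <= bilinear_a S u v / Hcurl_norm (Omega S) v ->
  (x%:E <= ereal_sup [set (bilinear_a S u v / Hcurl_norm (Omega S) v)%:E |
                v in ND0 M `\` [set v | L2_zero (Omega S) v]])%E.
  move=> vN vz xv; apply: (@le_trans _ _ (bilinear_a S u v / Hcurl_norm (Omega S) v)%:E).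
    by rewrite lee_fin.
  by apply: ereal_sup_ubound; exists v.
have nz (V : elt M -> vfield R) (ndV : forall T, exists a b, V T = ndf a b) T : V T <> ndf 0 0 ->
    ~ L2_zero (Omega S) (glued V) /\ 0 < Hcurl_norm (Omega S) (glued V).
  move=> VT; have [a [b E]] := ndV T; rewrite E in VT; split.
    move=> [N [mN N0 sN]]; apply: (ndf_not_ae0 VT (T := T)); exists N; split => // x Tx Nx.
    rewrite -E -(gluedE V Tx); apply: contrapT => hn; apply: Nx; apply: sN => /= hh; apply: hn; apply: hh.
    exact: tri_sub Tx.
  rewrite /Hcurl_norm sqrtr_gt0 (norm_pieces_glued ndV) (bigD1 T)//= E.
  apply: ltr_pwDl; first exact: norm2_ndf_gt0.
  by apply: sumr_ge0 => T' _; exact: norm2_ge0.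
have [s00|sp] := eqVneq s 0; last first.
  have sp0 : 0 < s by rewrite lt_neqAle eq_sym sp.
  have aE : c_local S * s <= bilinear_a S u (glued W).
    rewrite (bilinear_pieces hS ndW bu) /s mulrA mulr_sumr mulr_suml; apply: ler_sum => T _.
    have [_ e _ _] := mP T.
    exact: e.
  (* The glued field is an admissible test field because its energy against [u] is positive, which
     excludes that all local fields vanish. *)
  have [T WT] : exists T, W T <> ndf 0 0.
    apply: contrapT => hn; have W0 T : W T = ndf 0 0.
      by apply: contrapT => h'; apply: hn; exists T.
    have : bilinear_a S u (glued W) = 0.
      rewrite (bilinear_pieces hS ndW bu) big1// => T _; rewrite W0.
      have fT := (tri_area T).1.
      have e := energyN hS fT (bu T) (tri_ndf_bounded T 0 0).
      by move: e; rewrite !oppr0 => e; lra.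
    by move=> e; move: aE; rewrite e leNgt mulr_gt0.
  have [nL nv] := nz W ndW T WT.
  apply: (fin _ (glued W)) => //; first exact: glued_ND0.
  have e10 : 10 * Num.sqrt s = Num.sqrt (100%:R * s).
    have -> : 100%:R * s = (10 : R) ^+ 2 * s by ring.
    have := sqrtrM s (sqr_ge0 (10 : R)); rewrite sqrtr_sqr ger0_norm//.
  have s100 : 0 <= 100%:R * s by exact: mulr_ge0.
  have nv2 : Hcurl_norm (Omega S) (glued W) <= 10 * Num.sqrt s.
    rewrite /Hcurl_norm (norm_pieces_glued ndW).
    rewrite e10.
    rewrite (ler_sqrt _ s100) /s mulrA mulr_sumr mulr_suml; apply: ler_sum => T' _.
    have [_ _ _ e] := mP T'.
    exact: e.
  have nu2 : Hcurl_norm (Omega S) u <= 10 * Num.sqrt s.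
    rewrite e10.
    by rewrite (ler_sqrt _ s100).
  rewrite ler_pdivlMr//; apply: le_trans aE.
  have ss : Num.sqrt s * Num.sqrt s = s by rewrite -expr2 sqr_sqrtr.
  have : Hcurl_norm (Omega S) u * Hcurl_norm (Omega S) (glued W) <= (10 * Num.sqrt s) * (10 * Num.sqrt s).
    by apply: ler_pM; [exact: sqrtr_ge0|exact: sqrtr_ge0|exact: nu2|exact: nv2].
  have c100 : 0 <= c_local S / 100%:R by rewrite divr_ge0// ltW.
  move=> /(ler_wpM2l c100) H; rewrite -[leLHS]mulrA; apply: (le_trans H).
  have -> : 10 * Num.sqrt s * (10 * Num.sqrt s) = 100%:R * s.
    by rewrite mulrACA ss -natrM.
  by rewrite mulrA divfK ?pnatr_eq0.
(* Here the norm of [u] is zero and the supremum only has to be nonnegative: the diagonal basis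
   field or its opposite gives a nonnegative quotient. The sides of the domain are positive, so the
   mesh has at least one square to carry it. *)
have -> : Hcurl_norm (Omega S) u = 0.
  apply/eqP; rewrite sqrtr_eq0; apply: le_trans nu _; by rewrite s00 mulr0.
rewrite mulr0.
have [[w1 w2] _ _ _ _] := hS.
have n1 : (0 < mesh_n1 M)%N.
  rewrite lt0n; apply/eqP => e; move: (mesh_width M); rewrite e mul0r => /eqP; rewrite subr_eq0 => /eqP e'.
  by rewrite e' ltxx in w1.
have n2 : (0 < mesh_n2 M)%N.
  rewrite lt0n; apply/eqP => e; move: (mesh_height M); rewrite e mul0r => /eqP; rewrite subr_eq0 => /eqP e'.
  by rewrite e' ltxx in w2.
pose V k := diag_basis (Ordinal n1) (Ordinal n2) k.
have ndV k T : exists a b, V k T = ndf a b by eexists; eexists; reflexivity.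
have VN k : ND0 M (glued (V k)).
  by apply: glued_ND0; [exact: ndV|exact: diag_basis_conf|exact: diag_basis_bdry].
have aN : bilinear_a S u (glued (V (- 1))) = - bilinear_a S u (glued (V 1)).
  rewrite !(bilinear_pieces hS (ndV _) bu) -sumrN; apply: eq_bigr => T _.
  have [a [b [e1 e2]]] := diag_basisN (Ordinal n1) (Ordinal n2) 1 T.
  rewrite /V e1 e2 (energyN hS)//; [exact: (tri_area T).1|exact: tri_ndf_bounded].
have n10 : (1 : R) != 0 := oner_neq0 _.
have n10' : (-1 : R) != 0 by rewrite oppr_eq0.
case: (leP 0 (bilinear_a S u (glued (V 1)))) => sg.
  have [nL nv] := nz _ (ndV 1) _ (@diag_basis_neq0 _ _ _ (Ordinal n1) (Ordinal n2) _ n10).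
  by apply: (fin _ (glued (V 1))) => //; rewrite divr_ge0// ltW.
have [nL nv] := nz _ (ndV (-1)) _ (@diag_basis_neq0 _ _ _ (Ordinal n1) (Ordinal n2) _ n10').
by apply: (fin _ (glued (V (-1)))) => //; rewrite aN divr_ge0 ?oppr_ge0// ltW.
Qed.

End Stability.

Theorem theorem5p4 (R : realType) (S : interface_data R)
  (hS : interface_setting S)
  (hbeta : Num.max (be S plus / be S minus) (be S minus / be S plus)
           < 1065%:R / 100%:R) :
  exists h1 Cs : R, [/\ 0 < h1, 0 < Cs &
    forall M : cartesian_mesh S, mesh_size M < h1 -> unfitted_mesh M ->
    forall u : vfield R, IND0 M u ->
      ((Cs * Hcurl_norm (Omega S) u)%:E <=
       ereal_sup [set (bilinear_a S u v / Hcurl_norm (Omega S) v)%:E |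
                   v in ND0 M `\` [set v | L2_zero (Omega S) v]])%E].
Proof.
move: hbeta; rewrite gt_max => /andP[r1 r2].
have [h1 h10 test] := element_test hS r1 r2.
exists h1, (c_local S / 100%:R); split => //; first by rewrite divr_gt0// c_local_gt0.
move=> M hM uf u uI.
have [[_ uT _] _] := uI.
have [W good] := test M hM uf u uT.
exact: (inf_sup hS uI good).
Qed.
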